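(* Consider the equation $$\varphi-\alpha\varphi''-\beta\mathcal{H}\varphi'=\tfrac12\varphi^2. \qquad (P_{\alpha,\beta})$$ There exists $\tilde\beta_0>0$ (respectively $\tilde\alpha_0>0$) such that for all $\beta$ with $|\beta|<\tilde\beta_0$ (respectively for all $0\le\alpha<\tilde\alpha_0$) there exists a unique even ground state solution $Q_{1,1,\beta}$ of $(P_{1,\beta})$ (respectively $Q_{1,\alpha,1}$ of $(P_{\alpha,1})$). Moreover, the maps $$]-\tilde\beta_0,\tilde\beta_0[\,\ni\beta\longmapsto Q_{1,1,\beta}\in H^1(\mathbb{R})\qquad\text{and}\qquad[0,\tilde\alpha_0[\,\ni\alpha\longmapsto Q_{1,\alpha,1}\in H^1(\mathbb{R})$$ are continuous.
   Context: All functions are real-valued. $\mathcal{H}$ is the Hilbert transform with $\widehat{\mathcal{H}v}(\xi)=i\,\mathrm{sgn}(\xi)\hat v(\xi)$, so $-\mathcal{H}\partial_x$ has Fourier symbol $|\xi|$. $D_x^{1/2}$ is the Fourier multiplier with symbol $|\xi|^{1/2}$. For $s\ge0$, $H^s_e(\mathbb{R})$ is the subspace of even functions in $H^s(\mathbb{R})$. Put $\theta=1$ if $\alpha>0$ and $\theta=1/2$ if $\alpha=0$. Set $I_{1,\alpha,\beta}(\varphi)=\frac12\int_{\mathbb{R}}\big(\alpha(\varphi_x)^2+\beta(D_x^{1/2}\varphi)^2+\varphi^2\big)dx$ (for $\alpha=0$ the first term is absent), $K(\varphi)=\frac16\int_{\mathbb{R}}\varphi^3dx$, and for $\lambda>0$,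 $M^\lambda_{1,\alpha,\beta}=\inf\{I_{1,\alpha,\beta}(\varphi):\varphi\in H^\theta_e(\mathbb{R}),\ K(\varphi)=\lambda\}$. An even ground state solution of $(P_{\alpha,\beta})$ is an $H^\theta(\mathbb{R})$-solution of it that solves the constrained minimization problem $M^\lambda_{1,\alpha,\beta}$ for some $\lambda>0$, i.e. it lies in $H^\theta_e(\mathbb{R})$, satisfies $K=\lambda$, and attains the infimum. *)

(* Defs.v *)
From HB Require Import structures.
From mathcomp Require Import all_boot all_order all_algebra.
From mathcomp Require Import complex.
From mathcomp Require Import all_classical all_reals all_analysis.
Set Implicit Arguments.
Unset Strict Implicit.
Unset Printing Implicit Defensive.
Import Order.TTheory GRing.Theory Num.Theory.
Import numFieldNormedType.Exports.
Local Open Scope classical_set_scope.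
Local Open Scope ring_scope.

(* Functions are representatives of their classes modulo equality almost
   everywhere for the Lebesgue measure. *)

Definition L2 {R : realType} (f : R -> R) : Prop :=
  f \in Lfun (@lebesgue_measure R) 2%:E.

Definition sqnormc {R : realType} (z : R[i]) : R :=
  (complex.Re z) ^+ 2 + (complex.Im z) ^+ 2.

(* (2 pi)^(-1/2) int_[-n, n] f(x) e^(- i x xi) dx *)
Definition fourier_trunc {R : realType} (f : R -> R) (n : nat) (xi : R)
    : R[i] :=
  let I := `[- n%:R, n%:R]%classic in
  let c := (Num.sqrt (2 * pi))^-1 in
  Complex (c * \int[@lebesgue_measure R]_(x in I) (f x * cos (x * xi)))
          (- (c * \int[@lebesgue_measure R]_(x in I) (f x * sin (x * xi)))).

(* g is the Fourier-Plancherel transform of f, i.e. the limit in L^2 of the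
   transforms of the truncations of f. *)
Definition is_fourier {R : realType} (f : R -> R) (g : R -> R[i]) : Prop :=
  [/\ measurable_fun setT (fun xi => complex.Re (g xi)),
      measurable_fun setT (fun xi => complex.Im (g xi)) &
      (\int[@lebesgue_measure R]_xi
         (sqnormc (fourier_trunc f n xi - g xi))%:E)%E @[n --> \oo] --> 0%E].

(* By Plancherel's theorem the transform exists, and is unique almost
   everywhere, for every f in L^2; for other f the value is irrelevant. *)
Definition fourier {R : realType} (f : R -> R) : R -> R[i] :=
  xget (cst 0) [set g | is_fourier f g].

(* The real-valued L^2 function whose Fourier transform is m * fourier f. *)
Definition fourier_mult {R : realType} (m : R -> R[i]) (f : R -> R) : R -> R :=
  xget (cst 0) [set g | L2 g /\
    {ae @lebesgue_measure R, forall xi, fourier g xi = m xi * fourier f xi}].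

Definition hilbert {R : realType} : (R -> R) -> R -> R :=
  fourier_mult (fun xi => Complex 0 (Num.sg xi)).

Definition Dhalf {R : realType} : (R -> R) -> R -> R :=
  fourier_mult (fun xi => Complex (`|xi| `^ 2^-1) 0).

Definition Hnorm {R : realType} (s : R) (f : R -> R) : \bar R :=
  ((\int[@lebesgue_measure R]_xi
      ((1 + xi ^+ 2) `^ s * sqnormc (fourier f xi))%:E) `^ 2^-1)%E.

Definition Hs {R : realType} (s : R) (f : R -> R) : Prop :=
  L2 f /\ (Hnorm s f < +oo)%E.

Definition Hs_even {R : realType} (s : R) (f : R -> R) : Prop :=
  Hs s f /\ {ae @lebesgue_measure R, forall x, f (- x) = f x}.

Definition test_function {R : realType} (psi : R -> R) : Prop :=
  (forall (n : nat) (x : R), derivable (derive1n n psi) x 1) /\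
  exists A : R, forall x, A < `|x| -> psi x = 0.

Definition weak_derivative {R : realType} (f : R -> R) : R -> R :=
  xget (cst 0) [set g | L2 g /\
    forall psi : R -> R, test_function psi ->
      \int[@lebesgue_measure R]_x (f x * derive1 psi x) =
      - \int[@lebesgue_measure R]_x (g x * psi x)].

Definition theta {R : realType} (alpha : R) : R :=
  if 0 < alpha then 1 else 2^-1.

(* Equation (P_{alpha,beta}) in the sense of distributions. The operator
   H d/dx has the even symbol - |xi|, hence is its own transpose. *)
Definition solvesP {R : realType} (alpha beta : R) (phi : R -> R) : Prop :=
  forall psi : R -> R, test_function psi ->
    \int[@lebesgue_measure R]_x
      (phi x * (psi x - alpha * derive1n 2 psi x - beta * hilbert (derive1 psi) x)) =
    \int[@lebesgue_measure R]_x (2^-1 * phi x ^+ 2 * psi x).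

(* For alpha = 0 the factor alpha removes the first term, whether or not phi
   has a weak derivative in L^2. *)
Definition energy {R : realType} (alpha beta : R) (phi : R -> R) : R :=
  2^-1 * \int[@lebesgue_measure R]_x
    (alpha * weak_derivative phi x ^+ 2 + beta * Dhalf phi x ^+ 2 +
     phi x ^+ 2).

Definition K {R : realType} (phi : R -> R) : R :=
  6^-1 * \int[@lebesgue_measure R]_x (phi x ^+ 3).

Definition M {R : realType} (alpha beta lambda : R) : \bar R :=
  ereal_inf [set (energy alpha beta phi)%:E |
             phi in [set phi | Hs_even (theta alpha) phi /\ K phi = lambda]].

Definition even_ground_state {R : realType} (alpha beta : R) (phi : R -> R)
    : Prop :=
  [/\ Hs (theta alpha) phi, solvesP alpha beta phi &
      exists lambda : R, [/\ 0 < lambda, Hs_even (theta alpha) phi,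
        K phi = lambda & (energy alpha beta phi)%:E = M alpha beta lambda]].

Definition unique_even_ground_state {R : realType} (alpha beta : R)
    (phi : R -> R) : Prop :=
  even_ground_state alpha beta phi /\
  forall psi : R -> R, even_ground_state alpha beta psi ->
    psi = phi %[ae @lebesgue_measure R].

Definition H1_continuous_on {R : realType} (A : set R) (Q : R -> R -> R)
    : Prop :=
  forall a : R, A a ->
    Hs 1 (Q a) /\
    Hnorm 1 (Q b \- Q a) @[b --> within A (nbhs a)] --> 0%E.

(* Main.v *)
(** The Hartley transform is an involutive isometry of L^2; on even functions it turns the energy
into the quadratic form of the weight w = 1 + alpha x^2 + beta |x| and K into a cubic form T3,
the integral of v against its autocorrelation. Replacing v by |v| does not lower T3, so one
maximizes T3 over nonnegative v with q_w(v) = 1. At the two base weights the maximizer is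
explicit (the transforms of the Benjamin-Ono and KdV solitons), almost maximizers are close to
it, and the second variation is coercive. These facts survive a small perturbation of w: the
midpoint of two almost maximizers near the profile would do better unless they are close, so
maximizing sequences converge, and the deficit of T3 controls the distance to the maximizer.
The Euler-Lagrange equation makes the maximizer continuous and positive, which excludes sign
changes of any other one; the same equation gives the dependence on w in the H^1 norm. *)
Require Import Defs.
From HB Require Import structures.
From mathcomp Require Import all_boot all_order all_algebra.
From mathcomp Require Import complex ring lra.
From mathcomp Require Import all_classical all_reals all_analysis measurable_realfun.
Import Order.TTheory GRing.Theory Num.Theory.
Import numFieldNormedType.Exports.
Local Open Scope classical_set_scope.
Local Open Scope ring_scope.
Set Implicit Arguments.
Unset Strict Implicit.

(** Two obstacles shape the proof. Near [alpha = 0] the term [alpha x^2] is unbounded relative to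
    [1 + |x|], so the perturbed quadratic form is not close to the base form. Hence [near_base] asks
    for smallness at the profile only, plus a Cauchy-Schwarz bound on the difference of the two
    forms; and since the energy then controls only H^(1/2) as [alpha] tends to 0, the H^1 norm has
    to come from the Euler-Lagrange equation. The other obstacle is stability of the two profiles,
    usually drawn from concentration compactness and spectral theory. Both are replaced by explicit
    inequalities. For the exponential profile the deficit is an L^2 distance between [p (x + y)] and
    [p x * p y] on a quadrant. For the KdV soliton it is the integrated square of the defect in the
    first-order equation of the soliton, and nonnegativity on the frequency side places the maximum
    at 0, where the comparison starts. The second variations become weighted inequalities on the
    half line, proved with explicit Riccati functions. Existence for perturbed weights then needs
    completeness only, no compactness. *)

Definition rint {d} {T : measurableType d} {R : realType}
  (mu : {measure set T -> \bar R}) (f : T -> R) : Prop :=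
 mu.-integrable setT (EFin \o f).

Definition sqint {d} {T : measurableType d} {R : realType}
  (mu : {measure set T -> \bar R}) (f : T -> R) : Prop :=
 measurable_fun setT f /\ rint mu (fun x => f x ^+ 2).

Definition ip {d} {T : measurableType d} {R : realType}
  (mu : {measure set T -> \bar R}) (f g : T -> R) : R :=
 \int[mu]_x (f x * g x).

Lemma cvgn_EFin {R : realType} (u : nat -> R) (l : R) :
 u n @[n --> \oo] --> l -> (u n)%:E @[n --> \oo] --> l%:E.
Proof. by move=> h; apply: cvg_EFin => //; exact: nearW. Qed.

Notation mfunM := measurable_funM.
Notation mfunC := measurableT_comp.
Notation mEFinP := measurable_EFinP.

Lemma le_of_eq {d} {T : porderType d} (x y : T) : x = y -> (x <= y)%O.
Proof. by move=> ->. Qed.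

Lemma norm_sq {R : realDomainType} (x : R) : `|x| ^+ 2 = x ^+ 2.
Proof. by rewrite real_normK ?num_real. Qed.

(** * Real-valued integrals and the L^2 inner product *)

Section rint.
Context {d} {T : measurableType d} {R : realType}.
Variable mu : {measure set T -> \bar R}.
Implicit Types f g h : T -> R.
Local Notation rint := (rint mu).

Lemma rint_meas f : rint f -> measurable_fun setT f.
Proof. by move=> /integrableP[/mEFinP]. Qed.

Lemma rintP f : measurable_fun setT f ->
 (\int[mu]_x `|f x|%:E < +oo)%E -> rint f.
Proof.
by move=> mf h; apply/integrableP; split; [exact/mEFinP|].
Qed.

Lemma rint_eq f g : f =1 g -> rint f -> rint g.
Proof. by move=> /funext ->. Qed.

Lemma rint_le f g : measurable_fun setT f -> rint g ->
 (forall x, `|f x| <= g x) -> rint f.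
Proof.
move=> mf ig fg; apply: le_integrable ig => //; first exact/mEFinP.
by move=> x _ /=; rewrite lee_fin (le_trans (fg x)) ?ler_norm.
Qed.

Lemma rintD f g : rint f -> rint g -> rint (fun x => f x + g x).
Proof. by move=> f1 g1; apply: eq_integrable (integrableD measurableT f1 g1). Qed.

Lemma rintB f g : rint f -> rint g -> rint (fun x => f x - g x).
Proof. by move=> f1 g1; apply: eq_integrable (integrableB measurableT f1 g1). Qed.

Lemma rintZ a f : rint f -> rint (fun x => a * f x).
Proof. by move=> f1; apply: eq_integrable (integrableZl measurableT a f1). Qed.

Lemma rintN f : rint f -> rint (fun x => - f x).
Proof. by move=> f1; apply: eq_integrable (integrableN f1). Qed.

Lemma rint_norm f : rint f -> rint (fun x => `|f x|).
Proof. by move=> f1; exact: integrable_norm. Qed.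

Lemma rint0 : rint (fun=> 0).
Proof. exact: integrable0. Qed.

Lemma IntE f : rint f -> (\int[mu]_x (f x)%:E)%E = (\int[mu]_x f x)%:E.
Proof.
by move=> f1; rewrite /Rintegral fineK//; exact: integrable_fin_num f1.
Qed.

Lemma IntD f g : rint f -> rint g ->
 \int[mu]_x (f x + g x) = \int[mu]_x f x + \int[mu]_x g x.
Proof. by move=> f1 g1; exact: RintegralD. Qed.

Lemma IntB f g : rint f -> rint g ->
 \int[mu]_x (f x - g x) = \int[mu]_x f x - \int[mu]_x g x.
Proof. by move=> f1 g1; exact: RintegralB. Qed.

Lemma IntZ a f : rint f -> \int[mu]_x (a * f x) = a * \int[mu]_x f x.
Proof. by move=> f1; exact: RintegralZl. Qed.

Lemma IntN f : rint f -> \int[mu]_x (- f x) = - \int[mu]_x f x.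
Proof.
move=> f1; rewrite -mulN1r -IntZ//; congr Rintegral.
by apply/funext => x; rewrite mulN1r.
Qed.

Lemma Int_le f g : rint f -> rint g -> (forall x, f x <= g x) ->
 \int[mu]_x f x <= \int[mu]_x g x.
Proof. by move=> f1 g1 fg; apply: le_Rintegral. Qed.

Lemma Int_ge0 f : (forall x, 0 <= f x) -> 0 <= \int[mu]_x f x.
Proof. by move=> f0; apply: Rintegral_ge0. Qed.

Lemma Int_norm f : rint f -> `|\int[mu]_x f x| <= \int[mu]_x `|f x|.
Proof. by move=> f1; apply: le_normr_Rintegral. Qed.

Lemma eq_Int f g : f =1 g -> \int[mu]_x f x = \int[mu]_x g x.
Proof. by move=> /funext ->. Qed.

Lemma ae_Int f g : measurable_fun setT f -> measurable_fun setT g ->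
 {ae mu, forall x, f x = g x} -> \int[mu]_x f x = \int[mu]_x g x.
Proof.
move=> mf mg fg; congr fine; apply: ae_eq_integral => //.
- exact/mEFinP.
- exact/mEFinP.
- by apply: filterS fg => x -> .
Qed.

Lemma ae_rint f g : measurable_fun setT g ->
 {ae mu, forall x, f x = g x} -> rint f -> rint g.
Proof.
move=> mg fg f1; have mf := rint_meas f1; apply: rintP => //.
have /integrableP[_] := f1.
rewrite (ae_eq_integral (fun x => `|g x|%:E))//.
- by apply/mEFinP; exact: mfunC.
- by apply/mEFinP; exact: mfunC.
- by apply: filterS fg => x /= ->.
Qed.

Lemma Int0_ae f : rint f -> (forall x, 0 <= f x) -> \int[mu]_x f x = 0 ->
 {ae mu, forall x, f x = 0}.
Proof.
move=> f1 f0 i0.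
have := IntE f1; rewrite i0 => h.
have mf : measurable_fun setT (EFin \o f) by apply/mEFinP/rint_meas.
have : (\int[mu]_x `|(EFin \o f) x| = 0)%E.
 by rewrite -[RHS]h; apply: eq_integral => x _ /=; rewrite ger0_norm.
move=> /(ae_eq_integral_abs mu measurableT mf).
by apply: filterS => x /(_ I) /= -[].
Qed.

Lemma ge0_rintP f : measurable_fun setT f -> (forall x, 0 <= f x) ->
 (\int[mu]_x (f x)%:E < +oo)%E -> rint f.
Proof.
move=> mf f0 h; apply: rintP => //.
by under eq_integral => x _ do rewrite ger0_norm//.
Qed.

Lemma rint_lty f : rint f -> (\int[mu]_x (f x)%:E < +oo)%E.
Proof. by move=> f1; rewrite IntE// ltry. Qed.

Lemma Int_ler f (r : R) : measurable_fun setT f -> (forall x, 0 <= f x) ->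
 (\int[mu]_x (f x)%:E <= r%:E)%E -> rint f /\ \int[mu]_x f x <= r.
Proof.
move=> mf f0 h; have f1 : rint f by apply: ge0_rintP => //; exact: le_lt_trans h (ltry _).
by split=> //; rewrite -lee_fin -IntE.
Qed.

End rint.

Section sqint.
Context {d} {T : measurableType d} {R : realType}.
Variable mu : {measure set T -> \bar R}.
Implicit Types f g h : T -> R.
Local Notation rint := (rint mu).
Local Notation sqint := (sqint mu).
Local Notation ip := (ip mu).

Lemma sqint_meas f : sqint f -> measurable_fun setT f. Proof. by case. Qed.
Lemma sqint_sq f : sqint f -> rint (fun x => f x ^+ 2). Proof. by case. Qed.


Lemma sqint_mul f g : sqint f -> sqint g -> rint (fun x => f x * g x).
Proof.
move=> [mf f2] [mg g2]; apply: (@rint_le _ _ _ _ _ (fun x => f x ^+ 2 + g x ^+ 2)).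
- exact: mfunM.
- exact: rintD.
move=> x; rewrite normrM -(norm_sq (f x)) -(norm_sq (g x)).
have := sqr_ge0 (`|f x| - `|g x|); have := normr_ge0 (f x); have := normr_ge0 (g x).
nra.
Qed.

Lemma sqint_le f g : measurable_fun setT f -> sqint g ->
 (forall x, `|f x| <= `|g x|) -> sqint f.
Proof.
move=> mf [mg g2] fg; split=> //; apply: rint_le g2 _; first exact: measurable_funX.
by move=> x; rewrite normrX -(norm_sq (g x)) lerXn2r ?nnegrE.
Qed.

Lemma sqintZ a f : sqint f -> sqint (fun x => a * f x).
Proof.
move=> [mf f2]; split; first exact: mfunM.
by apply: rint_eq (rintZ (a ^+ 2) f2) => x; rewrite exprMn.
Qed.

Lemma sqintD f g : sqint f -> sqint g -> sqint (fun x => f x + g x).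
Proof.
move=> f2 g2; split; first by apply: measurable_funD; exact: sqint_meas.
have := rintD (rintD (sqint_sq f2) (rintZ 2 (sqint_mul f2 g2))) (sqint_sq g2).
by apply: rint_eq => x; ring.
Qed.

Lemma sqintN f : sqint f -> sqint (fun x => - f x).
Proof. by move/(sqintZ (-1)); under eq_fun do rewrite mulN1r. Qed.

Lemma sqintB f g : sqint f -> sqint g -> sqint (fun x => f x - g x).
Proof. by move=> f2 /sqintN; exact: sqintD. Qed.

Lemma sqint0 : sqint (fun=> 0).
Proof. by split => //; apply: rint_eq (rint0 mu) => x; rewrite expr0n. Qed.

Lemma sqint_norm f : sqint f -> sqint (fun x => `|f x|).
Proof.
move=> f2; apply: (@sqint_le _ f) => // [|x]; last by rewrite normr_id.
by apply: mfunC => //; exact: sqint_meas.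
Qed.

Lemma ae_sqint f g : measurable_fun setT g -> {ae mu, forall x, f x = g x} ->
 sqint f -> sqint g.
Proof.
move=> mg fg [mf f2]; split => //; apply: ae_rint f2; first exact: measurable_funX.
by apply: filterS fg => x ->.
Qed.

Lemma ipE f g : ip f g = \int[mu]_x (f x * g x). Proof. by []. Qed.

Lemma ipC f g : ip f g = ip g f.
Proof. by apply: eq_Int => x; rewrite mulrC. Qed.

Lemma ipDl f g h : sqint f -> sqint g -> sqint h ->
 ip (fun x => f x + g x) h = ip f h + ip g h.
Proof.
move=> f2 g2 h2; rewrite !ipE -IntD; try exact: sqint_mul.
by apply: eq_Int => x; rewrite mulrDl.
Qed.

Lemma ipZl a f h : sqint f -> sqint h -> ip (fun x => a * f x) h = a * ip f h.
Proof.
move=> f2 h2; rewrite !ipE -IntZ; last exact: sqint_mul.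
by apply: eq_Int => x; rewrite mulrA.
Qed.

Lemma ipBl f g h : sqint f -> sqint g -> sqint h ->
 ip (fun x => f x - g x) h = ip f h - ip g h.
Proof.
move=> f2 g2 h2; rewrite !ipE -IntB; try exact: sqint_mul.
by apply: eq_Int => x; rewrite mulrBl.
Qed.

Lemma ipDr f g h : sqint f -> sqint g -> sqint h ->
 ip h (fun x => f x + g x) = ip h f + ip h g.
Proof. by move=> *; rewrite ipC ipDl// !(ipC h). Qed.

Lemma ipBr f g h : sqint f -> sqint g -> sqint h ->
 ip h (fun x => f x - g x) = ip h f - ip h g.
Proof. by move=> *; rewrite ipC ipBl// !(ipC h). Qed.

Lemma ipZr a f h : sqint f -> sqint h -> ip h (fun x => a * f x) = a * ip h f.
Proof. by move=> *; rewrite ipC ipZl// ipC. Qed.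

Lemma ip_ge0 f : 0 <= ip f f.
Proof. by apply: Int_ge0 => x; rewrite -expr2 sqr_ge0. Qed.

Lemma ipsE f : ip f f = \int[mu]_x (f x ^+ 2).
Proof. by apply: eq_Int => x; rewrite expr2. Qed.

Lemma ip_comb a b f g : sqint f -> sqint g ->
 ip (fun x => a * f x + b * g x) (fun x => a * f x + b * g x) =
 a ^+ 2 * ip f f + 2 * a * b * ip f g + b ^+ 2 * ip g g.
Proof.
move=> f2 g2; have af := sqintZ a f2; have bg := sqintZ b g2.
rewrite ipDl ?ipDr ?ipZl ?ipZr//; try exact: sqintD.
by rewrite (ipC g f); ring.
Qed.

Lemma ipD_sq f g : sqint f -> sqint g ->
 ip (fun x => f x + g x) (fun x => f x + g x) = ip f f + 2 * ip f g + ip g g.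
Proof. by move=> f2 g2; rewrite ipDl ?ipDr ?(ipC g f) //; [ring|exact: sqintD]. Qed.

Lemma ipB_sq f g : sqint f -> sqint g ->
 ip (fun x => f x - g x) (fun x => f x - g x) = ip f f - 2 * ip f g + ip g g.
Proof. by move=> f2 g2; rewrite ipBl ?ipBr ?(ipC g f) //; [ring|exact: sqintB]. Qed.

Lemma cauchy_schwarz f g : sqint f -> sqint g ->
 ip f g ^+ 2 <= ip f f * ip g g.
Proof.
move=> f2 g2.
have h a b : 0 <= a ^+ 2 * ip f f + 2 * a * b * ip f g + b ^+ 2 * ip g g.
 by rewrite -ip_comb//; exact: ip_ge0.
have := ip_ge0 f; rewrite le_eqVlt => /predU1P[f0|f0]; last first.
 by have := h (ip f g) (- ip f f); nra.
have [->|n0] := eqVneq (ip f g) 0; first by rewrite -f0 expr0n /= mul0r.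
(* With [ip f f = 0] the form is affine in its first argument, and this value makes it [-1]. *)
have := h (- (ip g g + 1) / (2 * ip f g)) 1.
rewrite -f0 mulr0 add0r (_ : 2 * _ * 1 * ip f g = - (ip g g + 1)); last by field.
by rewrite expr1n mul1r => ?; exfalso; lra.
Qed.

Lemma ip_eq0 f : sqint f -> ip f f = 0 -> {ae mu, forall x, f x = 0}.
Proof.
move=> f2; rewrite ipsE => /Int0_ae.
move=> /(_ (sqint_sq f2) (fun x => sqr_ge0 _)).
by apply: filterS => x /eqP; rewrite sqrf_eq0 => /eqP.
Qed.

Lemma ae_ip f g f' g' : measurable_fun setT f -> measurable_fun setT g ->
 measurable_fun setT f' -> measurable_fun setT g' ->
 {ae mu, forall x, f x = f' x} -> {ae mu, forall x, g x = g' x} ->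
 ip f g = ip f' g'.
Proof.
move=> mf mg mf' mg' ff gg; apply: ae_Int; try exact: mfunM.
by apply: filterS2 ff gg => x -> ->.
Qed.

Lemma ip_parallelogram f g : sqint f -> sqint g ->
 ip (fun x => f x + g x) (fun x => f x + g x) <= 2 * ip f f + 2 * ip g g.
Proof.
move=> f2 g2; have := ip_ge0 (fun x => f x - g x).
by rewrite ipB_sq// ipD_sq//; lra.
Qed.

End sqint.
#[global] Hint Extern 0 (measurable_fun setT _) => (apply: sqint_meas; assumption) : core.

Lemma sqintL2 {R : realType} (f : R -> R) :
 L2 f <-> sqint (@lebesgue_measure R) f.
Proof.
split=> [|[mf f2]].
 rewrite /L2 => h; split; last exact: Lfun2_integrable_sqr.
 by move: h; rewrite inE => /andP[+ _]; rewrite inE.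
rewrite /L2 inE; apply/andP; split; rewrite inE//= /finite_norm unlock /Lnorm.
rewrite poweR_lty//.
have /rint_lty := f2; apply: le_lt_trans.
apply: le_of_eq; apply: eq_integral => x _ /=.
by rewrite powR_mulrn// real_normK// num_real.
Qed.

(** * Almost everywhere limits and completeness of L^2 *)

Section completeness.
Context {d} {T : measurableType d} {R : realType}.
Variable mu : {measure set T -> \bar R}.
Implicit Types f g h : T -> R.

Definition sqdist f g : R := ip mu (fun x => f x - g x) (fun x => f x - g x).

Lemma sqdist_ge0 f g : 0 <= sqdist f g. Proof. exact: ip_ge0. Qed.

Lemma sqdistC f g : sqdist f g = sqdist g f.
Proof. by apply: eq_Int => x; ring. Qed.

Lemma sqdist_tri f g h : sqint mu f -> sqint mu g -> sqint mu h ->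
 sqdist f h <= 2 * sqdist f g + 2 * sqdist g h.
Proof.
move=> f2 g2 h2.
have := @ip_parallelogram _ _ _ mu _ _ (sqintB f2 g2) (sqintB g2 h2).
by congr (_ <= _); apply: eq_Int => x; ring.
Qed.

(* Fast subsequence: weighting the squared increments by 2^k keeps the series
 summable and makes the increments geometrically small almost everywhere. *)
Lemma sq_fast_cauchy_ae (v : nat -> T -> R) :
 (forall n, sqint mu (v n)) ->
 (forall n, sqdist (v n.+1) (v n) <= 4^-1 ^+ n) ->
 {ae mu, forall x, cvgn (v ^~ x)}.
Proof.
move=> v2 vc.
pose a n x := 2 ^+ n * (v n.+1 x - v n x) ^+ 2.
have a2 n : rint mu (a n).
 by apply: rintZ; apply: sqint_sq; exact: sqintB.
have a0 n x : 0 <= a n x by rewrite mulr_ge0 ?sqr_ge0 ?exprn_ge0.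
have ma n : measurable_fun setT (fun x => (a n x)%:E).
 by apply/mEFinP; exact: rint_meas.
have ia n : (\int[mu]_x (a n x)%:E <= ((2^-1 ^+ n)%R)%:E)%E.
 rewrite IntE// lee_fin IntZ; last by apply: sqint_sq; exact: sqintB.
 rewrite -ipsE; apply: le_trans (_ : 2 ^+ n * 4^-1 ^+ n <= _).
  by rewrite ler_wpM2l ?exprn_ge0//; exact: vc.
 by rewrite -exprMn (_ : 2 * 4^-1 = 2^-1 :> R)//; field.
have sl : (\int[mu]_x (\sum_(n <oo) (a n x)%:E) < +oo)%E.
 rewrite integral_nneseries//; last by move=> n x _; rewrite lee_fin.
 apply: (@le_lt_trans _ _ (\sum_(n <oo) ((2^-1 ^+ n)%R)%:E)%E).
  by apply: lee_nneseries => [n _ _|n _]; [apply: integral_ge0 => x _; rewrite lee_fin|exact: ia].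
 have -> : (\sum_(n <oo) ((2^-1 ^+ n)%R)%:E = 2%:E :> \bar R)%E; last exact: ltry.
 apply/cvg_lim => //.
 have := @cvg_geometric_series R 1 2^-1; rewrite ger0_norm ?invr_ge0// => /(_ _).
 move=> /(_ ltac:(lra)) h.
 have := cvgn_EFin h.
 rewrite (_ : 1 / (1 - 2^-1) = 2); last by field.
 apply: cvg_trans; apply: near_eq_cvg; near=> n => /=.
 by rewrite /series /= -sumEFin; apply: eq_bigr => i _; rewrite /geometric/= mul1r.
have := integrable_ae measurableT (_ : mu.-integrable setT (fun x => \sum_(n <oo) (a n x)%:E)%E).
have h : mu.-integrable setT (fun x => \sum_(n <oo) (a n x)%:E)%E.
 apply/integrableP; split.
  by apply: ge0_emeasurable_sum => // n x _ _; rewrite lee_fin.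
 apply: le_lt_trans sl; apply: le_of_eq.
 apply: eq_integral => x _; rewrite gee0_abs//.
 by apply: nneseries_ge0 => n _ _; rewrite lee_fin.
move=> /(_ h); apply: filterS => x /(_ I) fx.
set S := (\sum_(n <oo) _)%E in fx.
have aS n : a n x <= fine S.
 rewrite -lee_fin fineK//; apply: le_trans (nneseries_lim_ge n.+1 _); last first.
  by move=> *; rewrite lee_fin.
 by rewrite big_mkord big_ord_recr/= leeDr// sume_ge0// => *; rewrite lee_fin.
have cv : cvgn (series (telescope (v ^~ x))).
 apply: normed_cvg.
 pose r := Num.sqrt (2^-1 : R).
 have r1 : `|r| < 1.
  rewrite ger0_norm ?sqrtr_ge0// -[ltRHS]sqrtr1 ltr_sqrt//; lra.
 apply: (@series_le_cvg _ _ (geometric (Num.sqrt (fine S)) r)) => //.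
 - by move=> n /=.
 - by move=> n; rewrite /geometric/= mulr_ge0 ?exprn_ge0 ?sqrtr_ge0.
 - move=> n /=; rewrite /telescope -sqrtr_sqr.
  have -> : r ^+ n = Num.sqrt (2^-1 ^+ n).
   by rewrite /r; elim: n => [|n IH]; rewrite ?expr0 ?sqrtr1// exprSr IH exprSr sqrtrM ?exprn_ge0.
  rewrite -sqrtrM; last exact: le_trans (a0 0%N x) (aS 0%N).
  rewrite ler_wsqrtr// exprVn ler_pdivlMr ?exprn_gt0// mulrC; exact: aS.
 - exact: is_cvg_geometric_series.
rewrite (_ : v ^~ x = (fun n => v 0%N x + series (telescope (v ^~ x)) n)); last first.
 by apply/funext => n; exact: (eq_sum_telescope (v ^~ x)).
by apply: is_cvgD => //; exact: is_cvg_cst.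
Unshelve. all: end_near. Qed.

Lemma fatou_le (f : nat -> T -> R) g (e : R) :
 (forall n, rint mu (f n)) -> (forall n x, 0 <= f n x) ->
 measurable_fun setT g -> (forall x, 0 <= g x) ->
 {ae mu, forall x, f n x @[n --> \oo] --> g x} ->
 (\forall n \near \oo, \int[mu]_x f n x <= e) ->
 rint mu g /\ \int[mu]_x g x <= e.
Proof.
move=> f1 f0 mg g0 fg fe; apply: Int_ler => //.
have mf n : measurable_fun setT (fun x => (f n x)%:E).
 by apply/mEFinP; exact: rint_meas.
have := @fatou _ T R mu setT measurableT (fun n x => (f n x)%:E) mf
 (fun n x _ => ltac:(by rewrite lee_fin)).
rewrite (_ : (\int[mu]_x limn_einf _)%E = (\int[mu]_x (g x)%:E)%E).
 move=> /le_trans; apply; rewrite limn_einf_lim; apply: lime_le.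
  exact: is_cvg_einfs.
 near=> n; apply: le_trans (_ : (\int[mu]_x (f n x)%:E <= _)%E).
  by apply: ereal_inf_lbound; exists n => /=.
 by rewrite IntE// lee_fin; near: n.
apply: ae_eq_integral => //.
- have -> : (fun x => limn_einf (fun n => (f n x)%:E)) =
  (fun x => - limn_esup (fun n => - (f n x)%:E))%E by [].
 apply: mfunC => //; apply: measurable_fun_limn_esup => n.
 exact: mfunC.
- exact/mEFinP.
apply: filterS fg => x h _.
have h' : (f n x)%:E @[n --> \oo] --> (g x)%:E by exact: cvgn_EFin.
by rewrite is_cvg_limn_einfE; [by have /cvg_lim -> := h'|exact: cvgP h'].
Unshelve. all: end_near. Qed.

(** The limsup is measurable everywhere, whereas the pointwise limit may fail to exist on a null
    set. *)
Lemma ae_lim (v : nat -> T -> R) : (forall n, measurable_fun setT (v n)) ->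
 {ae mu, forall x, cvgn (v ^~ x)} ->
 exists2 f : T -> R, measurable_fun setT f & {ae mu, forall x, v n x @[n --> \oo] --> f x}.
Proof.
move=> mv cv; exists (fun x => fine (limn_esup (fun n => (v n x)%:E))).
 apply: mfunC => //; apply: measurable_fun_limn_esup => n.
 exact/mEFinP.
apply: filterS cv => x cx.
have h' : (v n x)%:E @[n --> \oo] --> (limn (v ^~ x))%:E.
 exact: cvgn_EFin.
by rewrite is_cvg_limn_esupE; [rewrite (cvg_lim _ h')|exact: cvgP h'].
Qed.

(* Riesz-Fischer, together with an almost everywhere convergent subsequence. *)
Lemma sq_complete (u : nat -> T -> R) : (forall n, sqint mu (u n)) ->
 (forall e, 0 < e -> exists N, forall m n, (N <= m)%N -> (N <= n)%N ->
  sqdist (u m) (u n) <= e) ->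
 exists f, [/\ sqint mu f, sqdist (u n) f @[n --> \oo] --> 0 &
  exists2 s : nat -> nat, (forall k, (k <= s k)%N) &
   {ae mu, forall x, u (s n) x @[n --> \oo] --> f x}].
Proof.
move=> u2 uc.
have /choice[N NP] k : exists N, forall m n, (N <= m)%N -> (N <= n)%N ->
 sqdist (u m) (u n) <= 4^-1 ^+ k by apply: uc; rewrite exprn_gt0.
pose s k := (\sum_(i < k.+1) (N i).+1)%N.
have sN j k : (j <= k)%N -> (N j <= s k)%N.
 move=> jk; rewrite /s (bigD1 (Ordinal (jk : (j < k.+1)%N)))//=.
 by rewrite (leq_trans (leqnSn _))// leq_addr.
have sk k : (k <= s k)%N.
 rewrite /s; elim: k => // k IH; rewrite big_ord_recr/= addnS ltnS.
 exact: leq_trans IH (leq_addr _ _).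
pose v k := u (s k).
have [f mf vf] : exists2 f : T -> R, measurable_fun setT f &
  {ae mu, forall x, v n x @[n --> \oo] --> f x}.
 apply: ae_lim => [n|]; first by apply: sqint_meas; exact: u2.
 by apply: sq_fast_cauchy_ae => n; [exact: u2|apply: NP; exact: sN].
have key k n : (N k <= n)%N ->
  rint mu (fun x => (u n x - f x) ^+ 2) /\ sqdist (u n) f <= 4^-1 ^+ k.
 move=> kn; rewrite /sqdist ipsE.
 apply: (@fatou_le (fun j x => (u n x - v j x) ^+ 2)).
 - by move=> j; apply: sqint_sq; apply: sqintB; exact: u2.
 - by move=> j x; exact: sqr_ge0.
 - by apply: measurable_funX; apply: measurable_funB => //; apply: sqint_meas; exact: u2.
 - by move=> x; exact: sqr_ge0.
 - apply: filterS vf => x vx; under eq_fun do rewrite expr2.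
  by rewrite expr2; apply: cvgM; apply: cvgB => //; exact: cvg_cst.
 - near=> j; rewrite -ipsE; apply: NP => //; apply: sN.
  by near: j; exact: nbhs_infty_ge.
have f2 : sqint mu f.
 have h : sqint mu (fun x => u (N 0%N) x - f x).
  split; first by apply: measurable_funB => //; apply: sqint_meas; exact: u2.
  by have [] := key 0%N (N 0%N) (leqnn _).
 by have := sqintB (u2 (N 0%N)) h; under eq_fun do rewrite subKr.
exists f; split=> //; last by exists s.
apply/cvgrPdist_le => e e0.
have [k ke] : exists k, 4^-1 ^+ k <= e :> R.
 have /cvgrPdist_le/(_ _ e0)[k _ /(_ k (leqnn _))] := @cvg_geometric R 1 4^-1
  ltac:(rewrite ger0_norm ?invr_ge0//; lra).
 rewrite /= sub0r normrN mul1r ger0_norm ?exprn_ge0// => ?; by exists k.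
near=> n; rewrite sub0r normrN ger0_norm ?sqdist_ge0//.
apply: le_trans ke; apply: (proj2 (key _ _ _)).
by near: n; exact: nbhs_infty_ge.
Unshelve. all: end_near. Qed.

End completeness.

Section ip_lin.
Context {d} {T : measurableType d} {R : realType}.
Variable mu : {measure set T -> \bar R}.
Implicit Types f g h : T -> R.

Lemma ipl_lin a b f g h : sqint mu f -> sqint mu g -> sqint mu h ->
 ip mu (fun x => a * f x + b * g x) h = a * ip mu f h + b * ip mu g h.
Proof.
move=> f2 g2 h2; rewrite ipDl//; try exact: sqintZ.
by rewrite (@ipZl _ _ _ mu a f h)// (@ipZl _ _ _ mu b g h).
Qed.

Lemma ipr_lin a b f g h : sqint mu f -> sqint mu g -> sqint mu h ->
 ip mu h (fun x => a * f x + b * g x) = a * ip mu h f + b * ip mu h g.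
Proof. by move=> f2 g2 h2; rewrite ipC ipl_lin// !(ipC _ h). Qed.

Lemma sqint_lin a b f g : sqint mu f -> sqint mu g ->
 sqint mu (fun x => a * f x + b * g x).
Proof. by move=> f2 g2; apply: sqintD; exact: sqintZ. Qed.

End ip_lin.

Lemma quad_disc {R : realFieldType} (e b c : R) :
 (forall t, 0 <= e - 2 * t * b + t ^+ 2 * c) -> 0 <= c -> b ^+ 2 <= e * c.
Proof.
move=> h; rewrite le_eqVlt => /predU1P[c0|c0]; last first.
 have := h (b / c).
 have -> : e - 2 * (b / c) * b + (b / c) ^+ 2 * c = (e * c - b ^+ 2) / c by field; rewrite gt_eqF.
 by rewrite pmulr_lge0 ?invr_gt0// subr_ge0.
have [->|b0] := eqVneq b 0; first by rewrite expr0n /= -c0 mulr0.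
have := h ((e + 1) / (2 * b)); rewrite -c0 mulr0 addr0.
have -> : 2 * ((e + 1) / (2 * b)) * b = e + 1 by field.
by move=> ?; exfalso; lra.
Qed.

(** * Density of a subspace with trivial orthogonal complement *)

Section density.
Context {d} {T : measurableType d} {R : realType}.
Variable mu : {measure set T -> \bar R}.
Variable D : (T -> R) -> Prop.
Hypothesis D_sq : forall g, D g -> sqint mu g.
Hypothesis D0 : D (fun=> 0).
Hypothesis D_lin : forall a b g h, D g -> D h -> D (fun x => a * g x + b * h x).
Hypothesis D_orth : forall p, sqint mu p -> (forall g, D g -> ip mu p g = 0) ->
 {ae mu, forall x, p x = 0}.

(** [D] is not closed, so there is no projection onto it. A sequence in [D] minimizing the distance
    to [f] is Cauchy by the parallelogram identity, and its limit [p] makes [f - p] orthogonal to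
    [D]; hence [f = p] almost everywhere. *)
Lemma dense_of_orth f : sqint mu f ->
 forall e, 0 < e -> exists2 g, D g & sqdist mu f g <= e.
Proof.
move=> f2 e e0; pose A := [set sqdist mu f g | g in D].
have hA : has_inf A.
 split; first by exists (sqdist mu f (fun=> 0)); exists (fun=> 0).
 by exists 0 => _ [g _ <-]; exact: sqdist_ge0.
have dl g : D g -> inf A <= sqdist mu f g.
 by move=> Dg; apply: ge_inf; [case: hA|exists g].
have /choice[g gP] : forall n : nat, exists g, D g /\ sqdist mu f g <= inf A + n.+1%:R^-1.
 move=> n; have [|_ [g Dg <-] /ltW gl] := inf_adherent (_ : 0 < n.+1%:R^-1) hA; first by [].
 by exists g.
have Dg n : D (g n) := proj1 (gP n).
have gl n : sqdist mu f (g n) <= inf A + n.+1%:R^-1 := proj2 (gP n).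
have g2 n : sqint mu (g n) by exact: D_sq.
(* Almost minimality gives almost orthogonality: moving [g n] along [h] cannot lower the squared
   distance to [f] by more than [n.+1%:R^-1], which bounds a discriminant. *)
have ob n h : D h -> ip mu (fun x => f x - g n x) h ^+ 2 <= n.+1%:R^-1 * ip mu h h.
 move=> Dh; have h2 := D_sq Dh; apply: quad_disc; last exact: ip_ge0.
 move=> t; have := dl _ (D_lin 1 t (Dg n) Dh).
 have -> : sqdist mu f (fun x => 1 * g n x + t * h x) =
   sqdist mu f (g n) - 2 * t * ip mu (fun x => f x - g n x) h + t ^+ 2 * ip mu h h.
  rewrite /sqdist.
  have -> : (fun x => f x - (1 * g n x + t * h x)) =
   (fun x => 1 * (f x - g n x) + (- t) * h x) by apply/funext => x; ring.
  by rewrite ip_comb//; [ring|exact: sqintB].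
 have := gl n; set X := ip mu (fun x => f x - g n x) h; set Y := ip mu h h.
 set S := sqdist mu f (g n); set I := inf A; set N := n.+1%:R^-1.
 by move=> k1 k2; rewrite -(lerD2l I) addr0; apply: le_trans k2 _; rewrite !addrA !lerD2r.
have [p [p2 gp _]] : exists p, [/\ sqint mu p, sqdist mu (g n) p @[n --> \oo] --> 0 &
  exists2 s : nat -> nat, (forall k, (k <= s k)%N) &
   {ae mu, forall x, g (s n) x @[n --> \oo] --> p x}].
 apply: sq_complete => // e' e'0.
 have [N Ne] : exists N : nat, 4 * N.+1%:R^-1 <= e'.
  have [N _ /(_ N (leqnn _))] := near_infty_natSinv_lt (PosNum (divr_gt0 e'0 (ltr0n R 4))).
  by rewrite /= => /ltW h; exists N; move: h; rewrite ler_pdivlMr// mulrC.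
 exists N => m n Nm Nn.
 have := dl _ (D_lin 2^-1 2^-1 (Dg m) (Dg n)).
 have -> : sqdist mu f (fun x => 2^-1 * g m x + 2^-1 * g n x) =
  2^-1 * sqdist mu f (g m) + 2^-1 * sqdist mu f (g n) - 4^-1 * sqdist mu (g m) (g n).
  have fm := sqintB f2 (g2 m); have fn := sqintB f2 (g2 n).
  rewrite /sqdist.
  have -> : (fun x => f x - (2^-1 * g m x + 2^-1 * g n x)) =
   (fun x => 2^-1 * (f x - g m x) + 2^-1 * (f x - g n x)) by apply/funext => x; field.
  have -> : (fun x => g m x - g n x) =
   (fun x => (-1) * (f x - g m x) + 1 * (f x - g n x)) by apply/funext => x; ring.
  by rewrite !ip_comb//; field.
 have := gl m; have := gl n.
 have : m.+1%:R^-1 <= N.+1%:R^-1 :> R by rewrite lef_pV2 ?posrE// ler_nat.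
 have : n.+1%:R^-1 <= N.+1%:R^-1 :> R by rewrite lef_pV2 ?posrE// ler_nat.
 move: Ne; move: (N.+1%:R^-1) (m.+1%:R^-1) (n.+1%:R^-1) => i j k.
 by move: (inf A) (sqdist _ _ _) (sqdist _ _ _) (sqdist _ _ _) => i' j' k' l'; lra.
have fp2 := sqintB f2 p2.
have po : {ae mu, forall x, f x - p x = 0}.
 apply: D_orth => // h Dh; have h2 := D_sq Dh.
 apply/eqP; rewrite -normr_eq0 -sqrf_eq0 -normrX; apply/eqP/le_anti; rewrite normr_ge0 andbT.
 apply/ler_addgt0Pl => e' e'0; rewrite addr0.
 pose c := 2 * (ip mu h h + 1).
 have c0 : 0 < c by rewrite mulr_gt0// ltr_wpDl ?ip_ge0.
 have ec : 0 < e' / (2 * c) by apply: divr_gt0 => //; exact: mulr_gt0.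
 have /cvgrPdist_le/(_ _ ec) [N1 _ N1P] := gp.
 have [N2 _ N2P] := near_infty_natSinv_lt (PosNum (divr_gt0 e'0 (mulr_gt0 (ltr0n R 2) c0))).
 pose n := maxn N1 N2.
 have := N1P n (leq_maxl _ _); rewrite /= sub0r normrN ger0_norm ?sqdist_ge0// => h1.
 have := N2P n (leq_maxr _ _) => /= /ltW h3.
 have gp2 := sqintB (g2 n) p2; have fg2 := sqintB f2 (g2 n).
 have -> : (fun x => f x - p x) = (fun x => (f x - g n x) + (g n x - p x)).
  by apply/funext => x; ring.
 rewrite ipDl// normrX norm_sq//.
 have := ob n h Dh; have := cauchy_schwarz gp2 h2.
 rewrite -/(sqdist mu (g n) p).
 set A1 := ip mu (fun x => g n x - p x) h; set A2 := ip mu (fun x => f x - g n x) h; pose H := ip mu h h; rewrite -/H.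
 have cH : c = 2 * (H + 1) by [].
 have H0 : 0 <= H by exact: ip_ge0.
 move=> k1 k2.
 have : (A2 + A1) ^+ 2 <= 2 * (A2 ^+ 2 + A1 ^+ 2) by have := sqr_ge0 (A2 - A1); nra.
 have : e' / (2 * c) * (2 * H) + e' / (2 * c) * (2 * H) <= e'.
  have -> : e' / (2 * c) * (2 * H) + e' / (2 * c) * (2 * H) = e' * (2 * H / c).
   by field; rewrite gt_eqF.
  by rewrite ler_piMr ?(ltW e'0)// ler_pdivrMr// mul1r cH; lra.
 have : sqdist mu (g n) p * H <= e' / (2 * c) * H by rewrite ler_wpM2r.
 have : n.+1%:R^-1 * H <= e' / (2 * c) * H by rewrite ler_wpM2r.
 move: k1 k2; clear; move: (e' / (2 * c)) (n.+1%:R^-1) (sqdist _ _ _) => E N S.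
 by lra.
have /cvgrPdist_le/(_ e e0) [N _ /(_ N (leqnn _))] := gp.
rewrite /= sub0r normrN ger0_norm ?sqdist_ge0// => h; exists (g N) => //.
apply: le_trans h; rewrite sqdistC le_eqVlt; apply/orP; left; apply/eqP.
have m1 := sqint_meas (sqintB (g2 N) f2).
have m2 := sqint_meas (sqintB (g2 N) p2).
by apply: ae_ip => //; apply: filterS po => x /eqP; rewrite subr_eq0 => /eqP ->.
Qed.

End density.

(* [measurableTypeR R] carries the display on which [lebesgue_measure] lives. *)
Definition leb (R : realType) : {sigma_finite_measure set (measurableTypeR R) -> \bar R} :=
 @lebesgue_measure R.
Notation measR f := (@measurable_fun _ _ (measurableTypeR _) _ setT f).
Notation measR2 f :=
 (@measurable_fun _ _ (measurableTypeR _ * measurableTypeR _)%type _ setT f).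
Notation leb2 R := ((leb R \x leb R)%E).

Global Instance ae_filter_leb (R : realType) : Filter (nbhs (almost_everywhere (leb R))).
Proof. by apply: ae_filter_ringOfSetsType. Qed.

Lemma continuous_measR (R : realType) (f : R -> R) : continuous f -> measR f.
Proof. by move=> h; apply: continuous_measurable_fun h. Qed.

(** * Fubini for real-valued integrals on products *)

Section product.
Context {d1 d2} {T1 : measurableType d1} {T2 : measurableType d2} {R : realType}.
Variable m1 : {sigma_finite_measure set T1 -> \bar R}.
Variable m2 : {sigma_finite_measure set T2 -> \bar R}.
Implicit Types F : T1 * T2 -> R.

Lemma rint_prod F : measurable_fun setT F ->
 (\int[m1]_x \int[m2]_y (`|F (x, y)|%:E) < +oo)%E -> rint (m1 \x m2)%E F.
Proof.
by move=> mF h; apply: (proj2 (integrable12ltyP _ _ _)) => //; exact/mEFinP.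
Qed.

Lemma ae_rint1 F : rint (m1 \x m2)%E F ->
 {ae m1, forall x, rint m2 (fun y => F (x, y))}.
Proof. by move=> h; have := ae_integrable1 h; apply: filterS. Qed.

Lemma rint_Fubini1 F : rint (m1 \x m2)%E F ->
 rint m1 (fun x => \int[m2]_y F (x, y)).
Proof.
move=> h; have := integrable_fubini_F h; rewrite /fubini_F => h1.
have mf : measurable_fun setT (fun x => \int[m2]_y F (x, y)).
 by apply: mfunC => //; exact: measurable_int h1.
have /integrableP[_ h2] := h1; apply: rintP => //; apply: le_lt_trans h2.
apply: le_of_eq; apply: ae_eq_integral => //.
- by apply/mEFinP; exact: mfunC.
- by apply: mfunC => //; exact: measurable_int h1.
apply: filterS (ae_rint1 h) => x hx _.
by rewrite [X in (`|X|)%E](IntE hx).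
Qed.

Lemma Int_Fubini1 F : rint (m1 \x m2)%E F ->
 \int[m1]_x \int[m2]_y F (x, y) = \int[(m1 \x m2)%E]_z F z.
Proof.
move=> h; congr fine; rewrite -integral12_prod_meas1//.
have h1 := integrable_fubini_F h.
apply: ae_eq_integral => //.
- by apply/mEFinP; apply: rint_meas; exact: rint_Fubini1.
- exact: measurable_int h1.
apply: filterS (ae_rint1 h) => x hx _.
by rewrite /fubini_F [RHS](IntE hx).
Qed.

End product.

Section product2.
Context {d1 d2} {T1 : measurableType d1} {T2 : measurableType d2} {R : realType}.
Variable m1 : {sigma_finite_measure set T1 -> \bar R}.
Variable m2 : {sigma_finite_measure set T2 -> \bar R}.
Implicit Types F : T1 * T2 -> R.

Lemma ae_rint2 F : rint (m1 \x m2)%E F ->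
 {ae m2, forall y, rint m1 (fun x => F (x, y))}.
Proof. by move=> h; have := ae_integrable2 h; apply: filterS. Qed.

Lemma rint_Fubini2 F : rint (m1 \x m2)%E F ->
 rint m2 (fun y => \int[m1]_x F (x, y)).
Proof.
move=> h; have mG := measurable_fubini_G h.
have mf : measurable_fun setT (fun y => \int[m1]_x F (x, y)) by exact: mfunC.
have mF : measurable_fun setT F := rint_meas h.
have h2 := proj1 (integrable21ltyP m1 m2 (proj2 (mEFinP _ _) mF)) h.
apply: rintP => //; apply: le_lt_trans h2; apply: ae_ge0_le_integral => //.
- by apply/mEFinP; exact: mfunC.
- by move=> y _; exact: integral_ge0.
- apply: (measurable_fun_fubini_tonelli_G (fun z => `|F z|%:E)) => //.
 by apply/mEFinP; exact: mfunC.
apply: filterS (ae_rint2 h) => y hy _.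
rewrite (@IntE _ _ _ _ (fun x => `|F (x, y)|)); last exact: rint_norm.
by rewrite lee_fin Int_norm.
Qed.

Lemma Int_Fubini2 F : rint (m1 \x m2)%E F ->
 \int[m2]_y \int[m1]_x F (x, y) = \int[(m1 \x m2)%E]_z F z.
Proof.
move=> h; congr fine; rewrite -integral21_prod_meas1//.
apply: ae_eq_integral => //.
- by apply/mEFinP; exact: (rint_meas (rint_Fubini2 h)).
- exact: (measurable_fubini_G h).
apply: filterS (ae_rint2 h) => x hx _.
by rewrite /fubini_G [RHS](IntE hx).
Qed.

Lemma Int_swap F : rint (m1 \x m2)%E F ->
 \int[m1]_x \int[m2]_y F (x, y) = \int[m2]_y \int[m1]_x F (x, y).
Proof. by move=> h; rewrite Int_Fubini1// Int_Fubini2. Qed.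

Lemma measurable_tensor (f : T1 -> R) (g : T2 -> R) :
 measurable_fun setT f -> measurable_fun setT g ->
 measurable_fun setT (fun z : T1 * T2 => f z.1 * g z.2).
Proof.
move=> mf mg; apply: mfunM.
 exact: mfunC mf measurable_fst.
exact: mfunC mg measurable_snd.
Qed.

Lemma rint_tensor (f : T1 -> R) (g : T2 -> R) : rint m1 f -> rint m2 g ->
 rint (m1 \x m2)%E (fun z => f z.1 * g z.2).
Proof.
move=> f1 g1; apply: rint_prod.
 by apply: measurable_tensor; [exact: (rint_meas f1)|exact: (rint_meas g1)].
have gn := rint_norm g1; have fn := rint_norm f1.
rewrite (_ : (fun x => _) = (fun x => (\int[m2]_y `|g y| * `|f x|)%:E)); last first.
 apply/funext => x /=; under eq_integral do rewrite normrM.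
 rewrite (@IntE _ _ _ _ (fun y => `|f x| * `|g y|)); last exact: rintZ.
 by rewrite IntZ// mulrC.
apply: rint_lty; exact: rintZ.
Qed.

Lemma Int_tensor (f : T1 -> R) (g : T2 -> R) : rint m1 f -> rint m2 g ->
 \int[(m1 \x m2)%E]_z (f z.1 * g z.2) = (\int[m1]_x f x) * (\int[m2]_y g y).
Proof.
move=> f1 g1; rewrite -Int_Fubini1; last exact: rint_tensor.
under eq_Int => x do rewrite /= IntZ// mulrC.
by rewrite IntZ// mulrC.
Qed.

Lemma sqint_tensor (f : T1 -> R) (g : T2 -> R) : sqint m1 f -> sqint m2 g ->
 sqint (m1 \x m2)%E (fun z => f z.1 * g z.2).
Proof.
move=> [mf f2] [mg g2]; split; first exact: measurable_tensor.
by have := rint_tensor f2 g2; under eq_fun do rewrite -exprMn.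
Qed.

Lemma ip_tensor (f h : T1 -> R) (g k : T2 -> R) :
 sqint m1 f -> sqint m2 g -> sqint m1 h -> sqint m2 k ->
 ip (m1 \x m2)%E (fun z => f z.1 * g z.2) (fun z => h z.1 * k z.2) =
 ip m1 f h * ip m2 g k.
Proof.
move=> f2 g2 h2 k2; rewrite -Int_tensor; try exact: sqint_mul.
by apply: eq_Int => z; ring.
Qed.

End product2.

Lemma dct {d} {T : measurableType d} {R : realType} (mu : {measure set T -> \bar R})
  (u : nat -> T -> R) (f g : T -> R) :
 (forall n, measurable_fun setT (u n)) -> measurable_fun setT f -> rint mu g ->
 (forall n x, `|u n x| <= g x) -> {ae mu, forall x, u n x @[n --> \oo] --> f x} ->
 rint mu f /\ \int[mu]_x u n x @[n --> \oo] --> \int[mu]_x f x.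
Proof.
move=> mu_ mf g1 ug uf.
have um n : measurable_fun setT (fun x => (u n x)%:E) by exact/mEFinP.
have fm : measurable_fun setT (fun x => (f x)%:E) by exact/mEFinP.
have uf' : {ae mu, forall x, setT x -> (u n x)%:E @[n --> \oo] --> (f x)%:E}.
 by apply: filterS uf => x ux _; exact: cvgn_EFin.
have ub : {ae mu, forall x n, setT x -> (`|(u n x)%:E| <= (g x)%:E)%E}.
 by apply: nearW => x n _; rewrite lee_fin.
have [fi _ h] := @dominated_convergence _ T R mu setT measurableT
 (fun n x => (u n x)%:E) (fun x => (f x)%:E) (fun x => (g x)%:E) um fm uf' g1 ub.
split=> //.
have ui n : rint mu (u n) by apply: rint_le g1 _.
by move: h; rewrite (IntE fi) => /fine_cvgP [_].
Qed.

Section line.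
Context {R : realType}.
Local Notation mu := (leb R).
Local Notation mu2 := (leb2 R).
Local Notation rint2 := (rint mu2).
Local Notation sqint2 := (sqint mu2).
Local Notation ip2 := (ip mu2).
Local Notation rint := (rint mu).
Local Notation sqint := (sqint mu).
Local Notation ip := (ip mu).
Local Notation sqdist := (sqdist mu).
Implicit Types (f g h u v w F : R -> R) (a b c x : R).

(** * Translations and reflections of the line *)

Section line_isometries.
Implicit Types (s : R).

Lemma measR_affine s a : measR (fun x : R => s * x + a).
Proof. by apply: measurable_funD => //; apply: mfunM. Qed.

Let m s a : {mfun measurableTypeR R >-> measurableTypeR R} :=
 HB.pack (fun x : R => s * x + a) (isMeasurableFun.Build _ _ (measurableTypeR R) (measurableTypeR R) _ (measR_affine s a)).

(** Lebesgue measure is determined by its values on half-open intervals, and a translation or a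
    reflection pulls these back to intervals of the same length, up to the end that is included. *)
Lemma leb_affine s a (A : set R) : s = 1 \/ s = -1 -> measurable A ->
 mu ((fun x => s * x + a) @^-1` A) = mu A.
Proof.
move=> s1 mA; apply/esym.
have h : forall X, ocitv X -> lebesgue_measure X = pushforward mu (m s a) X.
 move=> X [[u v] _ <-] /=; rewrite /pushforward/= lebesgue_measure_itv/= lte_fin.
 case: s1 => ->.
  rewrite (_ : _ @^-1` _ = `](u - a), (v - a)]%classic); last first.
   by apply/seteqP; split => x /=; rewrite !in_itv/= => /andP[? ?]; apply/andP; split; lra.
  rewrite [RHS]lebesgue_measure_itv/= lte_fin ltrD2r; case: ifP => // _.
  by rewrite -!EFinD; congr (_%:E); ring.
 rewrite (_ : _ @^-1` _ = `[(a - v), (a - u)[%classic); last first.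
  by apply/seteqP; split => x /=; rewrite !in_itv/= => /andP[? ?]; apply/andP; split; lra.
 rewrite [RHS]lebesgue_measure_itv/= lte_fin ltrD2l ltrN2; case: ifP => // _.
 by rewrite -!EFinD; congr (_%:E); ring.
exact: (@lebesgue_measure_unique R (pushforward mu (m s a)) h A mA).
Qed.

Lemma ge0_integral_affine s a (f : R -> \bar R) : s = 1 \/ s = -1 ->
 measR f -> (forall x, (0 <= f x)%E) ->
 (\int[mu]_x f (s * x + a)%R = \int[mu]_x f x)%E.
Proof.
move=> s1 mf f0.
have := @ge0_integral_pushforward _ _ (measurableTypeR R) (measurableTypeR R) R
 _ (measR_affine s a) mu setT f measurableT mf (fun x _ => f0 x).
rewrite preimage_setT => <-; apply: eq_measure_integral => [|H A mA _]; first exact: measR_affine.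
exact: leb_affine.
Qed.

Lemma rint_affine s a f : s = 1 \/ s = -1 -> rint f ->
 rint (fun x => f (s * x + a)).
Proof.
move=> s1 f1; apply: rintP.
 by apply: mfunC (rint_meas f1) _; exact: measR_affine.
rewrite (@ge0_integral_affine s a (fun x => `|f x|%:E))//.
 by have /integrableP[_] := f1.
by apply/mEFinP; apply: mfunC => //; exact: (rint_meas f1).
Qed.

Lemma Int_affine s a f : s = 1 \/ s = -1 -> measR f ->
 \int[mu]_x f (s * x + a) = \int[mu]_x f x.
Proof.
move=> s1 mf; congr fine; rewrite integralE [RHS]integralE.
have mE : measurable_fun setT (fun x => (f x)%:E) by exact/mEFinP.
congr (_ - _)%E.
 rewrite -[RHS](@ge0_integral_affine s a)//.
 - by apply: eq_integral => x _; rewrite !funeposE.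
 - exact: measurable_funepos.
rewrite -[RHS](@ge0_integral_affine s a)//.
- by apply: eq_integral => x _; rewrite !funenegE.
- exact: measurable_funeneg.
Qed.

Lemma sqint_affine s a f : s = 1 \/ s = -1 -> sqint f ->
 sqint (fun x => f (s * x + a)).
Proof.
move=> s1 [mf f2]; split; last exact: (@rint_affine s a (fun x => f x ^+ 2)).
by apply: mfunC mf _; exact: measR_affine.
Qed.

Lemma ae_affine s a (P : R -> Prop) : s = 1 \/ s = -1 ->
 {ae mu, forall x, P x} -> {ae mu, forall x, P (s * x + a)}.
Proof.
move=> s1 [N [mN N0 PN]]; exists ((fun x => s * x + a) @^-1` N); split.
- by rewrite -[X in measurable X]setTI; apply: measR_affine.
- by rewrite leb_affine.
- by move=> x /= h; apply: PN.
Qed.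

Lemma rint_opp f : rint f -> rint (fun x => f (- x)).
Proof.
by move/(@rint_affine (-1) 0 f (or_intror erefl)); under eq_fun do rewrite mulN1r addr0.
Qed.

Lemma Int_opp f : measR f -> \int[mu]_x f (- x) = \int[mu]_x f x.
Proof.
move=> mf; rewrite -[RHS](@Int_affine (-1) 0)//; last by right.
by apply: eq_Int => x; rewrite mulN1r addr0.
Qed.

Lemma sqint_opp f : sqint f -> sqint (fun x => f (- x)).
Proof.
by move/(@sqint_affine (-1) 0 f (or_intror erefl)); under eq_fun do rewrite mulN1r addr0.
Qed.

Lemma ae_opp (P : R -> Prop) :
 {ae mu, forall x, P x} -> {ae mu, forall x, P (- x)}.
Proof.
move/(@ae_affine (-1) 0 P (or_intror erefl)).
by apply: filterS => x; rewrite mulN1r addr0.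
Qed.

Lemma rint_shift a f : rint f -> rint (fun x => f (x + a)).
Proof.
by move/(@rint_affine 1 a f (or_introl erefl)); under eq_fun do rewrite mul1r.
Qed.

Lemma Int_shift a f : measR f -> \int[mu]_x f (x + a) = \int[mu]_x f x.
Proof.
move=> mf; rewrite -[RHS](@Int_affine 1 a)//; last by left.
by apply: eq_Int => x; rewrite mul1r.
Qed.

Lemma sqint_shift a f : sqint f -> sqint (fun x => f (x + a)).
Proof.
by move/(@sqint_affine 1 a f (or_introl erefl)); under eq_fun do rewrite mul1r.
Qed.

Lemma meas_opp f : measR f -> measR (fun x => f (- x)).
Proof. by move=> mf; apply: mfunC mf _. Qed.

(** No integrability is assumed: the positive and negative parts have equal integrals, and if both
    are infinite the extended difference is infinite and [fine] sends it to 0. *)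
Lemma Int_odd f : measR f -> (forall x, f (- x) = - f x) ->
 \int[mu]_x f x = 0.
Proof.
move=> mf fo; have [f1|f1] := pselect (rint f).
 by have := Int_opp mf; under eq_Int do rewrite fo; rewrite IntN// => ?; lra.
have mE : measR (fun x => (f x)%:E) by exact/mEFinP.
have pn : (\int[mu]_x ((EFin \o f)^\- x) = \int[mu]_x ((EFin \o f)^\+ x))%E.
 rewrite -[RHS](@ge0_integral_affine (-1) 0); last by []; last first.
 - exact: measurable_funepos.
 - by right.
 apply: eq_integral => x _.
 by rewrite funenegE funeposE /= mulN1r addr0 fo.
rewrite /Rintegral integralE pn.
by case: (\int[mu]_x _)%E => [r||]//=; rewrite subrr.
Qed.

End line_isometries.

(** * Derivatives of one real variable *)

Definition hasder (f : R -> R) (x d : R) : Prop := is_derive x 1 f d.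

Lemma der_eq f x d1 d2 : hasder f x d1 -> d1 = d2 -> hasder f x d2.
Proof. by move=> h <-. Qed.

Lemma der_cst (c x : R) : hasder (fun=> c) x 0.
Proof. exact: is_derive_cst. Qed.

Lemma der_id x : hasder (fun y : R => y) x (1 : R).
Proof. exact: is_derive_id. Qed.

Lemma derD f g x df dg : hasder f x df -> hasder g x dg ->
 hasder (fun y : R => f y + g y) x (df + dg).
Proof. by move=> hf hg; exact: is_deriveD. Qed.

Lemma derN f x df : hasder f x df -> hasder (fun y : R => - f y) x (- df).
Proof. by move=> hf; exact: is_deriveN. Qed.

Lemma derM f g x df dg : hasder f x df -> hasder g x dg ->
 hasder (fun y : R => f y * g y) x (df * g x + f x * dg).
Proof.
move=> hf hg; apply: (der_eq (is_deriveM hf hg)).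
by rewrite /GRing.scale/= [RHS]addrC; congr (_ + _); rewrite mulrC.
Qed.

Lemma derX f n x df : hasder f x df ->
 hasder (fun y : R => f y ^+ n) x (n%:R * f x ^+ n.-1 * df).
Proof.
elim: n => [|n IH] hf.
 by apply: (der_eq (der_cst 1 x)); rewrite !mul0r.
under eq_fun do rewrite exprS.
apply: (der_eq (derM hf (IH hf))); case: n {IH} => [|n]; rewrite ?expr0 /=.
 by ring.
by rewrite !exprS -[n.+2%:R]natr1; ring.
Qed.

Lemma der_comp f g x df dg : hasder g x dg -> hasder f (g x) df ->
 hasder (fun y : R => f (g y)) x (df * dg).
Proof. by move=> hg hf; exact: is_derive1_comp. Qed.

Lemma der_expR f x df : hasder f x df ->
 hasder (fun y : R => expR (f y)) x (expR (f x) * df).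
Proof. by move=> hf; apply: der_comp hf (is_derive_expR _). Qed.

Lemma der_cos f x df : hasder f x df ->
 hasder (fun y : R => cos (f y)) x (- sin (f x) * df).
Proof. by move=> hf; apply: der_comp hf (is_derive_cos _). Qed.

Lemma der_sin f x df : hasder f x df ->
 hasder (fun y : R => sin (f y)) x (cos (f x) * df).
Proof. by move=> hf; apply: der_comp hf (is_derive_sin _). Qed.

Lemma derV f x df : hasder f x df -> f x != 0 ->
 hasder (fun y : R => (f y)^-1) x (- (f x) ^- 2 * df).
Proof.
move=> hf fx; have := is_deriveV fx hf.
by move=> h; apply: (der_eq h); rewrite /GRing.scale.
Qed.

Lemma der_sqrt f x df : hasder f x df -> 0 < f x ->
 hasder (fun y : R => Num.sqrt (f y)) x ((2 * Num.sqrt (f x))^-1 * df).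
Proof. by move=> hf fx; apply: der_comp hf (is_derive1_sqrt fx). Qed.

Lemma der_atan f x df : hasder f x df ->
 hasder (fun y : R => atan (f y)) x ((1 + f x ^+ 2)^-1 * df).
Proof. by move=> hf; apply: der_comp hf (is_derive1_atan _). Qed.

Lemma der_at_continuous f x df : hasder f x df -> {for x, continuous f}.
Proof. by case=> df1 _; apply: differentiable_continuous; exact/derivable1_diffP. Qed.

Lemma der_continuous f (df : R -> R) : (forall x, hasder f x (df x)) -> continuous f.
Proof. by move=> h x; exact: der_at_continuous (h x). Qed.

Lemma der_derive1 f x df : hasder f x df -> derive1 f x = df.
Proof. by move=> [_ <-]; rewrite derive1E. Qed.

Lemma der_derivable f x df : hasder f x df -> derivable f x 1.
Proof. by case. Qed.

Lemma derivable_der f x : derivable f x 1 -> hasder f x (derive1 f x).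
Proof. by move=> h; split => //; rewrite derive1E. Qed.

Lemma derivable_oo f (df : R -> R) a b : (forall x, hasder f x (df x)) ->
 derivable_oo_LRcontinuous f a b.
Proof.
move=> h; split.
- by move=> x _; exact: der_derivable (h x).
- by apply: cvg_at_right_filter; exact: der_continuous h a.
- by apply: cvg_at_left_filter; exact: der_continuous h b.
Qed.

Ltac der_step :=
 match goal with
 | |- hasder (fun y => ?c) _ _ => exact: der_cst
 | |- hasder (fun y => y) _ _ => exact: der_id
 | |- hasder (fun y => _ + _) _ _ => apply: derD
 | |- hasder (fun y => - _) _ _ => apply: derN
 | |- hasder (fun y => _ * _) _ _ => apply: derM
 | |- hasder (fun y => _ ^+ _) _ _ => apply: derX
 | |- hasder (fun y => expR _) _ _ => apply: der_expR
 | |- hasder (fun y => cos _) _ _ => apply: der_cos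
 | |- hasder (fun y => sin _) _ _ => apply: der_sin
 | |- hasder (fun y => atan _) _ _ => apply: der_atan
 | |- hasder (fun y => Num.sqrt _) _ _ => apply: der_sqrt
 | |- hasder (fun y => _^-1) _ _ => apply: derV
 | |- hasder ( *%R ?c) ?x _ => refine (@derM (fun=> c) (fun y => y) x _ _ _ _)
 | |- hasder ( +%R ?c) ?x _ => refine (@derD (fun=> c) (fun y => y) x _ _ _ _)
 | |- hasder -%R ?x _ => refine (@derN (fun y => y) x _ _)
 | |- hasder expR ?x _ => refine (@der_expR (fun y => y) x _ _)
 | |- hasder cos ?x _ => refine (@der_cos (fun y => y) x _ _)
 | |- hasder sin ?x _ => refine (@der_sin (fun y => y) x _ _)
 | |- hasder atan ?x _ => refine (@der_atan (fun y => y) x _ _)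
 | h : forall x, hasder ?f x _ |- hasder (fun y => ?f y) _ _ => exact: h
 | h : hasder ?f ?x _ |- hasder (fun y => ?f y) ?x _ => exact: h
 | h : hasder ?f ?x _ |- hasder ?f ?x _ => exact: h
 | h : forall x, hasder ?f x _ |- hasder ?f _ _ => exact: h
 end.
Ltac der := apply: der_eq; first (repeat der_step); cbv beta.

(** * The fundamental theorem of calculus and some explicit integrals *)

Lemma measR_inv : measR (fun x : R => x^-1).
Proof.
rewrite (_ : (fun _ => _) = (fun x : R => x * (x ^+ 2) `^ (-1))).
 apply: mfunM => //; apply: (@mfunC _ _ _ _ _ _ (fun y : R => y `^ (-1))); first exact: measurable_powR.
 exact: measurable_funX.
apply/funext => x; rewrite powR_inv1 ?sqr_ge0//.
have [->|x0] := eqVneq x 0; first by rewrite invr0 mul0r.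
by field.
Qed.

Lemma Int_itv_indic f (D : set (measurableTypeR R)) : measurable D ->
 \int[mu]_(x in D) f x = \int[mu]_x (\1_D x * f x).
Proof.
move=> mD; rewrite Rintegral_mkcond; apply: eq_Int => x.
by rewrite patchE indicE; case: (x \in D); rewrite ?mul1r ?mul0r.
Qed.

Lemma int_itv_indic f (D : set (measurableTypeR R)) : measurable D ->
 (\int[mu]_(x in D) (f x)%:E = \int[mu]_x (\1_D x * f x)%:E)%E.
Proof.
move=> mD; rewrite integral_mkcond; apply: eq_integral => x _.
by rewrite patchE indicE; case: (x \in D); rewrite ?mul1r ?mul0r.
Qed.

Lemma rint_indic f (D : set (measurableTypeR R)) : measurable D ->
 mu.-integrable D (EFin \o f) <-> rint (fun x => \1_D x * f x).
Proof.
move=> mD; split=> [|] h.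
 have := proj1 (integrable_mkcond _ mD) h; apply: eq_integrable => // x _.
 by rewrite patchE /= indicE; case: (x \in D); rewrite ?mul1r ?mul0r.
apply/(integrable_mkcond _ mD); move: h; apply: eq_integrable => // x _.
by rewrite patchE /= indicE; case: (x \in D); rewrite ?mul1r ?mul0r.
Qed.

Lemma measR_indic (D : set (measurableTypeR R)) : measurable D -> measR (\1_D : R -> R).
Proof. by move=> mD; exact: measurable_indic. Qed.

Lemma indic0y (x : R) : \1_`[0%R, +oo[ x = (0 <= x)%R%:R :> R.
Proof. by rewrite indicE mem_setE in_itv/= andbT. Qed.

Lemma indic_cc (a b x : R) : \1_`[a, b] x = (a <= x <= b)%R%:R :> R.
Proof. by rewrite indicE mem_setE in_itv. Qed.

Lemma continuous_rint_itv f a b : continuous f ->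
 rint (fun x => \1_`[a, b] x * f x).
Proof.
move=> cf; apply: (proj1 (rint_indic _ _)) => //.
apply: continuous_compact_integrable; first exact: segment_compact.
exact: continuous_subspaceT.
Qed.

Lemma FTC f F a b : a <= b -> continuous f -> (forall x, hasder F x (f x)) ->
 \int[mu]_(x in `[a, b]) f x = F b - F a.
Proof.
move=> ab cf dF; have [->|nab] := eqVneq a b.
 by rewrite set_itv1 Rintegral_set1 subrr.
rewrite /Rintegral (@continuous_FTC2 _ f F a b)//.
- by rewrite lt_neqAle nab.
- exact: continuous_subspaceT.
- exact: derivable_oo dF.
- by move=> x _; exact: der_derive1 (dF x).
Qed.

Lemma FTCy f F a l : (forall x, a <= x -> 0 <= f x) -> continuous f ->
 (forall x, hasder F x (f x)) -> F x @[x --> +oo] --> l ->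
 (\int[mu]_(x in `[a, +oo[) (f x)%:E = (l - F a)%:E)%E.
Proof.
move=> f0 cf dF Fl; rewrite EFinB; apply: ge0_continuous_FTC2y => //.
- exact: continuous_subspaceT.
- by move=> x _; exact: der_derivable (dF x).
- by apply: cvg_at_right_filter; exact: der_continuous dF a.
- by move=> x _; exact: der_derive1 (dF x).
Qed.

Lemma expR_cvg0 (t : R) : 0 < t -> expR (- (t * x)) @[x --> +oo] --> 0.
Proof.
move=> t0; apply: (@cvg_comp _ _ _ (fun x : R => t * x) (fun x => expR (- x)) _ +oo).
 by apply: gt0_cvgMrNy || (apply/cvgryPge => A; near=> x; rewrite -ler_pdivrMl//; near: x; exact: nbhs_pinfty_ge).
exact: cvgr_expR.
Unshelve. all: by end_near. Qed.

Lemma xexpR_le (t x : R) : 0 < t -> 0 <= x ->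
 x * expR (- (t * x)) <= 2 / t * expR (- (t / 2 * x)).
Proof.
move=> t0 x0; have := expR_ge1Dx (t / 2 * x) => h.
have -> : - (t * x) = - (t / 2 * x) + - (t / 2 * x) by field.
rewrite expRD mulrA ler_wpM2r ?expR_ge0//.
rewrite expRN ler_pdivrMr ?expR_gt0//.
rewrite {1}(_ : x = 2 / t * (t / 2 * x)); last by field; rewrite gt_eqF.
by rewrite ler_wpM2l ?divr_ge0 ?ltW//; lra.
Qed.

Lemma xexpR_cvg0 (t : R) : 0 < t -> x * expR (- (t * x)) @[x --> +oo] --> 0.
Proof.
move=> t0; apply: (@squeeze_cvgr _ _ _ _ (fun=> 0) (fun x => 2 / t * expR (- (t / 2 * x)))).
- near=> x; have x0 : 0 <= x by near: x; exact: nbhs_pinfty_ge.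
 by rewrite mulr_ge0 ?expR_ge0//= xexpR_le.
- exact: cvg_cst.
- rewrite -[X in _ --> X](mulr0 (2 / t)); apply: cvgM; first exact: cvg_cst.
 by apply: expR_cvg0; rewrite divr_gt0.
Unshelve. all: by end_near. Qed.

Lemma int_exp_cos (a t : R) : 0 < t ->
 (\int[mu]_(x in `[0%R, +oo[) (expR (- (t * x)) * (1 - cos (a * x)))%:E
 = (a ^+ 2 / (t * (a ^+ 2 + t ^+ 2)))%:E)%E.
Proof.
move=> t0; have t20 : 0 < a ^+ 2 + t ^+ 2 by rewrite ltr_wpDl ?sqr_ge0 ?exprn_gt0.
have t21 : a ^+ 2 + t ^+ 2 != 0 by rewrite gt_eqF.
pose F x := expR (- (t * x)) * ((t * cos (a * x) - a * sin (a * x)) / (a ^+ 2 + t ^+ 2) - t^-1).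
have dF (x : R) : hasder F x (expR (- (t * x)) * (1 - cos (a * x))).
 by rewrite /F; der; field; rewrite t21 gt_eqF.
have -> : a ^+ 2 / (t * (a ^+ 2 + t ^+ 2)) = 0 - F 0.
 by rewrite /F !mulr0 oppr0 expR0 cos0 sin0; field; rewrite t21 gt_eqF.
apply: FTCy => //.
- by apply: (@der_continuous _ (fun x => - t * expR (- (t * x)) * (1 - cos (a * x)) + a * (expR (- (t * x)) * sin (a * x)))) => x; der; ring.
pose C := (t + `|a|) / (a ^+ 2 + t ^+ 2) + t^-1.
apply/cvgr0Pnorm_le => e e0.
have /cvgr0Pnorm_le h := @expR_cvg0 t t0.
have C0 : 0 < C.
 by apply: ltr_wpDl; rewrite ?invr_gt0// divr_ge0 ?(ltW t20)// addr_ge0// ltW.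
have := h (e / C); rewrite divr_gt0// => /(_ isT); apply: filterS => x hx.
rewrite /F normrM; apply: le_trans (_ : e / C * C <= _); last by rewrite divfK ?gt_eqF.
apply: ler_pM => //; apply: le_trans (ler_normB _ _) _; apply: lerD.
 rewrite normrM [X in _ * X]ger0_norm ?invr_ge0 ?(ltW t20)// ler_wpM2r ?invr_ge0 ?(ltW t20)//.
 apply: le_trans (ler_normB _ _) _; apply: lerD.
  by rewrite normrM (gtr0_norm t0) -[leRHS]mulr1 ler_pM2l// ler_norml cos_geN1 cos_le1.
 by rewrite normrM -[leRHS]mulr1 ler_wpM2l// ler_norml sin_geN1 sin_le1.
by rewrite ger0_norm// invr_ge0 ltW.
Qed.

Lemma int_t_exp (x : R) : 0 < x ->
 (\int[mu]_(t in `[0%R, +oo[) (t * expR (- (t * x)))%:E = ((x ^+ 2)^-1)%:E)%E.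
Proof.
move=> x0; pose F t := - (x^-1 * (t * expR (- (x * t))) + (x ^+ 2)^-1 * expR (- (x * t))).
under eq_integral do rewrite [X in expR (- X)]mulrC.
have dF (t : R) : hasder F t (t * expR (- (x * t))).
 rewrite /F; der; by field; rewrite gt_eqF.
have -> : (x ^+ 2)^-1 = 0 - F 0 by rewrite /F mulr0 oppr0 expR0; ring.
apply: FTCy => //.
- by move=> t t0; rewrite mulr_ge0 ?expR_ge0.
- by apply: (@der_continuous _ (fun t => (1 - x * t) * expR (- (x * t)))) => t; der; ring.
rewrite -oppr0; apply: cvgN; rewrite -[X in _ --> X]addr0; apply: cvgD.
 rewrite -[X in _ --> X](mulr0 x^-1); apply: cvgM; first exact: cvg_cst.
 exact: xexpR_cvg0.
rewrite -[X in _ --> X](mulr0 (x ^+ 2)^-1); apply: cvgM; first exact: cvg_cst.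
exact: expR_cvg0.
Qed.

Lemma int_invDsq (a : R) : 0 < a ->
 (\int[mu]_(t in `[0%R, +oo[) (a ^+ 2 / (a ^+ 2 + t ^+ 2))%:E = (a * (pi / 2))%:E)%E.
Proof.
move=> a0; have p t : a ^+ 2 + t ^+ 2 != 0.
 by rewrite gt_eqF// ltr_pwDl ?exprn_gt0 ?sqr_ge0.
have q t : 1 + (a^-1 * t) ^+ 2 != 0 by rewrite gt_eqF// ltr_wpDr ?sqr_ge0.
have -> : a * (pi / 2) = a * (pi / 2) - a * atan (a^-1 * 0) by rewrite mulr0 atan0 mulr0 subr0.
apply: (@FTCy _ (fun t => a * atan (a^-1 * t))).
- by move=> t _; rewrite divr_ge0 ?addr_ge0 ?sqr_ge0.
- apply: (@der_continuous _ (fun t => - a ^+ 2 * (a ^+ 2 + t ^+ 2) ^- 2 * (2 * t))) => t.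
 by der => //; rewrite /=; ring.
- by move=> t; der; field; rewrite ?p ?q ?gt_eqF.
apply: cvgM; first exact: cvg_cst.
apply: (@cvg_comp _ _ _ (fun x : R => a^-1 * x) (@atan R) _ +oo); last exact: cvgy_atan.
apply/cvgryPge => A; near=> x; rewrite mulrC ler_pdivlMr//; near: x; exact: nbhs_pinfty_ge.
Unshelve. all: by end_near. Qed.

Lemma ae_neq (a : R) : {ae mu, forall x : R, x != a}.
Proof.
exists [set a]; split => //; first exact: lebesgue_measure_set1.
by move=> x /= /negP; rewrite negbK => /eqP.
Qed.

Lemma ge0_int_even (f : R -> R) : measR f -> (forall x, 0 <= f x) ->
 (forall x, f (- x) = f x) ->
 (\int[mu]_x (f x)%:E = 2%:E * \int[mu]_(x in `[0%R, +oo[) (f x)%:E)%E.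
Proof.
move=> mf f0 fe; rewrite (@int_itv_indic _ `[0%R, +oo[)//; set h := fun x => \1_`[0%R, +oo[ x * f x.
have mh : measR h by apply: mfunM => //; exact: measR_indic.
have h0 x : 0 <= h x by rewrite mulr_ge0.
have mhE : measR (fun x => (h x)%:E) by exact/mEFinP.
transitivity (\int[mu]_x ((h x)%:E + (h (- x))%:E))%E.
 apply: ae_eq_integral => //; first exact/mEFinP.
  by apply/mEFinP; apply: measurable_funD => //; exact: meas_opp.
 apply: filterS (ae_neq 0) => x x0 _.
 rewrite -EFinD /h !indic0y fe oppr_ge0; congr (_%:E).
 have [xp|xn|x00] := ltgtP 0 x; last by rewrite -x00 eqxx in x0.
 - by rewrite mul1r mul0r addr0.
 - by rewrite mul1r mul0r add0r.
rewrite ge0_integralD//; last first.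
- by apply/mEFinP; exact: meas_opp.
- by move=> x _; rewrite lee_fin.
- by move=> x _; rewrite lee_fin.
have e : (\int[mu]_x (h (- x))%:E = \int[mu]_x (h x)%:E)%E.
 rewrite -(@ge0_integral_affine (-1) 0 (fun x => (h x)%:E))//; last by right.
 by apply: eq_integral => x _; rewrite mulN1r addr0.
by rewrite e -mule2n mule_natl.
Qed.

(** For [x > 0], [x^-2] is the integral of [t * expR (- (t * x))] over [t >= 0]. By Tonelli the
    integral becomes that of [a^2 / (a^2 + t^2)], the Laplace transform of [1 - cos (a x)] being
    explicit. The value, linear in [a], is what makes the transform isometric on intervals. *)
Lemma int_1Bcos (a : R) : 0 < a ->
 (\int[mu]_(x in `[0%R, +oo[) ((1 - cos (a * x)) / x ^+ 2)%:E = (a * (pi / 2))%:E)%E.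
Proof.
move=> a0; rewrite int_itv_indic//.
pose D : set R := `[0%R, +oo[%classic.
pose f (z : R * R) := ((\1_D z.1 * (1 - cos (a * z.1))) * (\1_D z.2 * z.2) * expR (- (z.2 * z.1)))%:E.
have mD : measR (\1_D : R -> R) by apply: measR_indic; exact: measurable_itv.
have mf : measR2 f.
 apply/mEFinP; apply: mfunM.
  apply: (@measurable_tensor _ _ _ _ _ (fun x => \1_D x * (1 - cos (a * x))) (fun t => \1_D t * t)).
   apply: mfunM => //; apply: continuous_measR.
   by apply: (@der_continuous _ (fun x => a * sin (a * x))) => x; der; ring.
  exact: mfunM.
 apply: (mfunC (f := expR)) => //; apply: mfunC => //.
 by apply: mfunM.
have f0 z : (0 <= f z)%E.
 rewrite lee_fin /D !indic0y; case: (leP 0 z.2) => h; last by rewrite !(mul0r, mulr0).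
 by rewrite !mulr_ge0 ?expR_ge0// subr_ge0 cos_le1.
have fa x : x != 0 -> (\int[mu]_t f (x, t) = (\1_D x * ((1 - cos (a * x)) / x ^+ 2))%:E)%E.
 move=> x0; rewrite /f /=.
 have [xD|xD] := boolP (x \in D); last first.
  under eq_integral do rewrite indicE (negbTE xD) !mul0r.
  by rewrite integral0 indicE (negbTE xD) mul0r.
 have xp : 0 < x by move: xD; rewrite inE /D/= in_itv/= andbT lt_neqAle eq_sym x0.
 under eq_integral => t _.
  rewrite {1}indicE xD mul1r -mulrA -mulrA EFinM.
  over.
 rewrite ge0_integralZl//=; last 2 first.
 - apply/mEFinP; apply: mfunM => //; apply: mfunM => //.
  apply: continuous_measR; apply: (@der_continuous _ (fun t => - x * expR (- (t * x)))) => t.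
  by der; ring.
 - move=> t _; rewrite lee_fin indicE; case: (boolP (t \in D)); rewrite ?mul1r ?mul0r//.
  by rewrite inE /D/= in_itv/= andbT => t0; rewrite mulr_ge0 ?expR_ge0.
 have := int_t_exp xp; rewrite int_itv_indic// => ->.
 by rewrite indicE xD mul1r.
have fb t : t != 0 -> (\int[mu]_x f (x, t) = (\1_D t * (a ^+ 2 / (a ^+ 2 + t ^+ 2)))%:E)%E.
 move=> t0; rewrite /f /=.
 have [tD|tD] := boolP (t \in D); last first.
  under eq_integral do rewrite [\1_D t]indicE (negbTE tD) !(mul0r, mulr0).
  by rewrite integral0 indicE (negbTE tD) mul0r.
 have tp : 0 < t by move: tD; rewrite inE /D/= in_itv/= andbT lt_neqAle eq_sym t0.
 under eq_integral => x _.
  rewrite [\1_D t]indicE tD mul1r (_ : _ * _ * _ = t * (\1_D x * (expR (- (t * x)) * (1 - cos (a * x))))); last by ring.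
  rewrite EFinM.
  over.
 rewrite ge0_integralZl//=; last 2 first.
 - apply/mEFinP; apply: mfunM => //.
  apply: continuous_measR; apply: (@der_continuous _ (fun x => - t * expR (- (t * x)) * (1 - cos (a * x)) + a * (expR (- (t * x)) * sin (a * x)))) => x.
  by der; ring.
 - by rewrite lee_fin ltW.
 have := int_exp_cos a tp; rewrite int_itv_indic// => ->.
 rewrite indicE tD mul1r -EFinM; congr (_%:E).
 have t20 : 0 < a ^+ 2 + t ^+ 2 by rewrite ltr_wpDl ?sqr_ge0 ?exprn_gt0.
 by field; rewrite !gt_eqF.
have := fubini_tonelli (m1 := mu) (m2 := mu) f mf f0.
rewrite (_ : (\int[mu]_x \int[mu]_y f (x, y) = \int[mu]_x (\1_D x * ((1 - cos (a * x)) / x ^+ 2))%:E)%E); last first.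
 apply: ae_eq_integral => //.
 - exact: measurable_fun_fubini_tonelli_F.
 - apply/mEFinP; apply: mfunM => //; apply: mfunM.
   apply: continuous_measR.
   by apply: (@der_continuous _ (fun x => a * sin (a * x))) => x; der; ring.
  by apply: mfunC; [exact: measR_inv|exact: measurable_funX].
 - by apply: filterS (ae_neq 0) => x x0 _; exact: fa.
move=> ->; rewrite -int_invDsq// int_itv_indic//.
apply: ae_eq_integral => //.
- exact: measurable_fun_fubini_tonelli_G.
- apply/mEFinP; apply: mfunM => //; apply: continuous_measR.
 apply: (@der_continuous _ (fun t => - a ^+ 2 * (a ^+ 2 + t ^+ 2) ^- 2 * (2 * t))) => t.
 by der; [rewrite gt_eqF// ltr_pwDl ?exprn_gt0 ?sqr_ge0|rewrite /=; ring].
- by apply: filterS (ae_neq 0) => x x0 _; exact: fb.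
Qed.

Lemma rint_1Bcos (a : R) : rint (fun x => (1 - cos (a * x)) / x ^+ 2) /\
 \int[mu]_x ((1 - cos (a * x)) / x ^+ 2) = `|a| * pi.
Proof.
wlog a0 : a / 0 <= a.
 move=> h; have [/h//|an] := leP 0 a; have := h (- a); rewrite normrN oppr_ge0 ltW// => /(_ isT).
 by rewrite (_ : (fun x => _) = (fun x => (1 - cos (a * x)) / x ^+ 2))//; apply/funext => x; rewrite mulNr cosN.
have mf : measR (fun x => (1 - cos (a * x)) / x ^+ 2).
 apply: mfunM.
  apply: continuous_measR.
  by apply: (@der_continuous _ (fun x => a * sin (a * x))) => x; der; ring.
 by apply: mfunC; [exact: measR_inv|exact: measurable_funX].
have f0 x : 0 <= (1 - cos (a * x)) / x ^+ 2 by rewrite divr_ge0 ?sqr_ge0// subr_ge0 cos_le1.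
have e : (\int[mu]_x ((1 - cos (a * x)) / x ^+ 2)%:E = (a * pi)%:E)%E.
 rewrite ge0_int_even//; last by move=> x; rewrite mulrN cosN sqrrN.
 move: a0; rewrite le_eqVlt => /predU1P[<-|a0].
  under eq_integral do rewrite mul0r cos0 subrr mul0r.
  by rewrite integral0 mule0 mul0r.
 by rewrite int_1Bcos// -EFinM; congr (_%:E); field.
split; last by rewrite /Rintegral e ger0_norm.
by apply: ge0_rintP => //; rewrite e ltry.
Qed.

(** Integrability of the slices is not assumed, so the slice integral is written as a difference of
    two nonnegative ones, each measurable by Tonelli. *)
Lemma measR_Int2 (F : R * R -> R) : measR2 F ->
 measR (fun x => \int[leb R]_y F (x, y)).
Proof.
move=> mF; have mE : measR2 (fun z => (F z)%:E) by exact/mEFinP.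
rewrite (_ : (fun x => _) = (fun x => fine
 (\int[leb R]_y (fun z => (F z)%:E)^\+ (x, y) - \int[leb R]_y (fun z => (F z)%:E)^\- (x, y))%E)).
 apply: mfunC => //; apply: emeasurable_funB.
  apply: (measurable_fun_fubini_tonelli_F (m2 := leb R) (fun z => (F z)%:E)^\+%E) => //.
  exact: measurable_funepos.
 apply: (measurable_fun_fubini_tonelli_F (m2 := leb R) (fun z => (F z)%:E)^\-%E) => //.
 exact: measurable_funeneg.
apply/funext => x; rewrite /Rintegral integralE; congr (fine (_ - _)).
 by apply: eq_integral => y _; rewrite !funeposE.
by apply: eq_integral => y _; rewrite !funenegE.
Qed.

(** * The Hartley transform of integrable functions *)

Definition cas x : R := cos x + sin x.

Lemma cas_le2 x : `|cas x| <= 2.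
Proof.
apply: le_trans (ler_normD _ _) _.
have -> : 2 = 1 + 1 :> R by [].
by apply: lerD; rewrite ler_norml ?cos_geN1 ?cos_le1 ?sin_geN1 ?sin_le1.
Qed.

Lemma hasder_cas x : hasder cas x (cos x - sin x).
Proof. by rewrite /cas; der; ring. Qed.

Lemma measR_cas : measR cas.
Proof. by apply: continuous_measR; exact: (der_continuous hasder_cas). Qed.

Lemma measR2_mul : measR2 (fun z : R * R => z.1 * z.2).
Proof. exact: (@measurable_tensor _ _ _ _ _ (fun x : measurableTypeR R => x) (fun x : measurableTypeR R => x)). Qed.

Lemma measR2_cas : measR2 (fun z : R * R => cas (z.1 * z.2)).
Proof. exact: mfunC measR_cas measR2_mul. Qed.

Definition hc : R := (Num.sqrt (2 * pi))^-1.

Lemma hc_gt0 : 0 < hc.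
Proof. by rewrite invr_gt0 sqrtr_gt0 mulr_gt0 ?pi_gt0. Qed.

Lemma hc_sq : hc ^+ 2 * (2 * pi) = 1.
Proof.
have p : 0 < 2 * pi :> R by rewrite mulr_gt0 ?pi_gt0.
by rewrite exprVn sqr_sqrtr ?ltW// mulVf ?gt_eqF.
Qed.

(** The Hartley transform: its even part in [x] is the cosine transform and its odd part the sine
    transform. It carries the same information as the Fourier transform while staying real, and its
    kernel is symmetric. *)
Definition hint f x : R := hc * \int[mu]_y (f y * cas (y * x)).

Lemma rint_cas f x : rint f -> rint (fun y => f y * cas (y * x)).
Proof.
move=> f1; apply: (@rint_le _ _ _ mu _ (fun y => 2 * `|f y|)).
- apply: mfunM; first exact: (rint_meas f1).
 by apply: mfunC measR_cas _; apply: mfunM.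
- by apply: rintZ; exact: rint_norm.
- by move=> y; rewrite normrM mulrC ler_wpM2r// cas_le2.
Qed.

Lemma hint_meas f : measR f -> measR (hint f).
Proof.
move=> mf; apply: mfunM => //.
apply: (@measR_Int2 (fun z => f z.2 * cas (z.2 * z.1))); apply: mfunM.
 exact: mfunC mf measurable_snd.
apply: (mfunC (f := cas)); first exact: measR_cas.
by apply: mfunM.
Qed.

Lemma hint_le f x : rint f -> `|hint f x| <= 2 * hc * \int[mu]_y `|f y|.
Proof.
move=> f1; rewrite /hint normrM (ger0_norm (ltW hc_gt0)) mulrAC mulrC ler_wpM2r ?(ltW hc_gt0)//.
apply: le_trans (Int_norm (rint_cas _ f1)) _.
rewrite -IntZ; last exact: rint_norm.
apply: Int_le.
- by apply: rint_norm; exact: rint_cas.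
- by apply: rintZ; exact: rint_norm.
- by move=> y; rewrite normrM mulrC ler_wpM2r// cas_le2.
Qed.

Lemma rint_hint f g : rint f -> rint g -> rint (fun x => hint f x * g x).
Proof.
move=> f1 g1; apply: (@rint_le _ _ _ mu _ (fun x => (2 * hc * \int[mu]_y `|f y|) * `|g x|)).
- apply: mfunM; [apply: hint_meas; exact: (rint_meas f1)|exact: (rint_meas g1)].
- by apply: rintZ; exact: rint_norm.
- by move=> x; rewrite normrM ler_wpM2r// hint_le.
Qed.

Lemma rint2_cas f g : rint f -> rint g ->
 rint2 (fun z => f z.1 * g z.2 * cas (z.1 * z.2)).
Proof.
move=> f1 g1; have fg := rint_tensor f1 g1.
apply: (@rint_le _ _ _ (leb2 R) _ (fun z => 2 * `|f z.1 * g z.2|)).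
- by apply: mfunM; [exact: (rint_meas fg)|exact: measR2_cas].
- by apply: rintZ; exact: rint_norm.
- by move=> z; rewrite normrM mulrC ler_wpM2r// cas_le2.
Qed.

Lemma hint_sym f g : rint f -> rint g -> ip (hint f) g = ip f (hint g).
Proof.
move=> f1 g1; have := Int_swap (rint2_cas f1 g1).
under eq_Int => x.
 rewrite /= (_ : (fun y => _) = (fun y => f x * (g y * cas (y * x)))); last first.
  by apply/funext => y; rewrite (mulrC y) mulrA.
 rewrite IntZ; last exact: rint_cas.
 over.
move=> e; rewrite /ip.
rewrite (_ : (fun x => f x * hint g x) = (fun x => hc * (f x * \int[mu]_y (g y * cas (y * x))))); last first.
 by apply/funext => x; rewrite /hint; ring.
rewrite IntZ; last first.
 have := rintZ hc^-1 (rint_hint g1 f1).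
 apply: rint_eq => x; rewrite /hint; field; rewrite gt_eqF ?hc_gt0//.
rewrite e -IntZ; last first.
 have := rintZ hc^-1 (rint_hint f1 g1).
 apply: rint_eq => x; rewrite /hint.
 rewrite (_ : (fun y => f (y, x).1 * _ * _) = (fun y => g x * (f y * cas (y * x)))); last first.
  by apply/funext => y /=; ring.
 rewrite IntZ; last exact: rint_cas.
 by field; rewrite gt_eqF ?hc_gt0.
apply: eq_Int => x; rewrite /hint.
rewrite (_ : (fun y => f (y, x).1 * _ * _) = (fun y => g x * (f y * cas (y * x)))); last first.
 by apply/funext => y /=; ring.
by rewrite IntZ; [ring|exact: rint_cas].
Qed.

Lemma hint_lin a b f g x : rint f -> rint g ->
 hint (fun y => a * f y + b * g y) x = a * hint f x + b * hint g x.
Proof.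
move=> f1 g1; rewrite /hint.
rewrite (_ : (fun y => _) = (fun y => a * (f y * cas (y * x)) + b * (g y * cas (y * x)))); last first.
 by apply/funext => y; ring.
by rewrite IntD ?IntZ; [ring|..]; try apply: rintZ; exact: rint_cas.
Qed.

Definition icc a b : R -> R := \1_`[a, b].

Lemma iccE a b x : icc a b x = (a <= x <= b)%R%:R.
Proof. exact: indic_cc. Qed.

Lemma icc0 a b : b < a -> icc a b = fun=> 0.
Proof.
move=> h; apply/funext => x; rewrite iccE; case: (boolP (_ <= _ <= _)) => // /andP[h1 h2].
by have := le_trans h1 h2; rewrite leNgt h.
Qed.

Lemma icc_meas a b : measR (icc a b).
Proof. by apply: measR_indic; exact: measurable_itv. Qed.

Lemma icc_sq a b x : icc a b x ^+ 2 = icc a b x.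
Proof. by rewrite iccE; case: (a <= x <= b); rewrite ?expr1n ?expr0n. Qed.

Lemma icc_rint a b : rint (icc a b).
Proof.
have := @continuous_rint_itv (fun=> 1) a b (@cst_continuous _ _ _).
by apply: rint_eq => x; rewrite mulr1.
Qed.

Lemma icc_sqint a b : sqint (icc a b).
Proof.
by split; [exact: icc_meas|apply: rint_eq (icc_rint a b) => x; rewrite icc_sq].
Qed.

Lemma Int_icc f a b : \int[mu]_(x in `[a, b]) f x = \int[mu]_x (icc a b x * f x).
Proof. by rewrite Int_itv_indic. Qed.

Lemma hint_icc a b x : a <= b -> x != 0 ->
 hint (icc a b) x = hc * ((sin (b * x) - cos (b * x)) - (sin (a * x) - cos (a * x))) / x.
Proof.
move=> ab x0; rewrite /hint -Int_icc.
rewrite (@FTC _ (fun y => (sin (y * x) - cos (y * x)) / x))//.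
- by field.
- apply: (@der_continuous _ (fun y => x * (cos (y * x) - sin (y * x)))) => y.
 by rewrite /cas; der; ring.
- by move=> y; rewrite /cas; der; field.
Qed.

Lemma hint_icc0 a b : b < a -> hint (icc a b) = fun=> 0.
Proof.
move=> ba; have -> : icc a b = fun=> 0 by exact: icc0.
apply/funext => x; rewrite /hint; under eq_Int do rewrite mul0r.
by rewrite Rintegral_cst// mul0r mulr0.
Qed.

(* sin^2 + cos^2 collapses the square to 2 (1 - cos), up to the cross term. *)
Lemma hint_icc_sq a b : sqint (hint (icc a b)).
Proof.
have [ba|ab] := ltP b a; first by rewrite hint_icc0//; exact: sqint0.
have m := hint_meas (icc_meas a b); split=> //.
apply: (@ae_rint _ _ _ mu (fun x => ((x != 0)%R%:R * hint (icc a b) x) ^+ 2)).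
- exact: measurable_funX.
- by apply: filterS (ae_neq 0) => x ->; rewrite mul1r.
apply: (@rint_le _ _ _ mu _ (fun x => 4 * hc ^+ 2 * ((1 - cos ((b - a) * x)) / x ^+ 2))).
- apply: measurable_funX; apply: mfunM => //.
 rewrite (_ : (fun x => _) = (fun x : R => x * x^-1)); last first.
  by apply/funext => x; have [->|x0] := eqVneq x 0; rewrite ?mul0r// mulfV.
 by apply: mfunM => //; exact: measR_inv.
- by apply: rintZ; exact: (proj1 (rint_1Bcos _)).
move=> x; have [->|x0] := eqVneq x 0.
 by rewrite /= mul0r expr0n /= normr0 mulr0 cos0 subrr mul0r mulr0.
rewrite /= mul1r hint_icc// ger0_norm ?sqr_ge0//.
rewrite (_ : cos ((b - a) * x) = cos (b * x) * cos (a * x) + sin (b * x) * sin (a * x)); last first.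
 by rewrite mulrBl cosB.
have := cos2Dsin2 (a * x); have := cos2Dsin2 (b * x).
set ca := cos (a * x); set cb := cos (b * x); set sa := sin (a * x); set sb := sin (b * x).
move=> hb ha.
rewrite (_ : (hc * _ / x) ^+ 2 = (hc / x) ^+ 2 * ((sb - cb) - (sa - ca)) ^+ 2); last by ring.
rewrite (_ : 4 * _ * _ = (hc / x) ^+ 2 * (4 * (1 - (cb * ca + sb * sa)))); last first.
 by field.
rewrite ler_wpM2l ?sqr_ge0//.
have := sqr_ge0 ((sb - sa) + (cb - ca)); nra.
Qed.

(** The length of the overlap of two intervals, written with the four distances between endpoints,
    because [(1 - cos (e x)) / x^2] integrates to [|e| * pi]. *)
Lemma Int_icc2 a b c d : a <= b -> c <= d -> ip (icc a b) (icc c d) =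
 2^-1 * (`|b - c| + `|a - d| - `|b - d| - `|a - c|).
Proof.
move=> ab cd; rewrite /ip.
rewrite (_ : (fun x => _) = (icc (Num.max a c) (Num.min b d))); last first.
 apply/funext => x; rewrite !iccE -natrM mulnb; congr ((_ : bool)%:R).
 by rewrite ge_max le_min; do 4 case: (_ <= _).
have [e|e] := leP (Num.max a c) (Num.min b d).
 have -> : \int[mu]_x icc (Num.max a c) (Num.min b d) x = Num.min b d - Num.max a c.
  have := FTC e (@cst_continuous _ _ _) der_id.
  by rewrite Int_icc => <-; apply: eq_Int => x; rewrite mulr1.
 move: e; rewrite ge_max !le_min => /andP[/andP[_ ad] /andP[cb _]].
 rewrite (ger0_norm (_ : 0 <= b - c)) ?(ler0_norm (_ : a - d <= 0)); try lra.
 rewrite /Num.max /Num.min; do 2 case: ltP => ?; do 2 case: (ger0P (_ - _)) => ?; lra.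
rewrite (icc0 e) Rintegral_cst// mul0r.
move: e; rewrite lt_max !gt_min => /orP[/orP[|]|/orP[|]] e; try lra.
 by rewrite !ger0_norm; lra.
by rewrite !ler0_norm; lra.
Qed.

(** Plancherel for intervals. The product of the two explicit transforms is, up to an odd function,
    a combination of functions [(1 - cos (e x)) / x^2] where [e] runs over the four differences of
    endpoints, and [hc ^+ 2 * pi = 2^-1]. *)
Lemma ip_hint_icc a b c d : ip (hint (icc a b)) (hint (icc c d)) =
 ip (icc a b) (icc c d).
Proof.
have i0 f : ip (fun=> 0) f = 0.
 by rewrite /ip; under eq_Int do rewrite mul0r; rewrite Rintegral_cst// mul0r.
have [ba|ab] := ltP b a; first by rewrite hint_icc0// i0 icc0// i0.
have [dc|cd] := ltP d c; first by rewrite ipC [RHS]ipC (@hint_icc0 c d)// (@icc0 c d)// !i0.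
rewrite Int_icc2//.
pose g e x := (1 - cos (e * x)) / x ^+ 2.
have ig e : rint (g e) by exact: (proj1 (rint_1Bcos _)).
have Ig e : \int[mu]_x g e x = `|e| * pi by exact: (proj2 (rint_1Bcos _)).
pose E x := g (b - c) x + g (a - d) x - g (b - d) x - g (a - c) x.
have iE : rint E by apply: rintB => //; apply: rintB => //; apply: rintD.
have IE : \int[mu]_x E x = pi * (`|b - c| + `|a - d| - `|b - d| - `|a - c|).
 rewrite IntB//; last by apply: rintB => //; apply: rintD.
 by rewrite IntB//; [rewrite IntD// !Ig; ring|exact: rintD].
(* The sine terms left over by the addition formulas; the function is odd, so its integral
   vanishes. *)
pose O x := hc ^+ 2 * ((sin ((b + c) * x) + sin ((a + d) * x) - sin ((b + d) * x) - sin ((a + c) * x)) / x ^+ 2).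
have mO : measR O.
 apply: mfunM => //; apply: mfunM.
  apply: continuous_measR; apply: (@der_continuous _ (fun x => (b + c) * cos ((b + c) * x)
   + (a + d) * cos ((a + d) * x) - (b + d) * cos ((b + d) * x) - (a + c) * cos ((a + c) * x))) => x.
  by der; ring.
 by apply: mfunC; [exact: measR_inv|exact: measurable_funX].
have eO x : x != 0 -> hint (icc a b) x * hint (icc c d) x - hc ^+ 2 * E x = O x.
 move=> x0; rewrite !hint_icc// /E /O /g !mulrBl !mulrDl !cosB !sinD.
 by field.
have iH := sqint_mul (hint_icc_sq a b) (hint_icc_sq c d).
have iE' := rintZ (hc ^+ 2) iE.
have : \int[mu]_x (hint (icc a b) x * hint (icc c d) x - hc ^+ 2 * E x) = 0.
 rewrite -(Int_odd mO); last first.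
  move=> x; rewrite /O !mulrN !sinN sqrrN; ring.
 apply: ae_Int => //; last by apply: filterS (ae_neq 0) => x; exact: eO.
 exact: (rint_meas (rintB iH iE')).
rewrite IntB// IntZ// IE /ip => /eqP; rewrite subr_eq0 => /eqP ->.
have h : hc ^+ 2 * pi = 2^-1 by have := hc_sq; lra.
by rewrite mulrA h.
Qed.

(** The primitive started at [- n] vanishes identically, so by the Lebesgue differentiation theorem
    [f] is zero almost everywhere to the right of [- n], for every [n]. *)
Lemma zero_itv_ae f : (forall a b, rint (fun x => icc a b x * f x)) -> measR f ->
 (forall a b, a <= b -> \int[mu]_x (icc a b x * f x) = 0) ->
 {ae mu, forall x, f x = 0}.
Proof.
move=> fi mf f0.
have li : locally_integrable setT f.
 split => //; first exact: openT.
 move=> K _ cK; have [A [_ KA]] := compact_bounded cK.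
 have := KA (`|A| + 1) ltac:(by rewrite (le_lt_trans (ler_norm A))// ltrDl).
 move=> KA1.
 have mK : measurable (K : set (measurableTypeR R)) by exact: compact_measurable.
 have h := proj2 (rint_indic f (measurable_itv _)) (fi (- (`|A| + 1)) (`|A| + 1)).
 have h2 := @integrableS _ (measurableTypeR R) R mu _ K _ (measurable_itv _) mK _ h.
 have {}h2 : mu.-integrable K (EFin \o f).
  by apply: h2 => x /KA1 /=; rewrite in_itv/= ler_norml.
 by have /integrableP[_] := h2.
have h n : {ae mu, forall x, - n%:R < x -> f x = 0}.
 have ii y : mu.-integrable [set` Interval (BLeft (- n%:R)) (BRight y)] (EFin \o f).
  exact: (proj2 (rint_indic f (measurable_itv _)) (fi _ _)).
 apply: filterS (FTC1 ii li) => x hx nx.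
 have [_ <-] := hx ltac:(by rewrite lte_fin).
 rewrite (_ : (fun x => _) = cst 0) ?derive1_cst//.
 apply/funext => y /=; have [ny|ny] := leP (- n%:R) y.
  by rewrite (Int_icc f) f0.
 by rewrite set_itv_ge ?Rintegral_set0// lteBSide/= -ltNge.
have := @ae_foralln _ _ R mu (fun n x => - n%:R < x -> f x = 0) h.
apply: filterS => x /(_ (Num.truncn `|x|).+1); apply.
by rewrite ltrNl; apply: le_lt_trans (truncnS_gt _); rewrite -normrN ler_norm.
Qed.

(** * Step functions and isometry *)

Fixpoint stepf (l : seq (R * (R * R))) : R -> R :=
 if l is t :: l' then fun x => t.1 * icc t.2.1 t.2.2 x + 1 * stepf l' x else fun=> 0.

Lemma stepf_sqint l : sqint (stepf l).
Proof.
elim: l => [|t l IH] /=; first exact: sqint0.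
by apply: sqintD; apply: sqintZ => //; exact: icc_sqint.
Qed.

Lemma stepf_rint l : rint (stepf l).
Proof.
elim: l => [|t l IH] /=; first exact: rint0.
by apply: rintD; apply: rintZ => //; exact: icc_rint.
Qed.

Lemma stepf_lin a b l l' : exists k, (fun x => a * stepf l x + b * stepf l' x) = stepf k.
Proof.
elim: l => [|t l [k kE]] /=.
 elim: l' => [|t l [k kE]] /=.
  by exists [::]; apply/funext => x /=; rewrite !mulr0 addr0.
 exists ((b * t.1, t.2) :: k); apply/funext => x /=; rewrite -kE; ring.
by exists ((a * t.1, t.2) :: k); apply/funext => x /=; rewrite -kE; ring.
Qed.

Lemma stepf_dense f : sqint f -> forall e, 0 < e ->
 exists l, sqdist f (stepf l) <= e.
Proof.
move=> f2 e e0.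
have [||||g [l <-] h] := @dense_of_orth _ _ _ mu (fun g => exists l, stepf l = g) _ _ _ _ f f2 e e0.
- by move=> _ [l <-]; exact: stepf_sqint.
- by exists [::].
- by move=> a b _ _ [l <-] [l' <-]; have [k ->] := stepf_lin a b l l'; exists k.
- move=> p p2 ph; apply: zero_itv_ae => //.
 + by move=> a b; apply: sqint_mul => //; exact: icc_sqint.
 + exact: sqint_meas p2.
 + move=> a b _; have := ph _ (ex_intro (fun l => stepf l = stepf [:: (1, (a, b))]) _ erefl).
  by rewrite ipC /ip /=; under eq_Int do rewrite mul1r mulr0 addr0.
- by exists l.
Qed.

Lemma hint0 : hint (fun=> 0) = (fun=> 0 : R).
Proof.
apply/funext => x; rewrite /hint; under eq_Int do rewrite mul0r.
by rewrite Rintegral_cst// mul0r mulr0.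
Qed.

Lemma hint_stepf t l : hint (stepf (t :: l)) =
 (fun x => t.1 * hint (icc t.2.1 t.2.2) x + 1 * hint (stepf l) x).
Proof.
by apply/funext => x; rewrite /= hint_lin//; [exact: icc_rint|exact: stepf_rint].
Qed.

Lemma hint_stepf_sqint l : sqint (hint (stepf l)).
Proof.
elim: l => [|t l IH]; first by rewrite hint0; exact: sqint0.
by rewrite hint_stepf; apply: sqintD; apply: sqintZ => //; exact: hint_icc_sq.
Qed.

Lemma ip_hint_stepf l l' : ip (hint (stepf l)) (hint (stepf l')) = ip (stepf l) (stepf l').
Proof.
have i0 f : ip (fun=> 0) f = 0.
 by rewrite /ip; under eq_Int do rewrite mul0r; rewrite Rintegral_cst// mul0r.
have h1 a b k : ip (hint (icc a b)) (hint (stepf k)) = ip (icc a b) (stepf k).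
 elim: k => [|t k IH]; first by rewrite hint0 /= ipC i0 ipC i0.
 have hk := hint_stepf_sqint k; have sk := stepf_sqint k.
 have hi := hint_icc_sq a b; have si := icc_sqint a b.
 have ht := hint_icc_sq t.2.1 t.2.2; have st := icc_sqint t.2.1 t.2.2.
 rewrite hint_stepf /= !ipr_lin//.
 by rewrite ip_hint_icc IH.
elim: l => [|t l IH]; first by rewrite hint0 /= !i0.
have hk := hint_stepf_sqint l; have sk := stepf_sqint l.
have hk' := hint_stepf_sqint l'; have sk' := stepf_sqint l'.
have ht := hint_icc_sq t.2.1 t.2.2; have st := icc_sqint t.2.1 t.2.2.
rewrite hint_stepf /= !ipl_lin//.
by rewrite h1 IH.
Qed.

Lemma cvgn_uniq (u v : nat -> R) (a b : R) :
 u n @[n --> \oo] --> a -> v n @[n --> \oo] --> b -> (forall n, u n = v n) -> a = b.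
Proof. by move=> + + /funext uv; rewrite uv => h1 h2; exact: (cvg_unique _ h1 h2). Qed.

Lemma ae_sym f g : {ae mu, forall x, f x = g x} -> {ae mu, forall x, g x = f x}.
Proof. by apply: filterS => x ->. Qed.

Lemma ae_trans f g h : {ae mu, forall x, f x = g x} -> {ae mu, forall x, g x = h x} ->
 {ae mu, forall x, f x = h x}.
Proof. by apply: filterS2 => x -> ->. Qed.

Lemma ip_icc_ae f g : sqint f -> sqint g ->
 (forall a b, ip f (icc a b) = ip g (icc a b)) -> {ae mu, forall x, f x = g x}.
Proof.
move=> f2 g2 h; have fg2 := sqintB f2 g2.
suff : {ae mu, forall x, f x - g x = 0} by apply: filterS => x /eqP; rewrite subr_eq0 => /eqP.
apply: zero_itv_ae.
- by move=> a b; apply: sqint_mul => //; exact: icc_sqint.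
- exact: (sqint_meas fg2).
- move=> a b _; have := icc_sqint a b => i2.
 by rewrite -ipE ipC ipBl// h subrr.
Qed.

Lemma ip_sqdist_cvg (u : nat -> R -> R) f h : (forall n, sqint (u n)) -> sqint f ->
 sqint h -> sqdist (u n) f @[n --> \oo] --> 0 ->
 ip (u n) h @[n --> \oo] --> ip f h.
Proof.
move=> u2 f2 h2 uf; apply/cvgrPdist_le => e e0.
pose c := ip h h + 1.
have c0 : 0 < c by rewrite ltr_wpDl ?ip_ge0.
have ec : 0 < e ^+ 2 / c by rewrite divr_gt0 ?exprn_gt0.
have /cvgrPdist_le/(_ _ ec) := uf; apply: filterS => n.
rewrite sub0r normrN ger0_norm ?sqdist_ge0// => hn.
rewrite distrC -ipBl// -(@ler_pXn2r _ 2) ?nnegrE ?(ltW e0)//.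
rewrite norm_sq//.
apply: le_trans (cauchy_schwarz (sqintB (u2 n) f2) h2) _.
apply: le_trans (_ : e ^+ 2 / c * c <= _); last by rewrite divfK ?gt_eqF.
by apply: ler_pM => //; [exact: ip_ge0|exact: ip_ge0|rewrite /c lerDl].
Qed.

Lemma ip_sqdist_cvg2 (u : nat -> R -> R) f : (forall n, sqint (u n)) -> sqint f ->
 sqdist (u n) f @[n --> \oo] --> 0 ->
 ip (u n) (u n) @[n --> \oo] --> ip f f.
Proof.
move=> u2 f2 uf.
have e n : ip (u n) (u n) = sqdist (u n) f + 2 * ip (u n) f - ip f f.
 by rewrite /sqdist ipB_sq//; ring.
have h : sqdist (u n) f + 2 * ip (u n) f - ip f f @[n --> \oo]
  --> 0 + 2 * ip f f - ip f f.
 apply: cvgB; last exact: cvg_cst.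
 apply: cvgD => //; apply: cvgM; first exact: cvg_cst.
 exact: ip_sqdist_cvg.
rewrite (_ : (fun n => ip (u n) (u n)) =
 (fun n => sqdist (u n) f + 2 * ip (u n) f - ip f f)); last exact/funext.
by apply: cvg_trans h _; rewrite (_ : 0 + _ - _ = ip f f)//; ring.
Qed.

(** * The Hartley transform on L^2 *)

Definition isH f g : Prop :=
 sqint g /\ forall a b, ip g (icc a b) = ip f (hint (icc a b)).

(** Selected through its duality with intervals. That condition is linear and fixes the function up
    to a null set, so parity, involutivity and the agreement with [hint] are checked on intervals
    alone. *)
Definition Ht f : R -> R := xget (fun=> 0) [set g | isH f g].

Lemma isH_uniq f g g' : isH f g -> isH f g' -> {ae mu, forall x, g x = g' x}.
Proof. by move=> [g2 gh] [g2' gh']; apply: ip_icc_ae => // a b; rewrite gh gh'. Qed.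

(** The transforms of step functions approximating [f] are as far apart as the step functions
    themselves, hence form a Cauchy sequence; norm and duality pass to its limit. *)
Lemma isH_exists f : sqint f -> exists g, isH f g /\ ip g g = ip f f.
Proof.
move=> f2.
have /choice[l lP] : forall n : nat, exists l, sqdist f (stepf l) <= n.+1%:R^-1.
 by move=> n; apply: stepf_dense => //; rewrite invr_gt0.
pose u n := stepf (l n); pose v n := hint (u n).
have u2 n : sqint (u n) by exact: stepf_sqint.
have v2 n : sqint (v n) by exact: hint_stepf_sqint.
have uf : sqdist (u n) f @[n --> \oo] --> 0.
 apply: (@squeeze_cvgr _ _ _ _ (fun=> 0) (fun n => n.+1%:R^-1)).
 - by apply: nearW => n; rewrite sqdist_ge0 sqdistC lP.
 - exact: cvg_cst.
 - exact: cvg_harmonic.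
have vu m n : sqdist (v m) (v n) = sqdist (u m) (u n).
 by rewrite /sqdist !ipB_sq// !ip_hint_stepf.
have [g [g2 vg _]] : exists p, [/\ sqint p, sqdist (v n) p @[n --> \oo] --> 0 &
  exists2 s : nat -> nat, (forall k, (k <= s k)%N) &
   {ae mu, forall x, v (s n) x @[n --> \oo] --> p x}].
 apply: sq_complete => // e e0.
 have /cvgrPdist_le/(_ _ (divr_gt0 e0 (ltr0n R 4)))[N _ NP] := uf.
 exists N => m n Nm Nn; rewrite vu.
 apply: le_trans (sqdist_tri (u2 m) f2 (u2 n)) _ => //.
 have := NP m Nm; have := NP n Nn.
 rewrite /= !sub0r !normrN !ger0_norm ?sqdist_ge0// (sqdistC mu f (u n)).
 by move: (sqdist _ _) (sqdist _ _) => A B; lra.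
exists g; split; [split => // a b|].
- have i2 := icc_sqint a b; have hi2 := hint_icc_sq a b.
 have c1 := @ip_sqdist_cvg v g (icc a b) v2 g2 i2 vg.
 have c2 := @ip_sqdist_cvg u f (hint (icc a b)) u2 f2 hi2 uf.
 apply: cvgn_uniq c1 c2 _ => n.
 by apply: hint_sym; [exact: stepf_rint|exact: icc_rint].
- have c1 := @ip_sqdist_cvg2 v g v2 g2 vg.
 have c2 := @ip_sqdist_cvg2 u f u2 f2 uf.
 by apply: cvgn_uniq c1 c2 _ => n; exact: ip_hint_stepf.
Qed.

Lemma HtP f : sqint f -> isH f (Ht f).
Proof.
move=> f2; have [g [fg _]] := isH_exists f2.
exact: (@xgetPex _ _ [set g | isH f g] (ex_intro _ g fg)).
Qed.

Lemma Ht_sq f : sqint f -> sqint (Ht f).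
Proof. by move=> /HtP[]. Qed.

Lemma Ht_uniq f g : sqint f -> isH f g -> {ae mu, forall x, Ht f x = g x}.
Proof. by move=> f2; apply: isH_uniq; exact: HtP. Qed.

Lemma Ht_norm f : sqint f -> ip (Ht f) (Ht f) = ip f f.
Proof.
move=> f2; have [g [fg <-]] := isH_exists f2.
have h := Ht_uniq f2 fg; have m1 := sqint_meas (Ht_sq f2).
have m2 := sqint_meas (proj1 fg).
by apply: ae_ip.
Qed.

Lemma isH_lin a b f f' g g' : sqint f -> sqint f' -> isH f g -> isH f' g' ->
 isH (fun x => a * f x + b * f' x) (fun x => a * g x + b * g' x).
Proof.
move=> f2 f2' [g2 gh] [g2' gh']; split; first exact: sqint_lin.
move=> c e; have i2 := icc_sqint c e; have hi2 := hint_icc_sq c e.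
by rewrite !ipl_lin// gh gh'.
Qed.

Lemma Ht_lin a b f g : sqint f -> sqint g ->
 {ae mu, forall x, Ht (fun x => a * f x + b * g x) x = a * Ht f x + b * Ht g x}.
Proof.
move=> f2 g2; apply: Ht_uniq; first exact: sqint_lin.
by apply: isH_lin => //; exact: HtP.
Qed.

Lemma Ht_ip f g : sqint f -> sqint g -> ip (Ht f) (Ht g) = ip f g.
Proof.
move=> f2 g2; have hf := Ht_sq f2; have hg := Ht_sq g2.
(* Polarization: the norm identity at [f + g]. *)
have fg := sqint_lin 1 1 f2 g2.
have := Ht_norm fg.
rewrite (@ae_ip _ _ _ mu _ _ (fun x => 1 * Ht f x + 1 * Ht g x) (fun x => 1 * Ht f x + 1 * Ht g x)).
- rewrite !ip_comb// !Ht_norm//; lra.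
- exact: sqint_meas (Ht_sq fg).
- exact: sqint_meas (Ht_sq fg).
- exact: sqint_meas (sqint_lin _ _ hf hg).
- exact: sqint_meas (sqint_lin _ _ hf hg).
- exact: Ht_lin.
- exact: Ht_lin.
Qed.

Lemma Ht_explicit f : sqint f -> rint f -> {ae mu, forall x, Ht f x = hint f x}.
Proof.
move=> f2 f1; have [h2 hh] := HtP f2.
have ii a b : rint (fun x => icc a b x * hint f x).
 by apply: rint_eq (rint_hint f1 (icc_rint a b)) => x; rewrite mulrC.
suff : {ae mu, forall x, Ht f x - hint f x = 0}.
 by apply: filterS => x /eqP; rewrite subr_eq0 => /eqP.
have ij a b : rint (fun x => icc a b x * Ht f x) by apply: sqint_mul => //; exact: icc_sqint.
apply: zero_itv_ae.
- move=> a b; apply: rint_eq (rintB (ij a b) (ii a b)) => x; ring.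
- by apply: measurable_funB; [exact: sqint_meas h2|apply: hint_meas; exact: sqint_meas f2].
move=> a b _.
rewrite (_ : (fun x => _) = (fun x => icc a b x * Ht f x - icc a b x * hint f x)); last first.
 by apply/funext => x; ring.
rewrite IntB// -!ipE ipC hh ipC -hint_sym//; last exact: icc_rint.
by rewrite ipC subrr.
Qed.

Lemma Ht_icc a b : {ae mu, forall x, Ht (icc a b) x = hint (icc a b) x}.
Proof. by apply: Ht_explicit; [exact: icc_sqint|exact: icc_rint]. Qed.

(** By isometry, [f] paired with an interval is [Ht f] paired with the transform of that interval,
    which is the property characterizing the transform of [Ht f]. *)
Lemma HtK f : sqint f -> {ae mu, forall x, Ht (Ht f) x = f x}.
Proof.
move=> f2; have h2 := Ht_sq f2; apply: Ht_uniq => //; split => // a b.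
have i2 := icc_sqint a b; rewrite -Ht_ip//; apply: ae_ip.
- exact: sqint_meas h2.
- exact: sqint_meas (Ht_sq i2).
- exact: sqint_meas h2.
- exact: sqint_meas (hint_icc_sq _ _).
- by apply: nearW.
- exact: Ht_icc.
Qed.

Lemma Ht_sym f g : sqint f -> sqint g -> ip (Ht f) g = ip f (Ht g).
Proof.
move=> f2 g2; have hf := Ht_sq f2; rewrite -Ht_ip//; apply: ae_ip.
- exact: sqint_meas (Ht_sq hf).
- exact: sqint_meas (Ht_sq g2).
- exact: sqint_meas f2.
- exact: sqint_meas (Ht_sq g2).
- exact: HtK.
- by apply: nearW.
Qed.

Lemma Ht_ae f g : sqint f -> sqint g -> {ae mu, forall x, f x = g x} ->
 {ae mu, forall x, Ht f x = Ht g x}.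
Proof.
move=> f2 g2 fg; apply: Ht_uniq => //; have [h2 hh] := HtP g2; split => // a b.
rewrite hh; apply: ae_ip.
- exact: sqint_meas g2.
- exact: sqint_meas (hint_icc_sq _ _).
- exact: sqint_meas f2.
- exact: sqint_meas (hint_icc_sq _ _).
- exact: ae_sym.
- by apply: nearW.
Qed.

Lemma hint_opp f x : measR f -> hint (fun y => f (- y)) x = hint f (- x).
Proof.
move=> mf; rewrite /hint; congr (_ * _).
rewrite -[RHS]Int_opp.
 by apply: eq_Int => y; rewrite mulNr mulrN opprK.
apply: mfunM => //; apply: mfunC; first exact: measR_cas.
by apply: mfunM.
Qed.

Lemma Ht_opp f : sqint f -> {ae mu, forall x, Ht (fun y => f (- y)) x = Ht f (- x)}.
Proof.
move=> f2; have [h2 hh] := HtP f2; have f2' := sqint_opp f2.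
apply: Ht_uniq => //; split; first exact: sqint_opp.
move=> a b.
have io x : icc a b (- x) = icc (- b) (- a) x.
 by rewrite !iccE lerNr lerNl andbC.
have -> : ip (fun x => Ht f (- x)) (icc a b) = ip (Ht f) (icc (- b) (- a)).
 rewrite /ip -[LHS]Int_opp.
  by apply: eq_Int => x; rewrite opprK io.
 apply: mfunM; last exact: icc_meas.
 by apply: meas_opp; exact: sqint_meas h2.
rewrite hh /ip -[RHS]Int_opp.
 apply: eq_Int => x; rewrite opprK -hint_opp; last exact: icc_meas.
 by congr (_ * _); congr (hint _ x); apply/funext => y; rewrite io.
apply: mfunM; first by apply: meas_opp; exact: sqint_meas f2.
exact: sqint_meas (hint_icc_sq _ _).
Qed.

(** * Even and odd parts, and the Fourier transform *)

Definition ev f x : R := 2^-1 * (f x + f (- x)).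
Definition od f x : R := 2^-1 * (f x - f (- x)).

Lemma ev_meas f : measR f -> measR (ev f).
Proof. by move=> mf; apply: mfunM => //; apply: measurable_funD => //; exact: meas_opp. Qed.

Lemma od_meas f : measR f -> measR (od f).
Proof. by move=> mf; apply: mfunM => //; apply: measurable_funB => //; exact: meas_opp. Qed.

Lemma ev_sqint f : sqint f -> sqint (ev f).
Proof. by move=> f2; apply: sqintZ; apply: sqintD => //; exact: sqint_opp. Qed.

Lemma od_sqint f : sqint f -> sqint (od f).
Proof. by move=> f2; apply: sqintZ; apply: sqintB => //; exact: sqint_opp. Qed.

Lemma evod_sq f : sqint f ->
 \int[mu]_x (ev f x ^+ 2 + od f x ^+ 2) = \int[mu]_x f x ^+ 2.
Proof.
move=> f2; have f2' := sqint_opp f2.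
rewrite (_ : (fun x => _) = (fun x => 2^-1 * f x ^+ 2 + 2^-1 * f (- x) ^+ 2)); last first.
 by apply/funext => x; rewrite /ev /od; field.
rewrite IntD; try (apply: rintZ; exact: sqint_sq).
rewrite !IntZ; try exact: sqint_sq.
rewrite (@Int_opp (fun x => f x ^+ 2)); first by field.
by apply: measurable_funX; exact: (sqint_meas f2).
Qed.

Definition trunc (n : nat) f x : R := icc (- n%:R) n%:R x * f x.

Lemma trunc_meas n f : measR f -> measR (trunc n f).
Proof. by move=> mf; apply: mfunM => //; exact: icc_meas. Qed.

Lemma trunc_le n f x : `|trunc n f x| <= `|f x|.
Proof. by rewrite /trunc iccE; case: (_ <= _ <= _); rewrite ?mul1r// mul0r normr0. Qed.

Lemma trunc_sqint n f : sqint f -> sqint (trunc n f).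
Proof.
move=> f2; apply: (sqint_le _ f2); last exact: trunc_le.
by apply: trunc_meas; exact: (sqint_meas f2).
Qed.

Lemma trunc_rint n f : sqint f -> rint (trunc n f).
Proof. by move=> f2; apply: sqint_mul => //; exact: icc_sqint. Qed.

Lemma trunc_near f x : \forall n \near \oo, trunc n f x = f x.
Proof.
exists (Num.truncn `|x|).+1 => // n /= h.
have : `|x| <= n%:R by apply: le_trans (ltW (truncnS_gt _)) _; rewrite ler_nat.
by rewrite ler_norml /trunc iccE => ->; rewrite mul1r.
Qed.

Lemma trunc_cvg f x : trunc n f x @[n --> \oo] --> f x.
Proof.
apply: cvg_near_cst; exact: trunc_near.
Qed.

Lemma trunc_sqdist f : sqint f -> sqdist (trunc n f) f @[n --> \oo] --> 0.
Proof.
move=> f2; have mf := sqint_meas f2.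
have [||||_] := @dct _ _ _ mu (fun n x => (trunc n f x - f x) ^+ 2) (fun=> 0)
  (fun x => 4 * f x ^+ 2) _ (measurable_cst _).
- by move=> n; apply: measurable_funX; apply: measurable_funB => //; exact: trunc_meas.
- by apply: rintZ; exact: sqint_sq.
- move=> n x; rewrite ger0_norm ?sqr_ge0// /trunc iccE.
 by have := sqr_ge0 (f x); case: (_ <= _ <= _); rewrite ?mul1r ?mul0r; nra.
- apply: nearW => x; apply: cvg_near_cst; apply: filterS (trunc_near f x) => n ->.
 by rewrite subrr expr0n.
rewrite Rintegral_cst// mul0r => h.
by rewrite (_ : (fun n => sqdist _ _) = (fun n => \int[mu]_x (trunc n f x - f x) ^+ 2)).
Qed.

(** The even part of the Hartley transform is the cosine integral and its odd part the sine
    integral, that is, the real part and minus the imaginary part of the Fourier integral. *)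
Lemma fourier_truncE f n xi : sqint f -> fourier_trunc f n xi =
 Complex (ev (hint (trunc n f)) xi) (- od (hint (trunc n f)) xi).
Proof.
move=> f2; rewrite /fourier_trunc.
have t1 := trunc_rint n f2.
have bd (F : R -> R) : measR F -> (forall y, `|F y| <= 1) -> rint (fun y => trunc n f y * F y).
 move=> mF F1; apply: (rint_le _ (rint_norm t1)).
  by apply: mfunM => //; exact: (rint_meas t1).
 by move=> x; rewrite normrM -[leRHS]mulr1 ler_wpM2l.
have mc : measR (fun y => cos (y * xi)).
 by apply: continuous_measR; apply: (@der_continuous _ (fun y => - xi * sin (y * xi))) => y; der; ring.
have ms : measR (fun y => sin (y * xi)).
 by apply: continuous_measR; apply: (@der_continuous _ (fun y => xi * cos (y * xi))) => y; der; ring.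
have ic : rint (fun y => trunc n f y * cos (y * xi)).
 by apply: bd => // y; rewrite ler_norml cos_geN1 cos_le1.
have is' : rint (fun y => trunc n f y * sin (y * xi)).
 by apply: bd => // y; rewrite ler_norml sin_geN1 sin_le1.
have h1 : hint (trunc n f) xi = hc * (\int[mu]_y (trunc n f y * cos (y * xi)) + \int[mu]_y (trunc n f y * sin (y * xi))).
 by rewrite /hint -IntD//; congr (_ * _); apply: eq_Int => y; rewrite /cas mulrDr.
have h2 : hint (trunc n f) (- xi) = hc * (\int[mu]_y (trunc n f y * cos (y * xi)) - \int[mu]_y (trunc n f y * sin (y * xi))).
 by rewrite /hint -IntB//; congr (_ * _); apply: eq_Int => y; rewrite /cas mulrN cosN sinN; ring.
rewrite /ev /od h1 h2.
have e (F : R -> R) : \int[@lebesgue_measure R]_(x in `[- n%:R, n%:R]) (f x * F x) = \int[mu]_y (trunc n f y * F y).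
 by rewrite (Int_icc (fun x => f x * F x)); apply: eq_Int => x; rewrite /trunc mulrA.
by rewrite !e; congr Complex; rewrite -/hc; field.
Qed.

Lemma sqnormcB (z w : R[i]) : sqnormc (z - w) =
 (complex.Re z - complex.Re w) ^+ 2 + (complex.Im z - complex.Im w) ^+ 2.
Proof. by case: z => a b; case: w => c e. Qed.

(** Squared modulus splits over even and odd parts, so the L^2 error of the truncated Fourier
    integral is exactly the L^2 error of the truncation of [f]. *)
Lemma is_fourier_Ht f : sqint f ->
 is_fourier f (fun xi => Complex (ev (Ht f) xi) (- od (Ht f) xi)).
Proof.
move=> f2; have hf := Ht_sq f2; have mh := sqint_meas hf.
split.
- exact: ev_meas.
- by apply: mfunC => //; exact: od_meas.
have key n : (\int[@lebesgue_measure R]_xi (sqnormc (fourier_trunc f n xi -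
  Complex (ev (Ht f) xi) (- od (Ht f) xi)))%:E)%E = (sqdist (trunc n f) f)%:E.
 have t2 := trunc_sqint n f2; have t1 := trunc_rint n f2.
 have ht := Ht_sq t2; have dt := sqintB t2 f2.
 have mt := hint_meas (sqint_meas t2).
 pose k x := hint (trunc n f) x - Ht f x.
 have k2 : sqint k.
  apply: (@ae_sqint _ _ _ mu (fun x => Ht (trunc n f) x - Ht f x)); first exact: measurable_funB.
   by apply: filterS (Ht_explicit t2 t1) => x; rewrite /k => ->.
  exact: sqintB.
 transitivity (\int[mu]_x (ev k x ^+ 2 + od k x ^+ 2)%:E)%E.
  apply: eq_integral => x _; rewrite fourier_truncE// sqnormcB/=; congr (_%:E).
  by rewrite /ev /od /k; field.
 rewrite IntE; last first.
  by apply: rintD; apply: sqint_sq; [exact: ev_sqint|exact: od_sqint].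
 rewrite evod_sq// -ipsE; congr (_%:E).
 have -> : ip k k = sqdist (Ht (trunc n f)) (Ht f).
  have m1 := sqint_meas k2; have m2 := sqint_meas (sqintB ht hf).
  apply: ae_ip => //; by apply: filterS (Ht_explicit t2 t1) => x; rewrite /k => ->.
 by rewrite /sqdist !ipB_sq// !Ht_norm// Ht_ip.
under eq_fun do rewrite key.
by apply: cvgn_EFin; exact: trunc_sqdist.
Qed.

(** The squared distance [k] of two candidates is at most twice the sum of their squared errors
    against each truncated transform, and these errors integrate to something tending to 0. *)
Lemma is_fourier_uniq f (g g' : R -> R[i]) : sqint f -> is_fourier f g -> is_fourier f g' ->
 {ae mu, forall x, g x = g' x}.
Proof.
move=> f2 [m1 m2 lg] [m1' m2' lg'].
have mt n : measR (fun x => complex.Re (fourier_trunc f n x)) /\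
      measR (fun x => complex.Im (fourier_trunc f n x)).
 have mt := hint_meas (sqint_meas (trunc_sqint n f2)).
 under eq_fun do rewrite fourier_truncE//; under [X in _ /\ measurable_fun _ X]eq_fun do rewrite fourier_truncE//.
 by split => /=; [exact: ev_meas|apply: mfunC => //; exact: od_meas].
pose k x := (complex.Re (g x) - complex.Re (g' x)) ^+ 2 + (complex.Im (g x) - complex.Im (g' x)) ^+ 2.
have mk : measR k by apply: measurable_funD; apply: measurable_funX; exact: measurable_funB.
have k0 x : 0 <= k x by rewrite addr_ge0 ?sqr_ge0.
pose A n (g : R -> R[i]) := (\int[mu]_xi (sqnormc (fourier_trunc f n xi - g xi))%:E)%E.
have mA n (h : R -> R[i]) : measR (fun x => complex.Re (h x)) -> measR (fun x => complex.Im (h x)) ->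
  measR (fun xi => (sqnormc (fourier_trunc f n xi - h xi))%:E).
 move=> mh1 mh2; apply/mEFinP; under eq_fun do rewrite sqnormcB.
 have [? ?] := mt n.
 by apply: measurable_funD; apply: measurable_funX; exact: measurable_funB.
have kA n : (\int[mu]_x (k x)%:E <= 2%:E * A n g + 2%:E * A n g')%E.
 rewrite -!ge0_integralZl//; try (exact: mA); try (by move=> x _; rewrite lee_fin addr_ge0 ?sqr_ge0).
 rewrite -ge0_integralD//; try (by apply: measurable_funeM; exact: mA);
  try (by move=> x _; rewrite mule_ge0// lee_fin addr_ge0 ?sqr_ge0).
 apply: ge0_le_integral => //.
 - by move=> x _; rewrite lee_fin.
 - exact/mEFinP.
 - by apply: emeasurable_funD; apply: measurable_funeM; exact: mA.
 - move=> x _; rewrite -!EFinM -EFinD lee_fin !sqnormcB /k.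
  set a := complex.Re (fourier_trunc _ _ _); set b := complex.Im (fourier_trunc _ _ _).
  set p := complex.Re (g x); set q := complex.Re (g' x).
  set r := complex.Im (g x); set s := complex.Im (g' x).
  by have := sqr_ge0 ((a - p) + (a - q)); have := sqr_ge0 ((b - r) + (b - s)); nra.
have k00 : (\int[mu]_x (k x)%:E <= 0)%E.
 have : (2%:E * A n g + 2%:E * A n g')%E @[n --> \oo] --> (2%:E * 0 + 2%:E * 0 : \bar R)%E.
  apply: cvgeD; first by rewrite !mule0.
   by apply: cvgeZl.
  by apply: cvgeZl.
 rewrite !mule0 adde0 => h; apply: cvge_ge h; apply: nearW => n; exact: kA.
have [k1 kI] := Int_ler mk k0 k00.
have := Int0_ae k1 k0 ltac:(by apply/eqP; rewrite eq_le kI Int_ge0).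
apply: filterS => x /eqP; rewrite paddr_eq0 ?sqr_ge0// !sqrf_eq0 !subr_eq0.
by case: (g x) => a b; case: (g' x) => a' b' /= /andP[/eqP-> /eqP->].
Qed.

Lemma fourierE f : sqint f ->
 {ae mu, forall xi, fourier f xi = Complex (ev (Ht f) xi) (- od (Ht f) xi)}.
Proof.
move=> f2; have h := is_fourier_Ht f2.
apply: (@is_fourier_uniq f) => //.
exact: (@xgetPex _ _ [set g | is_fourier f g] (ex_intro _ _ h)).
Qed.

Definition aeven g : Prop := {ae mu, forall x, g (- x) = g x}.

Lemma aeven_Ht g : sqint g -> aeven g -> aeven (Ht g).
Proof.
move=> g2 ge; apply: ae_trans (ae_sym (Ht_opp g2)) _.
by apply: Ht_ae => //; exact: sqint_opp.
Qed.

Lemma hint_even g x : rint g -> aeven g -> hint g (- x) = hint g x.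
Proof.
move=> g1 ge; have mg := rint_meas g1; rewrite -hint_opp// /hint; congr (_ * _).
apply: ae_Int.
- exact: (rint_meas (rint_cas x (rint_opp g1))).
- exact: (rint_meas (rint_cas x g1)).
- by apply: filterS ge => y ->.
Qed.

Lemma sqint_hint g : sqint g -> rint g -> sqint (hint g).
Proof.
move=> g2 g1; apply: (ae_sqint _ (Ht_explicit g2 g1)); last exact: Ht_sq.
by apply: hint_meas; exact: (rint_meas g1).
Qed.

Lemma ip_hint g h : sqint g -> rint g -> sqint h -> rint h ->
 ip (hint g) (hint h) = ip g h.
Proof.
move=> g2 g1 h2 h1; rewrite -(@Ht_ip g h)//; apply: ae_ip.
- by apply: hint_meas; exact: (rint_meas g1).
- by apply: hint_meas; exact: (rint_meas h1).
- exact: (sqint_meas (Ht_sq g2)).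
- exact: (sqint_meas (Ht_sq h2)).
- by apply: ae_sym; exact: Ht_explicit.
- by apply: ae_sym; exact: Ht_explicit.
Qed.

(** * Correlations and transforms of products *)

Definition avg h (a : R) : R -> R := fun y => 2^-1 * h (y + a) + 2^-1 * h (y + - a).

Lemma avg_sqint h a : sqint h -> sqint (avg h a).
Proof. by move=> h2; apply: sqint_lin; exact: sqint_shift. Qed.

Lemma avg_rint h a : rint h -> rint (avg h a).
Proof. by move=> h1; apply: rintD; apply: rintZ; exact: rint_shift. Qed.

(* Translating the frequency by +-a multiplies the transform by cos (a x). *)
Lemma hint_avg h a x : rint h -> hint (avg h a) x = cos (a * x) * hint h x.
Proof.
move=> h1; rewrite hint_lin; try exact: rint_shift.
have mh := rint_meas h1.
have e b : hint (fun y => h (y + b)) x = hc * \int[mu]_y (h y * cas ((y - b) * x)).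
 rewrite /hint; congr (_ * _).
 rewrite -[RHS](Int_shift b).
  by apply: eq_Int => y; rewrite addrK.
 apply: mfunM => //; apply: mfunC; first exact: measR_cas.
 by apply: mfunM => //; apply: measurable_funB.
have i b : rint (fun y => h y * cas ((y - b) * x)).
 apply: (@rint_le _ _ _ mu _ (fun y => 2 * `|h y|)).
 - apply: mfunM => //; apply: mfunC; first exact: measR_cas.
  by apply: mfunM => //; apply: measurable_funB.
 - by apply: rintZ; exact: rint_norm.
 - by move=> y; rewrite normrM mulrC ler_wpM2r// cas_le2.
have ip' := i a; have im := i (- a); have i0 := rint_cas x h1.
rewrite !e opprK.
have -> : hint h x = hc * \int[mu]_y (h y * cas (y * x)) by [].
set I0 := \int[mu]_y (h y * cas (y * x)).
set I1 := \int[mu]_y (h y * cas ((y - a) * x)).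
have -> : \int[mu]_y (h y * cas ((y + a) * x)) = 2 * (cos (a * x) * I0) - I1.
 rewrite /I0 /I1 -!IntZ//; last exact: rintZ.
 rewrite -IntB//; last by apply: rintZ; exact: rintZ.
 by apply: eq_Int => y; rewrite /cas !mulrBl !mulrDl !cosB !cosD !sinB !sinD; ring.
by field.
Qed.

Definition corr g h (x : R) : R := \int[mu]_y (g y * h (x + y)).

Lemma corr_meas g h : measR g -> measR h -> measR (corr g h).
Proof.
move=> mg mh; apply: (@measR_Int2 (fun z => g z.2 * h (z.1 + z.2))).
apply: mfunM; first exact: mfunC mg measurable_snd.
by apply: mfunC mh _; apply: measurable_funD.
Qed.

(** The convolution theorem for even functions. The sine part of the kernel integrates an odd
    function; the cosine part turns [hint h] into the transform of the average of two translates,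
    and Plancherel gives the mean of the correlations at [x] and [- x], which coincide by parity. *)
Lemma hint_mul g h x : sqint g -> rint g -> aeven g ->
 sqint h -> rint h -> aeven h ->
 hint (fun y => hint g y * hint h y) x = hc * corr g h x.
Proof.
move=> g2 g1 ge h2 h1 he; rewrite {1}/hint; congr (_ * _).
have pg := sqint_hint g2 g1; have ph := sqint_hint h2 h1.
have F1 := sqint_mul pg ph; set F := fun y => _ in F1.
have mF := rint_meas F1.
have Fe y : F (- y) = F y by rewrite /F !hint_even.
have ms : measR (fun y => sin (y * x)).
 by apply: continuous_measR; apply: (@der_continuous _ (fun y => x * cos (y * x))) => y; der; ring.
have mc : measR (fun y => cos (y * x)).
 by apply: continuous_measR; apply: (@der_continuous _ (fun y => - x * sin (y * x))) => y; der; ring.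
have bd (G : R -> R) : measR G -> (forall y, `|G y| <= 1) -> rint (fun y => F y * G y).
 move=> mG G1; apply: (rint_le _ (rint_norm F1)).
  exact: mfunM.
 by move=> y; rewrite normrM -[leRHS]mulr1 ler_wpM2l.
have ic : rint (fun y => F y * cos (y * x)).
 by apply: bd => // y; rewrite ler_norml cos_geN1 cos_le1.
have is' : rint (fun y => F y * sin (y * x)).
 by apply: bd => // y; rewrite ler_norml sin_geN1 sin_le1.
transitivity (\int[mu]_y (F y * cos (y * x)) + \int[mu]_y (F y * sin (y * x))).
 by rewrite -IntD//; apply: eq_Int => y; rewrite /cas mulrDr.
rewrite (Int_odd (rint_meas is')) ?addr0; last by move=> y; rewrite Fe mulNr sinN mulrN.
transitivity (ip (hint g) (hint (avg h x))).
 by apply: eq_Int => y; rewrite hint_avg// /F (mulrC x y); ring.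
rewrite ip_hint//; [|exact: avg_sqint|exact: avg_rint].
have hp := sqint_shift x h2; have hm := sqint_shift (- x) h2.
rewrite ipr_lin//.
have -> : ip g (fun y => h (y + - x)) = corr g h x.
 rewrite /ip /corr -[LHS]Int_opp; last exact: (rint_meas (sqint_mul g2 hm)).
 have a1 := ae_affine x (or_introl erefl) he.
 apply: ae_Int.
 - exact: (@meas_opp (fun y => g y * h (y + - x)) (rint_meas (sqint_mul g2 hm))).
 - have := rint_meas (sqint_mul g2 hp).
  by under eq_fun do rewrite addrC.
 apply: filterS2 ge a1 => y -> ; rewrite mul1r => e.
 by rewrite -opprD e addrC.
rewrite (_ : ip g _ = corr g h x); first by field.
by apply: eq_Int => y; rewrite addrC.
Qed.

Definition hs (x : R) : R := Num.sqrt `|x|.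

(** The squared H^(1/2) norm on the frequency side, with weight [1 + |x|], kept as a sum of two
    inner products so that L^2 facts apply to each. *)
Definition wn g : R := ip g g + ip (fun x => hs x * g x) (fun x => hs x * g x).

Lemma hs_sq x : hs x ^+ 2 = `|x|.
Proof. by rewrite sqr_sqrtr. Qed.

Lemma measR_norm : measR (fun x : R => `|x|).
Proof. by apply: mfunC. Qed.

Lemma hs_meas : measR hs.
Proof.
apply: (@mfunC _ _ _ _ _ _ (fun y : R => Num.sqrt y)); last exact: measR_norm.
by apply: continuous_measR => y; exact: sqrt_continuous.
Qed.

Lemma wn_ge0 g : 0 <= wn g.
Proof. by rewrite addr_ge0 ?ip_ge0. Qed.

Lemma wnE g : sqint g -> sqint (fun x => hs x * g x) ->
 rint (fun x => (1 + `|x|) * g x ^+ 2) /\ \int[mu]_x ((1 + `|x|) * g x ^+ 2) = wn g.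
Proof.
move=> g2 hg; have i1 := sqint_sq g2; have i2 := sqint_sq hg.
have e : (fun x => (1 + `|x|) * g x ^+ 2) = (fun x => g x ^+ 2 + (hs x * g x) ^+ 2).
 by apply/funext => x; rewrite exprMn hs_sq; ring.
by rewrite e; split; [exact: rintD|rewrite IntD// /wn !ipsE].
Qed.

Lemma rint_invDsq : rint (fun x => (1 + x ^+ 2)^-1) /\ \int[mu]_x (1 + x ^+ 2)^-1 = pi.
Proof.
have m : measR (fun x : R => (1 + x ^+ 2)^-1).
 apply: mfunC; first exact: measR_inv.
 by apply: measurable_funD => //; exact: measurable_funX.
have p x : 0 <= (1 + x ^+ 2)^-1 :> R by rewrite invr_ge0 addr_ge0 ?sqr_ge0.
have e : (\int[mu]_x ((1 + x ^+ 2)^-1)%:E = pi%:E)%E.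
 rewrite ge0_int_even//; last by move=> x; rewrite sqrrN.
 have := int_invDsq ltr01.
 under eq_integral do rewrite expr1n mul1r.
 by move=> ->; rewrite mul1r -EFinM; congr (_%:E); field.
split; last by rewrite /Rintegral e.
by apply: ge0_rintP => //; rewrite e ltry.
Qed.

Lemma inv_weight_le (x y : R) : ((1 + `|y|) * (1 + `|x + y|))^-1 <=
 2^-1 * ((1 + y ^+ 2)^-1 + (1 + (y + x) ^+ 2)^-1).
Proof.
set a := `|y|; set b := `|x + y|.
have -> : (y + x) ^+ 2 = b ^+ 2 by rewrite norm_sq// addrC.
have -> : y ^+ 2 = a ^+ 2 by rewrite norm_sq.
have a0 : 0 <= a by rewrite /a normr_ge0.
have b0 : 0 <= b by rewrite /b normr_ge0.
apply: le_trans (_ : 2^-1 * (((1 + a) ^+ 2)^-1 + ((1 + b) ^+ 2)^-1) <= _).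
 have := sqr_ge0 ((1 + a)^-1 - (1 + b)^-1).
 by rewrite -!exprVn invfM; nra.
rewrite ler_pM2l ?invr_gt0//; apply: lerD.
 by rewrite lef_pV2 ?posrE ?exprn_gt0 ?ltr_pwDl// ?addr_gt0 ?ltr_pwDl ?sqr_ge0//; nra.
by rewrite lef_pV2 ?posrE ?exprn_gt0 ?ltr_pwDl// ?addr_gt0 ?ltr_pwDl ?sqr_ge0//; nra.
Qed.

(** The frequency form of the embedding of H^(1/2) in L^4. By Cauchy-Schwarz in [y] against the
    weight [w y * w (x + y)], the square of the correlation at [x] is at most a slice of [F] times
    the integral of the inverse weight, which is bounded uniformly in [x]; the total integral of [F]
    is [wn g * wn h]. *)
Lemma corr_bound g h : sqint g -> sqint h ->
 sqint (fun x => hs x * g x) -> sqint (fun x => hs x * h x) ->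
 sqint (corr g h) /\ ip (corr g h) (corr g h) <= pi * (wn g * wn h).
Proof.
move=> g2 h2 hg hh; have mg := sqint_meas g2; have mh := sqint_meas h2.
have [wg1 wg2] := wnE g2 hg; have [wh1 wh2] := wnE h2 hh.
pose w (x : R) := 1 + `|x|.
have w1 x : 0 < w x by rewrite ltr_wpDr.
have mw : measR w by apply: measurable_funD => //; exact: measR_norm.
pose F (z : R * R) := (w z.2 * g z.2 ^+ 2) * (w (z.1 + z.2) * h (z.1 + z.2) ^+ 2).
have mF : measR2 F.
 apply: mfunM.
  apply: (mfunC (f := fun y : R => w y * g y ^+ 2)) => //.
  by apply: mfunM => //; exact: measurable_funX.
 apply: (mfunC (f := fun y : R => w y * h y ^+ 2)).
  by apply: mfunM => //; exact: measurable_funX.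
 by apply: measurable_funD.
have F0 z : 0 <= F z.
 by apply: mulr_ge0; apply: mulr_ge0; try exact: sqr_ge0; apply: ltW; exact: w1.
have F1 : rint2 F /\ \int[(leb2 R)]_z F z = wn g * wn h.
 have e : (\int[mu]_y \int[mu]_x (F (x, y))%:E = (wn g * wn h)%:E)%E.
  transitivity (\int[mu]_y ((wn h) * (w y * g y ^+ 2))%:E)%E.
   apply: eq_integral => y _.
   have i : rint (fun x => w (x + y) * h (x + y) ^+ 2).
    exact: (@rint_shift y (fun x => w x * h x ^+ 2)).
   apply: etrans (IntE (rintZ (w y * g y ^+ 2) i)) _; congr (_%:E).
   rewrite IntZ// (@Int_shift y (fun x => w x * h x ^+ 2)); last exact: (rint_meas wh1).
   by rewrite wh2 mulrC.
  by rewrite IntE; [rewrite IntZ// wg2 mulrC|exact: rintZ].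
 have mFE : measR2 (fun z => (F z)%:E) by exact/mEFinP.
 have e2 := fubini_tonelli2 (m1 := mu) (m2 := mu) (fun z => (F z)%:E) mFE (fun z => ltac:(by rewrite lee_fin)).
 have i : rint2 F.
  apply: (@ge0_rintP _ _ _ mu2) => //.
  have := fubini_tonelli1 (m1 := mu) (m2 := mu) (fun z => (F z)%:E) mFE (fun z => ltac:(by rewrite lee_fin)).
  by move=> ->; rewrite (fubini_tonelli (m1 := mu) (m2 := mu) (fun z => (F z)%:E))// e ltry.
 split=> //; rewrite -Int_Fubini2//.
 have := IntE (rint_Fubini2 i).
 rewrite (_ : (\int[mu]_x _)%E = (wn g * wn h)%:E); first by case=> ->.
 rewrite -e; apply: ae_eq_integral => //.
 - by apply/mEFinP; exact: (rint_meas (rint_Fubini2 i)).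
 - exact: (measurable_fun_fubini_tonelli_G (m1 := mu) (fun z => (F z)%:E)).
 - by apply: filterS (ae_rint2 i) => y iy _; rewrite (IntE iy).
have [Fi FI] := F1.
have mc := corr_meas mg mh.
(* The inverse weight is below the mean of two translates of [1 / (1 + y^2)], whose integral is
   [pi]. *)
have b2 x : sqint (fun y => Num.sqrt ((w y * w (x + y))^-1)) /\
 ip (fun y => Num.sqrt ((w y * w (x + y))^-1)) (fun y => Num.sqrt ((w y * w (x + y))^-1)) <= pi.
 have [j1 j2] := rint_invDsq.
 have js := rint_shift x j1.
 have mb : measR (fun y => Num.sqrt ((w y * w (x + y))^-1)).
  apply: (@mfunC _ _ _ _ _ _ (fun y : R => Num.sqrt y)).
   by apply: continuous_measR => y; exact: sqrt_continuous.
  apply: mfunC; first exact: measR_inv.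
  apply: mfunM => //; apply: mfunC mw _.
  by apply: measurable_funD.
 have sq y : Num.sqrt ((w y * w (x + y))^-1) ^+ 2 = (w y * w (x + y))^-1.
  by rewrite sqr_sqrtr// invr_ge0 mulr_ge0 ?ltW.
 have ii : rint (fun y => 2^-1 * ((1 + y ^+ 2)^-1 + (1 + (y + x) ^+ 2)^-1)).
  by apply: rintZ; exact: rintD.
 have i2 : rint (fun y => Num.sqrt ((w y * w (x + y))^-1) ^+ 2).
  apply: (rint_le _ ii); first exact: measurable_funX.
  by move=> y; rewrite ger0_norm ?sqr_ge0// sq; exact: inv_weight_le.
 split=> //; rewrite ipsE; apply: le_trans (Int_le i2 ii _) _.
  by move=> y; rewrite sq; exact: inv_weight_le.
 rewrite IntZ ?IntD//; last exact: rintD.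
 rewrite (@Int_shift x (fun y => (1 + y ^+ 2)^-1)); last exact: (rint_meas j1).
 by rewrite j2; lra.
have key : {ae mu, forall x, corr g h x ^+ 2 <= pi * \int[mu]_y F (x, y)}.
 apply: filterS (ae_rint1 Fi) => x ix.
 have [bb1 bb2] := b2 x.
 pose a y := Num.sqrt (w y * w (x + y)) * (g y * h (x + y)).
 have sq y : Num.sqrt (w y * w (x + y)) ^+ 2 = w y * w (x + y).
  by rewrite sqr_sqrtr// mulr_ge0 ?ltW.
 have aF y : a y ^+ 2 = F (x, y) by rewrite /a exprMn sq /F/=; ring.
 have a2 : sqint a.
  split; last by apply: rint_eq ix => y; rewrite aF.
  apply: mfunM.
   apply: (@mfunC _ _ _ _ _ _ (fun y : R => Num.sqrt y)).
    by apply: continuous_measR => y; exact: sqrt_continuous.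
   apply: mfunM => //; apply: mfunC mw _.
   by apply: measurable_funD.
  apply: mfunM => //; apply: mfunC mh _.
  by apply: measurable_funD.
 have := cauchy_schwarz a2 bb1.
 rewrite (_ : ip a _ = corr g h x); last first.
  apply: eq_Int => y; rewrite /a mulrAC -sqrtrM ?mulr_ge0 ?ltW//.
  by rewrite mulfV ?sqrtr1 ?mul1r// mulf_neq0// gt_eqF.
 have -> : ip a a = \int[mu]_y F (x, y) by rewrite ipsE; apply: eq_Int.
 move=> /le_trans; apply.
 by rewrite mulrC ler_wpM2r//; apply: Int_ge0 => y.
have iF := rint_Fubini1 Fi.
have c2 : rint (fun x => corr g h x ^+ 2) /\ \int[mu]_x corr g h x ^+ 2 <= pi * (wn g * wn h).
 apply: Int_ler.
 - exact: measurable_funX.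
 - by move=> x; exact: sqr_ge0.
 rewrite -FI -Int_Fubini1// -IntZ// -IntE; last exact: rintZ.
 apply: ae_ge0_le_integral => //.
 - by move=> x _; rewrite lee_fin sqr_ge0.
 - by apply/mEFinP; exact: measurable_funX.
 - by move=> x _; rewrite lee_fin mulr_ge0 ?pi_ge0//; apply: Int_ge0 => y.
 - by apply/mEFinP; exact: (rint_meas (rintZ _ iF)).
 - by apply: filterS key => x h' _; rewrite lee_fin.
by split; [split => //; exact: (proj1 c2)|rewrite ipsE; exact: (proj2 c2)].
Qed.

Lemma ip_le_half f g : sqint f -> sqint g ->
 `|ip f g| <= 2^-1 * ip f f + 2^-1 * ip g g.
Proof.
move=> f2 g2; have := ip_ge0 mu (fun x => f x + g x); rewrite ipD_sq//.
have := ip_ge0 mu (fun x => f x - g x); rewrite ipB_sq// => h1 h2.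
by rewrite ler_norml; apply/andP; split; lra.
Qed.

Lemma ip_cvg2 (u v : nat -> R -> R) f g :
 (forall n, sqint (u n)) -> (forall n, sqint (v n)) -> sqint f -> sqint g ->
 sqdist (u n) f @[n --> \oo] --> 0 -> sqdist (v n) g @[n --> \oo] --> 0 ->
 ip (u n) (v n) @[n --> \oo] --> ip f g.
Proof.
move=> u2 v2 f2 g2 cu cv.
have e n : ip (u n) (v n) = ip (fun x => u n x - f x) (fun x => v n x - g x) +
  (ip (u n) g + ip (v n) f - ip f g).
 rewrite ipBl//; last exact: sqintB.
 rewrite (@ipBr _ _ _ mu (v n) g (u n))// (@ipBr _ _ _ mu (v n) g f)// (ipC mu (v n) f); ring.
have c1 : ip (fun x => u n x - f x) (fun x => v n x - g x) @[n --> \oo] --> 0.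
 apply: norm_cvg0; apply: (@squeeze_cvgr _ _ _ _ (fun=> 0)
  (fun n => 2^-1 * sqdist (u n) f + 2^-1 * sqdist (v n) g)).
 - by near=> n; rewrite normr_ge0/=; apply: ip_le_half; exact: sqintB.
 - exact: cvg_cst.
 - rewrite -[X in _ --> X](_ : 2^-1 * 0 + 2^-1 * 0 = 0 :> R); last by ring.
  by apply: cvgD; apply: cvgM => //; exact: cvg_cst.
have c2 := ip_sqdist_cvg u2 f2 g2 cu.
have c3 := ip_sqdist_cvg v2 g2 f2 cv.
rewrite (_ : (fun n => _) = (fun n => ip (fun x => u n x - f x) (fun x => v n x - g x) +
  (ip (u n) g + ip (v n) f - ip f g))); last exact/funext.
rewrite -[X in _ --> X](_ : 0 + (ip f g + ip g f - ip f g) = ip f g); last first.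
 by rewrite add0r (ipC mu g) addrK.
by apply: cvgD => //; apply: cvgB; [exact: cvgD|exact: cvg_cst].
Unshelve. all: by end_near. Qed.

Lemma Ht_sqdist f g : sqint f -> sqint g -> sqdist (Ht f) (Ht g) = sqdist f g.
Proof.
move=> f2 g2; have d2 := sqintB f2 g2; have f2' := Ht_sq f2; have g2' := Ht_sq g2.
rewrite [RHS]/(sqdist _ _) -[RHS]Ht_norm//.
have e : {ae mu, forall x, Ht f x - Ht g x = Ht (fun x => f x - g x) x}.
 apply: ae_sym; apply: ae_trans (_ : {ae mu, forall x, _ x = 1 * Ht f x + -1 * Ht g x}) _; last first.
  by apply: aeW => x; ring.
 apply: ae_trans (Ht_lin 1 (-1) f2 g2); apply: Ht_ae => //; first exact: sqint_lin.
 by apply: aeW => x; ring.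
have m1 := sqint_meas (sqintB f2' g2'); have m2 := sqint_meas (Ht_sq d2).
exact: ae_ip.
Qed.

Lemma hint_trunc_sq n g : sqint g -> sqint (hint (trunc n g)).
Proof. by move=> g2; apply: sqint_hint; [exact: trunc_sqint|exact: trunc_rint]. Qed.

Lemma hint_trunc_sqdist g : sqint g ->
 sqdist (hint (trunc n g)) (Ht g) @[n --> \oo] --> 0.
Proof.
move=> g2; have := trunc_sqdist g2; apply: cvg_trans; apply: near_eq_cvg; near=> n.
have t2 := trunc_sqint n g2; rewrite -Ht_sqdist//.
have hm := sqint_meas (hint_trunc_sq n g2); have tm := sqint_meas (Ht_sq t2).
have gm := sqint_meas (Ht_sq g2).
have e := Ht_explicit t2 (trunc_rint n g2).
by apply: ae_ip; try exact: measurable_funB; apply: filterS e => x ->.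
Unshelve. all: by end_near. Qed.

Lemma trunc_aeven n g : aeven g -> aeven (trunc n g).
Proof.
apply: filterS => x e; rewrite /trunc e; congr (_ * _).
by rewrite !iccE; congr (_%:R); congr nat_of_bool; apply/idP/idP => /andP[? ?]; apply/andP; split; lra.
Qed.

Lemma sqint_casM f x : sqint f -> sqint (fun y => f y * cas (y * x)).
Proof.
move=> f2; apply: (@sqint_le _ _ _ mu _ (fun y => 2 * f y)).
- apply: mfunM; first exact: (sqint_meas f2).
 by apply: mfunC; [exact: measR_cas|exact: mfunM].
- exact: sqintZ.
- by move=> y; rewrite !normrM mulrC ler_wpM2r// [`|2|]gtr0_norm// cas_le2.
Qed.

Lemma sqdist_scale_cvg (u : nat -> R -> R) f (w : R -> R) (C : R) :
 (forall n, sqint (u n)) -> sqint f -> (forall x, `|w x| <= C) -> measR w ->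
 sqdist (u n) f @[n --> \oo] --> 0 ->
 sqdist (fun x => u n x * w x) (fun x => f x * w x) @[n --> \oo] --> 0.
Proof.
move=> u2 f2 wC mw c.
have C0 : 0 <= C by apply: le_trans (wC 0).
apply: (@squeeze_cvgr _ _ _ _ (fun=> 0) (fun n => C ^+ 2 * sqdist (u n) f)).
- near=> n; rewrite sqdist_ge0/= /sqdist !ipsE.
 have d2 := sqintB (u2 n) f2.
 have b x : (u n x * w x - f x * w x) ^+ 2 <= C ^+ 2 * (u n x - f x) ^+ 2.
  rewrite -mulrBl exprMn mulrC ler_wpM2r ?sqr_ge0//.
  by rewrite -[w x ^+ 2]norm_sq// lerXn2r// nnegrE.
 rewrite -IntZ; last exact: sqint_sq.
 apply: Int_le => //; last by apply: rintZ; exact: sqint_sq.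
 apply: (@rint_le _ _ _ mu _ (fun x => C ^+ 2 * (u n x - f x) ^+ 2)).
 + apply: measurable_funX; apply: measurable_funB; apply: mfunM => //.
   exact: (sqint_meas (u2 n)).
  exact: (sqint_meas f2).
 + by apply: rintZ; exact: sqint_sq.
 + by move=> x; rewrite ger0_norm ?sqr_ge0.
- exact: cvg_cst.
- by rewrite -[X in _ --> X](mulr0 (C ^+ 2)); apply: cvgM => //; exact: cvg_cst.
Unshelve. all: by end_near. Qed.

(** Truncations are integrable and satisfy the convolution formula. At a fixed [x] both sides are
    inner products of L^2 functions, hence continuous in the truncation, so the identity holds at
    every [x]. *)
Lemma hint_Ht_mul g h x : sqint g -> aeven g -> sqint h -> aeven h ->
 hint (fun y => Ht g y * Ht h y) x = hc * corr g h x.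
Proof.
move=> g2 ge h2 he.
have g2' := Ht_sq g2; have h2' := Ht_sq h2.
have e n : hint (fun y => hint (trunc n g) y * hint (trunc n h) y) x = hc * corr (trunc n g) (trunc n h) x.
 apply: hint_mul; try exact: trunc_sqint; try exact: trunc_rint; exact: trunc_aeven.
have cc : measR (fun y => cas (y * x)) by apply: mfunC; [exact: measR_cas|exact: mfunM].
apply: cvgn_uniq e.
- pose u n := hint (trunc n g); pose v n := fun y => hint (trunc n h) y * cas (y * x).
 have eu n : hint (fun y => hint (trunc n g) y * hint (trunc n h) y) x = hc * ip (u n) (v n).
  by rewrite /hint; congr (_ * _); apply: eq_Int => y; rewrite -mulrA.
 rewrite (_ : (fun n => _) = (fun n => hc * ip (u n) (v n))); last by apply/funext.
 have -> : hint (fun y => Ht g y * Ht h y) x = hc * ip (Ht g) (fun y => Ht h y * cas (y * x)).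
  by rewrite /hint; congr (_ * _); apply: eq_Int => y; rewrite -mulrA.
 apply: cvgM; first exact: cvg_cst.
 apply: ip_cvg2 => //.
 + by move=> n; exact: hint_trunc_sq.
 + by move=> n; apply: sqint_casM; exact: hint_trunc_sq.
 + exact: sqint_casM.
 + exact: hint_trunc_sqdist.
 + apply: (@sqdist_scale_cvg _ _ _ 2) => //.
  * by move=> n; exact: hint_trunc_sq.
  * by move=> y; exact: cas_le2.
  * exact: hint_trunc_sqdist.
- apply: cvgM; first exact: cvg_cst.
 have sh f : sqint f -> sqint (fun y => f (x + y)).
  by move=> f2; have := sqint_shift x f2; under eq_fun do rewrite addrC.
 apply: (@ip_cvg2 (fun n => trunc n g) (fun n y => trunc n h (x + y)) g (fun y => h (x + y))) => //.
 + by move=> n; exact: trunc_sqint.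
 + by move=> n; apply: sh; exact: trunc_sqint.
 + exact: sh.
 + exact: trunc_sqdist.
 + have := trunc_sqdist h2; apply: cvg_trans; apply: near_eq_cvg; near=> n.
  have d2 := sqintB (trunc_sqint n h2) h2.
  rewrite /sqdist !ipsE -(Int_shift x); last exact: (rint_meas (sqint_sq d2)).
  by apply: eq_Int => y; rewrite (addrC x y).
Unshelve. all: by end_near. Qed.

(* The form domain H^(1/2), on the frequency side. *)
Definition V1 g : Prop := sqint g /\ sqint (fun x => hs x * g x).

Lemma V1_lin a b f g : V1 f -> V1 g -> V1 (fun x => a * f x + b * g x).
Proof.
move=> [f2 hf] [g2 hg]; split; first exact: sqint_lin.
have := sqint_lin a b hf hg.
by rewrite (_ : (fun x => _) = (fun x => hs x * (a * f x + b * g x)))//; apply/funext => x; ring.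
Qed.

Lemma aeven_lin a b f g : aeven f -> aeven g -> aeven (fun x => a * f x + b * g x).
Proof. by apply: filterS2 => x -> ->. Qed.

Lemma hs_trunc n g : (fun x => hs x * trunc n g x) = trunc n (fun x => hs x * g x).
Proof. by apply/funext => x; rewrite /trunc; ring. Qed.

Lemma V1_trunc n g : V1 g -> V1 (trunc n g).
Proof. by move=> [g2 hg]; split; [exact: trunc_sqint|rewrite hs_trunc; exact: trunc_sqint]. Qed.

Lemma wn_trunc n g : V1 g -> wn (trunc n g) <= wn g.
Proof.
have le f : sqint f -> ip (trunc n f) (trunc n f) <= ip f f.
 move=> f2; rewrite !ipsE; apply: Int_le; try exact: sqint_sq.
  by apply: sqint_sq; exact: trunc_sqint.
 move=> x; rewrite -[leLHS]norm_sq// -[leRHS]norm_sq//.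
 by rewrite lerXn2r ?nnegrE// trunc_le.
by move=> [g2 hg]; rewrite /wn hs_trunc lerD// le.
Qed.

Lemma wn_trunc_cvg g : V1 g -> wn (fun x => 1 * trunc n g x + -1 * g x) @[n --> \oo] --> 0.
Proof.
move=> [g2 hg].
rewrite (_ : (fun n => _) = (fun n => sqdist (trunc n g) g +
  sqdist (trunc n (fun x => hs x * g x)) (fun x => hs x * g x))).
 by rewrite -[X in _ --> X]addr0; apply: cvgD; exact: trunc_sqdist.
apply/funext => n.
by rewrite /wn /sqdist; congr (_ + _); apply: eq_Int => x; rewrite -?hs_trunc /trunc; ring.
Qed.

Lemma corr_sub x f : sqint f -> sqint (fun y => f (x + y)).
Proof. by move=> f2; have := sqint_shift x f2; under eq_fun do rewrite addrC. Qed.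

Lemma corr_linl a b f f' g x : sqint f -> sqint f' -> sqint g ->
 corr (fun x => a * f x + b * f' x) g x = a * corr f g x + b * corr f' g x.
Proof. by move=> f2 f2' g2; have := ipl_lin a b f2 f2' (corr_sub x g2). Qed.

Lemma corr_linr a b f f' g x : sqint f -> sqint f' -> sqint g ->
 corr g (fun x => a * f x + b * f' x) x = a * corr g f x + b * corr g f' x.
Proof.
by move=> f2 f2' g2; have := ipr_lin a b (corr_sub x f2) (corr_sub x f2') g2.
Qed.

Lemma corr_sqint f g : V1 f -> V1 g -> sqint (corr f g).
Proof. by move=> [? ?] [? ?]; case: (@corr_bound f g). Qed.

Lemma corr_le f g : V1 f -> V1 g -> ip (corr f g) (corr f g) <= pi * (wn f * wn g).
Proof. by move=> [? ?] [? ?]; case: (@corr_bound f g). Qed.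

Lemma corr_cvg (u v : nat -> R -> R) f g C : (forall n, V1 (u n)) -> (forall n, V1 (v n)) ->
 V1 f -> V1 g -> (forall n, wn (u n) <= C) ->
 wn (fun x => 1 * u n x + -1 * f x) @[n --> \oo] --> 0 ->
 wn (fun x => 1 * v n x + -1 * g x) @[n --> \oo] --> 0 ->
 sqdist (corr (u n) (v n)) (corr f g) @[n --> \oo] --> 0.
Proof.
move=> Vu Vv Vf Vg uC cu cv.
have C0 : 0 <= C by apply: le_trans (uC 0); exact: wn_ge0.
apply: (@squeeze_cvgr _ _ _ _ (fun=> 0) (fun n =>
 2 * (pi * (C * wn (fun x => 1 * v n x + -1 * g x))) +
 2 * (pi * (wn (fun x => 1 * u n x + -1 * f x) * wn g)))).
- near=> n; rewrite sqdist_ge0/=.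
 apply: le_trans (@sqdist_tri _ _ _ mu _ (corr (u n) g) _ _ _ _) _; try exact: corr_sqint.
 have [u2 _] := Vu n; have [v2 _] := Vv n; have [f2 _] := Vf; have [g2 _] := Vg.
 apply: lerD; rewrite ler_pM2l//.
  have -> : sqdist (corr (u n) (v n)) (corr (u n) g) =
   ip (corr (u n) (fun x => 1 * v n x + -1 * g x)) (corr (u n) (fun x => 1 * v n x + -1 * g x)).
   by rewrite /sqdist; apply: eq_Int => x; rewrite corr_linr//; ring.
  apply: le_trans (corr_le (Vu n) (V1_lin _ _ (Vv n) Vg)) _.
  by rewrite ler_wpM2l ?pi_ge0// ler_wpM2r ?wn_ge0.
 have -> : sqdist (corr (u n) g) (corr f g) =
   ip (corr (fun x => 1 * u n x + -1 * f x) g) (corr (fun x => 1 * u n x + -1 * f x) g).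
  by rewrite /sqdist; apply: eq_Int => x; rewrite corr_linl//; ring.
 exact: corr_le (V1_lin _ _ (Vu n) Vf) Vg.
- exact: cvg_cst.
- rewrite -[X in _ --> X](_ : 2 * (pi * (C * 0)) + 2 * (pi * (0 * wn g)) = 0 :> R); last by ring.
 apply: cvgD; apply: cvgM; try exact: cvg_cst; apply: cvgM; try exact: cvg_cst; apply: cvgM => //; exact: cvg_cst.
Unshelve. all: by end_near. Qed.

(** A priori the product of the transforms is only integrable. Paired with intervals it agrees with
    the transform of [hc * corr g h], as the limit of the same identity for truncations; the
    correlation is in L^2 by [corr_bound], hence so is the product. *)
Lemma Ht_mul g h : V1 g -> aeven g -> V1 h -> aeven h ->
 sqint (fun y => Ht g y * Ht h y) /\
 {ae mu, forall x, Ht (fun y => Ht g y * Ht h y) x = hc * corr g h x}.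
Proof.
move=> Vg ge Vh he; have [g2 hg] := Vg; have [h2 hh] := Vh.
have g2' := Ht_sq g2; have h2' := Ht_sq h2.
pose P y := Ht g y * Ht h y; have P1 : rint P by exact: sqint_mul.
pose k x := hc * corr g h x; have k2 : sqint k by apply: sqintZ; exact: corr_sqint.
have Hk2 := Ht_sq k2.
have imul a b f : rint f -> rint (fun x => icc a b x * f x).
 move=> f1; apply: (rint_le _ (rint_norm f1)).
  by apply: mfunM; [exact: icc_meas|exact: (rint_meas f1)].
 by move=> x; rewrite normrM iccE; case: (_ <= _ <= _)%R; rewrite ?normr1 ?normr0 ?mul1r ?mul0r.
have itv a b : \int[mu]_x (icc a b x * P x) = \int[mu]_x (icc a b x * Ht k x).
 pose G n := trunc n g; pose H n := trunc n h.
 have e n : \int[mu]_x (icc a b x * (hint (G n) x * hint (H n) x)) =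
   ip (fun x => hc * corr (G n) (H n) x) (hint (icc a b)).
  have VG := V1_trunc n Vg; have VH := V1_trunc n Vh.
  have [G2 _] := VG; have [H2 _] := VH.
  have G1 := trunc_rint n g2; have H1 := trunc_rint n h2.
  have pG := hint_trunc_sq n g2; have pH := hint_trunc_sq n h2.
  pose Q y := hint (G n) y * hint (H n) y.
  have Q1 : rint Q by exact: sqint_mul.
  have Q2 : sqint Q.
   apply: (@sqint_le _ _ _ mu _ (fun y => (2 * hc * \int[mu]_y `|G n y|) * hint (H n) y)).
   - exact: (rint_meas Q1).
   - exact: sqintZ.
   - move=> y; rewrite /Q [leLHS]normrM [leRHS]normrM ler_wpM2r//.
    apply: le_trans (hint_le _ G1) _.
    exact: ler_norm.
  have eQ : {ae mu, forall x, hc * corr (G n) (H n) x = Ht Q x}.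
   apply: ae_sym; apply: ae_trans (Ht_explicit Q2 Q1) _; apply: aeW => x.
   by apply: hint_mul => //; exact: trunc_aeven.
  have mh := sqint_meas (hint_icc_sq a b).
  rewrite (@ae_ip _ _ _ mu _ (hint (icc a b)) (Ht Q) (Ht (icc a b))) //.
  - rewrite (@Ht_ip Q (icc a b)); [|exact: Q2|exact: icc_sqint].
   by apply: eq_Int => x; rewrite mulrC.
  - by apply: mfunM => //; exact: (sqint_meas (corr_sqint VG VH)).
  - exact: (sqint_meas (Ht_sq Q2)).
  - exact: (sqint_meas (Ht_sq (icc_sqint a b))).
  - by apply: ae_sym; exact: Ht_icc.
 apply: cvgn_uniq e.
  have e' n : \int[mu]_x (icc a b x * (hint (G n) x * hint (H n) x)) =
    ip (hint (G n)) (fun x => hint (H n) x * icc a b x).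
   by apply: eq_Int => x; ring.
  rewrite (_ : (fun n => _) = (fun n => ip (hint (G n)) (fun x => hint (H n) x * icc a b x))); last exact/funext.
  rewrite (_ : \int[mu]_x _ = ip (Ht g) (fun x => Ht h x * icc a b x)); last first.
   by apply: eq_Int => x; rewrite /P; ring.
  have im f : sqint f -> sqint (fun x => f x * icc a b x).
   move=> f2; apply: (@sqint_le _ _ _ mu _ f) => //.
    by apply: mfunM; [exact: (sqint_meas f2)|exact: icc_meas].
   by move=> x; rewrite normrM iccE; case: (_ <= _ <= _)%R; rewrite ?normr1 ?normr0 ?mulr1 ?mulr0.
  apply: ip_cvg2 => //.
  - by move=> n; exact: hint_trunc_sq.
  - by move=> n; apply: im; exact: hint_trunc_sq.
  - exact: im.
  - exact: hint_trunc_sqdist.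
  - apply: (@sqdist_scale_cvg _ _ _ 1) => //.
   + by move=> n; exact: hint_trunc_sq.
   + by move=> x; rewrite iccE; case: (_ <= _ <= _)%R; rewrite ?normr1 ?normr0.
   + exact: icc_meas.
   + exact: hint_trunc_sqdist.
 have -> : \int[mu]_x (icc a b x * Ht k x) = ip k (hint (icc a b)).
  have -> : \int[mu]_x (icc a b x * Ht k x) = ip (Ht k) (icc a b).
   by apply: eq_Int => x; rewrite mulrC.
  by have [_ ->] := HtP k2.
 rewrite /k ipZl; [|exact: corr_sqint|exact: hint_icc_sq].
 rewrite (_ : (fun n => _) = (fun n => hc * ip (corr (G n) (H n)) (hint (icc a b)))); last first.
  by apply/funext => n; rewrite ipZl//; [apply: corr_sqint; exact: V1_trunc|exact: hint_icc_sq].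
 apply: cvgM; first exact: cvg_cst.
 apply: ip_sqdist_cvg; [by move=> n; apply: corr_sqint; exact: V1_trunc|exact: corr_sqint|exact: hint_icc_sq|].
 apply: (@corr_cvg _ _ _ _ (wn g)) => //; try (by move=> n; exact: V1_trunc); try exact: wn_trunc_cvg.
 by move=> n; exact: wn_trunc.
have Pk : {ae mu, forall x, P x = Ht k x}.
 have := @zero_itv_ae (fun x => P x - Ht k x).
 have i1 a b := imul a b _ P1.
 have i2 a b : rint (fun x => icc a b x * Ht k x) by apply: sqint_mul => //; exact: icc_sqint.
 have ee a b : (fun x => icc a b x * (P x - Ht k x)) = (fun x => icc a b x * P x - icc a b x * Ht k x).
  by apply/funext => x; ring.
 move=> Z; have : {ae mu, forall x, P x - Ht k x = 0}.
  apply: Z.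
  - by move=> a b; rewrite ee; exact: rintB.
  - by apply: measurable_funB; [exact: (rint_meas P1)|exact: (sqint_meas Hk2)].
  - by move=> a b _; rewrite ee IntB// itv subrr.
 by apply: filterS => x /eqP; rewrite subr_eq0 => /eqP.
have P2 : sqint P by apply: (ae_sqint _ (ae_sym Pk)) => //; exact: (rint_meas P1).
split=> //; apply: ae_trans (Ht_explicit P2 P1) _; apply: aeW => x; exact: hint_Ht_mul.
Qed.

(* Sealed, so that conversion never unfolds the integrals. *)
Fact T_spec : {T : (R -> R) -> (R -> R) -> (R -> R) -> R |
 forall f g h, T f g h = hc * ip f (corr g h)}.
Proof. by exists (fun f g h => hc * ip f (corr g h)). Qed.

Definition T := sval T_spec.

Lemma Tdef f g h : T f g h = hc * ip f (corr g h).
Proof. exact: (svalP T_spec). Qed.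

#[local] Opaque Ht.

(** In physical space the cubic form is the integral of a product of three functions, and its
    symmetry in the arguments becomes evident there. *)
Lemma TE f g h : sqint f -> V1 g -> aeven g -> V1 h -> aeven h ->
 T f g h = \int[mu]_x (Ht f x * (Ht g x * Ht h x)).
Proof.
move=> f2 Vg ge Vh he; have [P2 e] := Ht_mul Vg ge Vh he.
have c2 := corr_sqint Vg Vh.
rewrite Tdef -ipZr//.
have -> : \int[mu]_x (Ht f x * (Ht g x * Ht h x)) = ip (Ht f) (fun x => Ht g x * Ht h x) by [].
rewrite Ht_sym//; apply: ae_ip => //; last exact: ae_sym.
- exact: (sqint_meas f2).
- exact: (sqint_meas (sqintZ hc c2)).
- exact: (sqint_meas f2).
- exact: (sqint_meas (Ht_sq P2)).
- exact: aeW.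
Qed.

Lemma T_swap23 f g h : sqint f -> V1 g -> aeven g -> V1 h -> aeven h -> T f g h = T f h g.
Proof.
move=> f2 Vg ge Vh he; rewrite (TE f2 Vg ge Vh he) (TE f2 Vh he Vg ge).
by apply: eq_Int => x; congr (_ * _); exact: mulrC.
Qed.

Lemma T_swap12 f g h : V1 f -> aeven f -> V1 g -> aeven g -> V1 h -> aeven h -> T f g h = T g f h.
Proof.
move=> Vf fe Vg ge Vh he; have [f2 _] := Vf; have [g2 _] := Vg.
rewrite (TE f2 Vg ge Vh he) (TE g2 Vf fe Vh he).
by apply: eq_Int => x; exact: mulrCA.
Qed.

Lemma T_lin a b f f' g h : sqint f -> sqint f' -> V1 g -> V1 h ->
 T (fun x => a * f x + b * f' x) g h = a * T f g h + b * T f' g h.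
Proof. by move=> f2 f2' Vg Vh; rewrite !Tdef ipl_lin//; [ring|exact: corr_sqint]. Qed.

Lemma T_bound f g h : sqint f -> V1 g -> V1 h ->
 T f g h ^+ 2 <= 2^-1 * (ip f f * (wn g * wn h)).
Proof.
move=> f2 Vg Vh; have c2 := corr_sqint Vg Vh.
rewrite Tdef exprMn; apply: le_trans (_ : hc ^+ 2 * (ip f f * (pi * (wn g * wn h))) <= _).
 rewrite ler_wpM2l ?sqr_ge0//; apply: le_trans (cauchy_schwarz f2 c2) _.
 by rewrite ler_wpM2l ?ip_ge0// corr_le.
have h2 := hc_sq; apply: le_of_eq.
have -> : 2^-1 = hc ^+ 2 * pi :> R by move: h2; lra.
ring.
Qed.

(** * Weighted quadratic forms and the expansion of the cubic form *)

Notation lin a f b g := (fun x => a * f x + b * g x).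

Definition weight w c : Prop :=
 [/\ measR w, 0 < c, forall x, c * (1 + `|x|) <= w x & forall x, w (- x) = w x].

Definition sw w x : R := Num.sqrt (w x).

Lemma weight_gt0 w c x : weight w c -> 0 < w x.
Proof. by move=> [_ c0 h _]; apply: lt_le_trans (h x); rewrite mulr_gt0// ltr_wpDr. Qed.

Lemma sw_sq w c x : weight w c -> sw w x ^+ 2 = w x.
Proof. by move=> h; rewrite sqr_sqrtr// ltW// (weight_gt0 _ h). Qed.

Lemma sw_gt0 w c x : weight w c -> 0 < sw w x.
Proof. by move=> h; rewrite sqrtr_gt0 (weight_gt0 _ h). Qed.

Lemma sw_meas w : measR w -> measR (sw w).
Proof.
move=> m; apply: (@mfunC _ _ _ _ _ _ (fun y : R => Num.sqrt y)) => //.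
by apply: continuous_measR => y; exact: sqrt_continuous.
Qed.

Definition VD w g : Prop := [/\ V1 g, aeven g & sqint (fun x => sw w x * g x)].

(** Sealed like [T_spec], to keep the integrals folded. *)
Fact q_spec : {q : (R -> R) -> (R -> R) -> (R -> R) -> R |
 forall w f g, q w f g = ip (fun x => sw w x * f x) (fun x => sw w x * g x)}.
Proof. by exists (fun w f g => ip (fun x => sw w x * f x) (fun x => sw w x * g x)). Qed.

Definition q := sval q_spec.

Lemma qdef w f g : q w f g = ip (fun x => sw w x * f x) (fun x => sw w x * g x).
Proof. exact: (svalP q_spec). Qed.

Lemma VD_sq w g : VD w g -> sqint g. Proof. by case=> -[]. Qed.
Lemma VD_V1 w g : VD w g -> V1 g. Proof. by case. Qed.
Lemma VD_even w g : VD w g -> aeven g. Proof. by case. Qed.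
Lemma VD_sw w g : VD w g -> sqint (fun x => sw w x * g x). Proof. by case. Qed.

Lemma VD_lin w a b f g : VD w f -> VD w g -> VD w (lin a f b g).
Proof.
move=> [Vf fe wf] [Vg ge wg]; split; [exact: V1_lin|exact: aeven_lin|].
have := sqint_lin a b wf wg.
by rewrite (_ : (fun x => _) = (fun x => sw w x * (a * f x + b * g x)))//; apply/funext => x; ring.
Qed.

Lemma VDP w c g : weight w c -> measR g -> aeven g -> sqint (fun x => sw w x * g x) -> VD w g.
Proof.
move=> hw mg ge wg; have [mw c0 wc _] := hw.
have b (k : R -> R) : measR k -> (forall x, k x ^+ 2 <= 1 + `|x|) -> sqint (fun x => k x * g x).
 move=> mk kle; apply: (@sqint_le _ _ _ mu _ (fun x => (Num.sqrt c)^-1 * (sw w x * g x))).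
 - exact: mfunM.
 - exact: sqintZ.
 - move=> x; rewrite mulrA 2!normrM ler_wpM2r// -[leLHS]ger0_norm// -[leRHS]ger0_norm//.
  rewrite -ler_sqr ?nnegrE// !norm_sq// exprMn exprVn sqr_sqrtr ?(ltW c0)//.
  by rewrite (sw_sq _ hw) ler_pdivlMl//; apply: le_trans (wc x); rewrite ler_pM2l.
split=> //; split.
 have := b (fun=> 1) (@measurable_cst _ _ _ _ _ _); under eq_fun do rewrite mul1r.
 by apply=> x; rewrite expr1n lerDl.
by apply: b; [exact: hs_meas|move=> x; rewrite hs_sq lerDr].
Qed.

Lemma qC w f g : q w f g = q w g f. Proof. by rewrite !qdef ipC. Qed.
Lemma q_ge0 w f : 0 <= q w f f. Proof. by rewrite qdef ip_ge0. Qed.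

Lemma q_linl w a b f g h : VD w f -> VD w g -> VD w h ->
 q w (lin a f b g) h = a * q w f h + b * q w g h.
Proof.
move=> Vf Vg Vh; rewrite !qdef -(ipl_lin) ?(@VD_sw w)//; try exact: VD_sw.
by apply: eq_Int => x; congr (_ * _); ring.
Qed.

Lemma q_linr w a b f g h : VD w f -> VD w g -> VD w h ->
 q w h (lin a f b g) = a * q w h f + b * q w h g.
Proof. by move=> *; rewrite qC q_linl// !(qC w h). Qed.

Lemma q_comb w a b f g : VD w f -> VD w g ->
 q w (lin a f b g) (lin a f b g) = a ^+ 2 * q w f f + 2 * a * b * q w f g + b ^+ 2 * q w g g.
Proof.
move=> Vf Vg; have Vl := VD_lin a b Vf Vg.
by rewrite q_linl// !q_linr// (qC w g f); ring.
Qed.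

Lemma q_cs w f g : VD w f -> VD w g -> q w f g ^+ 2 <= q w f f * q w g g.
Proof. by move=> /VD_sw f2 /VD_sw g2; rewrite !qdef; exact: cauchy_schwarz. Qed.

Lemma q_scale w a f : VD w f -> q w (lin a f 0 f) (lin a f 0 f) = a ^+ 2 * q w f f.
Proof. by move=> Vf; rewrite q_comb//; ring. Qed.

Lemma qE w c f g : weight w c -> q w f g = \int[mu]_x (w x * f x * g x).
Proof. by move=> hw; rewrite qdef; apply: eq_Int => x; rewrite -(sw_sq _ hw); ring. Qed.

Lemma q_eq0 w c g : weight w c -> VD w g -> q w g g = 0 -> {ae mu, forall x, g x = 0}.
Proof.
move=> hw Vg; rewrite qdef => /(ip_eq0 (VD_sw Vg)); apply: filterS => x /eqP.
by rewrite mulf_eq0 gt_eqF ?(sw_gt0 _ hw)//= => /eqP.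
Qed.

Lemma wn_le w c g : weight w c -> VD w g -> wn g <= c^-1 * q w g g.
Proof.
move=> hw Vg; have [mw c0 wc _] := hw; have [[g2 hg] _ wg] := Vg.
have [i1 <-] := wnE g2 hg; rewrite qdef ipsE -IntZ; last exact: (sqint_sq wg).
apply: Int_le => //; first by apply: rintZ; exact: (sqint_sq wg).
move=> x; rewrite exprMn (sw_sq _ hw) [leRHS]mulrA ler_wpM2r ?sqr_ge0//.
by rewrite ler_pdivlMl.
Qed.

Lemma ip_le_wn g : ip g g <= wn g.
Proof. by rewrite lerDl ip_ge0. Qed.

Lemma VD_norm w g : VD w g -> VD w (fun x => `|g x|) /\
 q w (fun x => `|g x|) (fun x => `|g x|) = q w g g.
Proof.
move=> [[g2 hg] ge wg].
have n k : (forall x, 0 <= k x) -> sqint (fun x => k x * g x) -> sqint (fun x => k x * `|g x|).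
 move=> k0 kg; have := sqint_norm kg.
 by rewrite (_ : (fun x => _) = (fun x => k x * `|g x|))//; apply/funext => x; rewrite normrM ger0_norm.
split; last first.
 rewrite !qdef; apply: eq_Int => x; rewrite -!expr2 !exprMn; congr (_ * _).
 by rewrite norm_sq.
split; last by apply: n => // x; exact: sqrtr_ge0.
 by split; [exact: sqint_norm|apply: n => // x; exact: sqrtr_ge0].
by apply: filterS ge => x ->.
Qed.

Definition T3 g : R := T g g g.

Lemma T3_norm g : V1 g -> T3 g <= T3 (fun x => `|g x|).
Proof.
move=> [g2 hg].
have Vn : V1 (fun x => `|g x|).
 split; first exact: sqint_norm.
 have := sqint_norm hg.
 by rewrite (_ : (fun x => _) = (fun x => hs x * `|g x|))//; apply/funext => x; rewrite normrM ger0_norm ?sqrtr_ge0.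
have gc := corr_sqint (conj g2 hg) (conj g2 hg); have nc := corr_sqint Vn Vn.
rewrite /T3 !Tdef (ler_pM2l hc_gt0); apply: Int_le; [exact: sqint_mul|apply: sqint_mul => //; exact: sqint_norm|].
move=> x; apply: le_trans (ler_norm _) _; rewrite normrM ler_wpM2l//.
have i : rint (fun y => g y * g (x + y)) by apply: sqint_mul => //; exact: corr_sub.
apply: le_trans (Int_norm i) _; apply: le_of_eq.
by apply: eq_Int => y; rewrite normrM.
Qed.

Lemma T_lin2 a b f g h k : sqint h -> V1 f -> V1 g -> V1 k ->
 T h (lin a f b g) k = a * T h f k + b * T h g k.
Proof.
move=> h2 Vf Vg Vk; have [f2 _] := Vf; have [g2 _] := Vg; have [k2 _] := Vk.
have -> : T h (lin a f b g) k = hc * ip h (lin a (corr f k) b (corr g k)).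
 by rewrite Tdef; congr (_ * _); apply: eq_Int => x; rewrite corr_linl.
rewrite !Tdef ipr_lin ?mulrDr; [|exact: corr_sqint|exact: corr_sqint|exact: h2].
by congr (_ + _); rewrite mulrCA.
Qed.

Lemma T_lin3 a b f g h k : sqint h -> V1 f -> V1 g -> V1 k ->
 T h k (lin a f b g) = a * T h k f + b * T h k g.
Proof.
move=> h2 Vf Vg Vk; have [f2 _] := Vf; have [g2 _] := Vg; have [k2 _] := Vk.
have -> : T h k (lin a f b g) = hc * ip h (lin a (corr k f) b (corr k g)).
 by rewrite Tdef; congr (_ * _); apply: eq_Int => x; rewrite corr_linr.
rewrite !Tdef ipr_lin ?mulrDr; [|exact: corr_sqint|exact: corr_sqint|exact: h2].
by congr (_ + _); rewrite mulrCA.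
Qed.

(** The binomial expansion: on even functions the cubic form is symmetric, so the mixed terms
    merge. *)
Lemma T_comb a b f g : V1 f -> aeven f -> V1 g -> aeven g ->
 T3 (lin a f b g) = a ^+ 3 * T3 f + 3 * a ^+ 2 * b * T f f g + 3 * a * b ^+ 2 * T f g g + b ^+ 3 * T3 g.
Proof.
move=> Vf fe Vg ge; have [f2 _] := Vf; have [g2 _] := Vg.
have Vl := V1_lin a b Vf Vg.
have e2 h : sqint h -> T h (lin a f b g) (lin a f b g) =
  a ^+ 2 * T h f f + a * b * (T h f g + T h g f) + b ^+ 2 * T h g g.
 move=> h2; rewrite (T_lin2 _ _ h2 Vf Vg Vl).
 rewrite (T_lin3 _ _ h2 Vf Vg Vf) (T_lin3 _ _ h2 Vf Vg Vg).
 by move: (T h f f) (T h f g) (T h g f) (T h g g) => t1 t2 t3 t4; ring.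
rewrite /T3 (T_lin _ _ f2 g2 Vl Vl) (e2 _ f2) (e2 _ g2).
have s1 := T_swap23 f2 Vg ge Vf fe.
have s2 := T_swap12 Vg ge Vf fe Vf fe.
have s3 := T_swap12 Vf fe Vg ge Vg ge.
have s4 := T_swap23 g2 Vf fe Vg ge.
move: s1 s2 s3 s4.
move: (T f f f) (T g g g) (T f f g) (T f g f) (T f g g) (T g f f) (T g f g) (T g g f).
by move=> t1 t2 t3 t4 t5 t6 t7 t8 -> -> -> <-; ring.
Qed.

(** The constant of [T_bound] after each norm has been replaced by [c^-1] times the quadratic
    form. *)
Definition TB c : R := Num.sqrt (2^-1 * c^-1 ^+ 3).

Lemma TB_ge0 c : 0 <= TB c. Proof. exact: sqrtr_ge0. Qed.

Lemma T_le w c f g h : weight w c -> VD w f -> VD w g -> VD w h ->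
 `|T f g h| <= TB c * (Num.sqrt (q w f f) * Num.sqrt (q w g g) * Num.sqrt (q w h h)).
Proof.
move=> hw Vf Vg Vh; have [_ c0 _ _] := hw.
have ci0 : 0 <= c^-1 by rewrite invr_ge0 ltW.
have qf := q_ge0 w f; have qg := q_ge0 w g; have qh := q_ge0 w h.
rewrite /TB -!sqrtrM ?mulr_ge0 ?exprn_ge0 ?invr_ge0 ?(ltW c0)//.
rewrite -sqrtr_sqr ler_wsqrtr//.
apply: le_trans (T_bound (VD_sq Vf) (VD_V1 Vg) (VD_V1 Vh)) _.
have := wn_le hw Vg; have := wn_le hw Vh.
have := le_trans (ip_le_wn f) (wn_le hw Vf).
have := wn_ge0 g; have := wn_ge0 h; have := ip_ge0 mu f.
move: (ip f f) (wn g) (wn h) (q w f f) (q w g g) (q w h h) qf qg qh => X Y Z x y z x0 y0 z0 X0 Z0 Y0 hX hZ hY.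
rewrite -!mulrA ler_pM2l//.
apply: le_trans (_ : (c^-1 * x) * ((c^-1 * y) * (c^-1 * z)) <= _); last first.
 by apply: le_of_eq; ring.
by apply: ler_pM => //; [exact: mulr_ge0|apply: ler_pM].
Qed.

Lemma T3_eq f g : sqint f -> sqint g -> {ae mu, forall x, f x = g x} -> T3 f = T3 g.
Proof.
move=> f2 g2 e; have mf := sqint_meas f2; have mg := sqint_meas g2.
rewrite /T3 !Tdef; congr (hc * _).
have m1 := corr_meas mf mf; have m2 := corr_meas mg mg.
apply: (ae_ip mf m1 mg m2 e).
apply: aeW => x; apply: ae_Int.
- by apply: mfunM => //; apply: mfunC => //; apply: measurable_funD.
- by apply: mfunM => //; apply: mfunC => //; apply: measurable_funD.
have := ae_affine x (or_introl erefl) e.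
by apply: filterS2 e => y -> ; rewrite mul1r addrC => ->.
Qed.

Lemma q_ae w f g : VD w f -> VD w g -> {ae mu, forall x, f x = g x} -> q w f f = q w g g.
Proof.
move=> /VD_sw/sqint_meas mf /VD_sw/sqint_meas mg e.
by rewrite !qdef; apply: ae_ip => //; apply: filterS e => x ->.
Qed.

Lemma T3_scale a f : V1 f -> aeven f -> T3 (lin a f 0 f) = a ^+ 3 * T3 f.
Proof. by move=> Vf fe; rewrite T_comb//; ring. Qed.

Lemma T3_cvg w c (u : nat -> R -> R) f : weight w c -> (forall n, VD w (u n)) -> VD w f ->
 q w (lin 1 (u n) (-1) f) (lin 1 (u n) (-1) f) @[n --> \oo] --> 0 ->
 T3 (u n) @[n --> \oo] --> T3 f.
Proof.
move=> hw Vu Vf cu; pose d n := lin 1 (u n) (-1) f.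
have Vd n : VD w (d n) by exact: VD_lin.
pose s n := Num.sqrt (q w (d n) (d n)).
have cs : s n @[n --> \oo] --> 0.
 rewrite -[X in _ --> X](sqrtr0 R); apply: (@cvg_comp _ _ _ _ (fun y : R => Num.sqrt y)) cu _.
 exact: sqrt_continuous.
have e n : T3 (u n) = T3 f + (3 * T f f (d n) + 3 * T f (d n) (d n) + T3 (d n)).
 have -> : T3 (u n) = T3 (lin 1 f 1 (d n)).
  by congr T3; apply/funext => x; rewrite /d; ring.
 rewrite T_comb; [|exact: VD_V1 Vf|exact: VD_even Vf|exact: VD_V1 (Vd n)|exact: VD_even (Vd n)].
 by move: (T3 f) (T f f (d n)) (T f (d n) (d n)) (T3 (d n)) => *; ring.
rewrite (_ : (fun n => _) = (fun n => T3 f + (3 * T f f (d n) + 3 * T f (d n) (d n) + T3 (d n)))); last exact/funext.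
rewrite -[X in _ --> X]addr0; apply: cvgD; first exact: cvg_cst.
pose F := Num.sqrt (q w f f).
apply: norm_cvg0; apply: (@squeeze_cvgr _ _ _ _ (fun=> 0)
 (fun n => TB c * ((3 * (F * F)) * s n + (3 * F) * (s n * s n) + s n * s n * s n))).
- near=> n; rewrite normr_ge0/=.
 have t1 := T_le hw Vf Vf (Vd n); have t2 := T_le hw Vf (Vd n) (Vd n).
 have t3 := T_le hw (Vd n) (Vd n) (Vd n).
 rewrite -/F -/(s n) in t1 t2 t3; rewrite /T3.
 move: (T f f (d n)) (T f (d n) (d n)) (T (d n) (d n) (d n)) t1 t2 t3 => a1 a2 a3 h1 h2 h3.
 apply: le_trans (ler_normD _ _) _; apply: le_trans (lerD (ler_normD _ _) (lexx _)) _.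
 rewrite !normrM (gtr0_norm (_ : 0 < 3 :> R))//.
 have -> : TB c * (3 * (F * F) * s n + 3 * F * (s n * s n) + s n * s n * s n) =
  3 * (TB c * (F * F * s n)) + 3 * (TB c * (F * s n * s n)) + TB c * (s n * s n * s n) by ring.
 by rewrite !lerD// ler_pM2l.
- exact: cvg_cst.
- rewrite -[X in _ --> X](_ : TB c * ((3 * (F * F)) * 0 + (3 * F) * (0 * 0) + 0 * 0 * 0) = 0 :> R); last by ring.
 apply: cvgM; first exact: cvg_cst.
 apply: cvgD; last by apply: cvgM => //; exact: cvgM.
 apply: cvgD; first by apply: cvgM => //; exact: cvg_cst.
 by apply: cvgM; [exact: cvg_cst|exact: cvgM].
Unshelve. all: by end_near. Qed.

Lemma q_cvg w (u : nat -> R -> R) f h : (forall n, VD w (u n)) -> VD w f -> VD w h ->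
 q w (lin 1 (u n) (-1) f) (lin 1 (u n) (-1) f) @[n --> \oo] --> 0 ->
 q w (u n) h @[n --> \oo] --> q w f h /\ q w (u n) (u n) @[n --> \oo] --> q w f f.
Proof.
move=> Vu Vf Vh cu.
have cu' : sqdist (fun x => sw w x * u n x) (fun x => sw w x * f x) @[n --> \oo] --> 0.
 rewrite (_ : (fun n => _) = (fun n => q w (lin 1 (u n) (-1) f) (lin 1 (u n) (-1) f)))//.
 by apply/funext => n; rewrite qdef; apply: eq_Int => x; ring.
have us n := VD_sw (Vu n); have fs := VD_sw Vf.
rewrite qdef (funext (fun n => qdef w (u n) h)) qdef (funext (fun n => qdef w (u n) (u n))).
by split; [apply: ip_sqdist_cvg => //; exact: VD_sw|exact: ip_cvg2].
Qed.

(** The functions [sw w * u n] converge in L^2. Nonnegativity and parity pass to the limit along an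
    almost everywhere convergent subsequence. *)
Lemma VD_complete w c (u : nat -> R -> R) : weight w c -> (forall n, VD w (u n)) ->
 (forall n x, 0 <= u n x) ->
 (forall e, 0 < e -> exists N, forall m n, (N <= m)%N -> (N <= n)%N ->
  q w (lin 1 (u m) (-1) (u n)) (lin 1 (u m) (-1) (u n)) <= e) ->
 exists f, [/\ VD w f, forall x, 0 <= f x &
  q w (lin 1 (u n) (-1) f) (lin 1 (u n) (-1) f) @[n --> \oo] --> 0].
Proof.
move=> hw Vu u0 cau; have [mw c0 wc we] := hw.
pose U n x := sw w x * u n x.
have U2 n : sqint (U n) := VD_sw (Vu n).
have sqU g h : sqdist (fun x => sw w x * g x) (fun x => sw w x * h x) =
  q w (lin 1 g (-1) h) (lin 1 g (-1) h) by rewrite qdef; apply: eq_Int => x; ring.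
have [|F [F2 cF [s _ sF]]] := @sq_complete _ _ _ mu U U2.
 by move=> e /cau[N hN]; exists N => m n Nm Nn; rewrite sqU; exact: hN.
have sg x := sw_gt0 x hw.
(* The absolute value changes [F] on a null set only and makes [f] nonnegative at every point. *)
pose f x := (sw w x)^-1 * `|F x|.
have mf : measR f.
 apply: mfunM.
  by apply: mfunC; [exact: measR_inv|exact: sw_meas].
 by apply: mfunC => //; exact: (sqint_meas F2).
have F0 : {ae mu, forall x, 0 <= F x}.
 apply: filterS sF => x sx; rewrite -(cvg_lim _ sx)//; apply: limr_ge.
  by apply/cvg_ex; exists (F x).
 by apply: nearW => n; rewrite mulr_ge0 ?(ltW (sg x)).
have swe x : sw w (- x) = sw w x by rewrite /sw we.
have Fe : {ae mu, forall x, F (- x) = F x}.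
 have ue : {ae mu, forall x, forall n, u n (- x) = u n x}.
  by apply: ae_foralln => n; exact: (VD_even (Vu n)).
 apply: filterS3 sF (ae_opp sF) ue => x s1 s2 e; apply: cvgn_uniq s2 s1 _ => n.
 by rewrite /U swe e.
have Fp : {ae mu, forall x, F x = sw w x * f x}.
 by apply: filterS F0 => x Fx; rewrite /f mulVKf ?gt_eqF// ger0_norm.
have Vf : VD w f.
 apply: (VDP hw) => //.
  by apply: filterS Fe => x e; rewrite /f swe e.
 apply: ae_sqint F2 => //; apply: mfunM => //; exact: sw_meas.
exists f; split=> //.
 by move=> x; rewrite mulr_ge0 ?invr_ge0 ?(ltW (sg x)).
move: cF; apply: cvg_trans; apply: near_eq_cvg; near=> n.
rewrite -sqU; have mU := sqint_meas (U2 n); have mF := sqint_meas F2.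
have mf' := sqint_meas (VD_sw Vf).
by apply: ae_ip; try exact: measurable_funB; apply: filterS Fp => x ->.
Unshelve. all: by end_near. Qed.

(** * The variational problem and its Euler-Lagrange equation *)

Definition cubic_max w (M : R) : Prop := forall g, VD w g -> T3 g <= M * (q w g g * Num.sqrt (q w g g)).

Lemma poly_zero (t L : R) : (forall e, 0 < e <= 1 -> e * t <= e ^+ 2 * L) -> t <= 0.
Proof.
move=> h; rewrite leNgt; apply/negP => t0.
have L0 : 0 < `|L| + t + 1 by have := normr_ge0 L; lra.
pose e := t / (`|L| + t + 1).
have e0 : 0 < e by rewrite divr_gt0.
have e1 : e <= 1 by rewrite ler_pdivrMr// mul1r; have := normr_ge0 L; lra.
have := h e; rewrite e0 e1 => /(_ isT); rewrite expr2 -mulrA ler_pM2l// => tl.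
have : e * L <= e * `|L| by rewrite ler_pM2l// ler_norm.
have : e * (`|L| + t + 1) = t by rewrite /e divfK// gt_eqF.
have := mulr_gt0 e0 t0; move: tl; move: (e * L) => X; rewrite !mulrDr mulr1; lra.
Qed.

Lemma sqrt1D_le (y : R) : 0 <= y -> (1 + y) * Num.sqrt (1 + y) <= 1 + 2 * y + y ^+ 2.
Proof.
move=> y0; have -> : 1 + 2 * y + y ^+ 2 = (1 + y) * (1 + y) by ring.
rewrite ler_pM2l; last by lra.
rewrite -[leRHS]ger0_norm; last by lra.
by rewrite -sqrtr_sqr ler_wsqrtr//; nra.
Qed.

(** In a direction orthogonal to [u] the quadratic form grows only at second order, so the
    first-order term of the cubic form must be nonpositive, and for the opposite direction too. A
    general direction is reduced to this case by subtracting its component along [u]. *)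
Lemma euler_lagrange_weak w M u : cubic_max w M -> 0 <= M -> VD w u -> q w u u = 1 -> T3 u = M ->
 forall d, VD w d -> T u u d = M * q w u d.
Proof.
move=> hM M0 Vu qu Tu.
have half d : VD w d -> q w u d = 0 -> T u u d <= 0.
 move=> Vd ud.
 suff : 3 * T u u d <= 0 by lra.
 apply: (@poly_zero _ (M * (2 * q w d d + q w d d ^+ 2) + 3 * `|T u d d| + `|T3 d|)) => e /andP[e0 e1].
 have Vl := VD_lin 1 e Vu Vd.
 have := hM _ Vl; rewrite T_comb; [|exact: VD_V1 Vu|exact: VD_even Vu|exact: VD_V1 Vd|exact: VD_even Vd].
 have -> : q w (lin 1 u e d) (lin 1 u e d) = 1 + e ^+ 2 * q w d d by rewrite q_comb// qu ud; ring.
 rewrite Tu; have y0 := q_ge0 w d; set y := q w d d in y0 *.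
 have ey0 : 0 <= e ^+ 2 * y by rewrite mulr_ge0// sqr_ge0.
 have := ler_wpM2l M0 (sqrt1D_le ey0).
 move: (_ * Num.sqrt _) => S hS.
 have := ler_norm (- T u d d); have := ler_norm (- T3 d); rewrite !normrN.
 have := normr_ge0 (T u d d); have := normr_ge0 (T3 d).
 move: (T u u d) (T u d d) (T3 d) `|T u d d| `|T3 d| => t t2 t3 n2 n3 p3 p2 h3 h2 hT.
 have ee : 0 < e ^+ 2 by rewrite exprn_gt0.
 have a1 : e ^+ 2 * - t2 <= e ^+ 2 * n2 by rewrite ler_pM2l.
 have a2 : e ^+ 3 * - t3 <= e ^+ 2 * n3.
  apply: le_trans (_ : e ^+ 3 * n3 <= _); first by rewrite ler_pM2l// exprn_gt0.
  by rewrite ler_wpM2r// (exprS e 2) ler_piMl// ltW.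
 have a3 : (e ^+ 2 * y) ^+ 2 <= e ^+ 2 * y ^+ 2.
  rewrite exprMn ler_wpM2r ?sqr_ge0// [leLHS]expr2 ler_piMl ?(ltW ee)//.
  by rewrite expr_le1// ltW.
 have a4 := ler_wpM2l M0 a3.
 by move: hT hS a1 a2 a4; nra.
move=> d Vd; pose k := q w u d; pose d' := lin 1 d (- k) u.
have Vd' : VD w d' by exact: VD_lin.
have ud' : q w u d' = 0 by rewrite q_linr// qu -/k; ring.
have Vn : VD w (lin (-1) d' 0 d') by exact: VD_lin.
have un : q w u (lin (-1) d' 0 d') = 0 by rewrite q_linr// ud'; ring.
have := half _ Vd' ud'; have := half _ Vn un.
have su := VD_sq Vu; have vu := VD_V1 Vu; have vd := VD_V1 Vd; have vd' := VD_V1 Vd'.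
rewrite (T_lin3 _ _ su vd' vd' vu) /d' (T_lin3 _ _ su vd vu vu).
by rewrite -[T u u u]/(T3 u) Tu /k; move: (T u u d) (q w u d) => t s; lra.
Qed.

(** Although [u] is even only almost everywhere, the identity holds at every point, because the
    correlation is a multiple of the transform of an integrable almost everywhere even function. *)
Lemma corr_even u x : sqint u -> aeven u -> corr u u (- x) = corr u u x.
Proof.
move=> u2 ue; have h y := hint_Ht_mul y u2 ue u2 ue.
have P1 : rint (fun y => Ht u y * Ht u y) by apply: sqint_mul; exact: Ht_sq.
have Pe : aeven (fun y => Ht u y * Ht u y).
 by apply: filterS (aeven_Ht u2 ue) => y ->.
apply: (mulfI (lt0r_neq0 hc_gt0)).
by rewrite -(h (- x)) -(h x) hint_even.
Qed.

(** [z] represents the functional [T u u] for the inner product [q w]; it lies in the form domain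
    since [w] is bounded below. The weak equation then says that [z - M u] is orthogonal to
    itself. *)
Lemma euler_lagrange w c M u : weight w c -> cubic_max w M -> 0 <= M -> VD w u ->
 q w u u = 1 -> T3 u = M -> {ae mu, forall x, hc * corr u u x = M * (w x * u x)}.
Proof.
move=> hw hM M0 Vu qu Tu; have EL := euler_lagrange_weak hM M0 Vu qu Tu.
have [mw c0 wc we] := hw.
pose k x := hc * corr u u x; pose z x := (w x)^-1 * k x.
have vu := VD_V1 Vu; have su := VD_sq Vu; have ue := VD_even Vu.
have k2 : sqint k by apply: sqintZ; exact: corr_sqint.
have w0 x := weight_gt0 x hw.
have mi : measR (fun x => (w x)^-1) by apply: mfunC; [exact: measR_inv|].
have mz : measR z by apply: mfunM => //; exact: (sqint_meas k2).
have Vz : VD w z.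
 apply: (VDP hw) => //.
  by apply: aeW => x; rewrite /z /k we corr_even.
 apply: (@sqint_le _ _ _ mu _ (fun x => (Num.sqrt c)^-1 * k x)).
 - by apply: mfunM => //; exact: sw_meas.
 - exact: sqintZ.
 - move=> x; rewrite /z (mulrA (sw w x)) [leLHS]normrM [leRHS]normrM ler_wpM2r//.
  have s0 := sw_gt0 x hw; rewrite -(sw_sq _ hw) expr2 invfM mulVKf ?gt_eqF//.
  rewrite !gtr0_norm ?invr_gt0 ?sqrtr_gt0// lef_pV2 ?posrE ?sqrtr_gt0//.
  by rewrite ler_wsqrtr//; apply: le_trans (wc x); rewrite ler_peMr ?(ltW c0)// lerDl.
have qz d : VD w d -> q w z d = T u u d.
 move=> Vd; rewrite (qE _ _ hw).
 have -> : T u u d = T d u u.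
  have Vd' := VD_V1 Vd; have de := VD_even Vd.
  by rewrite (T_swap23 su vu ue Vd' de); exact: (T_swap12 vu ue Vd' de vu ue).
 have -> : T d u u = ip d k by rewrite Tdef -ipZr//; [exact: corr_sqint|exact: VD_sq Vd].
 apply: eq_Int => x; rewrite /z mulVKf ?gt_eqF//; exact: mulrC.
pose d := lin 1 z (- M) u.
have Vd : VD w d by exact: VD_lin.
have : q w d d = 0.
 by rewrite /d (q_linl _ _ Vz Vu Vd) (qz _ Vd) (EL _ Vd) mul1r mulNr subrr.
move=> /(q_eq0 hw Vd); apply: filterS => x; rewrite /d mul1r mulNr => /eqP.
rewrite subr_eq0 => /eqP zx; rewrite -/(k x) mulrCA -zx /z mulVKf// gt_eqF//.
Qed.

(** * Stability of almost maximizers and existence of maximizers *)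

Section local_maximizer.
Implicit Types (s : R).

Lemma q_norm2 w f g : VD w f -> VD w g ->
 q w (lin 1 f (-1) g) (lin 1 f (-1) g) = q w f f - 2 * q w f g + q w g g.
Proof. by move=> Vf Vg; rewrite q_comb//; ring. Qed.

(** The supremum over the unit ball extends to all functions by homogeneity. An almost maximizer is
    replaced by its absolute value and scaled up to the unit sphere; neither operation lowers the
    cubic form. *)
Lemma cubic_sup w c Mb g0 : weight w c -> (forall g, VD w g -> q w g g <= 1 -> T3 g <= Mb) ->
 VD w g0 -> q w g0 g0 <= 1 -> 0 < T3 g0 ->
 exists M, [/\ 0 < M, M <= Mb, cubic_max w M & forall e, 0 < e ->
  exists v, [/\ VD w v, forall x, 0 <= v x, q w v v = 1 & M - e <= T3 v]].
Proof.
move=> hw bd V0 q0 T0.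
pose A := [set t : R | exists g, [/\ VD w g, q w g g <= 1 & T3 g = t]].
have hA : has_sup A.
 split; first by exists (T3 g0); exists g0.
 by exists Mb => _ [g [Vg qg <-]]; exact: bd.
have ub t : A t -> t <= sup A by move=> At; exact: (sup_upper_bound hA).
have M0 : 0 < sup A by apply: lt_le_trans T0 (ub _ _); exists g0.
have max : cubic_max w (sup A).
 move=> g Vg; have qg := q_ge0 w g.
 have [q0'|qp] := eqVneq (q w g g) 0.
  rewrite q0' mul0r mulr0; have := T_le hw Vg Vg Vg.
  by rewrite q0' sqrtr0 !mulr0 => /(le_trans (ler_norm _)).
 have {}qp : 0 < q w g g by rewrite lt_neqAle eq_sym qp.
 pose r := (Num.sqrt (q w g g))^-1; have sp : 0 < Num.sqrt (q w g g) by rewrite sqrtr_gt0.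
 have := ub (T3 (lin r g 0 g)).
 rewrite T3_scale; [|exact: VD_V1 Vg|exact: VD_even Vg] => /(_ _)/wrap[].
  exists (lin r g 0 g); split; first exact: VD_lin.
   by rewrite q_scale// /r exprVn sqr_sqrtr// mulVf ?gt_eqF.
  by rewrite T3_scale//; [exact: VD_V1 Vg|exact: VD_even Vg].
 rewrite /r exprVn ler_pdivrMl ?exprn_gt0// => /le_trans; apply.
 by rewrite exprSr sqr_sqrtr// mulrC.
exists (sup A); split=> //; first by apply: sup_le_ub => [|_ [g [Vg qg <-]]]; [exact: (proj1 hA)|exact: bd].
(* Capping the error at half the supremum keeps [T3 g] positive, so that [g] can be normalized. *)
move=> e e0; pose e' := Order.min e (sup A / 2).
have e'0 : 0 < e' by rewrite lt_min e0 divr_gt0.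
have [_ [g [Vg qg <-]] lt] := sup_adherent e'0 hA.
have [ee es] : e' <= e /\ e' <= sup A / 2 by split; rewrite ge_min lexx ?orbT.
have [Tg Tge] : 0 < T3 g /\ sup A - e <= T3 g.
 move: lt ee es M0; clear; clearbody e'; move: (T3 g) (sup A) => t S; clear; split; lra.
have [Vn qn] := VD_norm Vg; have Tn := T3_norm (VD_V1 Vg).
have qp : 0 < q w g g.
 rewrite lt_neqAle q_ge0 andbT eq_sym; apply/eqP => z; have := max _ Vg.
 by rewrite z mul0r mulr0 leNgt Tg.
pose r := (Num.sqrt (q w g g))^-1; have sp : 0 < Num.sqrt (q w g g) by rewrite sqrtr_gt0.
have r1 : 1 <= r.
 rewrite /r invf_ge1// -sqrtr1 ler_wsqrtr//.
exists (lin r (fun x => `|g x|) 0 (fun x => `|g x|)); split; first exact: VD_lin.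
- by move=> x; rewrite mul0r addr0 mulr_ge0// (le_trans ler01).
- by rewrite q_scale// qn /r exprVn sqr_sqrtr ?ltW// mulVf ?gt_eqF.
rewrite T3_scale; [|exact: VD_V1 Vn|exact: VD_even Vn].
apply: le_trans Tge (le_trans Tn _).
by rewrite ler_peMl ?exprn_ege1// (le_trans (ltW Tg) Tn).
Qed.

Lemma sqrt1B_le x : 0 <= x -> 0 <= 1 - x -> (1 - x) * Num.sqrt (1 - x) <= 1 - 3 * x / 2 + x ^+ 2 / 2.
Proof.
move=> x0 x1; have -> : 1 - 3 * x / 2 + x ^+ 2 / 2 = (1 - x) * (1 - x / 2) by field.
apply: ler_wpM2l => //; have h : 0 <= 1 - x / 2 by lra.
rewrite -(ger0_norm h) -sqrtr_sqr; apply: ler_wsqrtr.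
have -> : (1 - x / 2) ^+ 2 = 1 - x + (x / 2) ^+ 2 by field.
by rewrite lerDl sqr_ge0.
Qed.

(** With [d] the half difference and [m] the midpoint, the terms odd in [d] cancel in
    [T3 (m + d) + T3 (m - d)]. Since [q w m m = 1 - q w d d], the bound [M (1 - x)^(3/2)] on [T3 m],
    with [x = q w d d], turns two small deficits into an inequality for [T m d d]. *)
Lemma midpoint w M e u v : cubic_max w M -> 0 <= M -> VD w u -> VD w v ->
 q w u u = 1 -> q w v v = 1 -> M - e <= T3 u -> M - e <= T3 v ->
 let d := lin 2^-1 u (- 2^-1) v in let m := lin 2^-1 u 2^-1 v in
 [/\ q w m d = 0, q w m m = 1 - q w d d, q w (lin 1 u (-1) v) (lin 1 u (-1) v) = 4 * q w d d &
 3 * (M * q w d d - 2 * T m d d) <= 2 * e + M * q w d d ^+ 2].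
Proof.
move=> hM M0 Vu Vv qu qv Tu Tv d m.
have Vd : VD w d by exact: VD_lin.
have Vm : VD w m by exact: VD_lin.
have e1 : q w m d = 0.
 by rewrite /m q_linl// /d !q_linr// qu qv (qC w v u); ring.
have e2 : q w m m = 1 - q w d d by rewrite /m /d !q_comb// qu qv; field.
split=> //; first by rewrite /d !q_comb// qu qv; field.
have Eu : T3 u = T3 (lin 1 m 1 d) by congr T3; apply/funext => x; rewrite /m /d; field.
have Ev : T3 v = T3 (lin 1 m (-1) d) by congr T3; apply/funext => x; rewrite /m /d; field.
have Tc s := T_comb 1 s (VD_V1 Vm) (VD_even Vm) (VD_V1 Vd) (VD_even Vd).
move: Tu Tv; rewrite Eu Ev (Tc 1) (Tc (-1)).
have := hM _ Vm; rewrite e2; clearbody m d.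
have x0 := q_ge0 w d; have x1 : 0 <= 1 - q w d d by rewrite -e2; exact: q_ge0.
move: (ler_wpM2l M0 (sqrt1B_le x0 x1)).
move: (q w d d) (T3 m) (T m m d) (T m d d) (T3 d) => x t0 t1 t2 t3; clear.
move: (_ * Num.sqrt _) => S hS hT Tu Tv.
have : M * (1 - 3 * x / 2 + x ^+ 2 / 2) = M - 3 / 2 * (M * x) + M * x ^+ 2 / 2 by field.
move: hS; move: (M * (1 - 3 * x / 2 + x ^+ 2 / 2)) (M * x ^+ 2) (M * x) => X Y Z hS E.
lra.
Qed.

(** What is needed of an explicit profile. [base_S1]: nonnegative almost maximizers nearly coincide
    with it. [base_S2]: expanding [M0 q^(3/2) - T3] at [Q0], the second variation in a direction
    orthogonal to [Q0] is a multiple of [M0 * q w0 d d - 2 * T Q0 d d]; it stays coercive modulo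
    that direction. *)
Record base w0 c0 Q0 (M0 : R) : Prop := Base {
 base_w : weight w0 c0;
 base_V : VD w0 Q0;
 base_q : q w0 Q0 Q0 = 1;
 base_T : T3 Q0 = M0;
 base_M : 0 < M0;
 base_S1 : forall e, 0 < e -> exists2 d, 0 < d & forall g, VD w0 g -> (forall x, 0 <= g x) ->
  q w0 g g <= 1 -> M0 - d <= T3 g -> 1 - e <= q w0 g Q0;
 base_S2 : exists c C, 0 < c /\ forall d, VD w0 d ->
  2 * T Q0 d d <= (M0 - c) * q w0 d d + C * q w0 Q0 d ^+ 2 }.

(** A one-sided notion of closeness. [close_cross] covers two situations: a perturbation small
    relative to [w0] fits its term in [s], and a perturbation [w >= w0] of any size fits its first
    term, since the difference of the forms is then itself a nonnegative form. Smallness from above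
    is required at [Q0] only. *)
Record near_base w0 Q0 w s : Prop := Close {
 close_sub : forall g, VD w g -> VD w0 g;
 close_Q : VD w Q0;
 close_low : forall g, VD w g -> (1 - s) * q w0 g g <= q w g g;
 close_cross : forall m d, VD w m -> VD w d ->
  (q w0 m d - q w m d) ^+ 2 <= (`|q w m m - q w0 m m| + s * q w0 m m) * q w d d;
 close_up : q w Q0 Q0 <= 1 + s }.

(** Carries the quadratic control of the distance by the deficit; being restricted to nonnegative
    competitors, it says nothing by itself about maximizers that change sign. *)
Record maximizer w c1 M u : Prop := Maximizer {
 mx_V : VD w u;
 mx_ge0 : forall x, 0 <= u x;
 mx_q : q w u u = 1;
 mx_T : T3 u = M;
 mx_M : 0 < M;
 mx_max : cubic_max w M;
 mx_stab : forall v, VD w v -> (forall x, 0 <= v x) -> q w v v = 1 ->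
  c1 * q w (lin 1 u (-1) v) (lin 1 u (-1) v) <= M - T3 v }.

(* A quantitative stability estimate makes maximizing sequences Cauchy. *)
Lemma maximizer_of_stability w c M k dl : weight w c -> 0 < M -> cubic_max w M ->
 (forall e, 0 < e -> exists v, [/\ VD w v, forall x, 0 <= v x, q w v v = 1 & M - e <= T3 v]) ->
 0 < k -> 0 < dl ->
 (forall e u v, e <= dl -> VD w u -> VD w v -> (forall x, 0 <= u x) -> (forall x, 0 <= v x) ->
  q w u u = 1 -> q w v v = 1 -> M - e <= T3 u -> M - e <= T3 v ->
  k * q w (lin 1 u (-1) v) (lin 1 u (-1) v) <= e) ->
 exists u, maximizer w (Order.min k (dl / 4)) M u.
Proof.
move=> hw M0 hM seq k0 dl0 stab.
have [v hv] := choice (fun n : nat => seq n.+1%:R^-1 (ltac:(by rewrite invr_gt0))).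
have Vv n : VD w (v n) by case: (hv n).
have v0 n x : 0 <= v n x by case: (hv n).
have qv n : q w (v n) (v n) = 1 by case: (hv n).
have Tv n : M - n.+1%:R^-1 <= T3 (v n) by case: (hv n).
have inv_small e : 0 < e -> exists N, forall n, (N <= n)%N -> n.+1%:R^-1 <= e :> R.
 move=> e0; have /cvgrPdist_le/(_ _ e0) [N _ hN] := @cvg_harmonic R.
 by exists N => n /hN; rewrite /= sub0r normrN ger0_norm// /harmonic invr_ge0.
have [u [Vu u0 cu]] : exists u, [/\ VD w u, forall x, 0 <= u x &
  q w (lin 1 (v n) (-1) u) (lin 1 (v n) (-1) u) @[n --> \oo] --> 0].
 apply: (VD_complete hw) => // e e0.
 have ke : 0 < Order.min dl (k * e) by rewrite lt_min dl0 mulr_gt0.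
 have [N hN] := inv_small _ ke; exists N => m n Nm Nn.
 have le1 : Order.min dl (k * e) <= dl by rewrite ge_min lexx.
 have le2 : Order.min dl (k * e) <= k * e by rewrite ge_min lexx orbT.
 rewrite -(ler_pM2l k0); apply: le_trans le2.
 apply: stab => //; [have := Tv m; have := hN _ Nm|have := Tv n; have := hN _ Nn];
  move: (_^-1) (Order.min _ _) => *; lra.
have [_ cq] := q_cvg Vv Vu Vu cu.
have qu : q w u u = 1.
 by apply: (@cvgn_uniq _ (fun=> 1) _ _ cq) => [|n]; [exact: cvg_cst|rewrite qv].
have cT := T3_cvg hw Vv Vu cu.
have Tle : T3 u <= M by have := hM _ Vu; rewrite qu sqrtr1 !mulr1.
have Tu : T3 u = M.
 apply/eqP; rewrite eq_le Tle/= leNgt; apply/negP => lt.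
 have h0 : 0 < (M - T3 u) / 2 by rewrite divr_gt0// subr_gt0.
 have [N1 hN1] := inv_small _ (divr_gt0 h0 (ltr0n _ 2)).
 have /cvgrPdist_le/(_ _ (divr_gt0 h0 (ltr0n _ 2))) [N2 _ hN2] := cT.
 have := hN1 _ (leq_maxl N1 N2); have := hN2 _ (leq_maxr N1 N2); have := Tv (maxn N1 N2).
 rewrite ler_norml; move: (_^-1) => z h1 /andP[h2 _] h3; lra.
exists u; split=> // g Vg g0 qg.
have Tg : T3 g <= M by have := hM _ Vg; rewrite qg sqrtr1 !mulr1.
have [small|big] := leP (M - T3 g) dl.
 have := stab (M - T3 g) u g small Vu Vg u0 g0 qu qg.
 rewrite Tu subKr => /(_ Tg (lexx _)).
 by apply: le_trans; rewrite ler_wpM2r ?q_ge0// ge_min lexx.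
apply: le_trans (ltW big).
have q4 : q w (lin 1 u (-1) g) (lin 1 u (-1) g) <= 4.
 have := q_ge0 w (lin 1 u 1 g); rewrite !q_comb// qu qg; lra.
apply: le_trans (ler_wpM2l _ q4) _; first by rewrite le_min (ltW k0) divr_ge0// ltW.
apply: le_trans (_ : dl / 4 * 4 <= _); last by rewrite divfK.
by rewrite ler_wpM2r// ge_min lexx orbT.
Qed.

(* [x] is the energy of the half difference of two almost maximizers. *)
Lemma coercivity_num (M M0 c C B k s x p p0 y z t1 t2 : R) :
 0 < M0 -> 0 < c -> c <= M0 -> 0 <= C -> 0 <= B ->
 0 < k -> k <= 4^-1 -> k * (2 * M0 + 22 * C + 24 * B + c) <= c / 4 -> 0 <= s -> s <= k ^+ 2 / 4 ->
 M0 * (1 - 2 * s) <= M -> M <= 4 * B -> 0 <= x -> x <= 3 * k ^+ 2 ->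
 0 <= p -> (1 - s) * p <= x -> p0 <= 22 * k ^+ 2 * x -> 0 <= z -> z <= 2 * k ->
 2 * t1 <= (M0 - c) * p + C * p0 -> t2 <= B * z * p ->
 c / 2 * x <= M * x - 2 * (t1 + t2) /\ M * x <= c / 2.
Proof.
move=> M00 c0 cM C0 B0 k0 k4 kL s0 sk MM MB x0 xk p0' px hp0 z0 zk h1 h2.
have kk : k ^+ 2 <= k / 4 by rewrite expr2; nra.
have p2 : p <= (1 + 2 * s) * x.
 have : (1 + 2 * s) * ((1 - s) * p) <= (1 + 2 * s) * x by rewrite ler_pM2l//; lra.
 apply: le_trans; rewrite mulrA ler_peMl//; nra.
have px2 : p <= 2 * x by apply: le_trans p2 _; rewrite ler_wpM2r//; nra.
have a1 : (M0 - c) * p <= (M0 - c) * ((1 + 2 * s) * x) by rewrite ler_wpM2l// subr_ge0.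
have a2 : C * p0 <= C * (22 * k ^+ 2 * x) by rewrite ler_wpM2l.
have a3 : B * z * p <= B * (2 * k) * (2 * x).
 by apply: ler_pM => //; [exact: mulr_ge0|exact: ler_wpM2l].
have a4 : M0 * (1 - 2 * s) * x <= M * x by rewrite ler_wpM2r.
have a5 : s * x <= k / 4 * x by rewrite ler_wpM2r//; lra.
have a6 : C * (22 * k ^+ 2 * x) <= C * (22 * k * x).
 by rewrite ler_wpM2l// ler_wpM2r//; lra.
have a7 : (M0 - c) * (s * x) <= M0 * (k / 4 * x).
 by apply: le_trans (_ : M0 * (s * x) <= _); [rewrite ler_wpM2r ?mulr_ge0//; lra|rewrite ler_pM2l].
have a8 : M0 * (s * x) <= M0 * (k / 4 * x) by rewrite ler_pM2l.
have kLx : k * (2 * M0 + 22 * C + 24 * B + c) * x <= c / 4 * x by rewrite ler_wpM2r.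
split.
 have b1 : M0 * (1 - 2 * s) * x = M0 * x - 2 * (M0 * (s * x)) by ring.
 have b2 : (M0 - c) * ((1 + 2 * s) * x) = M0 * x - c * x + 2 * ((M0 - c) * (s * x)) by ring.
 have b3 : k * (2 * M0 + 22 * C + 24 * B + c) * x =
  8 * (M0 * (k / 4 * x)) + C * (22 * k * x) + 6 * (B * (2 * k) * (2 * x)) + k * (c * x) by field.
 have b4 : 0 <= k * (c * x) by rewrite !mulr_ge0// ltW.
 have b5 : 0 <= M0 * (k / 4 * x) by rewrite !mulr_ge0 ?invr_ge0// ltW.
 have b6 : 0 <= C * (22 * k * x) by rewrite !mulr_ge0// ltW.
 have b7 : 0 <= B * (2 * k) * (2 * x) by rewrite !mulr_ge0// ltW.
 have b8 : 0 <= c * x by rewrite mulr_ge0// ltW.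
 move: a1 a2 a3 a4 a6 a7 a8 kLx; rewrite b1 b2 b3.
 move: b4 b5 b6 b7 b8.
 move: (k * (c * x)) (M0 * (k / 4 * x)) (C * (22 * k * x)) (B * (2 * k) * (2 * x)) => X1 X2 X3 X4.
 move: (C * (22 * k ^+ 2 * x)) ((M0 - c) * (s * x)) (M0 * (s * x)) (M * x) (M0 * x) => X5 X6 X7 X8 X9.
 have -> : c / 4 * x = (c * x) / 4 by field.
 have -> : c / 2 * x = (c * x) / 2 by field.
 move: (c * x) h1 h2 => X10; move: (C * p0) (B * z * p) ((M0 - c) * p) => Y1 Y2 Y3; clear.
 lra.
have d1 : M * x <= 4 * B * (3 * k ^+ 2).
 apply: le_trans (_ : 4 * B * x <= _); first by rewrite ler_wpM2r.
 by rewrite ler_wpM2l// mulr_ge0.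
have d2 : 4 * B * (3 * k ^+ 2) <= 3 * (B * k).
 have -> : 4 * B * (3 * k ^+ 2) = 12 * (B * k ^+ 2) by ring.
 by have := ler_wpM2l B0 kk; lra.
have d3 : 0 <= B * k by rewrite mulr_ge0// ltW.
have d4 : 0 <= k * M0 by rewrite mulr_ge0// ltW.
have d5 : 0 <= k * C by rewrite mulr_ge0// ltW.
have d6 : 0 <= k * c by rewrite mulr_ge0// ltW.
have d7 : k * (2 * M0 + 22 * C + 24 * B + c) = 2 * (k * M0) + 22 * (k * C) + 24 * (B * k) + k * c by ring.
by move: kL; rewrite d7; lra.
Qed.

Lemma upper_num (s y : R) : 0 < s -> s <= 64^-1 -> 0 <= y -> (1 - s) * y <= 1 -> y <= 1 + 2 * s.
Proof. by move=> *; nra. Qed.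

Lemma sup_lower_num (s M0 M : R) : 0 < s -> s <= 64^-1 -> 0 <= M -> M0 <= M * (1 + s) ^+ 2 ->
 M0 * (1 - 2 * s) <= M.
Proof.
move=> s0 s1 M_0 h.
have s2 : 0 <= 1 - 2 * s by lra.
apply: le_trans (ler_wpM2r s2 h) _; rewrite -mulrA ler_piMr//.
have := exprn_ge0 3 (ltW s0); have := sqr_ge0 s.
have -> : (1 + s) ^+ 2 * (1 - 2 * s) = 1 - 3 * s ^+ 2 - 2 * s ^+ 3 by ring.
lra.
Qed.

Lemma almost_max_num (s M0 M dl : R) : 0 < s -> s <= 64^-1 -> 0 < M0 -> 0 < dl -> dl <= M0 ->
 M0 * s <= dl / 8 -> M0 * (1 - 2 * s) <= M ->
 0 <= M - dl / 2 /\ M0 - dl <= (1 - s) ^+ 2 * (M - dl / 2).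
Proof.
move=> s0 s1 M00 dl0 dlM sd MM; split; first by lra.
have a1 : M0 * (1 - 2 * s) - dl / 2 <= M - dl / 2 by lra.
apply: le_trans (ler_wpM2l (sqr_ge0 _) a1).
apply: (@le_trans _ _ (M0 * (1 - 4 * s) - dl / 2)); first by lra.
have b1 : (1 - s) ^+ 2 <= 1 by rewrite expr_le1//; lra.
have b2 : (1 - s) ^+ 2 * (dl / 2) <= dl / 2 by rewrite ler_piMl// divr_ge0// ltW.
have b3 : M0 * (1 - 4 * s) <= (1 - s) ^+ 2 * (M0 * (1 - 2 * s)).
 have -> : (1 - s) ^+ 2 * (M0 * (1 - 2 * s)) = M0 * ((1 - s) ^+ 2 * (1 - 2 * s)) by ring.
 rewrite ler_pM2l//.
 have -> : (1 - s) ^+ 2 * (1 - 2 * s) = 1 - 4 * s + s ^+ 2 * (5 - 2 * s) by ring.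
 by rewrite lerDl mulr_ge0 ?sqr_ge0//; lra.
by rewrite mulrBr; lra.
Qed.

(** Here [x] is the perturbed energy of the half difference, [mm] and [m0] are the perturbed and
    base energies of the midpoint, [mQ] its overlap with the profile, and [a] the base product of
    midpoint and half difference. A large overlap forces [m0] near 1, hence [x] small and [a] almost
    zero. *)
Lemma geometry_num (s k x m0 mm mQ a : R) : 0 < s -> s <= k ^+ 2 / 4 -> k ^+ 2 <= 16^-1 ->
 0 <= x -> mm = 1 - x -> 1 - k ^+ 2 <= mQ -> mQ ^+ 2 <= m0 -> (1 - s) * m0 <= mm ->
 a ^+ 2 <= (`|mm - m0| + s * m0) * x ->
 [/\ x <= 3 * k ^+ 2, m0 <= 1 + 2 * s & a ^+ 2 <= 5 * k ^+ 2 * x].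
Proof.
move=> s0 sk kk x0 e hQ cs low hA.
have k0 := sqr_ge0 k.
have m0' : 0 <= m0 := le_trans (sqr_ge0 _) cs.
have mle : m0 <= 1 + 2 * s by apply: upper_num => //; lra.
have mge : 1 - 2 * k ^+ 2 <= m0.
 apply: le_trans cs; apply: le_trans (_ : (1 - k ^+ 2) ^+ 2 <= _).
  have -> : (1 - k ^+ 2) ^+ 2 = 1 - 2 * k ^+ 2 + (k ^+ 2) ^+ 2 by ring.
  by rewrite lerDl sqr_ge0.
 by rewrite lerXn2r ?nnegrE//; lra.
have sm : s * m0 <= 2 * s by rewrite mulrC ler_wpM2r ?(ltW s0)//; lra.
have xk : x <= 3 * k ^+ 2 by lra.
split=> //; apply: le_trans hA _; rewrite ler_wpM2r//.
have : `|mm - m0| <= 4 * k ^+ 2 by rewrite ler_norml; apply/andP; split; lra.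
lra.
Qed.

(** [a - b] stands for the product of the profile with the half difference, [a] coming from the
    midpoint and [b] from the small gap between midpoint and profile. *)
Lemma cross_num (s k a b x p y : R) : 0 < s -> s <= 64^-1 -> 0 <= x -> a ^+ 2 <= 5 * k ^+ 2 * x ->
 0 <= p -> (1 - s) * p <= x -> 0 <= y -> y <= 3 * k ^+ 2 -> b ^+ 2 <= y * p ->
 (a - b) ^+ 2 <= 22 * k ^+ 2 * x.
Proof.
move=> s0 s1 x0 ab p0 px y0 y3 hb.
have p2 : p <= 2 * x by nra.
have y4 : y * p <= 3 * k ^+ 2 * (2 * x) by apply: ler_pM.
have k0 : 0 <= k ^+ 2 * x by rewrite mulr_ge0 ?sqr_ge0.
have : (a - b) ^+ 2 <= 2 * a ^+ 2 + 2 * b ^+ 2.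
 by have := sqr_ge0 (a + b); rewrite sqrrB sqrrD; lra.
lra.
Qed.

(** Almost maximizers for [w] are, after a slight rescaling, almost maximizers for [w0], so they
    overlap strongly with [Q0]. Their midpoint is then close to [Q0] and their half difference
    almost orthogonal to it, so coercivity at [Q0] transfers to the midpoint inequality. *)
Lemma local_maximizer w0 c0 Q0 M0 : base w0 c0 Q0 M0 ->
 exists s c1, [/\ 0 < s, s <= 2^-1, 0 < c1 &
  forall w c, weight w c -> near_base w0 Q0 w s -> exists M u, maximizer w c1 M u].
Proof.
move=> [hw0 V0 q0 T0 M00 S1 [c' [C' [c'0 S2]]]].
pose c := Order.min c' M0; pose C := Order.max C' 0; pose B := TB c0.
have c_0 : 0 < c by rewrite lt_min c'0.
have [cc cM] : c <= c' /\ c <= M0 by rewrite !ge_min !lexx orbT.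
have [CC C0] : C' <= C /\ 0 <= C by rewrite !le_max !lexx orbT.
have B0 : 0 <= B := TB_ge0 c0.
have {}S2 d : VD w0 d -> 2 * T Q0 d d <= (M0 - c) * q w0 d d + C * q w0 Q0 d ^+ 2.
 move=> Vd; apply: le_trans (S2 d Vd) _; apply: lerD.
  by rewrite ler_wpM2r ?q_ge0// lerB.
 by rewrite ler_wpM2r ?sqr_ge0.
pose L := 2 * M0 + 22 * C + 24 * B + c.
have Lc : c <= L by rewrite /L; lra.
have L0 : 0 < L := lt_le_trans c_0 Lc.
(* [L] collects the coefficients of all errors of order [k] in [coercivity_num]; together they use
   at most [c / 4] of the gap. *)
pose k := c / (4 * L).
have k0 : 0 < k by rewrite divr_gt0// mulr_gt0.
have kL : k * L = c / 4 by rewrite /k; field; rewrite gt_eqF.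
have k4 : k <= 4^-1 by rewrite ler_pdivrMr ?mulr_gt0//; lra.
have k2 : 0 < k ^+ 2 by rewrite exprn_gt0.
have [dl0 dl0p hS1] := S1 _ k2.
pose dl := Order.min dl0 M0.
have dlp : 0 < dl by rewrite lt_min dl0p.
have [dle dlM] : dl <= dl0 /\ dl <= M0 by rewrite !ge_min !lexx orbT.
(* The first bound controls the change of the forms; the second keeps the change of the supremum
   within the deficit [dl] allowed by [base_S1]. *)
pose s := Order.min (k ^+ 2 / 4) (dl / (8 * M0)).
have sp : 0 < s by rewrite lt_min !divr_gt0// mulr_gt0.
have [sk sd] : s <= k ^+ 2 / 4 /\ s <= dl / (8 * M0) by rewrite !ge_min !lexx orbT.
have sd' : M0 * s <= dl / 8.
 have := ler_wpM2l (ltW M00) sd; rewrite (_ : M0 * (dl / (8 * M0)) = dl / 8)//.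
 by field; rewrite gt_eqF.
have kk : k ^+ 2 <= 16^-1 by rewrite expr2; nra.
have s8 : s <= 64^-1 by lra.
exists s, (Order.min (c / 8) (dl / 2 / 4)); split=> //; first by lra.
 by rewrite lt_min !divr_gt0.
move=> w cw hw [sub VQ low cross up].
have q02 g : VD w g -> q w g g <= 1 -> q w0 g g <= 1 + 2 * s.
 move=> Vg qg; have := le_trans (low _ Vg) qg; have := q_ge0 w0 g.
 exact: upper_num.
have bd g : VD w g -> q w g g <= 1 -> T3 g <= 4 * B.
 move=> Vg qg; have Vg0 := sub _ Vg.
 apply: le_trans (ler_norm _) (le_trans (T_le hw0 Vg0 Vg0 Vg0) _).
 rewrite -/B -expr2 sqr_sqrtr ?q_ge0// mulrC ler_wpM2r//.
 have y2 : q w0 g g <= 2 by apply: le_trans (q02 _ Vg qg) _; lra.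
 apply: le_trans (ler_pM (q_ge0 _ _) (sqrtr_ge0 _) y2 (_ : _ <= 2)) _; last by lra.
 rewrite -[leRHS]ger0_norm// -sqrtr_sqr ler_wsqrtr//.
 by apply: le_trans y2 _; rewrite expr2; lra.
have qQp : 0 < q w Q0 Q0 by apply: lt_le_trans (low _ VQ); rewrite q0; lra.
have [||M [M_0 MB hM seq]] := @cubic_sup w cw (4 * B) (lin (Num.sqrt (q w Q0 Q0))^-1 Q0 0 Q0) hw bd (VD_lin _ _ VQ VQ).
- by rewrite (q_scale _ VQ) exprVn (sqr_sqrtr (ltW qQp)) mulVf// gt_eqF.
- rewrite T3_scale; [|exact: VD_V1 VQ|exact: VD_even VQ].
 by rewrite T0 mulr_gt0// exprn_gt0// invr_gt0 sqrtr_gt0.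
have MM : M0 * (1 - 2 * s) <= M.
 have : M0 <= M * (1 + s) ^+ 2.
  rewrite -T0; apply: le_trans (hM _ VQ) _; rewrite ler_pM2l//.
  have s1 : 1 <= 1 + s by lra.
  apply: ler_pM => //; [exact: q_ge0|].
  rewrite -[leRHS]ger0_norm; last by lra.
  rewrite -sqrtr_sqr ler_wsqrtr//; apply: le_trans up _.
  by rewrite expr2 ler_peMl//; lra.
 exact: sup_lower_num (ltW M_0).
have [X0 X1] := almost_max_num sp s8 M00 dlp dlM sd' MM.
have near u : VD w u -> (forall x, 0 <= u x) -> q w u u = 1 -> M - dl / 2 <= T3 u ->
  1 - k ^+ 2 <= q w0 u Q0.
 move=> Vu u0 qu Tu.
 (* Scaling by [r] compensates the factor [1 - s] in [close_low] and puts [u] in the unit ball of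
    the base form. *)
 pose r := Num.sqrt (1 - s).
 have r2 : r ^+ 2 = 1 - s by rewrite sqr_sqrtr//; lra.
 have r0 : 0 <= r by exact: sqrtr_ge0.
 have r1 : r <= 1 by rewrite -(sqrtr1 R) ler_wsqrtr//; lra.
 have Vr := VD_lin r 0 Vu Vu.
 have h := hS1 (lin r u 0 u) (sub _ Vr) _ _ _.
 have {h} : 1 - k ^+ 2 <= q w0 (lin r u 0 u) Q0.
  apply: h.
  - by move=> x; rewrite mul0r addr0 mulr_ge0.
  - by rewrite (q_scale _ (sub _ Vu)) r2; apply: le_trans (low _ Vu) _; rewrite qu.
  rewrite T3_scale; [|exact: VD_V1 Vu|exact: VD_even Vu].
  have r3 : (1 - s) ^+ 2 <= r ^+ 3.
   rewrite (exprSr r 2) r2 expr2 ler_wpM2l//; first by rewrite -r2 sqr_ge0.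
   by rewrite -r2 expr2 ler_piMl.
  apply: le_trans (ler_pM (sqr_ge0 _) X0 r3 Tu).
  by apply: le_trans X1; rewrite lerB.
 rewrite (q_linl _ _ (sub _ Vu) (sub _ Vu) V0) mul0r addr0 => h.
 have q1 : 0 <= q w0 u Q0.
  rewrite leNgt; apply/negP => n.
  have := lt_le_trans (_ : 0 < 1 - k ^+ 2) h => /(_ ltac:(lra)).
  by rewrite ltNge mulr_ge0_le0// ltW.
 by apply: le_trans h _; rewrite ler_piMl.
suff stab e u v : e <= dl / 2 -> VD w u -> VD w v -> (forall x, 0 <= u x) -> (forall x, 0 <= v x) ->
  q w u u = 1 -> q w v v = 1 -> M - e <= T3 u -> M - e <= T3 v ->
  c / 8 * q w (lin 1 u (-1) v) (lin 1 u (-1) v) <= e.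
 have c8 : 0 < c / 8 by rewrite divr_gt0.
 have d2 : 0 < dl / 2 by rewrite divr_gt0.
 have [u hu] := maximizer_of_stability hw M_0 hM seq c8 d2 stab.
 by exists M, u.
move=> ed Vu Vv u0 v0 qu qv Tu Tv.
have Tu' : M - dl / 2 <= T3 u by apply: le_trans Tu; rewrite lerB.
have Tv' : M - dl / 2 <= T3 v by apply: le_trans Tv; rewrite lerB.
have nu := near _ Vu u0 qu Tu'; have nv := near _ Vv v0 qv Tv'.
have [md mm ->] := midpoint hM (ltW M_0) Vu Vv qu qv Tu Tv.
set d := lin 2^-1 u (- 2^-1) v; set m := lin 2^-1 u 2^-1 v => key.
have Vd : VD w d by exact: VD_lin.
have Vm : VD w m by exact: VD_lin.
have [Vu0 Vv0 Vd0 Vm0] : [/\ VD w0 u, VD w0 v, VD w0 d & VD w0 m] by split; exact: sub.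
have x0 := q_ge0 w d.
have mQ : 1 - k ^+ 2 <= q w0 m Q0.
 rewrite /m q_linl//; move: nu nv; move: (q w0 u Q0) (q w0 v Q0) (k ^+ 2); clear => *; lra.
have cs := q_cs Vm0 V0; rewrite q0 mulr1 in cs.
have hA := cross _ _ Vm Vd; rewrite md subr0 in hA.
have [xk mle dm] := geometry_num sp sk kk x0 mm mQ cs (low _ Vm) hA.
pose z := lin 1 m (-1) Q0.
have Vz : VD w0 z by exact: VD_lin.
have z3 : q w0 z z <= 3 * k ^+ 2.
 rewrite /z q_norm2// q0; move: mQ mle sk sp; move: (q w0 m Q0) (q w0 m m) (k ^+ 2); clear => *; lra.
have p0 := q_ge0 w0 d; have px := low _ Vd.
have Qd : q w0 Q0 d ^+ 2 <= 22 * k ^+ 2 * q w d d.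
 have e1 : q w0 Q0 d = q w0 m d - q w0 z d by rewrite /z (q_linl _ _ Vm0 V0 Vd0); ring.
 rewrite e1; exact: @cross_num _ s8 _ dm _ px (q_ge0 w0 z) z3 (q_cs Vz Vd0).
have hT : T m d d = T Q0 d d + T z d d.
 have -> : T m d d = T (lin 1 Q0 1 z) d d by congr (T _ d d); apply/funext => x; rewrite /z; ring.
 by rewrite (T_lin _ _ (VD_sq V0) (VD_sq Vz) (VD_V1 Vd) (VD_V1 Vd)) !mul1r.
have z2 : Num.sqrt (q w0 z z) <= 2 * k.
 rewrite -[leRHS]ger0_norm; last by rewrite mulr_ge0// ltW.
 rewrite -sqrtr_sqr ler_wsqrtr//; apply: le_trans z3 _.
 have -> : (2 * k) ^+ 2 = 4 * k ^+ 2 by ring.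
 by rewrite ler_pM2r// ler_nat.
have Tz : T z d d <= B * Num.sqrt (q w0 z z) * q w0 d d.
 apply: le_trans (ler_norm _) (le_trans (T_le hw0 Vz Vd0 Vd0) _).
 by rewrite -/B -!mulrA -expr2 sqr_sqrtr.
have [r1 r2] := @coercivity_num M M0 c C B k s _ _ _ 0 _ _ _ M00 c_0 cM C0 B0 k0 k4
 ltac:(by rewrite -/L kL) (ltW sp) sk MM MB x0 xk p0 px Qd (sqrtr_ge0 _) z2 (S2 _ Vd0) Tz.
move: key; rewrite hT; move: r1 r2 x0.
have -> : M * q w d d ^+ 2 = M * q w d d * q w d d by ring.
move: (T Q0 d d + T z d d) (q w d d) => t x; clear -c_0 => r1 r2 x0 key.
(* The midpoint inequality becomes [3 c x / 2 <= 2 e + c x / 2], so [c x / 2 <= e]; the full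
   difference has energy [4 x], whence the constant [c / 8]. *)
have : M * x * x <= c / 2 * x by rewrite ler_wpM2r.
lra.
Qed.

End local_maximizer.

(** * Continuity, positivity and uniqueness of maximizers *)

Lemma der_casM (y z : R) : hasder (fun z => cas (y * z)) z (y * (cos (y * z) - sin (y * z))).
Proof. rewrite /cas; der; ring. Qed.

Lemma hint_continuous f : rint f -> continuous (hint f).
Proof.
move=> f1 x; apply: cvgM; first exact: cvg_cst.
have := @continuity_under_integral R _ (measurableTypeR R) mu (fun x y => f y * cas (y * x))
 setT measurableT (x - 1) (x + 1) _ _ (fun y => 2 * `|f y|) _ _ x.
apply.
- by move=> y _; exact: rint_cas.
- apply: aeW => y _ z _; apply: cvgM; first exact: cvg_cst.
 exact: der_at_continuous (der_casM y z).
- by apply: rintZ; exact: rint_norm.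
- by move=> z _; apply: aeW => y _; rewrite normrM mulrC ler_wpM2r// cas_le2.
- by rewrite inE/= in_itv/=; apply/andP; split; lra.
Qed.

Lemma ae0_continuous f : continuous f -> {ae mu, forall x, f x = 0} -> forall x, f x = 0.
Proof.
move=> cf f0 r; apply/eqP; apply/negPn/negP => fr.
have fr0 : 0 < `|f r| by rewrite normr_gt0.
have /cvgrPdist_lt/(_ _ fr0)[e /= e0 he] := cf r.
have e2 : 0 < e / 2 by rewrite divr_gt0.
have z : {ae mu, forall x, icc (r - e / 2) (r + e / 2) x = 0}.
 apply: filterS f0 => x fx; rewrite iccE.
 have [/andP[h1 h2]|//] := boolP (r - e / 2 <= x <= r + e / 2); exfalso.
 have := he x; rewrite /= ltr_norml; have -> : - e < r - x < e by apply/andP; split; lra.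
 by move=> /(_ isT); rewrite fx subr0 ltxx.
have := @Int_icc2 (r - e / 2) (r + e / 2) (r - e / 2) (r + e / 2).
rewrite (@ae_ip _ _ _ mu _ _ (fun=> 0) (fun=> 0)) //; try exact: icc_meas.
rewrite ipE (@eq_Int _ _ _ _ _ (fun=> 0)); last by move=> x; rewrite mulr0.
rewrite Rintegral_cst// mul0r => /(_ _ _)/esym; rewrite subrr normr0.
have -> : r + e / 2 - (r - e / 2) = e by field.
have -> : r - e / 2 - (r + e / 2) = - e by field.
rewrite subrr normrN normr0 gtr0_norm// => h; have := h ltac:(lra) ltac:(lra); lra.
Qed.

(** The correlation is, up to a constant, the transform of the integrable function [Ht u ^ 2]. *)
Lemma corr_continuous u : sqint u -> aeven u -> continuous (corr u u).
Proof.
move=> u2 ue.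
have e : corr u u = fun x => hc^-1 * hint (fun y => Ht u y * Ht u y) x.
 by apply/funext => x; rewrite hint_Ht_mul// mulrA mulVf ?mul1r// gt_eqF ?hc_gt0.
rewrite e => x; apply: cvgM; first exact: cvg_cst.
by apply: hint_continuous; apply: sqint_mul; exact: Ht_sq.
Qed.

Lemma corr0 u : corr u u 0 = ip u u.
Proof. by apply: eq_Int => y; rewrite add0r. Qed.

Lemma corr_ae f g x : measR f -> measR g -> {ae mu, forall x, f x = g x} ->
 corr f f x = corr g g x.
Proof.
move=> mf mg e; apply: ae_Int.
- by apply: mfunM => //; apply: mfunC => //; apply: measurable_funD.
- by apply: mfunM => //; apply: mfunC => //; apply: measurable_funD.
have := ae_affine x (or_introl erefl) e.
by apply: filterS2 e => y -> ; rewrite mul1r addrC => ->.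
Qed.

(* Self-correlation doubles the interval on which a continuous nonnegative
 function is positive. *)
Lemma corr_gt0_double f x : sqint f -> continuous f -> (forall y, 0 <= f y) ->
 0 < f (- (x / 2)) -> 0 < f (x / 2) -> 0 < corr f f x.
Proof.
move=> f2 cf f0 p1 p2.
have i : rint (fun y => f y * f (x + y)) by apply: sqint_mul => //; exact: corr_sub.
rewrite lt_neqAle eq_sym; apply/andP; split; last first.
 by apply: Int_ge0 => y; rewrite mulr_ge0.
apply/eqP => z.
have z0 := Int0_ae i (fun y => mulr_ge0 (f0 _) (f0 _)) z.
have := @ae0_continuous (fun y => f y * f (x + y)) _ z0 (- (x / 2)).
have -> : x + - (x / 2) = x / 2 by field.
move=> h; have : f (- (x / 2)) * f (x / 2) = 0.
 apply: h => y; apply: cvgM; first exact: cf.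
 apply: (@continuous_comp _ _ _ (fun y => x + y) f); last exact: cf.
 by apply: cvgD; [exact: cvg_cst|exact: cvg_id].
by apply/eqP; rewrite mulf_neq0// gt_eqF.
Qed.

(** The absolute value of [g] is also a maximizer, and the deficit estimate identifies it with [u].
    By the Euler-Lagrange equation [u] and [g] have continuous representatives [U] and [G] with
    [|G| = U]. Positivity of [U] spreads from 0 by doubling, so [G] has no zero, and its sign is the
    one it has at 0. *)
Lemma maximizer_unique w c c1 M u g : weight w c -> continuous w -> 0 < c1 ->
 maximizer w c1 M u -> VD w g -> q w g g = 1 -> T3 g = M -> {ae mu, forall x, g x = u x}.
Proof.
move=> hw cw c10 [Vu u0 qu Tu M0 hM stab] Vg qg Tg.
have [Vn qn] := VD_norm Vg.
have Tn : T3 (fun x => `|g x|) = M.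
 apply/eqP; rewrite eq_le -{2}Tg T3_norm ?andbT; last exact: VD_V1 Vg.
 by have := hM _ Vn; rewrite qn qg sqrtr1 !mulr1.
have ug : {ae mu, forall x, u x = `|g x|}.
 have := stab _ Vn (fun x => normr_ge0 _); rewrite qn qg Tn subrr pmulr_rle0// => /(_ erefl) h.
 have z : q w (lin 1 u (-1) (fun x => `|g x|)) (lin 1 u (-1) (fun x => `|g x|)) = 0.
  by apply/eqP; rewrite eq_le h q_ge0.
 have := q_eq0 hw (VD_lin _ _ Vu Vn) z; apply: filterS => x.
 by rewrite mul1r mulN1r => /eqP; rewrite subr_eq0 => /eqP.
have w0 x := weight_gt0 x hw.
pose E v x := hc * corr v v x / (M * w x).
have Ec v : VD w v -> continuous (E v).
 move=> Vv x; apply: cvgM.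
  by apply: cvgM; [exact: cvg_cst|apply: corr_continuous; [exact: VD_sq Vv|exact: VD_even Vv]].
 apply: cvgV; first by rewrite mulf_neq0// gt_eqF.
 by apply: cvgM; [exact: cvg_cst|exact: cw].
have Eae v : VD w v -> q w v v = 1 -> T3 v = M -> {ae mu, forall x, v x = E v x}.
 move=> Vv qv Tv; have := euler_lagrange hw hM (ltW M0) Vv qv Tv.
 apply: filterS => x h; rewrite /E h; field.
 by rewrite !gt_eqF.
have uE := Eae _ Vu qu Tu; have gE := Eae _ Vg qg Tg.
pose U := E u; pose G := E g.
have Uc : continuous U by exact: Ec.
have Gc : continuous G by exact: Ec.
have GU x : `|G x| = U x.
 apply/eqP; rewrite -subr_eq0; apply/eqP.
 apply: (@ae0_continuous (fun x => `|G x| - U x)).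
  move=> y; apply: cvgB; last exact: Uc.
  by apply: cvg_norm; exact: Gc.
 by apply: filterS3 uE gE ug => y e1 e2 e3; rewrite /G /U -e1 -e2 e3 subrr.
have U0 x : 0 <= U x by rewrite -GU.
have u2 := VD_sq Vu; have mU := continuous_measR Uc.
have U2 : sqint U by apply: ae_sqint u2.
have ipu : 0 < ip u u.
 rewrite lt_neqAle ip_ge0 andbT eq_sym; apply/eqP => z.
 have := ip_eq0 u2 z => z0.
 have V0 := VD_lin 0 0 Vu Vu.
 have : q w u u = q w (lin 0 u 0 u) (lin 0 u 0 u).
  by apply: q_ae => //; apply: filterS z0 => x ->; ring.
 by rewrite qu q_comb// !(expr0n, mul0r, mulr0, addr0) => /eqP; rewrite oner_eq0.
have pos v x : 0 < corr v v x -> 0 < E v x.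
 by move=> h; rewrite divr_gt0 ?mulr_gt0 ?hc_gt0.
(* At 0 an autocorrelation is a squared norm, positive for [u] and for [g] alike; this excludes
   [g = - u]. *)
have Up0 : 0 < U 0 by apply: pos; rewrite corr0.
have Gp0 : 0 < G 0.
 apply: pos; rewrite corr0.
 suff -> : ip g g = ip u u by [].
 rewrite !ipsE; apply: ae_Int.
 - exact: (rint_meas (sqint_sq (VD_sq Vg))).
 - exact: (rint_meas (sqint_sq u2)).
 by apply: filterS ug => x ->; rewrite norm_sq.
have [r r0 Ur] : exists2 r, 0 < r & forall x, `|x| < r -> 0 < U x.
 have /cvgrPdist_lt/(_ _ Up0)[r /= r0 h] := Uc 0.
 exists r => // x xr; have := h x; rewrite /= sub0r normrN => /(_ xr).
 by move=> /(le_lt_trans (ler_norm _)); rewrite ltrBlDr ltrDl.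
have dbl s : (forall x, `|x| < s -> 0 < U x) -> forall x, `|x| < 2 * s -> 0 < U x.
 move=> h x xs; apply: pos.
 rewrite (corr_ae x (sqint_meas u2) mU uE).
 have x2 : `|x / 2| < s.
  by rewrite normrM (ger0_norm (_ : 0 <= 2^-1 :> R)) ?invr_ge0// ltr_pdivrMr// mulrC.
 by apply: corr_gt0_double => //; apply: h; rewrite ?normrN.
have Upos x : 0 < U x.
 have all n : forall x, `|x| < 2 ^+ n * r -> 0 < U x.
  elim: n => [|n IH] y; first by rewrite expr0 mul1r; exact: Ur.
  by rewrite exprS -mulrA; exact: dbl.
 pose n := Num.bound (`|x| / r).
 apply: (all n); rewrite -ltr_pdivrMr//.
 apply: lt_trans (archi_boundP (_ : 0 <= `|x| / r)) _; first by rewrite divr_ge0// ltW.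
 by rewrite -natrX ltr_nat ltn_expl.
have Gpos x : 0 < G x.
 have Gn y : G y != 0 by rewrite -normr_gt0 GU.
 rewrite lt_neqAle eq_sym Gn leNgt; apply/negP => Gx.
 have wc a b : {within `[a, b], continuous G} by exact: continuous_subspaceT.
 have [x0|x0] := leP 0 x.
  have [|y _ /eqP] := IVT (v := 0) x0 (wc _ _).
   by rewrite ge_min le_max (ltW Gx) (ltW Gp0) orbT.
  by rewrite (negPf (Gn y)).
 have [|y _ /eqP] := IVT (v := 0) (ltW x0) (wc _ _).
  by rewrite ge_min le_max (ltW Gx) (ltW Gp0) orbT.
 by rewrite (negPf (Gn y)).
apply: filterS2 uE gE => x e1 e2.
by rewrite e2 -/(G x) -(gtr0_norm (Gpos x)) GU.
Qed.

(** * Reduction of the cubic form to the half line *)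

Definition hp : R -> R := \1_`[0, +oo[.

Lemma hpE x : hp x = (0 <= x)%R%:R. Proof. exact: indic0y. Qed.

Lemma hp_meas : measR hp. Proof. exact: measR_indic. Qed.

Lemma hp_pos x : 0 <= x -> hp x = 1. Proof. by rewrite hpE => ->. Qed.

Lemma hp_neg x : x < 0 -> hp x = 0. Proof. by rewrite hpE leNgt => ->. Qed.

Lemma hp_sq x : hp x * hp x = hp x.
Proof. by rewrite hpE; case: (0 <= x); rewrite ?mulr1 ?mulr0. Qed.

Lemma hp_ge0 x : 0 <= hp x. Proof. by rewrite hpE. Qed.

Lemma hp_le1 x : `|hp x| <= 1.
Proof. by rewrite hpE; case: (0 <= x); rewrite ?normr1 ?normr0. Qed.

Lemma hp_rint f : rint f -> rint (fun x => hp x * f x).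
Proof.
move=> f1; apply: (rint_le _ (rint_norm f1)).
 by apply: mfunM; [exact: hp_meas|exact: (rint_meas f1)].
by move=> x; rewrite normrM ler_piMl// hp_le1.
Qed.

Lemma hp_sqint f : sqint f -> sqint (fun x => hp x * f x).
Proof.
move=> f2; apply: (sqint_le _ f2).
 by apply: mfunM; [exact: hp_meas|exact: (sqint_meas f2)].
by move=> x; rewrite normrM ler_piMl// hp_le1.
Qed.

Lemma hp_V1 f : V1 f -> V1 (fun x => hp x * f x).
Proof.
move=> [f2 hf]; split; first exact: hp_sqint.
have := hp_sqint hf; rewrite (_ : (fun x => _) = (fun x => hs x * (hp x * f x)))//.
by apply/funext => x; ring.
Qed.

Lemma V1_opp f : V1 f -> V1 (fun x => f (- x)).
Proof.
move=> [f2 hf]; split; first exact: sqint_opp.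
have := sqint_opp hf; rewrite (_ : (fun x => _) = (fun x => hs x * f (- x)))//.
by apply/funext => x; rewrite /hs normrN.
Qed.

Lemma Int_even f : rint f -> aeven f -> \int[mu]_x f x = 2 * \int[mu]_x (hp x * f x).
Proof.
move=> f1 fe; have i := hp_rint f1; have mi := rint_meas i; have io := rint_opp i.
have e : \int[mu]_x f x = \int[mu]_x (hp x * f x + hp (- x) * f (- x)).
 apply: ae_Int; [exact: (rint_meas f1)|exact: (rint_meas (rintD i io))|].
 apply: filterS2 fe (ae_neq 0) => x -> x0; rewrite !hpE oppr_ge0.
 by case: (ltrgt0P x) x0 => //; rewrite ?mul1r ?mul0r ?addr0 ?add0r ?eqxx.
by rewrite e IntD// (Int_opp mi); ring.
Qed.

Lemma rint_corr f g h : sqint f -> V1 g -> V1 h ->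
 rint2 (fun z => f z.1 * (g z.2 * h (z.1 + z.2))).
Proof.
move=> f2 [g2 hg] [h2 hh].
have Vn k : sqint k -> sqint (fun x => hs x * k x) -> V1 (fun x => `|k x|).
 move=> k2 hk; split; first exact: sqint_norm.
 have := sqint_norm hk.
 by rewrite (_ : (fun x => _) = (fun x => hs x * `|k x|))//; apply/funext => x; rewrite normrM ger0_norm ?sqrtr_ge0.
have Vg := Vn _ g2 hg; have Vh := Vn _ h2 hh.
apply: rint_prod.
 apply: mfunM; first exact: mfunC (sqint_meas f2) measurable_fst.
 apply: mfunM; first exact: mfunC (sqint_meas g2) measurable_snd.
 by apply: mfunC (sqint_meas h2) _; apply: measurable_funD.
have c2 := corr_sqint Vg Vh.
have i := sqint_mul (sqint_norm f2) c2.
rewrite (_ : (\int[mu]_x _)%E = (\int[mu]_x (`|f x| * corr (fun x => `|g x|) (fun x => `|h x|) x)%:E)%E).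
 exact: rint_lty i.
apply: eq_integral => x _ /=.
have j : rint (fun y => `|g y| * `|h (x + y)|).
 by apply: sqint_mul; [exact: sqint_norm|exact: (corr_sub x (sqint_norm h2))].
under eq_integral do rewrite !normrM.
by apply: etrans (IntE (@rintZ _ _ _ mu `|f x| _ j)) _; rewrite IntZ.
Qed.

(** Both sides are the double integral of [f x * g y * h (x + y)], which is symmetric in the first
    two functions. *)
Lemma corr_swap f g h : sqint f -> V1 g -> V1 h ->
 ip f (corr g h) = ip g (corr f h).
Proof.
move=> f2 Vg Vh; have i := rint_corr f2 Vg Vh.
have [g2 _] := Vg; have [h2 _] := Vh.
transitivity (\int[mu]_x \int[mu]_y (f x * (g y * h (x + y)))).
 by apply: eq_Int => x; rewrite IntZ//; apply: sqint_mul => //; exact: corr_sub.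
rewrite (Int_swap i); apply: eq_Int => y /=.
rewrite -IntZ; last by apply: sqint_mul => //; have := corr_sub y h2.
by apply: eq_Int => x; rewrite (addrC x); ring.
Qed.

Lemma corr_oppl f g x : measR f -> measR g -> corr (fun y => f (- y)) g x = \int[mu]_y (f y * g (x - y)).
Proof.
move=> mf mg; rewrite /corr -Int_opp; first by apply: eq_Int => y; rewrite opprK.
apply: mfunM; first exact: meas_opp.
by apply: mfunC mg _; apply: measurable_funD.
Qed.

Lemma corr_reflect f g x : measR f -> measR g -> corr f g (- x) = corr g f x.
Proof.
move=> mf mg; rewrite /corr.
rewrite -(@Int_shift x (fun y => f y * g (- x + y))).
 by apply: eq_Int => y; rewrite (_ : - x + (y + x) = y); [rewrite mulrC (addrC x)|ring].
apply: mfunM => //.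
by apply: mfunC mg _; apply: measurable_funD.
Qed.

Lemma even_split g : aeven g -> {ae mu, forall x, g x = hp x * g x + hp (- x) * g (- x)}.
Proof.
move=> ge; apply: filterS2 ge (ae_neq 0) => x -> x0; rewrite !hpE oppr_ge0.
by case: (ltrgt0P x) x0 => //; rewrite ?mul1r ?mul0r ?addr0 ?add0r ?eqxx.
Qed.

(** Two points at distance [x > 0] are both positive, both negative, which contributes the same by
    reflection, or the left one is negative and the right one positive. *)
Lemma corr_half g x : sqint g -> aeven g -> 0 < x ->
 let gp := fun x => hp x * g x in
 corr g g x = 2 * corr gp gp x + corr (fun y => gp (- y)) gp x.
Proof.
move=> g2 ge x0 gp.
have p2 : sqint gp by exact: hp_sqint.
have n2 : sqint (fun y => gp (- y)) by exact: sqint_opp.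
have mp := sqint_meas p2; have mn := sqint_meas n2.
have s2 := sqint_lin 1 1 p2 n2.
rewrite (@corr_ae _ (lin 1 gp 1 (fun y => gp (- y))) _ (sqint_meas g2) (sqint_meas s2)); last first.
 by apply: filterS (even_split ge) => y ->; rewrite !mul1r.
rewrite corr_linl// !corr_linr//.
have -> : corr gp (fun y => gp (- y)) x = 0.
 rewrite /corr (@eq_Int _ _ _ _ _ (fun=> 0)) ?Rintegral_cst ?mul0r// => y.
 rewrite /gp; have [y0|y0] := ltP y 0; first by rewrite hp_neg// !mul0r.
 by rewrite (@hp_neg (- (x + y))) ?mul0r ?mulr0//; lra.
have -> : corr (fun y => gp (- y)) (fun y => gp (- y)) x = corr gp gp x.
 rewrite corr_oppl//; transitivity (\int[mu]_y (gp y * gp (y - x))).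
  by apply: eq_Int => y; rewrite opprB.
 rewrite -(@Int_shift x (fun y => gp y * gp (y - x))).
  by apply: eq_Int => y; rewrite addrK mulrC (addrC y).
 apply: mfunM => //; apply: mfunC mp _.
 exact: measurable_funB.
by ring.
Qed.

(** The contribution of points on opposite sides of 0 becomes, after exchanging the order of
    integration and reflecting, a correlation of functions on the half line. *)
Lemma T_half f g : sqint f -> aeven f -> V1 g -> aeven g ->
 let gp := fun x => hp x * g x in let fp := fun x => hp x * f x in
 T f g g = 2 * hc * (2 * ip fp (corr gp gp) + ip gp (corr gp fp)).
Proof.
move=> f2 fe Vg ge gp fp; have [g2 hg] := Vg.
have Vp : V1 gp by exact: hp_V1.
have Vn : V1 (fun y => gp (- y)) by exact: V1_opp.
have c2 := corr_sqint Vg Vg; have fp2 : sqint fp by exact: hp_sqint.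
have [p2 _] := Vp; have [n2 _] := Vn.
have mp := sqint_meas p2; have mf := sqint_meas fp2.
rewrite Tdef -!mulrA mulrCA; congr (hc * _).
rewrite /ip Int_even; [|exact: sqint_mul|]; last first.
 by apply: filterS fe => x ->; rewrite corr_even.
congr (2 * _).
have cp2 := corr_sqint Vp Vp; have cn2 := corr_sqint Vn Vp.
have s2 := sqint_lin 2 1 cp2 cn2.
transitivity (ip fp (lin 2 (corr gp gp) 1 (corr (fun y => gp (- y)) gp))).
 apply: ae_Int; [exact: (rint_meas (hp_rint (sqint_mul f2 c2)))|exact: (rint_meas (sqint_mul fp2 s2))|].
 apply: filterS (ae_neq 0) => x x0; rewrite mulrA -/(fp x).
 have [xp|] := ltP 0 x; first by rewrite corr_half// mul1r.
 by rewrite le_eqVlt (negPf x0)/= => xn; rewrite /fp hp_neg// !mul0r.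
have e : ip fp (corr (fun y => gp (- y)) gp) = ip gp (corr gp fp).
 rewrite (corr_swap fp2 Vn Vp) ipE -(@Int_opp (fun y => gp (- y) * corr fp gp y)).
  by apply: eq_Int => y; rewrite opprK corr_reflect.
 by apply: mfunM; [exact: (sqint_meas n2)|exact: corr_meas].
by rewrite (ipr_lin _ _ cp2 cn2 fp2) mul1r e.
Qed.

Lemma FTCh f F l : continuous f -> (forall x, hasder F x (f x)) -> rint (fun x => hp x * f x) ->
 F x @[x --> +oo] --> l -> \int[mu]_x (hp x * f x) = l - F 0.
Proof.
move=> cf dF i cF.
have e n : \int[mu]_x (icc 0 n%:R x * f x) = F n%:R - F 0.
 by rewrite -Int_icc; exact: FTC.
have mf := continuous_measR cf.
have [_ c] : rint (fun x => hp x * f x) /\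
  \int[mu]_x (icc 0 n%:R x * f x) @[n --> \oo] --> \int[mu]_x (hp x * f x).
 apply: (@dct _ _ _ mu (fun n x => icc 0 n%:R x * f x) _ (fun x => `|hp x * f x|)).
 - by move=> n; apply: mfunM => //; exact: icc_meas.
 - exact: (rint_meas i).
 - exact: rint_norm.
 - move=> n x; rewrite !normrM ler_wpM2r// iccE hpE.
  by case: (0 <= x) => //=; rewrite ?normr0//; case: (x <= _); rewrite ?normr1 ?normr0.
 - apply: aeW => x; apply: cvgM; last exact: cvg_cst.
  have : (fun n : nat => hp x) @ \oo --> hp x by exact: cvg_cst.
  apply: cvg_trans; apply: near_eq_cvg.
  have [x0|x0] := leP 0 x.
   near=> n; rewrite hp_pos// iccE x0/= (_ : x <= n%:R)//.
   by near: n; exact: nbhs_infty_ger.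
  by near=> n; rewrite hp_neg// iccE leNgt x0.
apply: cvgn_uniq c _ e; apply: cvgB; last exact: cvg_cst.
have := cvg_comp _ _ (@cvgr_idn R) cF; exact.
Unshelve. all: by end_near. Qed.

(** * Second variation at the exponential profile *)

Section exponential_profile.
Implicit Types (d : R -> R).

Definition w1 x : R := 1 + `|x|.

Lemma w1_weight : weight w1 1.
Proof.
split=> //.
- by apply: measurable_funD => //; exact: measR_norm.
- by move=> x; rewrite mul1r.
- by move=> x; rewrite /w1 normrN.
Qed.

(** Up to a factor, the transform of the Benjamin-Ono soliton, itself a multiple of
    [1 / (1 + x^2)]. *)
Definition hE x : R := expR (- `|x|).
Definition Ep x : R := hp x * expR (- x).

Lemma hE_meas : measR hE.
Proof. by apply: mfunC => //; apply: mfunC => //; exact: measR_norm. Qed.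

Lemma hp_hE x : hp x * hE x = Ep x.
Proof.
rewrite /Ep /hE; have [x0|x0] := leP 0 x; first by rewrite ger0_norm.
by rewrite hp_neg// !mul0r.
Qed.

Lemma Ep_rint : rint Ep.
Proof.
have cx : continuous (fun x : R => expR (- x)).
 by apply: (@der_continuous _ (fun x => - expR (- x))) => x; der; ring.
have dx (x : R) : hasder (fun x => - expR (- x)) x (expR (- x)) by der; ring.
apply: ge0_rintP.
- by apply: mfunM; [exact: hp_meas|exact: continuous_measR].
- by move=> x; rewrite mulr_ge0 ?hp_ge0 ?expR_ge0.
- rewrite -int_itv_indic//.
 rewrite (@FTCy _ (fun x => - expR (- x)) 0 0)//; first by rewrite ltry.
 rewrite -oppr0; apply: cvgN.
 by have := @expR_cvg0 1 ltr01; under eq_fun do rewrite mul1r.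
Qed.

Lemma hp_exp_rint f C : measR f -> (forall x, 0 <= x -> `|f x| <= C * expR (- x)) ->
 rint (fun x => hp x * f x).
Proof.
move=> mf fC; apply: (@rint_le _ _ _ mu _ (fun x => C * Ep x)).
- by apply: mfunM => //; exact: hp_meas.
- by apply: rintZ; exact: Ep_rint.
- move=> x; rewrite /Ep mulrCA normrM ger0_norm ?hp_ge0//.
 have [x0|x0] := leP 0 x; last by rewrite hp_neg// !mul0r.
 by rewrite ler_wpM2l ?hp_ge0// fC.
Qed.

Lemma exp1D_le x : 0 <= x -> (1 + x) * expR (- (2 * x)) <= 2 * expR (- x).
Proof.
move=> x0; have e1 : 1 + x <= expR x by rewrite expR_ge1Dx.
have -> : expR (- (2 * x)) = expR (- x) * expR (- x) by rewrite -expRD; congr expR; ring.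
rewrite mulrA ler_pM2r ?expR_gt0//.
apply: le_trans (_ : expR x * expR (- x) <= _); first by rewrite ler_pM2r ?expR_gt0.
by rewrite -expRD subrr expR0; lra.
Qed.

Lemma even_rint f : rint (fun x => hp x * f x) -> measR f -> (forall x, f (- x) = f x) -> rint f.
Proof.
move=> i mf fe; apply: (ae_rint mf _ (rintD i (rint_opp i))).
by apply: ae_sym; apply: even_split; exact: aeW.
Qed.

Lemma even_sqint f : sqint (fun x => hp x * f x) -> measR f -> (forall x, f (- x) = f x) -> sqint f.
Proof.
move=> [_ i] mf fe; split=> //; apply: even_rint.
- by move: i; rewrite (_ : (fun x => _) = (fun x => hp x * f x ^+ 2))//; apply/funext => x; rewrite exprMn expr2 hp_sq.
- exact: measurable_funX.
- by move=> x; rewrite fe.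
Qed.

Lemma q_w1 f g : q w1 f g = \int[mu]_x (w1 x * f x * g x).
Proof. by rewrite (qE _ _ w1_weight). Qed.

Lemma q_w1_half f g : VD w1 f -> VD w1 g ->
 q w1 f g = 2 * \int[mu]_x (hp x * ((1 + x) * f x * g x)).
Proof.
move=> Vf Vg; rewrite q_w1 Int_even.
- congr (2 * _); apply: eq_Int => x; have [x0|x0] := leP 0 x; last by rewrite hp_neg// !mul0r.
 by rewrite /w1 ger0_norm.
- have := sqint_mul (VD_sw Vf) (VD_sw Vg); apply: rint_eq => x.
 by rewrite -(sw_sq _ w1_weight); ring.
- by apply: filterS2 (VD_even Vf) (VD_even Vg) => x -> ->; rewrite /w1 normrN.
Qed.

(** On the half line [P = corr Ep dp], where [dp] is the restriction of [d], solves [P' = P - d].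
    With [P = expR (- x) * u] this reads [d = expR (- x) * (2 u - u')]. In terms of [u] the nonlocal
    quadratic form becomes a local one with weight [expR (- (2 x))]. *)
Record bo_class d u u1 C : Prop := BoClass {
 bo_der : forall x, hasder u x (u1 x);
 bo_cont : continuous u1;
 bo_le : forall x, `|u x| <= C;
 bo_le1 : forall x, `|u1 x| <= C;
 bo_eq : forall x, d x = expR (- `|x|) * (2 * u `|x| - u1 `|x|) }.

Let den x : R := 1 + 6 * x + 10 * x ^+ 2.
(** An explicit supersolution of the Riccati inequality [psi_riccati], which yields a weighted
    Poincare inequality with constant [11 / 5]. Any constant above 2 would leave room for a factor
    below 1 in [class_num]. *)
Let psi x : R := 3 / 2 + 4 / den x.
Let psi1 x : R := - (4 * (6 + 20 * x) / den x ^+ 2).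

Let der_den x : hasder den x (6 + 20 * x).
Proof. rewrite /den; der; ring. Qed.

Let den_gt0 x : 0 < den x.
Proof.
have -> : den x = 10 * (x + 3 / 10) ^+ 2 + 10^-1 by rewrite /den; field.
by rewrite ltr_wpDl// mulr_ge0// sqr_ge0.
Qed.

Let den_neq0 x : den x != 0. Proof. by rewrite gt_eqF. Qed.

Let der_psi x : hasder psi x (psi1 x).
Proof. have dd := der_den; rewrite /psi /psi1; der; [exact: den_neq0|field; exact: den_neq0]. Qed.

Let cpsi : continuous psi.
Proof. exact: der_continuous der_psi. Qed.

Let cpsi1 : continuous psi1.
Proof.
have dd := der_den.
apply: (@der_continuous _ (fun x : R => - (80 / den x ^+ 2 - 8 * (6 + 20 * x) ^+ 2 / den x ^+ 3))) => x.
rewrite /psi1; der; first by rewrite expf_neq0.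
field; exact: den_neq0.
Qed.

Let den1 x : 0 <= x -> 1 <= den x.
Proof. by move=> x0; have := sqr_ge0 x; rewrite /den; lra. Qed.

Let psi_le x : 0 <= x -> `|psi x| <= 6.
Proof.
move=> x0; rewrite /psi ger0_norm; last by rewrite addr_ge0// divr_ge0// ltW.
have : (den x)^-1 <= 1 by rewrite invf_le1 ?den1.
by move: (_^-1) => z; lra.
Qed.

Let psi1_le x : 0 <= x -> `|psi1 x| <= 80 * (1 + x).
Proof.
move=> x0; have h : 0 <= 4 * (6 + 20 * x) by lra.
rewrite /psi1 normrN normrM (ger0_norm h).
apply: le_trans (_ : 4 * (6 + 20 * x) * 1 <= _); last by lra.
by rewrite ler_wpM2l// ger0_norm ?invr_ge0 ?sqr_ge0// invf_le1 ?exprn_gt0// exprn_ege1// den1.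
Qed.

(** The numerator of the defect in [psi_riccati] over [den x ^+ 2]. Its quartic factor is bounded
    below by completing the square in [x ^+ 2]. *)
Let quintic x : 0 <= x ->
 0 <= 51 / 20 + x * (357 / 5 + 82 / 5 * x - 246 / 5 * x ^+ 2 - 49 * x ^+ 3 + 80 * x ^+ 4).
Proof.
move=> x0; have p : 0 <= x * (357 / 5 + 82 / 5 * x - 246 / 5 * x ^+ 2 - 49 * x ^+ 3 + 80 * x ^+ 4).
 apply: (mulr_ge0 x0).
 have := sqr_ge0 (x ^+ 2 - 49 / 160 * x - 36 / 100); have := sqr_ge0 (x - 1).
 have -> : (x ^+ 2 - 49 / 160 * x - 36 / 100) ^+ 2 =
   x ^+ 4 - 49 / 80 * x ^+ 3 + (49 / 160) ^+ 2 * x ^+ 2 - 72 / 100 * x ^+ 2 +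
   49 / 160 * (72 / 100) * x + (36 / 100) ^+ 2 by field.
 rewrite sqrrB1; have := sqr_ge0 x.
 by move: (x ^+ 2) (x ^+ 3) (x ^+ 4) => X2 X3 X4; lra.
by lra.
Qed.

Let psi_riccati x : 0 <= x -> psi x ^+ 2 <= (1 + x) * (2 * psi x - psi1 x - 11 / 5).
Proof.
move=> x0; rewrite -subr_ge0.
have -> : (1 + x) * (2 * psi x - psi1 x - 11 / 5) - psi x ^+ 2 =
 (51 / 20 + x * (357 / 5 + 82 / 5 * x - 246 / 5 * x ^+ 2 - 49 * x ^+ 3 + 80 * x ^+ 4)) / den x ^+ 2.
 by have := den_neq0 x; rewrite /psi /psi1 /den => dx; field.
by apply: divr_ge0; [exact: quintic|exact: sqr_ge0].
Qed.

(** [y] is [u 0], and [J2], [J3] are the second and first moments of [u] for [expR (- (2 x))], a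
    measure of mass 1/2. Recentring at [u 0] replaces them by [Iv] and [V]; the hypotheses become
    [Iv >= 2 V^2], by Cauchy-Schwarz, and [J1 >= 11 / 5 * Iv]. The factor [66 / 67] is the
    coercivity gap. *)
Lemma class_num (J1 J2 J3 y : R) : 0 <= J2 - 2 * (2 * J3) * J3 + (2 * J3) ^+ 2 / 2 ->
 11 / 5 * (J2 - 2 * y * J3 + y ^+ 2 / 2) <= J1 ->
 4 * (J2 + y ^+ 2) <= 66 / 67 * (2 * y ^+ 2 + 2 * J2 + J1) + 2 * (y + J3) ^+ 2.
Proof.
have [V ->] : exists V, J3 = V + y / 2 by exists (J3 - y / 2); ring.
have [Iv ->] : exists Iv, J2 = Iv + 2 * y * V + y ^+ 2 / 2 by exists (J2 - 2 * y * V - y ^+ 2 / 2); ring.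
have -> : Iv + 2 * y * V + y ^+ 2 / 2 - 2 * (2 * (V + y / 2)) * (V + y / 2) + (2 * (V + y / 2)) ^+ 2 / 2 =
 Iv - 2 * V ^+ 2 by field.
have -> : Iv + 2 * y * V + y ^+ 2 / 2 - 2 * y * (V + y / 2) + y ^+ 2 / 2 = Iv by field.
have := sqr_ge0 (y + 2 / 3 * V); have := sqr_ge0 V; have := sqr_ge0 y.
have -> : (y + 2 / 3 * V) ^+ 2 = y ^+ 2 + 4 / 3 * (y * V) + 4 / 9 * V ^+ 2 by field.
have -> : 2 * y * V = 2 * (y * V) by ring.
have -> : (y + (V + y / 2)) ^+ 2 = 9 / 4 * y ^+ 2 + 3 * (y * V) + V ^+ 2 by field.
by move: (V ^+ 2) (y ^+ 2) (y * V) => a b c *; lra.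
Qed.

Section calculus.
Variables (d u u1 : R -> R) (C : R).
Hypothesis cl : bo_class d u u1 C.

Let C0 : 0 <= C. Proof. exact: le_trans (normr_ge0 _) (bo_le cl 0). Qed.
Let du : forall x, hasder u x (u1 x). Proof. exact: bo_der cl. Qed.
Let cu1 : continuous u1. Proof. exact: bo_cont cl. Qed.
Let cu : continuous u. Proof. exact: der_continuous du. Qed.

Lemma bo_even x : d (- x) = d x.
Proof. by rewrite !(bo_eq cl) normrN. Qed.

Let D x := expR (- x) * (2 * u x - u1 x).

Let hpd x : hp x * d x = hp x * D x.
Proof.
have [x0|x0] := leP 0 x; last by rewrite hp_neg// !mul0r.
by rewrite (bo_eq cl) ger0_norm.
Qed.

Let cexp (k : R) : continuous (fun x : R => expR (- (k * x))).
Proof. by apply: (@der_continuous _ (fun x => - k * expR (- (k * x)))) => x; der; ring. Qed.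

Let cexp1 : continuous (fun x : R => expR (- x)).
Proof. by apply: (@der_continuous _ (fun x => - expR (- x))) => x; der; ring. Qed.

Let cD : continuous D.
Proof.
move=> x; apply: cvgM; first exact: cexp1.
by apply: cvgB; [apply: cvgM; [exact: cvg_cst|exact: cu]|exact: cu1].
Qed.

Let D_le x : `|D x| <= 3 * C * expR (- x).
Proof.
rewrite /D normrM mulrC (ger0_norm (expR_ge0 _)) ler_wpM2r ?expR_ge0//.
apply: le_trans (ler_normB _ _) _; rewrite normrM gtr0_norm//.
have := bo_le cl x; have := bo_le1 cl x; lra.
Qed.

Lemma bo_meas : measR d.
Proof.
have -> : d = fun x => D `|x| by apply/funext => x; rewrite (bo_eq cl).
by apply: (mfunC (f := D)); [exact: continuous_measR|exact: measR_norm].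
Qed.

Let poly_exp f B : continuous f -> 0 <= B -> (forall x, 0 <= x -> `|f x| <= B * (1 + x)) ->
 rint (fun x => hp x * (expR (- (2 * x)) * f x)).
Proof.
move=> cf B0 fB; apply: (@hp_exp_rint _ (2 * B)).
 by apply: continuous_measR => x; apply: cvgM; [exact: cexp|exact: cf].
move=> x x0; rewrite normrM ger0_norm ?expR_ge0//.
apply: le_trans (ler_wpM2l (expR_ge0 _) (fB _ x0)) _.
have := ler_wpM2l B0 (exp1D_le x0).
have -> : expR (- (2 * x)) * (B * (1 + x)) = B * ((1 + x) * expR (- (2 * x))) by ring.
 by have -> : 2 * B * expR (- x) = B * (2 * expR (- x)) by ring.
Qed.

Let poly_exp_cvg0 f B : 0 <= B -> (forall x, 0 <= x -> `|f x| <= B * (1 + x)) ->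
 expR (- (2 * x)) * f x @[x --> +oo] --> 0.
Proof.
move=> B0 fB; apply: norm_cvg0.
apply: (@squeeze_cvgr _ _ _ _ (fun=> 0) (fun x => 2 * B * expR (- (1 * x)))).
- near=> x; have x0 : 0 <= x by near: x; exact: nbhs_pinfty_ge.
 rewrite normr_ge0/= normrM ger0_norm ?expR_ge0// mul1r.
 apply: le_trans (ler_wpM2l (expR_ge0 _) (fB _ x0)) _.
 have := ler_wpM2l B0 (exp1D_le x0).
 have -> : expR (- (2 * x)) * (B * (1 + x)) = B * ((1 + x) * expR (- (2 * x))) by ring.
 by have -> : 2 * B * expR (- x) = B * (2 * expR (- x)) by ring.
- exact: cvg_cst.
- rewrite -[X in _ --> X](mulr0 (2 * B)); apply: cvgM; first exact: cvg_cst.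
 exact: expR_cvg0.
Unshelve. all: by end_near. Qed.

Lemma bo_V : VD w1 d.
Proof.
have bnd x : 0 <= x -> `|(1 + x) * D x ^+ 2| <= 9 * C ^+ 2 * 2 * expR (- x).
 move=> x0; rewrite normrM (ger0_norm (_ : 0 <= 1 + x)); last by lra.
 rewrite normrX; apply: le_trans (_ : (1 + x) * (3 * C * expR (- x)) ^+ 2 <= _).
  by rewrite ler_wpM2l ?lerXn2r ?nnegrE ?D_le//; [lra|rewrite !mulr_ge0 ?expR_ge0].
 have -> : (3 * C * expR (- x)) ^+ 2 = 9 * C ^+ 2 * expR (- (2 * x)).
  rewrite exprMn -expRM_natl; congr (_ * expR _); [ring|by rewrite mulrN].
 have -> : (1 + x) * (9 * C ^+ 2 * expR (- (2 * x))) = 9 * C ^+ 2 * ((1 + x) * expR (- (2 * x))) by ring.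
 rewrite -[leRHS]mulrA ler_wpM2l ?exp1D_le// mulr_ge0 ?sqr_ge0//.
apply: (VDP w1_weight bo_meas); first by apply: aeW => x; exact: bo_even.
have ms : measR (sw w1) by apply: sw_meas; case: w1_weight.
split; first by apply: mfunM => //; exact: bo_meas.
apply: even_rint.
- apply: (@rint_eq _ _ _ mu (fun x => hp x * ((1 + x) * D x ^+ 2))).
  move=> x; rewrite (exprMn _ (sw w1 x)) (sw_sq _ w1_weight); have [x0|x0] := leP 0 x; last by rewrite hp_neg// !mul0r.
  by rewrite /w1 (bo_eq cl) !ger0_norm.
 apply: (hp_exp_rint _ bnd); apply: continuous_measR => x; apply: cvgM.
  by apply: cvgD; [exact: cvg_cst|exact: cvg_id].
 by rewrite /D; apply: cvgM; exact: cD.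
- by apply: measurable_funX; apply: mfunM => //; exact: bo_meas.
- by move=> x; rewrite bo_even /sw /w1 normrN.
Qed.

Let dp x := hp x * d x.

Let exp2 x : expR (- (2 * x)) = expR (- x) * expR (- x).
Proof. by rewrite -expRD; congr expR; ring. Qed.

(** The integrand is the exact derivative of a function vanishing at infinity; the parametrization
    by [u] was chosen for this. *)
Lemma bo_P x : 0 <= x -> corr Ep dp x = expR (- x) * u x.
Proof.
move=> x0.
pose f y := expR (- y) * D (x + y); pose F y := - (expR (- x) * (expR (- (2 * y)) * u (x + y))).
have E1 : corr Ep dp x = \int[mu]_y (hp y * f y).
 apply: eq_Int => y; rewrite /Ep /dp /f; have [y0|y0] := leP 0 y; last by rewrite hp_neg// !mul0r.
 by rewrite hpd (@hp_pos (x + y)) ?mul1r ?addr_ge0// -mulrA.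
have cf : continuous f.
 move=> y; apply: cvgM; first exact: cexp1.
 apply: (@continuous_comp _ _ _ (fun y => x + y) D); last exact: cD.
 by apply: cvgD; [exact: cvg_cst|exact: cvg_id].
have dF y : hasder F y (f y).
 have dux : hasder (fun y => u (x + y)) y (u1 (x + y)).
  by apply: der_eq; [apply: (@der_comp u (fun y => x + y)); [der; reflexivity|exact: du]|ring].
 rewrite /F /f /D; der.
 have -> : - (x + y) = - x + - y by ring.
 by rewrite expRD exp2; ring.
have i : rint (fun y => hp y * f y).
 apply: (@hp_exp_rint _ (3 * C)); first exact: continuous_measR.
 move=> y y0; rewrite /f normrM ger0_norm ?expR_ge0// mulrC ler_wpM2r ?expR_ge0//.
 apply: le_trans (D_le _) _; rewrite ler_piMr ?mulr_ge0// -expR0 ler_expR.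
 by rewrite oppr_le0 addr_ge0.
have cF : F y @[y --> +oo] --> 0.
 rewrite -oppr0; apply: cvgN; rewrite -(mulr0 (expR (- x))); apply: cvgM; first exact: cvg_cst.
 apply: (@poly_exp_cvg0 (fun y => u (x + y)) C C0) => y y0.
 by apply: le_trans (bo_le cl _) _; rewrite ler_peMr// lerDl.
by rewrite E1 (FTCh cf dF i cF) /F mulr0 oppr0 expR0 mul1r addr0 sub0r opprK.
Qed.

Lemma bo_F : ip Ep dp = u 0.
Proof.
have := bo_P (lexx 0); rewrite oppr0 expR0 mul1r => <-.
by apply: eq_Int => y; rewrite add0r.
Qed.

Let I1 := \int[mu]_x (hp x * (expR (- (2 * x)) * ((1 + x) * u1 x ^+ 2))).
Let I2 := \int[mu]_x (hp x * (expR (- (2 * x)) * u x ^+ 2)).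
Let I3 := \int[mu]_x (hp x * (expR (- (2 * x)) * u x)).

Lemma bo_PP : ip (fun x => hp x * corr Ep dp x) (fun x => hp x * corr Ep dp x) = I2.
Proof.
apply: eq_Int => x; have [x0|x0] := leP 0 x; last by rewrite hp_neg// !mul0r.
by rewrite bo_P// hp_pos// exp2; ring.
Qed.

Let cst_le (x B : R) : 0 <= B -> 0 <= x -> B <= B * (1 + x).
Proof. by move=> B0 x0; rewrite ler_peMr// lerDl. Qed.

Let u_sq x : `|u x ^+ 2| <= C ^+ 2.
Proof. by rewrite normrX lerXn2r ?nnegrE// (bo_le cl). Qed.

Let u1_sq x : `|u1 x ^+ 2| <= C ^+ 2.
Proof. by rewrite normrX lerXn2r ?nnegrE// (bo_le1 cl). Qed.

Let uu1 x : `|u x * u1 x| <= C ^+ 2.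
Proof. by rewrite normrM expr2 ler_pM// ?(bo_le cl) ?(bo_le1 cl). Qed.

Let CC : 0 <= C ^+ 2. Proof. exact: sqr_ge0. Qed.

Let cM f g : continuous f -> continuous g -> continuous (fun x => f x * g x).
Proof. by move=> cf cg x; apply: cvgM; [exact: cf|exact: cg]. Qed.

Let cX f : continuous f -> continuous (fun x => f x ^+ 2).
Proof. by move=> cf; rewrite (_ : (fun x => _) = (fun x => f x * f x))//; exact: cM. Qed.

Let c1x : continuous (fun x : R => 1 + x).
Proof. by move=> x; apply: cvgD; [exact: cvg_cst|exact: cvg_id]. Qed.

Let i1 : rint (fun x => hp x * (expR (- (2 * x)) * ((1 + x) * u1 x ^+ 2))).
Proof.
apply: (@poly_exp (fun x => (1 + x) * u1 x ^+ 2) (C ^+ 2)) => //; first by apply: cM => //; exact: cX.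
move=> x x0; rewrite normrM mulrC (ger0_norm (_ : 0 <= 1 + x)); last by lra.
by rewrite ler_wpM2r//; lra.
Qed.

Let i2 : rint (fun x => hp x * (expR (- (2 * x)) * u x ^+ 2)).
Proof.
apply: (@poly_exp (fun x => u x ^+ 2) (C ^+ 2)) => //; first exact: cX.
by move=> x x0; apply: le_trans (u_sq _) (cst_le CC x0).
Qed.

Let i3 : rint (fun x => hp x * (expR (- (2 * x)) * u x)).
Proof.
apply: (@poly_exp u C) => // x x0.
by apply: le_trans (bo_le cl _) (cst_le C0 x0).
Qed.

Let i4 : rint (fun x => hp x * (expR (- (2 * x)) * (u x * u1 x))).
Proof.
apply: (@poly_exp (fun x => u x * u1 x) (C ^+ 2)) => //; first exact: cM.
by move=> x x0; apply: le_trans (uu1 _) (cst_le CC x0).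
Qed.

(** Since [d = P - P'], the product of [d] and [P] integrates to the squared norm of [P] plus half
    of [P 0 ^ 2], and [P 0] is the pairing of [Ep] with [dp]. *)
Lemma bo_dP : ip dp (corr Ep dp) =
 ip (fun x => hp x * corr Ep dp x) (fun x => hp x * corr Ep dp x) + 2^-1 * ip Ep dp ^+ 2.
Proof.
rewrite bo_PP bo_F.
pose F x := - (2^-1 * (expR (- (2 * x)) * u x ^+ 2)).
pose f x := expR (- (2 * x)) * u x ^+ 2 - expR (- (2 * x)) * (u x * u1 x).
have i : rint (fun x => hp x * f x).
 by apply: rint_eq (rintB i2 i4) => x; rewrite /f; ring.
have cf : continuous f.
 by move=> x; apply: cvgB; apply: cvgM; try exact: cexp; [exact: (cX cu)|exact: (cM cu cu1)].
have dF x : hasder F x (f x) by rewrite /F /f; der; field.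
have e : \int[mu]_x (hp x * f x) = 0 - F 0.
 apply: (FTCh cf dF i).
 - rewrite -oppr0; apply: cvgN; rewrite -(mulr0 2^-1); apply: cvgM; first exact: cvg_cst.
  apply: (@poly_exp_cvg0 (fun x => u x ^+ 2) (C ^+ 2)) => // x x0.
  by apply: le_trans (u_sq _) (cst_le CC x0).
transitivity (\int[mu]_x (hp x * (expR (- (2 * x)) * u x ^+ 2) + hp x * f x)).
 apply: eq_Int => x; rewrite /dp; have [x0|x0] := leP 0 x; last by rewrite hp_neg// !mul0r addr0.
 by rewrite hpd bo_P// /f /D exp2; ring.
by rewrite IntD// e /F mulr0 oppr0 expR0 -/I2; field.
Qed.

Let W := \int[mu]_x (hp x * ((1 + x) * d x * d x)).
Let ell := \int[mu]_x (hp x * ((1 + x) * hE x * d x)).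

Let I0 : rint (fun x => hp x * (expR (- (2 * x)) * 1)) /\
 \int[mu]_x (hp x * (expR (- (2 * x)) * 1)) = 2^-1.
Proof.
have i : rint (fun x => hp x * (expR (- (2 * x)) * 1)).
 apply: (@poly_exp (fun=> 1) 1) => // [x|x x0]; first exact: cvg_cst.
 by rewrite normr1 mul1r lerDl.
split=> //; pose F x : R := - (2^-1 * (expR (- (2 * x)) * 1)).
have c1 : continuous (fun x : R => expR (- (2 * x)) * 1).
 by move=> x; apply: cvgM; [exact: cexp|exact: cvg_cst].
have dF x : hasder F x (expR (- (2 * x)) * 1) by rewrite /F; der; field.
have cF : F x @[x --> +oo] --> 0.
 rewrite -oppr0; apply: cvgN; rewrite -(mulr0 2^-1); apply: cvgM; first exact: cvg_cst.
 by apply: (@poly_exp_cvg0 (fun=> 1) 1) => // x x0; rewrite normr1 mul1r lerDl.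
by rewrite (FTCh c1 dF i cF) /F mulr0 oppr0 expR0; field.
Qed.

Let i1x f : continuous f -> (forall x, `|f x| <= C ^+ 2) ->
 rint (fun x => hp x * (expR (- (2 * x)) * ((1 + x) * f x))).
Proof.
move=> cf fC; apply: (@poly_exp (fun x => (1 + x) * f x) (C ^+ 2)) => //; first exact: cM.
move=> x x0; rewrite normrM mulrC (ger0_norm (_ : 0 <= 1 + x)); last by lra.
by rewrite ler_wpM2r//; lra.
Qed.

(** In [(2 u - u') ^ 2] the cross term is integrated by parts against the weight, leaving the
    boundary value at 0. *)
Let E_W : W = 2 * u 0 ^+ 2 + 2 * I2 + I1.
Proof.
pose F x := - (2 * (expR (- (2 * x)) * ((1 + x) * u x ^+ 2))).
pose f x := 4 * (expR (- (2 * x)) * ((1 + x) * u x ^+ 2)) - 2 * (expR (- (2 * x)) * u x ^+ 2)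
 - 4 * (expR (- (2 * x)) * ((1 + x) * (u x * u1 x))).
have j1 := i1x (cX cu) u_sq; have j2 := i1x (cM cu cu1) uu1.
have i : rint (fun x => hp x * f x).
 apply: rint_eq (rintB (rintB (rintZ 4 j1) (rintZ 2 i2)) (rintZ 4 j2)) => x.
 by rewrite /f; ring.
have cf : continuous f.
 have k1 := cM (@cexp 2) (cM c1x (cX cu)).
 have k2 := cM (@cexp 2) (cX cu).
 have k3 := cM (@cexp 2) (cM c1x (cM cu cu1)).
 move=> x; apply: cvgB; [apply: cvgB|].
 - by apply: cvgM; [exact: cvg_cst|exact: k1].
 - by apply: cvgM; [exact: cvg_cst|exact: k2].
 - by apply: cvgM; [exact: cvg_cst|exact: k3].
have dF x : hasder F x (f x) by rewrite /F /f; der; field.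
have cF : F x @[x --> +oo] --> 0.
 rewrite -oppr0; apply: cvgN; rewrite -(mulr0 2); apply: cvgM; first exact: cvg_cst.
 apply: (@poly_exp_cvg0 (fun x => (1 + x) * u x ^+ 2) (C ^+ 2)) => // x x0.
 rewrite normrM mulrC (ger0_norm (_ : 0 <= 1 + x)); last by lra.
 by rewrite ler_wpM2r//; lra.
have e := FTCh cf dF i cF.
transitivity (\int[mu]_x (hp x * f x + (2 * (hp x * (expR (- (2 * x)) * u x ^+ 2)) +
  hp x * (expR (- (2 * x)) * ((1 + x) * u1 x ^+ 2))))).
 apply: eq_Int => x; have [x0|x0] := leP 0 x; last by rewrite hp_neg// !mul0r mulr0 !addr0.
 by rewrite (bo_eq cl) ger0_norm// /f exp2; ring.
have k2 := rintZ 2 i2.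
rewrite IntD//; last exact: rintD.
by rewrite IntD// IntZ// e /F mulr0 oppr0 expR0 -/I1 -/I2; ring.
Qed.

Let E_ell : ell = u 0 + I3.
Proof.
pose F x := - (expR (- (2 * x)) * ((1 + x) * u x)).
pose f x := 2 * (expR (- (2 * x)) * ((1 + x) * u x)) - expR (- (2 * x)) * u x
 - expR (- (2 * x)) * ((1 + x) * u1 x).
have bx g x : (forall x, `|g x| <= C) -> 0 <= x -> `|(1 + x) * g x| <= C * (1 + x).
 move=> gC x0; rewrite normrM mulrC (ger0_norm (_ : 0 <= 1 + x)); last by lra.
 by rewrite ler_wpM2r//; lra.
have j1 : rint (fun x => hp x * (expR (- (2 * x)) * ((1 + x) * u x))).
 apply: (@poly_exp (fun x => (1 + x) * u x) C) => //; first exact: cM.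
 by move=> x x0; apply: bx => //; exact: bo_le cl.
have j2 : rint (fun x => hp x * (expR (- (2 * x)) * ((1 + x) * u1 x))).
 apply: (@poly_exp (fun x => (1 + x) * u1 x) C) => //; first exact: cM.
 by move=> x x0; apply: bx => //; exact: bo_le1 cl.
have i : rint (fun x => hp x * f x).
 by apply: rint_eq (rintB (rintB (rintZ 2 j1) i3) j2) => x; rewrite /f; ring.
have cf : continuous f.
 have k1 := cM (@cexp 2) (cM c1x cu).
 have k2 := cM (@cexp 2) cu.
 have k3 := cM (@cexp 2) (cM c1x cu1).
 move=> x; apply: cvgB; [apply: cvgB|exact: k3]; last exact: k2.
 by apply: cvgM; [exact: cvg_cst|exact: k1].
have dF x : hasder F x (f x) by rewrite /F /f; der; field.
have cF : F x @[x --> +oo] --> 0.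
 rewrite -oppr0; apply: cvgN; apply: (@poly_exp_cvg0 (fun x => (1 + x) * u x) C C0) => x x0.
 by apply: bx => //; exact: bo_le cl.
have e := FTCh cf dF i cF.
transitivity (\int[mu]_x (hp x * f x + hp x * (expR (- (2 * x)) * u x))).
 apply: eq_Int => x; have [x0|x0] := leP 0 x; last by rewrite hp_neg// !mul0r !addr0.
 by rewrite (bo_eq cl) /hE ger0_norm// /f exp2; ring.
by rewrite IntD// e /F mulr0 oppr0 expR0 -/I3; ring.
Qed.

Let Jc c : rint (fun x => hp x * (expR (- (2 * x)) * (u x - c) ^+ 2)) /\
 \int[mu]_x (hp x * (expR (- (2 * x)) * (u x - c) ^+ 2)) = I2 - 2 * c * I3 + c ^+ 2 / 2.
Proof.
have [i0 e0] := I0.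
have k3 := rintZ (2 * c) i3; have k0 := rintZ (c ^+ 2) i0; have k23 := rintB i2 k3.
have E x : hp x * (expR (- (2 * x)) * (u x - c) ^+ 2) =
  (hp x * (expR (- (2 * x)) * u x ^+ 2) - (2 * c) * (hp x * (expR (- (2 * x)) * u x))) +
  c ^+ 2 * (hp x * (expR (- (2 * x)) * 1)) by ring.
split; first by apply: (@rint_eq _ _ _ mu _ _ (fun x => esym (E x))); exact: rintD.
transitivity (\int[mu]_x ((hp x * (expR (- (2 * x)) * u x ^+ 2) - (2 * c) * (hp x * (expR (- (2 * x)) * u x))) +
  c ^+ 2 * (hp x * (expR (- (2 * x)) * 1)))); first by apply: eq_Int => x; exact: E.
by rewrite IntD// IntB// !IntZ// e0.
Qed.

(* The total derivative of - e^(-2x) psi v^2, v = u - u(0), completes the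
 square in the weighted Poincare inequality below. *)
Let poincare : 11 / 5 * (I2 - 2 * u 0 * I3 + u 0 ^+ 2 / 2) <= I1.
Proof.
pose v x := u x - u 0.
have dv x : hasder v x (u1 x) by rewrite /v; der; ring.
have cv : continuous v := der_continuous dv.
have v_le x : `|v x| <= 2 * C.
 by apply: le_trans (ler_normB _ _) _; have := bo_le cl x; have := bo_le cl 0; lra.
have v_sq x : `|v x ^+ 2| <= 4 * C ^+ 2.
 rewrite normrX; have -> : 4 * C ^+ 2 = (2 * C) ^+ 2 by ring.
 by rewrite lerXn2r ?nnegrE// mulr_ge0.
have vu x : `|v x * u1 x| <= 2 * C ^+ 2.
 have -> : 2 * C ^+ 2 = (2 * C) * C by ring.
 by rewrite normrM ler_pM// (bo_le1 cl).
pose g x := (2 * psi x - psi1 x) * v x ^+ 2 - 2 * (psi x * (v x * u1 x)).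
pose F x := - (expR (- (2 * x)) * (psi x * v x ^+ 2)).
have cg : continuous g.
 move=> x; apply: cvgB; last by apply: cvgM; [exact: cvg_cst|exact: (cM cpsi (cM cv cu1))].
 apply: cvgM; last exact: (cX cv).
 by apply: cvgB; [apply: cvgM; [exact: cvg_cst|exact: cpsi]|exact: cpsi1].
have g_le x : 0 <= x -> `|g x| <= 500 * C ^+ 2 * (1 + x).
 move=> x0; apply: le_trans (ler_normB _ _) _.
 rewrite (normrM (2 * psi x - psi1 x)) (normrM 2) (normrM (psi x)) (ger0_norm (ler0n R 2)).
 have a1 : `|2 * psi x - psi1 x| <= 92 * (1 + x).
  apply: le_trans (ler_normB _ _) _; rewrite normrM (ger0_norm (_ : 0 <= 2 :> R))//.
  by have := psi_le x0; have := psi1_le x0; lra.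
 have a2 := ler_pM (normr_ge0 _) (normr_ge0 _) a1 (v_sq x).
 have a3 := ler_pM (normr_ge0 _) (normr_ge0 _) (psi_le x0) (vu x).
 apply: le_trans (lerD a2 (ler_wpM2l (ler0n R 2) a3)) _.
 have xC : 0 <= x * C ^+ 2 by rewrite mulr_ge0.
 have -> : 92 * (1 + x) * (4 * C ^+ 2) + 2 * (6 * (2 * C ^+ 2)) = 392 * C ^+ 2 + 368 * (x * C ^+ 2) by ring.
 have -> : 500 * C ^+ 2 * (1 + x) = 500 * C ^+ 2 + 500 * (x * C ^+ 2) by ring.
 by move: CC xC; move: (C ^+ 2) (x * C ^+ 2) => y z; lra.
have B0 : 0 <= 500 * C ^+ 2 := mulr_ge0 (ler0n R 500) CC.
have ig := poly_exp cg B0 g_le.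
have dF x : hasder F x (expR (- (2 * x)) * g x).
 by have dp' := der_psi x; rewrite /F /g; der; ring.
have cF : F x @[x --> +oo] --> 0.
 rewrite -oppr0; apply: cvgN; have B24 : 0 <= 24 * C ^+ 2 := mulr_ge0 (ler0n R 24) CC.
 apply: (@poly_exp_cvg0 (fun x => psi x * v x ^+ 2) (24 * C ^+ 2) B24).
 move=> x x0; rewrite normrM; apply: le_trans (ler_pM _ _ (psi_le x0) (v_sq x)) _ => //.
 have -> : 6 * (4 * C ^+ 2) = 24 * C ^+ 2 by ring.
 exact: cst_le.
have e := FTCh (cM (@cexp 2) cg) dF ig cF.
have F0 : F 0 = 0 by rewrite /F /v subrr; ring.
rewrite F0 subr0 in e.
have [iv ev] := Jc (u 0).
have k1 := rintZ (11 / 5) iv; have k2 := rintB i1 k1.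
suff : 0 <= \int[mu]_x (hp x * (expR (- (2 * x)) * ((1 + x) * u1 x ^+ 2)) -
  11 / 5 * (hp x * (expR (- (2 * x)) * (u x - u 0) ^+ 2)) + hp x * (expR (- (2 * x)) * g x)).
 by rewrite IntD// IntB// IntZ// e ev addr0 subr_ge0.
apply: Int_ge0 => x; have [x0|x0] := leP 0 x; last by rewrite hp_neg// !mul0r mulr0 subrr addr0.
rewrite hp_pos// !mul1r -/(v x).
have -> : expR (- (2 * x)) * ((1 + x) * u1 x ^+ 2) - 11 / 5 * (expR (- (2 * x)) * v x ^+ 2) +
  expR (- (2 * x)) * g x =
  expR (- (2 * x)) * (((1 + x) * u1 x - psi x * v x) ^+ 2 +
   ((1 + x) * (2 * psi x - psi1 x - 11 / 5) - psi x ^+ 2) * v x ^+ 2) / (1 + x).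
 by rewrite /g; field; rewrite gt_eqF//; lra.
rewrite divr_ge0//; last by lra.
rewrite mulr_ge0 ?expR_ge0// addr_ge0 ?sqr_ge0// mulr_ge0 ?sqr_ge0// subr_ge0.
exact: psi_riccati.
Qed.

Lemma bo_S2_class :
 4 * (ip (fun x => hp x * corr Ep dp x) (fun x => hp x * corr Ep dp x) + ip Ep dp ^+ 2) <=
 66 / 67 * \int[mu]_x (hp x * ((1 + x) * d x * d x)) +
 2 * (\int[mu]_x (hp x * ((1 + x) * hE x * d x))) ^+ 2.
Proof.
rewrite bo_PP bo_F -/W -/ell E_W E_ell.
have := poincare.
(* The measure has mass 1/2, so [2 * I3] is the mean of [u] and this is its variance. *)
have [_ e] := Jc (2 * I3).
have : 0 <= I2 - 2 * (2 * I3) * I3 + (2 * I3) ^+ 2 / 2.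
 rewrite -e; apply: Int_ge0 => x; rewrite mulr_ge0 ?hp_ge0// mulr_ge0 ?expR_ge0// sqr_ge0//.
by move=> ? ?; exact: class_num.
Qed.

End calculus.

End exponential_profile.

(** * Density of the explicit class in the form domain *)

Section class_density.
Implicit Types (d : R -> R) (k : R).

Definition Cl d : Prop := exists u u1 C, bo_class d u u1 C.

Lemma Cl_V d : Cl d -> VD w1 d.
Proof. by move=> [u [u1 [C cl]]]; exact: bo_V cl. Qed.

Lemma Cl_lin a b d d' : Cl d -> Cl d' -> Cl (lin a d b d').
Proof.
move=> [u [u1 [C cl]]] [v [v1 [C' cl']]].
exists (lin a u b v), (lin a u1 b v1), (`|a| * C + `|b| * C'); split.
- by move=> x; have du := bo_der cl; have dv := bo_der cl'; der; ring.
- by move=> x; apply: cvgD; apply: cvgM; try exact: cvg_cst; [exact: bo_cont cl x|exact: bo_cont cl' x].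
- move=> x; apply: le_trans (ler_normD _ _) _; rewrite !normrM.
 by apply: lerD; apply: ler_wpM2l => //; [exact: bo_le cl x|exact: bo_le cl' x].
- move=> x; apply: le_trans (ler_normD _ _) _; rewrite !normrM.
 by apply: lerD; apply: ler_wpM2l => //; [exact: bo_le1 cl x|exact: bo_le1 cl' x].
- by move=> x; rewrite (bo_eq cl) (bo_eq cl'); ring.
Qed.

Lemma hE_Cl : Cl hE.
Proof.
exists (fun=> 2^-1), (fun=> 0), 1; split=> x.
- exact: der_cst.
- exact: cvg_cst.
- by rewrite ger0_norm ?invr_ge0// invf_le1// ler1n.
- by rewrite normr0.
- by rewrite /hE; field.
Qed.

Lemma hE_V : VD w1 (hE : R -> R). Proof. exact: Cl_V hE_Cl. Qed.

(** The equation [2 u - u' = cos (k x)] has a trigonometric solution. These functions suffice for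
    density: a function orthogonal to all of them has a vanishing transform after multiplication by
    the weighted exponential. *)
Lemma hE_cos_Cl k : Cl (fun x => hE x * cos (k * x)).
Proof.
have k0 : 4 + k ^+ 2 != 0 by rewrite gt_eqF// ltr_pwDl// sqr_ge0.
pose C := 2 / (4 + k ^+ 2) + `|k / (4 + k ^+ 2)|; pose A := (2 + `|k|) * (1 + `|k|) / (4 + k ^+ 2).
have cs (a b x : R) : `|a * cos x - b * sin x| <= `|a| + `|b|.
 apply: le_trans (ler_normB _ _) _; rewrite !normrM.
 by apply: lerD; rewrite ler_piMr// ler_norml ?cos_geN1 ?cos_le1 ?sin_geN1 ?sin_le1.
pose B1 : R := `|2 / (4 + k ^+ 2)| + `|k / (4 + k ^+ 2)|.
pose B2 : R := `|- (k ^+ 2 / (4 + k ^+ 2))| + `|2 * k / (4 + k ^+ 2)|.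
have p1 : 0 <= B1 by rewrite addr_ge0.
have p2 : 0 <= B2 by rewrite addr_ge0.
exists (fun x => 2 / (4 + k ^+ 2) * cos (k * x) - k / (4 + k ^+ 2) * sin (k * x)),
 (fun x => - (k ^+ 2 / (4 + k ^+ 2)) * cos (k * x) - 2 * k / (4 + k ^+ 2) * sin (k * x)), (B1 + B2).
split.
- by move=> x; der; field.
- apply: (@der_continuous _ (fun x => k * (k ^+ 2 / (4 + k ^+ 2)) * sin (k * x) - k * (2 * k / (4 + k ^+ 2)) * cos (k * x))).
 by move=> x; der; ring.
- by move=> x; apply: le_trans (cs _ _ _) _; rewrite lerDl.
- by move=> x; apply: le_trans (cs _ _ _) _; rewrite lerDr.
- move=> x; have -> : cos (k * x) = cos (k * `|x|).
  by have [x0|x0] := leP 0 x; [rewrite ger0_norm|rewrite ltr0_norm// mulrN cosN].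
 by rewrite /hE; field.
Qed.

Lemma wn_q1 g : VD w1 g -> wn g = q w1 g g.
Proof.
move=> Vg; have [g2 hg] := VD_V1 Vg; have [_ <-] := wnE g2 hg.
by rewrite q_w1; apply: eq_Int => x; rewrite /w1; ring.
Qed.

Lemma sw_hE_le x : `|sw w1 x * hE x| <= 1.
Proof.
rewrite ger0_norm; last by rewrite mulr_ge0 ?sqrtr_ge0 ?expR_ge0.
rewrite -(ler_pXn2r (ltn0Sn 1)) ?nnegrE ?mulr_ge0 ?sqrtr_ge0 ?expR_ge0//.
rewrite expr1n exprMn (sw_sq _ w1_weight) /w1 /hE.
have h := expR_ge1Dx `|x|.
apply: le_trans (_ : expR `|x| * expR (- `|x|) ^+ 2 <= _).
 by rewrite ler_wpM2r// sqr_ge0.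
by rewrite expr2 mulrA -expRD subrr expR0 mul1r -expR0 ler_expR oppr_le0.
Qed.

(** Odd functions are adjoined because the density criterion lives in the whole of L^2; against an
    even target their contribution only increases the distance. *)
Let D g := exists d o, [/\ Cl d, sqint o, forall x, o (- x) = - o x & g = fun x => sw w1 x * d x + o x].

(** Orthogonality to odd functions makes [p] even. Multiplied by [sw w1 * hE], which vanishes
    nowhere, it is an integrable function with zero transform. *)
Let D_orth p : sqint p -> (forall g, D g -> ip p g = 0) -> {ae mu, forall x, p x = 0}.
Proof.
move=> p2 pD; have o2 := od_sqint p2; have e2 := ev_sqint p2.
have Z : Cl (fun=> 0).
 have := Cl_lin 0 0 hE_Cl hE_Cl; rewrite (_ : (fun x => _) = (fun=> 0))//.
 by apply/funext => x; ring.
have oo x : od p (- x) = - od p x by rewrite /od opprK; ring.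
have ee x : ev p (- x) = ev p x by rewrite /ev opprK addrC.
have split' x : p x = 1 * ev p x + 1 * od p x by rewrite /ev /od; field.
have pe : {ae mu, forall x, p x = ev p x}.
 have h : ip (od p) (od p) = 0.
  have <- : ip p (od p) = 0.
   apply: pD; exists (fun=> 0), (od p); split=> //.
   by apply/funext => x; rewrite mulr0 add0r.
  have -> : ip p (od p) = ip (lin 1 (ev p) 1 (od p)) (od p) by apply: eq_Int => x; rewrite -split'.
  rewrite ipl_lin// [ip (ev p) (od p)]ipE Int_odd; first by rewrite mulr0 add0r mul1r.
   exact: (rint_meas (sqint_mul e2 o2)).
  by move=> x; rewrite ee oo mulrN.
 by apply: filterS (ip_eq0 o2 h) => x ox; rewrite {1}split' ox; ring.
pose f x := ev p x * (sw w1 x * hE x).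
have hm : measR (fun x => sw w1 x * hE x) by exact: (sqint_meas (VD_sw hE_V)).
have mf : measR f by apply: mfunM => //; exact: (sqint_meas e2).
have f2 : sqint f.
 by apply: (sqint_le mf e2) => x; rewrite normrM ler_piMr// sw_hE_le.
have f1 : rint f by apply: sqint_mul => //; exact: VD_sw hE_V.
have fe x : f (- x) = f x by rewrite /f ee /sw /w1 /hE normrN.
have hf k : hint f k = 0.
 have ik (c : R -> R) : measR c -> (forall x, `|c x| <= 1) -> rint (fun x => f x * c x).
  move=> mc c1; apply: (rint_le _ (rint_norm f1)); first exact: mfunM.
  by move=> x; rewrite normrM ler_piMr.
 have mc : measR (fun x => cos (k * x)).
  by apply: continuous_measR; apply: (@der_continuous _ (fun x => - k * sin (k * x))) => x; der; ring.
 have ms : measR (fun x => sin (k * x)).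
  by apply: continuous_measR; apply: (@der_continuous _ (fun x => k * cos (k * x))) => x; der; ring.
 have ic := ik _ mc (fun x => ltac:(by rewrite ler_norml cos_geN1 cos_le1)).
 have is' := ik _ ms (fun x => ltac:(by rewrite ler_norml sin_geN1 sin_le1)).
 rewrite /hint (_ : \int[mu]_y _ = \int[mu]_x (f x * cos (k * x)) + \int[mu]_x (f x * sin (k * x))); last first.
  by rewrite -IntD//; apply: eq_Int => x; rewrite /cas (mulrC x); ring.
 rewrite (Int_odd (rint_meas is')); last by move=> x; rewrite fe mulrN sinN mulrN.
 have z : ip p (fun x => sw w1 x * (hE x * cos (k * x)) + 0) = 0.
  apply: pD; exists (fun x => hE x * cos (k * x)), (fun=> 0); split=> //.
  - exact: hE_cos_Cl.
  - exact: sqint0.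
  - by move=> x; rewrite oppr0.
 suff e : \int[mu]_x (f x * cos (k * x)) = ip p (fun x => sw w1 x * (hE x * cos (k * x)) + 0).
  by rewrite e z addr0 mulr0.
 apply: ae_Int.
 - exact: (rint_meas ic).
 - apply: mfunM; first exact: (sqint_meas p2).
  by apply: measurable_funD => //; under eq_fun do rewrite mulrA; exact: mfunM.
 - by apply: filterS pe => x ->; rewrite /f; ring.
have f0 : {ae mu, forall x, f x = 0}.
 apply: ip_eq0 => //; rewrite -Ht_norm// ipsE (@ae_Int _ _ _ _ _ (fun=> 0)) ?Rintegral_cst ?mul0r//.
  by apply: measurable_funX; exact: (sqint_meas (Ht_sq f2)).
 by apply: filterS (Ht_explicit f2 f1) => x ->; rewrite hf expr0n.
apply: filterS2 pe f0 => x -> fx.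
have h : sw w1 x * hE x != 0 by rewrite mulf_neq0// gt_eqF ?expR_gt0// (sw_gt0 _ w1_weight).
by move/eqP: fx; rewrite /f mulf_eq0 (negPf h) orbF => /eqP.
Qed.

Lemma Cl_dense g e : VD w1 g -> 0 < e -> exists d, Cl d /\ q w1 (lin 1 d (-1) g) (lin 1 d (-1) g) <= e.
Proof.
move=> Vg e0; have g2 := VD_sw Vg.
have D2 (k : R -> R) : D k -> sqint k.
 case=> d [ o [cd o2 _ ek]]; rewrite ek; apply: sqintD => //; exact: (VD_sw (Cl_V cd)).
have D0 : D (fun=> 0).
 exists (fun=> 0), (fun=> 0); split=> //.
 - have := Cl_lin 0 0 hE_Cl hE_Cl; rewrite (_ : (fun x => _) = (fun=> 0))//.
  by apply/funext => x; ring.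
 - exact: sqint0.
 - by move=> x; rewrite oppr0.
 - by apply/funext => x; ring.
have Dl a b (k k' : R -> R) : D k -> D k' -> D (fun x => a * k x + b * k' x).
 case=> d [ o [cd o2 oo ek]]; case=> d' [ o' [cd' o2' oo' ek']].
 exists (lin a d b d'), (lin a o b o'); split; [exact: Cl_lin|exact: sqint_lin| |].
  by move=> x; rewrite oo oo'; ring.
 by rewrite ek ek'; apply/funext => x; ring.
have [k [d [ o [cd o2 oo ek]]] le] := @dense_of_orth _ _ _ mu D D2 D0 Dl D_orth _ g2 _ e0.
rewrite ek in le; exists d; split=> //; apply: le_trans le.
have Vd := Cl_V cd; have Vl := VD_lin 1 (-1) Vd Vg; have l2 := VD_sw Vl.
have -> : sqdist (fun x => sw w1 x * g x) (fun x => sw w1 x * d x + o x) =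
 ip (fun x => sw w1 x * lin 1 d (-1) g x + o x) (fun x => sw w1 x * lin 1 d (-1) g x + o x).
 by apply: eq_Int => x; ring.
rewrite ipD_sq// qdef.
have -> : ip (fun x => sw w1 x * lin 1 d (-1) g x) o = 0.
 have i := sqint_mul l2 o2.
 have h : ip (fun x => sw w1 x * lin 1 d (-1) g x) o = - ip (fun x => sw w1 x * lin 1 d (-1) g x) o.
  rewrite {1}ipE -(Int_opp (rint_meas i)) -IntN//.
  apply: ae_Int.
  - exact: (@meas_opp (fun x => sw w1 x * lin 1 d (-1) g x * o x) (rint_meas i)).
  - exact: (rint_meas (rintN i)).
  - by apply: filterS2 (VD_even Vd) (VD_even Vg) => x -> ->; rewrite oo /sw /w1 normrN; ring.
 lra.
by rewrite mulr0 addr0 lerDl ip_ge0.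
Qed.

Lemma Cl_seq g : VD w1 g -> exists d : nat -> R -> R, [/\ forall n, Cl (d n),
 forall n, wn (d n) <= 2 * wn g + 2 &
 wn (fun x => 1 * d n x + -1 * g x) @[n --> \oo] --> 0].
Proof.
move=> Vg.
have h n : exists d, Cl d /\ q w1 (lin 1 d (-1) g) (lin 1 d (-1) g) <= n.+1%:R^-1.
 by apply: Cl_dense => //; rewrite invr_gt0.
have [d hd] := choice h; have Vd n : VD w1 (d n) by apply: Cl_V; case: (hd n).
have wle n : wn (fun x => 1 * d n x + -1 * g x) <= n.+1%:R^-1.
 by rewrite wn_q1; [case: (hd n)|exact: VD_lin].
exists d; split=> [n|n|]; first by case: (hd n).
 have l1 : wn (fun x => 1 * d n x + -1 * g x) <= 1.
  by apply: le_trans (wle n) _; rewrite invf_le1// ler1n.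
 have := q_ge0 w1 (lin 1 (d n) (-2) g).
 move: l1; rewrite !wn_q1//; last exact: VD_lin.
 rewrite !q_comb//; move: (q w1 (d n) (d n)) (q w1 (d n) g) (q w1 g g) => x y z; clear; lra.
apply: (@squeeze_cvgr _ _ _ _ (fun=> 0) (fun n => n.+1%:R^-1)).
- by near=> n; rewrite wn_ge0 wle.
- exact: cvg_cst.
- exact: cvg_harmonic.
Unshelve. all: by end_near. Qed.

Lemma wn_hp_le g : V1 g -> wn (fun x => hp x * g x) <= wn g.
Proof.
have le f : sqint f -> ip (fun x => hp x * f x) (fun x => hp x * f x) <= ip f f.
 move=> f2; rewrite !ipsE; apply: Int_le; try exact: sqint_sq.
  by apply: sqint_sq; exact: hp_sqint.
 by move=> x; rewrite exprMn expr2 hp_sq ler_piMl ?sqr_ge0// hpE; case: (0 <= x).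
move=> [g2 hg]; rewrite /wn.
have -> : (fun x => hs x * (hp x * g x)) = (fun x => hp x * (hs x * g x)) by apply/funext => x; ring.
by rewrite lerD// le.
Qed.

Lemma Ep_V1 : V1 (Ep : R -> R).
Proof.
have := hp_V1 (VD_V1 hE_V).
by rewrite (_ : (fun x => _) = Ep)//; apply/funext => x; exact: hp_hE.
Qed.

(** The exponential factorizes, so correlating [gp] with [Ep] gives back a multiple of [Ep], and one
    of the half-line terms collapses to the square of a pairing. *)
Lemma T_exp g : V1 g -> aeven g -> let gp := fun x => hp x * g x in
 T hE g g = 2 * hc * (2 * ip gp (corr Ep gp) + ip Ep gp ^+ 2).
Proof.
move=> Vg ge gp; have [g2 _] := Vg.
have he : aeven (hE : R -> R) by exact: VD_even hE_V.
rewrite (T_half (VD_sq hE_V) he Vg ge).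
have -> : (fun x => hp x * hE x) = Ep by apply/funext => x; exact: hp_hE.
have Vp : V1 gp by exact: hp_V1.
have [E2 _] := Ep_V1; have [p2 _] := Vp.
have i := sqint_mul E2 p2.
have e1 : ip Ep (corr gp gp) = ip gp (corr Ep gp) := corr_swap E2 Vp Vp.
suff e2 : ip gp (corr gp Ep) = ip Ep gp ^+ 2 by rewrite -/gp e1 e2.
transitivity (\int[mu]_x (ip Ep gp * (Ep x * gp x))); last by rewrite IntZ.
apply: eq_Int => x.
have [x0|x0] := leP 0 x; last by rewrite /gp /Ep hp_neg// !mul0r mulr0.
have -> : corr gp Ep x = Ep x * ip Ep gp.
 rewrite ipE -IntZ//; apply: eq_Int => y.
 rewrite /gp /Ep; have [y0|y0] := leP 0 y; last by rewrite (@hp_neg y)// !mul0r mulr0.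
 by rewrite !hp_pos ?addr_ge0// opprD expRD; ring.
by ring.
Qed.

Let hpdiff (d : nat -> R -> R) g : (forall n, VD w1 (d n)) -> VD w1 g ->
 wn (fun x => 1 * d n x + -1 * g x) @[n --> \oo] --> 0 ->
 wn (fun x => 1 * (hp x * d n x) + -1 * (hp x * g x)) @[n --> \oo] --> 0.
Proof.
move=> Vd Vg c; apply: (@squeeze_cvgr _ _ _ _ (fun=> 0) (fun n => wn (fun x => 1 * d n x + -1 * g x))) => //.
- near=> n; rewrite wn_ge0/=.
 have -> : (fun x => 1 * (hp x * d n x) + -1 * (hp x * g x)) = (fun x => hp x * (1 * d n x + -1 * g x)).
  by apply/funext => x; ring.
 by apply: wn_hp_le; exact: VD_V1 (VD_lin 1 (-1) (Vd n) Vg).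
- exact: cvg_cst.
Unshelve. all: by end_near. Qed.

Let wn_sqdist f g : sqdist f g <= wn (fun x => 1 * f x + -1 * g x).
Proof.
apply: le_trans (ip_le_wn _); apply: le_of_eq.
by apply: eq_Int => x; ring.
Qed.

Let wn_cvg_sqdist (u : nat -> R -> R) f : wn (fun x => 1 * u n x + -1 * f x) @[n --> \oo] --> 0 ->
 sqdist (u n) f @[n --> \oo] --> 0.
Proof.
move=> c; apply: (@squeeze_cvgr _ _ _ _ (fun=> 0) (fun n => wn (fun x => 1 * u n x + -1 * f x))) => //.
- by near=> n; rewrite sqdist_ge0 wn_sqdist.
- exact: cvg_cst.
Unshelve. all: by end_near. Qed.

(** The identity [bo_dP], carried from the explicit class to the whole form domain by continuity. *)
Lemma half_identity g : VD w1 g -> let gp := fun x => hp x * g x in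
 ip gp (corr Ep gp) = ip (fun x => hp x * corr Ep gp x) (fun x => hp x * corr Ep gp x) + 2^-1 * ip Ep gp ^+ 2.
Proof.
move=> Vg gp; have [d [cd wd c]] := Cl_seq Vg.
have Vd n : VD w1 (d n) by exact: Cl_V.
pose dp n x := hp x * d n x.
have Vdp n : V1 (dp n) by apply: hp_V1; exact: VD_V1 (Vd n).
have Vgp : V1 gp by apply: hp_V1; exact: VD_V1 Vg.
have cp := hpdiff Vd Vg c.
have cE : sqdist (corr Ep (dp n)) (corr Ep gp) @[n --> \oo] --> 0.
 apply: (@corr_cvg (fun=> Ep) dp Ep gp (wn Ep) (fun=> Ep_V1) Vdp Ep_V1 Vgp (fun=> lexx _) _ cp).
 rewrite (_ : wn _ = 0); first exact: cvg_cst.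
 have [E2 hE2] := Ep_V1; rewrite /wn !ipsE -[RHS]addr0.
 congr (_ + _).
  by rewrite (@eq_Int _ _ _ _ _ (fun=> 0)) ?Rintegral_cst ?mul0r// => x; ring.
 by rewrite (@eq_Int _ _ _ _ _ (fun=> 0)) ?Rintegral_cst ?mul0r// => x; ring.
have E1 := Ep_V1; have s1 n := corr_sqint E1 (Vdp n); have s2 := corr_sqint E1 Vgp.
have cd2 := wn_cvg_sqdist cp.
have d2 n : sqint (dp n) by case: (Vdp n).
have g2 : sqint gp by case: Vgp.
have a1 := ip_cvg2 d2 s1 g2 s2 cd2 cE.
have a2 : ip (fun x => hp x * corr Ep (dp n) x) (fun x => hp x * corr Ep (dp n) x) @[n --> \oo] -->
  ip (fun x => hp x * corr Ep gp x) (fun x => hp x * corr Ep gp x).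
 have cs : sqdist (fun x => hp x * corr Ep (dp n) x) (fun x => hp x * corr Ep gp x) @[n --> \oo] --> 0.
  have := @sqdist_scale_cvg _ _ hp 1 s1 s2 hp_le1 hp_meas cE.
  rewrite (_ : (fun x => hp x * corr Ep gp x) = (fun x => corr Ep gp x * hp x)); last by apply/funext => x; exact: mulrC.
  by rewrite (_ : (fun n => _) = (fun n => sqdist (fun x => corr Ep (dp n) x * hp x) (fun x => corr Ep gp x * hp x)))//;
   apply/funext => n; congr (sqdist _ _); apply/funext => x; exact: mulrC.
 by apply: ip_cvg2 => // [n|n||]; exact: hp_sqint.
have [E2 _] := E1.
have a3 : ip Ep (dp n) @[n --> \oo] --> ip Ep gp.
 rewrite (ipC mu Ep gp) (_ : (fun n => _) = (fun n => ip (dp n) Ep)); last by apply/funext => n; exact: ipC.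
 exact: ip_sqdist_cvg.
have a4 : ip (fun x => hp x * corr Ep (dp n) x) (fun x => hp x * corr Ep (dp n) x) +
  2^-1 * (ip Ep (dp n) * ip Ep (dp n)) @[n --> \oo] -->
  ip (fun x => hp x * corr Ep gp x) (fun x => hp x * corr Ep gp x) + 2^-1 * ip Ep gp ^+ 2.
 by rewrite expr2; apply: cvgD => //; apply: cvgM; [exact: cvg_cst|exact: cvgM].
apply: cvgn_uniq a1 a4 _ => n.
by have [u [u1 [C cl]]] := cd n; rewrite (bo_dP cl) expr2.
Qed.

(** On the explicit class this is the half-line inequality after doubling; density extends it. For
    the unnormalized profile the critical constant is [hc], so [66 / 67] leaves a gap, up to the
    direction of the profile. *)
Lemma bo_second_variation d : VD w1 d ->
 2 * T hE d d <= hc * (66 / 67) * q w1 d d + hc * q w1 hE d ^+ 2.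
Proof.
have cls d' : Cl d' -> 2 * T hE d' d' <= hc * (66 / 67) * q w1 d' d' + hc * q w1 hE d' ^+ 2.
 move=> cd; have Vd := Cl_V cd.
 rewrite T_exp; [|exact: VD_V1 Vd|exact: VD_even Vd].
 rewrite (half_identity Vd) (q_w1_half Vd Vd) (q_w1_half hE_V Vd).
 have [u [u1 [C cl]]] := cd; have := bo_S2_class cl.
 move: (ip _ _) (ip _ _) (\int[mu]_x _) (\int[mu]_x _) => b a e c h.
 have -> : 2 * (2 * hc * (2 * (a + 2^-1 * b ^+ 2) + b ^+ 2)) = 2 * hc * (4 * (a + b ^+ 2)) by field.
 have -> : hc * (66 / 67) * (2 * c) + hc * (2 * e) ^+ 2 = 2 * hc * (66 / 67 * c + 2 * e ^+ 2) by ring.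
 by rewrite ler_pM2l// mulr_gt0// hc_gt0.
move=> Vd; have [u [cu wu c]] := Cl_seq Vd.
have Vu n : VD w1 (u n) by exact: Cl_V.
have V1u n := VD_V1 (Vu n); have V1d := VD_V1 Vd.
have cc : sqdist (corr (u n) (u n)) (corr d d) @[n --> \oo] --> 0.
 by apply: (corr_cvg V1u V1u V1d V1d wu c c).
have s1 n := corr_sqint (V1u n) (V1u n); have s2 := corr_sqint V1d V1d.
have cT : T hE (u n) (u n) @[n --> \oo] --> T hE d d.
 rewrite Tdef (_ : (fun n => _) = (fun n => hc * ip (corr (u n) (u n)) hE)).
  rewrite ipC; apply: cvgM; first exact: cvg_cst.
  by apply: ip_sqdist_cvg => //; exact: VD_sq hE_V.
 by apply/funext => n; rewrite Tdef ipC.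
have cq' : q w1 (lin 1 (u n) (-1) d) (lin 1 (u n) (-1) d) @[n --> \oo] --> 0.
 rewrite (_ : (fun n => _) = (fun n => wn (fun x => 1 * u n x + -1 * d x)))//.
 by apply/funext => n; rewrite wn_q1//; exact: VD_lin.
have [c1 c2] := q_cvg Vu Vd hE_V cq'.
have L : 2 * T hE (u n) (u n) @[n --> \oo] --> 2 * T hE d d by apply: cvgM => //; exact: cvg_cst.
have Rr : hc * (66 / 67) * q w1 (u n) (u n) + hc * q w1 hE (u n) ^+ 2 @[n --> \oo] -->
  hc * (66 / 67) * q w1 d d + hc * q w1 hE d ^+ 2.
 rewrite qC (_ : (fun n => _) = (fun n => hc * (66 / 67) * q w1 (u n) (u n) + hc * (q w1 (u n) hE * q w1 (u n) hE))).
  by rewrite expr2; apply: cvgD; apply: cvgM => //; try exact: cvg_cst; exact: cvgM.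
 by apply/funext => n; rewrite (qC w1 hE) expr2.
apply: ler_cvg_to L Rr _; apply: nearW => n; exact: cls.
Qed.

End class_density.

(** * Stability of the exponential profile *)

Section bo_stability.
Implicit Types (k d : R -> R).

Lemma int_icc0 (x : R) : 0 <= x -> \int[mu]_y icc 0 x y = x.
Proof.
move=> x0; have := Int_icc2 x0 x0.
have -> : ip (icc 0 x) (icc 0 x) = \int[mu]_y icc 0 x y.
 by apply: eq_Int => y; rewrite -expr2 icc_sq.
by move=> ->; rewrite !subr0 sub0r subrr !normr0 normrN ger0_norm//; field.
Qed.

Lemma hp_icc (x y : R) : hp y * hp (x - y) = icc 0 x y.
Proof.
by rewrite !hpE iccE subr_ge0; case: (0 <= y); case: (y <= x); rewrite /= ?mulr1 ?mulr0.
Qed.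

Section quadrant.
Variable p : R -> R.
Hypothesis Vp : V1 p.
Hypothesis p_supp : forall x, hp x * p x = p x.

Let p2 : sqint p. Proof. by case: Vp. Qed.
Let mp : measR p. Proof. exact: sqint_meas p2. Qed.

(** The function [p (x + y)] on the quadrant. It is a tensor product [p x * p y] exactly when [p] is
    exponential there, so its distance to that product measures how far [p] is from an
    exponential. *)
Let S (z : R * R) : R := hp z.1 * (hp z.2 * p (z.1 + z.2)).
Let A := ip (fun x => hs x * p x) (fun x => hs x * p x).
Let B := ip p p.
Let tau := ip p (corr p p).

Let mhp1 : measR2 (fun z : R * R => hp z.1).
Proof. exact: (mfunC (f := hp) hp_meas measurable_fst). Qed.
Let mhp2 : measR2 (fun z : R * R => hp z.2).
Proof. exact: (mfunC (f := hp) hp_meas measurable_snd). Qed.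

Let mS : measR2 S.
Proof.
apply: mfunM => //; apply: mfunM => //.
by apply: mfunC mp _; apply: measurable_funD.
Qed.

(** The segment of the quadrant where [x + y = s] is parametrized by an interval of length [s],
    which accounts for the weight [s] on [p s ^ 2]. *)
Lemma shift_sq : sqint2 S /\ ip2 S S = A.
Proof.
have hA : sqint (fun x => hs x * p x) by case: Vp.
have mf : measR (fun x => p x ^+ 2) by exact: measurable_funX.
pose G (z : R * R) := icc 0 z.2 z.1 * p z.2 ^+ 2.
have mG : measR2 (fun z => (G z)%:E).
 apply/mEFinP; apply: mfunM; last first.
  exact: (mfunC (f := fun x => p x ^+ 2) mf measurable_snd).
 rewrite (_ : (fun z => _) = (fun z : R * R => hp z.1 * hp (z.2 - z.1))); last by apply/funext => z; rewrite hp_icc.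
 apply: mfunM => //; apply: (mfunC (f := hp)); first exact: hp_meas.
 exact: measurable_funB.
have G0 z : (0 <= (G z)%:E)%E by rewrite lee_fin mulr_ge0 ?sqr_ge0// iccE.
have e1 : (\int[mu]_x \int[mu]_y (G (x, y))%:E = A%:E)%E.
 rewrite (fubini_tonelli (m1 := mu) (m2 := mu) (fun z => (G z)%:E) mG G0).
 rewrite /A ipsE -IntE; last exact: sqint_sq.
 apply: eq_integral => y _.
 rewrite (_ : (\int[mu]_x _)%E = (p y ^+ 2 * \int[mu]_x icc 0 y x)%:E); last first.
  rewrite -IntZ; last exact: icc_rint.
  rewrite -IntE; last by apply: rintZ; exact: icc_rint.
  by apply: eq_integral => x _; rewrite /G mulrC.
 congr (_%:E); rewrite exprMn hs_sq; have [y0|y0] := leP 0 y.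
  by rewrite int_icc0// ger0_norm// mulrC.
 by rewrite -p_supp hp_neg// mul0r expr0n mul0r mulr0.
have e2 : (\int[mu]_x \int[mu]_y (S (x, y) ^+ 2)%:E = A%:E)%E.
 rewrite -e1; apply: eq_integral => x _.
 pose K (y : R) := (hp x * (hp (y - x) * p y ^+ 2))%:E.
 have mK : measR K.
  apply/mEFinP; apply: mfunM => //; apply: mfunM => //.
  by apply: (mfunC (f := hp)); [exact: hp_meas|exact: measurable_funB].
 have K0 y : (0 <= K y)%E by rewrite lee_fin; do 2 (apply: mulr_ge0; first exact: hp_ge0); exact: sqr_ge0.
 transitivity (\int[mu]_y K (1 * y + x)%R)%E.
  apply: eq_integral => y _; congr (_%:E); rewrite mul1r addrK /S/= !exprMn !expr2 !hp_sq.
  by rewrite (addrC x).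
 rewrite (ge0_integral_affine x (or_introl erefl) mK K0).
 by apply: eq_integral => y _; congr (_%:E); rewrite /G/= -hp_icc; ring.
have mS2 : measR2 (fun z => (S z ^+ 2)%:E) by apply/mEFinP; exact: measurable_funX.
have S0 z : (0 <= (S z ^+ 2)%:E)%E by rewrite lee_fin sqr_ge0.
have iS : rint2 (fun z => S z ^+ 2).
 apply: (@ge0_rintP _ _ _ mu2).
 - exact: measurable_funX.
 - by move=> z; exact: sqr_ge0.
 - by rewrite (fubini_tonelli1 (m1 := mu) (m2 := mu) (fun z => (S z ^+ 2)%:E) mS2 S0) e2 ltry.
split; first by split.
rewrite ipsE; have := IntE iS.
by rewrite (fubini_tonelli1 (m1 := mu) (m2 := mu) (fun z => (S z ^+ 2)%:E) mS2 S0) e2 => -[->].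
Qed.

Lemma pair_shift f k : sqint f -> V1 k -> (forall x, hp x * f x = f x) ->
 (forall x, hp x * k x = k x) ->
 ip2 (fun z => f z.1 * k z.2) S = ip f (corr k p).
Proof.
move=> f2 Vk fs ks; have i := rint_corr f2 Vk Vp; have [k2 _] := Vk.
transitivity (\int[mu2]_z (f z.1 * (k z.2 * p (z.1 + z.2)))).
 apply: eq_Int => z; rewrite /S -[in RHS](fs z.1) -[in RHS](ks z.2).
 by move: (hp z.1) (hp z.2) (f z.1) (k z.2) (p _) => *; ring.
rewrite -(Int_Fubini1 i); apply: eq_Int => x /=.
by rewrite IntZ//; apply: sqint_mul => //; exact: corr_sub.
Qed.

Lemma pair_cs f k : sqint f -> V1 k -> (forall x, hp x * f x = f x) ->
 (forall x, hp x * k x = k x) -> ip f (corr k p) ^+ 2 <= ip f f * ip k k * A.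
Proof.
move=> f2 Vk fs ks; have [k2 _] := Vk; have [S2 <-] := shift_sq.
rewrite -pair_shift// -(ip_tensor f2 k2 f2 k2).
by apply: cauchy_schwarz => //; exact: sqint_tensor.
Qed.

(** The last factor is the squared distance of [p (x + y)] to [p x * p y]. It is small for almost
    maximizers, and then every pairing with a tensor product almost factorizes. *)
Lemma pair_defect f k : sqint f -> V1 k -> (forall x, hp x * f x = f x) ->
 (forall x, hp x * k x = k x) ->
 (ip f (corr k p) - ip f p * ip k p) ^+ 2 <= ip f f * ip k k * (A + B ^+ 2 - 2 * tau).
Proof.
move=> f2 Vk fs ks; have [k2 _] := Vk; have [S2 eS] := shift_sq.
have t2 := sqint_tensor f2 k2; have pp2 := sqint_tensor p2 p2.
have R2 := sqintB S2 pp2.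
have -> : A + B ^+ 2 - 2 * tau = ip2 (fun z => S z - p z.1 * p z.2) (fun z => S z - p z.1 * p z.2).
 have e : ip2 S (fun z => p z.1 * p z.2) = tau.
  by rewrite ipC; exact: (pair_shift p2 Vp p_supp p_supp).
 by rewrite (ipB_sq S2 pp2) eS e (ip_tensor p2 p2 p2 p2) -/B; ring.
rewrite -(pair_shift f2 Vk fs ks) -(ip_tensor f2 k2 p2 p2).
rewrite -(ip_tensor f2 k2 f2 k2) -(ipBr S2 pp2 t2).
exact: cauchy_schwarz.
Qed.

Let F := ip Ep p.

Lemma corr_le_B x : corr p p x <= B.
Proof.
have s2 := corr_sub x p2; apply: le_trans (ler_norm _) _.
apply: le_trans (ip_le_half p2 s2) _.
have -> : ip (fun y => p (x + y)) (fun y => p (x + y)) = B.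
 rewrite /B !ipsE -[RHS](@Int_shift x (fun y => p y ^+ 2)); last exact: measurable_funX.
 by apply: eq_Int => y; rewrite addrC.
by rewrite -mulrDl; rewrite -[leRHS]mul1r le_eqVlt; apply/orP; left; apply/eqP; congr (_ * _); field.
Qed.

(** The overlap [F] with the exponential cannot be small if [tau] is not: below [X] the exponential
    is at least [expR (- X)], and the part beyond [X] has squared norm at most [A / X]. *)
Lemma mass_lower (X : R) : (forall x, 0 <= p x) -> 0 < X ->
 tau <= expR X * B * F + Num.sqrt (A / X * B * A).
Proof.
move=> p0 X0; have c2 := corr_sqint Vp Vp.
have [E2 _] := Ep_V1.
have B0 : 0 <= B by exact: ip_ge0.
pose a x := icc 0 X x * p x; pose b x := p x - a x.
have ma : measR a by apply: mfunM => //; exact: icc_meas.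
have a_le x : `|a x| <= `|p x|.
 by rewrite normrM iccE; case: (_ && _); rewrite ?normr1 ?normr0 ?mul1r ?mul0r.
have a2 : sqint a by exact: (sqint_le ma p2 a_le).
have b2 : sqint b by exact: sqintB.
have -> : tau = ip a (corr p p) + ip b (corr p p).
 by rewrite /tau -ipDl//; apply: eq_Int => x; rewrite /b; ring.
apply: lerD.
 have -> : expR X * B * F = \int[mu]_x (expR X * B * (Ep x * p x)).
  by rewrite IntZ//; exact: sqint_mul.
 apply: Int_le; [exact: sqint_mul|by apply: rintZ; exact: sqint_mul|].
 move=> x; apply: le_trans (_ : a x * B <= _).
  by rewrite ler_wpM2l ?corr_le_B// mulr_ge0// iccE.
 rewrite /a iccE; have [/andP[x0 xX]|_] := boolP (0 <= x <= X); last first.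
  by rewrite !mul0r !mulr_ge0 ?expR_ge0 ?hp_ge0.
 rewrite mul1r /Ep hp_pos// mul1r.
 have -> : expR X * B * (expR (- x) * p x) = expR X * expR (- x) * (p x * B) by ring.
 rewrite ler_peMl ?mulr_ge0// -expRD -[leLHS](@expR0 R) ler_expR subr_ge0//.
have bs x : hp x * b x = b x.
 by rewrite /b /a mulrBr p_supp mulrCA p_supp.
have h := pair_cs b2 Vp bs p_supp.
apply: le_trans (ler_norm _) _; rewrite -sqrtr_sqr ler_wsqrtr//; apply: le_trans h _.
have A0 : 0 <= A by exact: ip_ge0.
rewrite -/B; do 2 (rewrite ler_wpM2r//).
rewrite ler_pdivlMr// mulrC /A !ipsE -IntZ; last exact: sqint_sq.
have hA : sqint (fun x => hs x * p x) by case: Vp.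
apply: Int_le; [by apply: rintZ; exact: sqint_sq|exact: sqint_sq|].
move=> x; rewrite exprMn hs_sq /b /a iccE.
have [|] := boolP (0 <= x <= X); first by rewrite mul1r subrr expr0n mulr0 mulr_ge0 ?sqr_ge0.
rewrite mul0r subr0 negb_and -!ltNge => /orP[xn|Xx].
 by rewrite -p_supp hp_neg// mul0r expr0n !mulr0.
by rewrite ler_wpM2r ?sqr_ge0//; apply: le_trans (ltW Xx) (ler_norm _).
Qed.

(** The exponential on the half line convolved with itself is [x * expR (- x)]. *)
Lemma Ep_moment : ip Ep (corr Ep p) = \int[mu]_x (x * (Ep x * p x)).
Proof.
have VE := Ep_V1; have [E2 _] := VE; have mE := sqint_meas E2.
have Vn : V1 (fun y => Ep (- y) : R) by exact: V1_opp.
have [n2 _] := Vn.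
have -> : ip Ep (corr Ep p) = ip p (corr (fun y => Ep (- y)) Ep).
 rewrite (corr_swap p2 Vn VE) ipE -[RHS](@Int_opp (fun y => Ep (- y) * corr p Ep y)).
  by apply: eq_Int => y; rewrite opprK corr_reflect.
 by apply: mfunM; [exact: (sqint_meas n2)|exact: corr_meas].
apply: eq_Int => x; rewrite corr_oppl//.
have [x0|x0] := leP 0 x; last by rewrite /Ep hp_neg// -p_supp hp_neg// !mul0r mulr0.
have -> : \int[mu]_y (Ep y * Ep (x - y)) = expR (- x) * \int[mu]_y icc 0 x y.
 rewrite -IntZ; last exact: icc_rint.
 apply: eq_Int => y; rewrite -hp_icc /Ep.
 have -> : hp y * expR (- y) * (hp (x - y) * expR (- (x - y))) =
  (expR (- y) * expR (- (x - y))) * (hp y * hp (x - y)) by ring.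
 by rewrite -expRD; congr (expR _ * _); ring.
by rewrite int_icc0// /Ep hp_pos// mul1r; ring.
Qed.

End quadrant.

Lemma sqr_abs_le (e b : R) : 0 <= b -> e ^+ 2 <= b ^+ 2 -> - b <= e <= b.
Proof.
move=> b0 h; rewrite -ler_norml -(ger0_norm b0) -ler_sqr ?nnegrE//.
by rewrite !norm_sq.
Qed.

(** [A], [B] and [tau] are the weighted energy, the mass and the cubic term of the half-line
    function [p]; [F] is its overlap with the exponential; [N] and [G] are the squared norm of [P],
    the half-line restriction of [corr Ep p], and its pairing with [p]; [m] is the first moment
    against the exponential. All are pinned near their values at [p = Ep], within errors of order
    [k]. *)
Lemma bo_num (A B F N G m tau k F0 a r2 : R) : 0 < k -> k <= 4^-1 -> 0 <= a -> A = a ^+ 2 -> 0 <= B ->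
 A + B <= 3 / 4 -> 4^-1 - k ^+ 2 <= tau -> tau <= a * B -> r2 = A + B ^+ 2 - 2 * tau ->
 0 <= F -> F ^+ 2 <= B / 2 -> 0 <= N ->
 (G - B * F) ^+ 2 <= B / 2 * r2 -> (N - G * F) ^+ 2 <= N / 2 * r2 -> (m - F ^+ 2) ^+ 2 <= r2 / 4 ->
 G = N + 2^-1 * F ^+ 2 -> 0 < F0 -> F0 <= F ->
 3 / 4 - (10 / F0 + 2) * k <= F + m.
Proof.
move=> k0 k4 a0 -> B0 AB ht hab hr F_0 FB N0 h1 h2 h3 hG F00 FF.
have kk0 : 0 <= k ^+ 2 by exact: sqr_ge0.
have aB : a * B <= a * (3 / 4 - a ^+ 2) by apply: ler_wpM2l => //; lra.
(* [a (3/4 - a^2)] has its maximum 1/4 over [a >= 0] at [a = 1/2], where the defect has a double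
   root. *)
have q1 : (a - 2^-1) ^+ 2 <= k ^+ 2.
 apply: le_trans (_ : (a - 2^-1) ^+ 2 * (a + 1) <= _).
  by rewrite ler_peMr ?sqr_ge0// lerDr.
 have -> : (a - 2^-1) ^+ 2 * (a + 1) = 4^-1 - a * (3 / 4 - a ^+ 2) by field.
 lra.
have /andP[al au] := sqr_abs_le (ltW k0) q1.
have y2 : (a ^+ 2 - 4^-1) ^+ 2 <= 2 * k ^+ 2.
 have -> : (a ^+ 2 - 4^-1) ^+ 2 = (a - 2^-1) ^+ 2 * (a + 2^-1) ^+ 2 by field.
 have : (a + 2^-1) ^+ 2 <= (5 / 4) ^+ 2 by rewrite lerXn2r ?nnegrE//; lra.
 move=> h; have := ler_pM (sqr_ge0 _) (sqr_ge0 _) q1 h; lra.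
have BB : B ^+ 2 <= (3 / 4 - a ^+ 2) ^+ 2 by rewrite lerXn2r ?nnegrE//; lra.
have r4 : r2 <= 4 * k ^+ 2.
 have e : (3 / 4 - a ^+ 2) ^+ 2 = 2^-1 - a ^+ 2 + (a ^+ 2 - 4^-1) ^+ 2 by field.
 by rewrite hr; lra.
have Bl : 2^-1 - k <= B.
 have h : (2^-1 - k) * (2^-1 + k) <= B * (2^-1 + k).
  have -> : (2^-1 - k) * (2^-1 + k) = 4^-1 - k ^+ 2 by field.
  apply: le_trans ht _; apply: le_trans hab _; rewrite mulrC ler_wpM2l//; lra.
 by rewrite -(ler_pM2r (_ : 0 < 2^-1 + k))//; lra.
have Bu : B <= 2^-1 + k.
 have : (2^-1 - k) ^+ 2 <= a ^+ 2 by rewrite lerXn2r ?nnegrE//; lra.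
 have -> : (2^-1 - k) ^+ 2 = 4^-1 - k + k ^+ 2 by field.
 lra.
have A0 : 0 <= a ^+ 2 by exact: sqr_ge0.
have B34 : B <= 3 / 4 by lra.
have r20 : 0 <= r2 by have := sqr_ge0 (m - F ^+ 2); lra.
have e1 : - (5 / 4 * k) <= G - B * F <= 5 / 4 * k.
 apply: sqr_abs_le; first by lra.
 have : B / 2 * r2 <= 3 / 8 * (4 * k ^+ 2) by apply: ler_pM => //; lra.
 by rewrite exprMn; lra.
have F58 : F <= 5 / 8.
 rewrite -(ler_pXn2r (ltn0Sn 1)) ?nnegrE//; last by lra.
have FF0 : 0 <= F ^+ 2 by exact: sqr_ge0.
have BF : B * F <= 3 / 4 * (5 / 8) by apply: ler_pM.
have N1 : N <= 1 by case/andP: e1 => _; lra.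
have e2 : - (3 / 2 * k) <= N - G * F <= 3 / 2 * k.
 apply: sqr_abs_le; first by lra.
 have : N / 2 * r2 <= 2^-1 * (4 * k ^+ 2) by apply: ler_pM => //; lra.
 by rewrite exprMn; lra.
have e3 : - k <= m - F ^+ 2 <= k by apply: sqr_abs_le; [exact: ltW|lra].
case/andP: e1 => e1l e1u; case/andP: e2 => e2l e2u; case/andP: e3 => e3l e3u.
(* Without errors, [G = B F], [N = G F], [B = 1/2] and [G = N + F^2 / 2] force [F = 0] or [F = 1/2];
   the identity measures this with errors. *)
have key : F * (2^-1 - F) = (N - G * F) - (G - B * F) * (1 - F) - F * (1 - F) * (B - 2^-1).
 by rewrite hG; field.
have k1 : - (G - B * F) * (1 - F) <= 5 / 4 * k * 1.
 apply: le_trans (_ : 5 / 4 * k * (1 - F) <= _); [apply: ler_wpM2r; lra|apply: ler_wpM2l; lra].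
have k2 : - (F * (1 - F)) * (B - 2^-1) <= 1 * k.
 have f0 : 0 <= F * (1 - F) by apply: mulr_ge0; lra.
 have f1 : F * (1 - F) <= 1 by rewrite -[leRHS]mulr1; apply: ler_pM; lra.
 apply: le_trans (_ : F * (1 - F) * k <= _); last by apply: ler_wpM2r => //; exact: ltW.
 rewrite mulNr -mulrN; apply: ler_wpM2l => //; lra.
have small : F * (2^-1 - F) <= 4 * k.
 by rewrite key; move: k1 k2; rewrite !mulNr; lra.
(* The lower bound [F0] excludes the alternative [F = 0]. *)
have t_le : 2^-1 - F <= 4 * k / F0.
 have [FS|FS] := leP 2^-1 F.
  by apply: le_trans (_ : 0 <= _); [lra|rewrite divr_ge0//; lra].
 rewrite ler_pdivlMr//; apply: le_trans small; rewrite mulrC; apply: ler_wpM2r => //; lra.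
have -> : (10 / F0 + 2) * k = 10 / 4 * (4 * k / F0) + 2 * k by field; rewrite gt_eqF.
have p0 : 0 <= 4 * k / F0 by rewrite divr_ge0//; lra.
move: t_le p0; move: (4 * k / F0) => t t_le p0.
have := sqr_ge0 (F - 2^-1).
have -> : (F - 2^-1) ^+ 2 = F ^+ 2 - F + 4^-1 by field.
move: e3l; move: (F ^+ 2) => Z; lra.
Qed.

Lemma Ep_facts : [/\ ip Ep Ep = 2^-1 :> R, ip Ep (corr Ep Ep) = 4^-1 :> R &
 q w1 hE hE = 3 / 2 :> R].
Proof.
have [u [u1 [C cl]]] := hE_Cl.
pose dp x : R := hp x * hE x.
have dE : dp = Ep by apply/funext => x; exact: hp_hE.
have hcl : bo_class (hE : R -> R) (fun=> 2^-1) (fun=> 0) 1.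
 split=> x; [exact: der_cst|exact: cvg_cst| |by rewrite normr0|by rewrite /hE; field].
 by rewrite ger0_norm ?invr_ge0// invf_le1// ler1n.
have e1 : ip Ep Ep = 2^-1 :> R by have := bo_F hcl; rewrite -/dp dE.
have [E2 _] := Ep_V1.
split=> //.
 have P x : 0 <= x -> corr Ep Ep x = expR (- x) * 2^-1 :> R.
  by move=> x0; have := bo_P hcl x0; rewrite -/dp dE.
 transitivity (2^-1 * ip Ep Ep : R); last by rewrite e1; field.
 rewrite -IntZ; last exact: sqint_mul.
 apply: eq_Int => x; have [x0|x0] := leP 0 x; last by rewrite /Ep hp_neg// !mul0r mulr0.
 by rewrite P// /Ep hp_pos//; ring.
rewrite (q_w1_half hE_V hE_V).
pose f x : R := expR (- (2 * x)) * (1 + x); pose F x : R := - (expR (- (2 * x)) * (3 / 4 + x / 2)).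
have cf : continuous f.
 by apply: (@der_continuous _ (fun x => - (expR (- (2 * x)) * (1 + 2 * x)))) => x; rewrite /f; der; ring.
have dF x : hasder F x (f x) by rewrite /F /f; der; field.
have i : rint (fun x => hp x * f x).
 apply: (@hp_exp_rint _ 2); first exact: continuous_measR.
 move=> x x0; rewrite /f mulrC ger0_norm ?exp1D_le// mulr_ge0 ?expR_ge0//; lra.
have cF : F x @[x --> +oo] --> 0.
 rewrite -oppr0; apply: cvgN.
 rewrite (_ : (fun x => _) = (fun x => 3 / 4 * expR (- (2 * x)) + 2^-1 * (x * expR (- (2 * x))))).
  rewrite -[X in _ --> X](_ : 3 / 4 * 0 + 2^-1 * 0 = 0 :> R); last by ring.
  by apply: cvgD; apply: cvgM; try exact: cvg_cst; [exact: expR_cvg0|exact: xexpR_cvg0].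
 by apply/funext => x; field.
rewrite (_ : \int[mu]_x _ = \int[mu]_x (hp x * f x)).
 by rewrite (FTCh cf dF i cF) /F mulr0 oppr0 expR0; field.
apply: eq_Int => x; have [x0|x0] := leP 0 x; last by rewrite hp_neg// !mul0r.
rewrite /f /hE ger0_norm// (_ : - (2 * x) = - x + - x); last by ring.
by rewrite expRD; ring.
Qed.

Lemma T3_half g : V1 g -> aeven g -> let gp := fun x => hp x * g x in
 T3 g = 6 * hc * ip gp (corr gp gp).
Proof.
move=> Vg ge gp; have [g2 _] := Vg; rewrite /T3 (T_half g2 ge Vg ge) -/gp.
by move: (ip _ _) => t; ring.
Qed.

(** The cubic form is [6 * hc * tau], and [A + B <= 3 / 4] is the energy constraint on the half
    line. An almost maximal [tau] makes the tensor defect small, and pairings of that defect with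
    [p], [Ep] and [P] feed the numerical lemma. *)
Lemma bo_profile_stability e : 0 < e -> exists2 d, 0 < d & forall g, VD w1 g -> (forall x, 0 <= g x) ->
 q w1 g g <= 3 / 2 -> 3 / 2 * hc - d <= T3 g -> 3 / 2 - e <= q w1 g hE.
Proof.
(* The cut [X = 108] makes the tail term of [mass_lower] at most 1/16, because
   [(3/4)^3 / 108 = (1/16)^2]; then [expR 108 * (3 / 4) * F >= 1 / 16]. *)
move=> e0; pose F0 : R := expR (- 108) / 12.
have F00 : 0 < F0 by rewrite divr_gt0 ?expR_gt0.
have L0 : 0 < 2 * (10 / F0 + 2) by rewrite mulr_gt0// addr_gt0// divr_gt0.
pose k := Order.min 4^-1 (e / (2 * (10 / F0 + 2))).
have k0 : 0 < k by rewrite lt_min; apply/andP; split; [rewrite invr_gt0|exact: divr_gt0].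
have [k4 ke] : k <= 4^-1 /\ k <= e / (2 * (10 / F0 + 2)) by rewrite !ge_min !lexx orbT.
have kk : k ^+ 2 <= 16^-1 by rewrite expr2; apply: le_trans (ler_pM (ltW k0) (ltW k0) k4 k4) _; lra.
exists (6 * hc * k ^+ 2); first by rewrite !mulr_gt0 ?hc_gt0 ?exprn_gt0.
move=> g Vg g0 qg Tg; have V1g := VD_V1 Vg; have ge := VD_even Vg.
pose p x := hp x * g x.
have Vp : V1 p by exact: hp_V1.
have ps x : hp x * p x = p x by rewrite /p mulrA hp_sq.
have p0 x : 0 <= p x by rewrite mulr_ge0 ?hp_ge0.
have [p2 hp2] := Vp; have VE := Ep_V1; have [E2 _] := VE.
have Es x : hp x * Ep x = Ep x by rewrite /Ep mulrA hp_sq.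
have [EE _ _] := Ep_facts.
pose A := ip (fun x => hs x * p x) (fun x => hs x * p x); pose B := ip p p.
pose F := ip Ep p; pose tau := ip p (corr p p).
have c2 := corr_sqint VE Vp.
pose P x := hp x * corr Ep p x; have P2 : sqint P by exact: hp_sqint.
have Ps x : hp x * P x = P x by rewrite /P mulrA hp_sq.
have AB : A + B <= 3 / 4.
 have : q w1 g g = 2 * (A + B).
  rewrite (q_w1_half Vg Vg); congr (2 * _).
  have [_ e1] := wnE p2 hp2; rewrite [RHS]addrC -[RHS]/(wn p) -e1.
  apply: eq_Int => x; rewrite /p; have [x0|x0] := leP 0 x; last by rewrite hp_neg// !mul0r expr0n mulr0.
  by rewrite ger0_norm// hp_pos//; ring.
 by lra.
have tl : 4^-1 - k ^+ 2 <= tau.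
 have := T3_half V1g ge; rewrite -/p -/tau => eT; rewrite eT in Tg.
 rewrite -(ler_pM2l (_ : 0 < 6 * hc)) ?mulr_gt0 ?hc_gt0//.
 by apply: le_trans Tg; apply: le_of_eq; field.
have A0 : 0 <= A by exact: ip_ge0.
have B0 : 0 <= B by exact: ip_ge0.
have F_0 : 0 <= F by apply: Int_ge0 => x; rewrite !mulr_ge0 ?hp_ge0 ?expR_ge0.
have a2 : A = Num.sqrt A ^+ 2 by rewrite sqr_sqrtr.
have ta : tau <= Num.sqrt A * B.
 apply: le_trans (ler_norm _) _; rewrite -sqrtr_sqr.
 apply: le_trans (ler_wsqrtr (pair_cs Vp ps p2 Vp ps ps)) _.
 rewrite -/A -/B sqrtrM ?mulr_ge0// mulrC -expr2 sqrtr_sqr ger0_norm//.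
have d1 := pair_defect Vp ps p2 VE ps Es.
have d2 := pair_defect Vp ps P2 VE Ps Es.
have d3 := pair_defect Vp ps E2 VE Es Es.
have FB : F ^+ 2 <= B / 2.
 by apply: le_trans (cauchy_schwarz E2 p2) _; rewrite EE mulrC.
have hid := half_identity Vg; rewrite -/p -/P in hid.
have PP : ip P (corr Ep p) = ip P P.
 by apply: eq_Int => x; rewrite -{1}(Ps x) /P; ring.
have Pp : ip P p = ip p (corr Ep p).
 by apply: eq_Int => x; rewrite /P -[in RHS]ps; ring.
rewrite PP Pp EE -/A -/B -/tau -/F in d2; rewrite EE -/A -/B -/tau -/F in d1 d3.
have FF : F0 <= F.
 have X0 : 0 < 108 :> R by [].
 have := mass_lower Vp ps p0 X0; rewrite -/A -/B -/tau -/F => h.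
 have A34 : A <= 3 / 4 by lra.
 have B34 : B <= 3 / 4 by lra.
 have s16 : Num.sqrt (A / 108 * B * A) <= 16^-1.
  rewrite -(ger0_norm (_ : 0 <= 16^-1 :> R)) ?invr_ge0// -sqrtr_sqr ler_wsqrtr//.
  have := ler_pM A0 A0 A34 A34 => h1.
  have := ler_pM (mulr_ge0 A0 A0) B0 h1 B34 => h2.
  have -> : A / 108 * B * A = A * A * B / 108 by field.
  by rewrite ler_pdivrMr// (_ : 16^-1 ^+ 2 * 108 = 3 / 4 * (3 / 4) * (3 / 4)) //; field.
 have h3 : expR 108 * B * F <= expR 108 * (3 / 4) * F.
  by rewrite ler_wpM2r// ler_wpM2l// expR_ge0.
 have h4 : 16^-1 <= expR 108 * (3 / 4) * F by lra.
 have : expR (- 108) * 16^-1 <= expR (- 108) * (expR 108 * (3 / 4) * F) by rewrite ler_pM2l ?expR_gt0.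
 have -> : expR (- 108) * (expR 108 * (3 / 4) * F) = expR (- 108) * expR 108 * (3 / 4 * F) by ring.
 by rewrite -expRD addNr expR0 mul1r /F0; move: (expR _) => z; lra.
have -> : q w1 g hE = 2 * (F + ip Ep (corr Ep p)).
 rewrite qC (q_w1_half hE_V Vg); congr (2 * _).
 rewrite (Ep_moment Vp ps) /F ipE.
 have j : rint (fun x => x * (Ep x * p x)).
  apply: (@rint_eq _ _ _ mu (fun x => (hs x * Ep x) * (hs x * p x))); last by apply: sqint_mul => //; case: VE.
  move=> x; have -> : hs x * Ep x * (hs x * p x) = hs x ^+ 2 * (Ep x * p x) by ring.
  rewrite hs_sq; have [x0|x0] := leP 0 x; first by rewrite ger0_norm.
  by rewrite /Ep hp_neg// !mul0r !mulr0.
 rewrite -IntD//; last exact: sqint_mul.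
 apply: eq_Int => x; have -> : Ep x * p x = hp x * (hE x * g x) by rewrite -hp_hE /p mulrACA hp_sq.
 ring.
have N0 : 0 <= ip P P by exact: ip_ge0.
have h1 : (ip p (corr Ep p) - B * F) ^+ 2 <= B / 2 * (A + B ^+ 2 - 2 * tau) by [].
have h2 : (ip P P - ip p (corr Ep p) * F) ^+ 2 <= ip P P / 2 * (A + B ^+ 2 - 2 * tau) by [].
have h3 : (ip Ep (corr Ep p) - F ^+ 2) ^+ 2 <= (A + B ^+ 2 - 2 * tau) / 4.
 by apply: le_trans d3 _; apply: le_of_eq; field.
have := bo_num k0 k4 (sqrtr_ge0 _) a2 B0 AB tl ta erefl F_0 FB N0 h1 h2 h3 hid F00 FF.
move: ke; rewrite ler_pdivlMr// => ke; move: (F + _) => y; lra.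
Qed.

Definition bo_r : R := Num.sqrt (2 / 3).

Lemma bo_base : base w1 1 (lin bo_r hE 0 hE) (bo_r * hc).
Proof.
have r2 : bo_r ^+ 2 = 2 / 3 by rewrite sqr_sqrtr// divr_ge0.
have r0 : 0 < bo_r by rewrite sqrtr_gt0 divr_gt0.
have Vh := hE_V; have [EE EEE qh] := Ep_facts.
have Th : T3 hE = 3 / 2 * hc :> R.
 rewrite (T3_half (VD_V1 Vh) (VD_even Vh)).
 have -> : (fun x : R => hp x * hE x) = Ep by apply/funext => x; exact: hp_hE.
 by rewrite EEE; field.
split.
- exact: w1_weight.
- exact: VD_lin.
- by rewrite q_scale// r2 qh; field.
- rewrite T3_scale; [|exact: VD_V1 Vh|exact: VD_even Vh].
 by rewrite Th exprSr r2; field.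
- by rewrite mulr_gt0 ?hc_gt0.
- move=> e e0; have [d d0 hd] := bo_profile_stability e0.
 exists (bo_r ^+ 3 * d); first by rewrite mulr_gt0 ?exprn_gt0.
 move=> g Vg g0 qg Tg; pose g' := lin bo_r^-1 g 0 g.
 have Vg' : VD w1 g' by exact: VD_lin.
 have hq : 3 / 2 - e <= q w1 g' hE.
  apply: hd => //.
  + by move=> x; rewrite /g' mul0r addr0 mulr_ge0// invr_ge0 ltW.
  + by rewrite q_scale// exprVn r2 invf_div ler_piMr.
  + rewrite T3_scale; [|exact: VD_V1 Vg|exact: VD_even Vg].
   rewrite exprVn ler_pdivlMl ?exprn_gt0//; apply: le_trans Tg.
   by rewrite mulrBr exprSr r2 le_eqVlt; apply/orP; left; apply/eqP; field.
 have -> : q w1 g (lin bo_r hE 0 hE) = 2 / 3 * q w1 g' hE.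
  rewrite q_linr// q_linl// !mul0r !addr0 -r2; field; exact: lt0r_neq0.
 lra.
- exists (bo_r * hc / 67), (bo_r^-1 * hc); split; first by rewrite divr_gt0// mulr_gt0 ?hc_gt0.
 move=> d Vd; have := bo_second_variation Vd.
 have V1d := VD_V1 Vd; have sh := VD_sq Vh.
 rewrite (T_lin _ _ sh sh V1d V1d) (q_linl _ _ Vh Vh Vd) !mul0r !addr0.
 move=> /(ler_wpM2l (ltW r0)) h.
 apply: le_trans (_ : bo_r * (2 * T hE d d) <= _).
  by apply: le_of_eq; ring.
 apply: le_trans h _; apply: le_of_eq.
 by field; exact: lt0r_neq0.
Qed.

End bo_stability.

(** * Functions of class H^1 and derivatives under the transform *)

Lemma FTCab f F a b : a <= b -> (forall x, a <= x <= b -> {for x, continuous f}) ->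
 (forall x, a <= x <= b -> hasder F x (f x)) ->
 rint (fun x => icc a b x * f x) /\ \int[mu]_x (icc a b x * f x) = F b - F a.
Proof.
move=> ab cf dF.
have wc : {within `[a, b], continuous f}.
 by apply: continuous_in_subspaceT => x; rewrite inE/= in_itv/=; exact: cf.
split.
 apply/(@rint_indic f `[a, b]) => //.
 by apply: continuous_compact_integrable => //; exact: segment_compact.
rewrite -Int_icc; have [->|nab] := eqVneq a b.
 by rewrite set_itv1 Rintegral_set1 subrr.
have ab' : a < b by rewrite lt_neqAle nab.
rewrite /Rintegral (@continuous_FTC2 _ f F a b)//.
- split.
 + move=> x; rewrite in_itv/= => /andP[ax xb]; apply: (@der_derivable _ _ (f x)).
  by apply: dF; rewrite !ltW.
 + by apply: cvg_at_right_filter; apply: (@der_at_continuous _ _ (f a)); apply: dF; rewrite lexx ab.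
 + by apply: cvg_at_left_filter; apply: (@der_at_continuous _ _ (f b)); apply: dF; rewrite lexx ab.
- move=> x; rewrite in_itv/= => /andP[ax xb]; apply: der_derive1.
 by apply: dF; rewrite !ltW.
Qed.

Lemma icc_hp_cvg a x : icc a n%:R x @[n --> \oo] --> hp (x - a).
Proof.
have : (fun n : nat => hp (x - a)) @ \oo --> hp (x - a) by exact: cvg_cst.
apply: cvg_trans; apply: near_eq_cvg; near=> n.
rewrite hpE subr_ge0 iccE (_ : x <= n%:R) ?andbT//.
by near: n; exact: nbhs_infty_ger.
Unshelve. all: by end_near. Qed.

Lemma FTCn f F a l : (forall x, a <= x -> {for x, continuous f}) ->
 (forall x, a <= x -> hasder F x (f x)) -> rint (fun x => hp (x - a) * f x) ->
 F n%:R @[n --> \oo] --> l -> \int[mu]_x (hp (x - a) * f x) = l - F a.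
Proof.
move=> cf dF i cF; have mi := rint_meas i.
have [N0 hN0] : exists N0 : nat, a <= N0%:R.
 by exists (Num.bound `|a|); apply: le_trans (ler_norm _) _; exact: ltW (archi_boundP (normr_ge0 a)).
pose m n := (n + N0)%N.
have am n : a <= (m n)%:R by apply: le_trans hN0 _; rewrite ler_nat leq_addl.
have h n := @FTCab f F a (m n)%:R (am n) (fun x hx => cf x (proj1 (andP hx))) (fun x hx => dF x (proj1 (andP hx))).
have e n : \int[mu]_x (icc a (m n)%:R x * f x) = F (m n)%:R - F a by case: (h n).
have cm (G : nat -> R) (L : R) : G n @[n --> \oo] --> L -> G (m n) @[n --> \oo] --> L.
 by move=> c; have := cvg_comp (fun n : nat => (n + N0)%N) G (cvg_addnr N0) c; exact.
have [_ c] : rint (fun x => hp (x - a) * f x) /\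
  \int[mu]_x (icc a (m n)%:R x * f x) @[n --> \oo] --> \int[mu]_x (hp (x - a) * f x).
 apply: (@dct _ _ _ mu (fun n x => icc a (m n)%:R x * f x) _ (fun x => `|hp (x - a) * f x|)).
 - by move=> n; case: (h n) => /rint_meas.
 - exact: mi.
 - exact: rint_norm.
 - move=> n x; rewrite !normrM ler_wpM2r// iccE hpE subr_ge0.
  by case: (a <= x) => //=; rewrite ?normr0//; case: (x <= _); rewrite ?normr1 ?normr0.
 - apply: aeW => x; apply: cvgM; last exact: cvg_cst.
  exact: (cm (fun n => icc a n%:R x)) (@icc_hp_cvg a x).
apply: cvgn_uniq c _ e; apply: cvgB; last exact: cvg_cst.
exact: (cm (fun n => F n%:R)).
Qed.

(** The value [f n ^ 2] is bounded by the integral over [[n, n + 1]] of an integrable function,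
    which tends to 0. Convergence along the integers is all that boundary terms require. *)
Lemma H1_vanish f f1 : (forall x, hasder f x (f1 x)) -> continuous f1 -> sqint f -> sqint f1 ->
 f n%:R @[n --> \oo] --> 0.
Proof.
move=> df cf1 f2 f12; have cf := der_continuous df.
pose B x := 2 * f x ^+ 2 + f1 x ^+ 2.
have iB : rint B by apply: rintD; [apply: rintZ; exact: sqint_sq|exact: sqint_sq].
have [_ c0] : rint (fun=> 0) /\ \int[mu]_x (icc n%:R n.+1%:R x * B x) @[n --> \oo] --> \int[mu]_x 0.
 apply: (@dct _ _ _ mu (fun n x => icc n%:R n.+1%:R x * B x) (fun=> 0) (fun x => `|B x|)).
 - by move=> n; apply: mfunM; [exact: icc_meas|exact: (rint_meas iB)].
 - by [].
 - exact: rint_norm.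
 - move=> n x; rewrite normrM ler_piMl// iccE; case: (_ <= _ <= _); by rewrite ?normr1 ?normr0.
 - apply: aeW => x; have : (fun n : nat => 0 : R) @ \oo --> 0 by exact: cvg_cst.
  apply: cvg_trans; apply: near_eq_cvg; near=> n.
  rewrite iccE (_ : n%:R <= x = false) ?mul0r//.
  by apply/negbTE; rewrite -ltNge; near: n; exact: nbhs_infty_gtr.
rewrite Rintegral_cst// mul0r in c0.
have le n : f n%:R ^+ 2 <= \int[mu]_x (icc n%:R n.+1%:R x * B x).
 (* The affine cutoff vanishes at the right end, so only the value at [n] survives. *)
 pose F y := - ((n.+1%:R - y) * f y ^+ 2).
 pose g y := f y ^+ 2 - 2 * ((n.+1%:R - y) * (f y * f1 y)).
 have nn : n%:R <= n.+1%:R :> R by rewrite ler_nat.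
 have dF y : hasder F y (g y) by rewrite /F /g; der; ring.
 have cg : continuous g.
  move=> y; apply: cvgB; first by under eq_fun do rewrite expr2; apply: cvgM; exact: cf.
  apply: cvgM; first exact: cvg_cst.
  apply: cvgM; first by apply: cvgB; [exact: cvg_cst|exact: cvg_id].
  by apply: cvgM; [exact: cf|exact: cf1].
 have [i e] := FTCab nn (fun x _ => cg x) (fun x _ => dF x).
 have -> : f n%:R ^+ 2 = \int[mu]_x (icc n%:R n.+1%:R x * g x).
  by rewrite e /F subrr -natr1; ring.
 apply: Int_le => //.
  apply: (rint_le _ (rint_norm iB)).
   by apply: mfunM; [exact: icc_meas|exact: (rint_meas iB)].
  by move=> x; rewrite normrM ler_piMl// iccE; case: (_ <= _ <= _); rewrite ?normr1 ?normr0.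
 move=> y; rewrite iccE; have [/andP[y0 y1]|_] := boolP (n%:R <= y <= n.+1%:R); last by rewrite !mul0r.
 rewrite !mul1r /g /B.
 have t0 : 0 <= n.+1%:R - y by rewrite subr_ge0.
 have t1 : n.+1%:R - y <= 1 by rewrite -natr1; lra.
 move: t0 t1; move: (n.+1%:R - y) (f y) (f1 y) => t p p1 t0 t1.
 have := sqr_ge0 (p + p1); have := sqr_ge0 (p - p1).
 have := sqr_ge0 p; have := sqr_ge0 p1; rewrite sqrrB sqrrD.
 have : - (t * (p * p1)) <= `|p * p1|.
  by apply: le_trans (ler_norm _) _; rewrite normrN normrM ler_piMl// ger0_norm.
 by case: (ler0P (p * p1)) => _; move: (p ^+ 2) (p1 ^+ 2) (t * (p * p1)); rewrite !mulr2n => *; lra.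
have cs : f n%:R ^+ 2 @[n --> \oo] --> 0.
 apply: (@squeeze_cvgr _ _ _ _ (fun=> 0) (fun n => \int[mu]_x (icc n%:R n.+1%:R x * B x))) => //.
 - by near=> n; rewrite sqr_ge0 le.
 - exact: cvg_cst.
apply: norm_cvg0; rewrite (_ : (fun n => _) = (fun n => Num.sqrt (f n%:R ^+ 2))); last first.
 by apply/funext => n; rewrite sqrtr_sqr.
rewrite -[X in _ --> X](sqrtr0 R); apply: (@cvg_comp _ _ _ _ (fun y : R => Num.sqrt y)) cs _.
exact: sqrt_continuous.
Unshelve. all: by end_near. Qed.

(* The transform turns a derivative into a multiplication. *)
Lemma hint_der f f1 xi : (forall x, hasder f x (f1 x)) -> continuous f1 -> rint f -> rint f1 ->
 f n%:R @[n --> \oo] --> 0 -> f (- n%:R) @[n --> \oo] --> 0 ->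
 hint f1 xi = - xi * hint f (- xi).
Proof.
move=> df cf1 i i1 cp cm; have cf := der_continuous df.
pose g x := f1 x * cas (x * xi) + xi * (f x * cas (x * - xi)).
pose F x := f x * cas (x * xi).
have ca (k : R) : continuous (fun x => cas (x * k)).
 by apply: (@der_continuous _ (fun x => k * (cos (x * k) - sin (x * k)))) => x; rewrite /cas; der; ring.
have dF x : hasder F x (g x) by rewrite /F /g /cas mulrN cosN sinN; der; ring.
have cg : continuous g.
 move=> x; apply: cvgD; first by apply: cvgM; [exact: cf1|exact: ca].
 by apply: cvgM; [exact: cvg_cst|apply: cvgM; [exact: cf|exact: ca]].
have j1 := rint_cas xi i1; have j2 := rintZ xi (rint_cas (- xi) i).
have ig : rint g by exact: rintD.
have e n : \int[mu]_x (icc (- n%:R) n%:R x * g x) = F n%:R - F (- n%:R).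
 have nn : - n%:R <= n%:R :> R by rewrite (@le_trans _ _ 0)// oppr_le0.
 by have [] := FTCab nn (fun x _ => cg x) (fun x _ => dF x).
have ac : {ae mu, forall x, icc (- n%:R) n%:R x * g x @[n --> \oo] --> g x}.
 by apply: aeW => x; exact: trunc_cvg.
have [_ c] := @dct _ _ _ mu (fun n x => icc (- n%:R) n%:R x * g x) g (fun x => `|g x|)
 (fun n => ltac:(by apply: mfunM; [exact: icc_meas|exact: (rint_meas ig)]))
 (rint_meas ig) (rint_norm ig)
 (fun n x => ltac:(by rewrite normrM ler_piMl// iccE; case: (_ <= _ <= _); rewrite ?normr1 ?normr0))
 ac.
have vanish (u : nat -> R) (s : nat -> R) : f (u n) @[n --> \oo] --> 0 -> F (u n) @[n --> \oo] --> 0.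
 move=> cu; apply: norm_cvg0; apply: (@squeeze_cvgr _ _ _ _ (fun=> 0) (fun n => 2 * `|f (u n)|)).
 - by near=> n; rewrite normr_ge0/= normrM mulrC ler_wpM2r// cas_le2.
 - exact: cvg_cst.
 - by rewrite -(mulr0 2); apply: cvgM; [exact: cvg_cst|rewrite -(normr0 R); exact: cvg_norm].
have Z : \int[mu]_x g x = 0.
 apply: cvgn_uniq c _ e; rewrite -(subr0 0); apply: cvgB.
  exact: (vanish (fun n => n%:R) (fun=> 0)).
 exact: (vanish (fun n => - n%:R) (fun=> 0)).
rewrite /hint mulrCA; move: Z; rewrite IntD// IntZ; last exact: rint_cas.
by move=> /eqP; rewrite addr_eq0 => /eqP ->; ring.
Unshelve. all: by end_near. Qed.

Lemma der_hint g x : rint g -> rint (fun y => y * g y) ->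
 hasder (hint g) x (hint (fun y => y * g y) (- x)).
Proof.
move=> g1 yg1.
pose f (x y : R) := g y * cas (y * x).
have df y z : hasder (f ^~ y) z (g y * (y * (cos (y * z) - sin (y * z)))).
 by rewrite /f; have d := der_casM y; der; ring.
have D1 z y : partial1of2 f z y = g y * (y * (cos (y * z) - sin (y * z))).
 by rewrite /partial1of2; exact: der_derive1 (df y z).
have Ix : `]x - 1, x + 1[%classic x by rewrite /= in_itv/=; apply/andP; split; lra.
have i1 z : `]x - 1, x + 1[%classic z -> mu.-integrable setT (EFin \o f z).
 by move=> _; exact: rint_cas.
have d1 z y : `]x - 1, x + 1[%classic z -> setT y -> derivable (f ^~ y) z 1.
 by move=> _ _; exact: der_derivable (df y z).
have G0 y : 0 <= 2 * `|y * g y| by rewrite mulr_ge0.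
have iG : mu.-integrable setT (EFin \o (fun y => 2 * `|y * g y|)).
 by apply: rintZ; exact: rint_norm.
have GU z y : `]x - 1, x + 1[%classic z -> setT y -> `|partial1of2 f z y| <= 2 * `|y * g y|.
 move=> _ _; rewrite D1; have -> : g y * (y * (cos (y * z) - sin (y * z))) = y * g y * cas (y * - z).
  by rewrite /cas mulrN cosN sinN; ring.
 by rewrite normrM mulrC ler_wpM2r// cas_le2.
have de := derivable_under_integral measurableT Ix i1 d1 G0 iG GU.
have va := differentiation_under_integral measurableT Ix i1 d1 G0 iG GU.
have dd := derivable_der de; rewrite va in dd.
apply: der_eq; first exact: derM (der_cst hc x) dd.
rewrite mul0r add0r /hint; congr (_ * _); apply: eq_Int => y.
by rewrite D1 /cas mulrN cosN sinN; ring.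
Qed.

(** * The KdV soliton and its transform *)

Section soliton.

(** This is [tanh (x / 2)], so that [kQ] is the KdV soliton [3 sech^2 (x / 2)], solving
    [Q - Q'' = Q^2 / 2]. Powers of [kQ] integrate through polynomials in [th]. *)
Definition th x : R := 1 - 2 * (expR x + 1)^-1.
Definition kQ x : R := 3 * (1 - th x ^+ 2).

Let e1 x : 0 < expR x + 1.
Proof. by rewrite addr_gt0 ?expR_gt0. Qed.

Lemma th_der x : hasder th x (kQ x / 6).
Proof.
have h : expR x + 1 != 0 by rewrite gt_eqF ?e1.
by rewrite /th; der; [exact: h|rewrite /kQ /th; field].
Qed.

Lemma kQ_der x : hasder kQ x (- (kQ x * th x)).
Proof. by rewrite /kQ; have d := th_der; der; rewrite /kQ; field. Qed.

Lemma th_continuous : continuous (th : R -> R).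
Proof. exact: der_continuous th_der. Qed.

Lemma kQ_continuous : continuous (kQ : R -> R).
Proof. exact: der_continuous kQ_der. Qed.

Lemma th_lt1 x : th x < 1.
Proof. by rewrite /th gtrBl mulr_gt0// invr_gt0. Qed.

Lemma th_odd x : th (- x) = - th x.
Proof.
rewrite /th expRN; have h := expR_gt0 x; have h1 := e1 x.
by field; rewrite !gt_eqF//= addrC; exact: e1.
Qed.

Lemma th_gtN1 x : - 1 < th x.
Proof. by rewrite -(opprK x) th_odd ltrN2 th_lt1. Qed.

Lemma th0 : th 0 = 0 :> R.
Proof. by rewrite /th expR0; field. Qed.

Lemma th_ge0 x : 0 <= x -> 0 <= th x.
Proof.
move=> x0; rewrite /th subr_ge0 ler_pdivrMr ?e1// mul1r.
have := expR_ge1Dx x; lra.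
Qed.

Lemma th_sq_lt1 x : th x ^+ 2 < 1.
Proof. by have := th_lt1 x; have := th_gtN1 x; nra. Qed.

Lemma kQ_gt0 x : 0 < kQ x.
Proof. by rewrite /kQ mulr_gt0// subr_gt0 th_sq_lt1. Qed.

Lemma kQ_le3 x : kQ x <= 3.
Proof. by rewrite /kQ; have := sqr_ge0 (th x); lra. Qed.

Lemma kQ_even x : kQ (- x) = kQ x.
Proof. by rewrite /kQ th_odd sqrrN. Qed.

Lemma one_Bth_le x : 1 - th x <= 2 * expR (- x).
Proof.
rewrite /th opprB addrCA subrr addr0 ler_wpM2l// expRN lef_pV2 ?posrE ?expR_gt0 ?e1//.
by rewrite lerDl.
Qed.

Lemma kQ_le_exp x : 0 <= x -> kQ x <= 12 * expR (- x).
Proof.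
move=> x0; have := one_Bth_le x; have := th_lt1 x; have := th_ge0 x0; rewrite /kQ; nra.
Qed.

Lemma th_cvg : th x @[x --> +oo] --> (1 : R).
Proof.
apply: (@squeeze_cvgr _ _ _ _ (fun x => 1 - 2 * expR (- (1 * x))) (fun=> 1)).
- by near=> x; rewrite (ltW (th_lt1 x)) andbT; have := one_Bth_le x; rewrite mul1r; lra.
- rewrite -[X in _ --> X](subr0 1) -(mulr0 2); apply: cvgB; first exact: cvg_cst.
 by apply: cvgM; [exact: cvg_cst|exact: expR_cvg0].
- exact: cvg_cst.
Unshelve. all: by end_near. Qed.

Lemma kQ_meas : measR (kQ : R -> R).
Proof. exact: continuous_measR kQ_continuous. Qed.

Lemma hp_kQ_rint f C : measR f -> (forall x, 0 <= x -> `|f x| <= C) -> rint (fun x => hp x * (kQ x * f x)).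
Proof.
move=> mf fC; apply: (@hp_exp_rint (fun x => kQ x * f x) (12 * C)).
 by apply: mfunM => //; exact: kQ_meas.
move=> x x0; rewrite normrM (ger0_norm (ltW (kQ_gt0 x))) [leRHS]mulrAC.
by apply: ler_pM => //; [exact: ltW (kQ_gt0 x)|exact: kQ_le_exp|exact: fC].
Qed.

Lemma kQ_rint : rint (kQ : R -> R).
Proof.
apply: even_rint; [|exact: kQ_meas|exact: kQ_even].
apply: rint_eq (@hp_kQ_rint (fun=> 1) 1 (measurable_cst _) _) => [x|x _]; first by rewrite mulr1.
by rewrite normr1.
Qed.

Lemma kQ_mul_sqint f C : measR f -> (forall x, `|f x| <= C) -> sqint (fun x => kQ x * f x).
Proof.
move=> mf fC; have C0 : 0 <= C by apply: le_trans (normr_ge0 _) (fC 0).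
split; first by apply: mfunM => //; exact: kQ_meas.
apply: (rint_le _ (rintZ (3 * C ^+ 2) kQ_rint)).
 by apply: measurable_funX; apply: mfunM => //; exact: kQ_meas.
move=> x; rewrite ger0_norm ?sqr_ge0// exprMn.
have q0 := kQ_gt0 x; have q3 := kQ_le3 x.
have f2 : f x ^+ 2 <= C ^+ 2 by rewrite -norm_sq// ler_pXn2r// ?nnegrE.
rewrite [leRHS](_ : _ = (3 * kQ x) * C ^+ 2); last by ring.
apply: ler_pM => //; [exact: sqr_ge0|exact: sqr_ge0|].
by rewrite expr2 ler_wpM2r// ltW.
Qed.

Lemma kQ_sqint : sqint (kQ : R -> R).
Proof.
have := @kQ_mul_sqint (fun=> 1) 1 (measurable_cst _) (fun _ => ltac:(by rewrite normr1)).
by rewrite (_ : (fun x => kQ x * 1) = kQ)//; apply/funext => x; rewrite mulr1.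
Qed.

Lemma kQ2_sqint : sqint (fun x => kQ x ^+ 2).
Proof.
rewrite (_ : (fun x => _) = (fun x => kQ x * kQ x)); last by apply/funext => x; rewrite expr2.
apply: (@kQ_mul_sqint kQ 3 kQ_meas) => x; rewrite ger0_norm; [exact: kQ_le3|exact: ltW (kQ_gt0 x)].
Qed.

Lemma kQ2_rint : rint (fun x => kQ x ^+ 2).
Proof. exact: sqint_sq kQ_sqint. Qed.

Lemma kQ3_rint : rint (fun x => kQ x ^+ 3).
Proof.
apply: rint_eq (sqint_mul kQ_sqint kQ2_sqint) => x; rewrite -exprS//.
Qed.

(** In the variable [t = th x], with [t' = kQ / 6], the integrand becomes [54 (1 - t^2)^2]. *)
Lemma kQ3_half : \int[mu]_x (hp x * kQ x ^+ 3) = 144 / 5.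
Proof.
pose F x := 54 * (th x - 2 / 3 * th x ^+ 3 + 5^-1 * th x ^+ 5).
have d := th_der.
have dF x : hasder F x (kQ x ^+ 3) by rewrite /F; der; rewrite /kQ; field.
have ck : continuous (fun x => kQ x ^+ 3).
 by move=> x; apply: (@continuous_comp _ _ _ kQ (fun y => y ^+ 3)); [exact: kQ_continuous|exact: exprn_continuous].
have cF : F x @[x --> +oo] --> (54 * (1 - 2 / 3 * 1 ^+ 3 + 5^-1 * 1 ^+ 5) : R).
 have cx k : th x ^+ k @[x --> +oo] --> (1 : R) ^+ k.
  by apply: (@cvg_comp _ _ _ th (fun y => y ^+ k)); [exact: th_cvg|exact: exprn_continuous].
 apply: cvgM; first exact: cvg_cst.
 apply: cvgD; last by apply: cvgM; [exact: cvg_cst|exact: cx].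
 by apply: cvgB; [exact: th_cvg|apply: cvgM; [exact: cvg_cst|exact: cx]].
rewrite (FTCh ck dF (hp_rint kQ3_rint) cF) /F th0 !expr1n; by field.
Qed.

Lemma kQ3_int : \int[mu]_x (kQ x ^+ 3) = 288 / 5.
Proof.
rewrite (Int_even kQ3_rint); first by rewrite kQ3_half; field.
by apply: aeW => x; rewrite kQ_even.
Qed.

Definition w2 x : R := 1 + x ^+ 2.

Lemma w2_weight : weight w2 2^-1.
Proof.
split.
- by apply: measurable_funD; [exact: measurable_cst|apply: measurable_funX; exact: measurable_id].
- by rewrite invr_gt0.
- move=> x; rewrite /w2 -(norm_sq x); have := sqr_ge0 (`|x| - 2^-1); have := normr_ge0 x; nra.
- by move=> x; rewrite /w2 sqrrN.
Qed.

Definition kG : R -> R := hint kQ.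

(** The transform of the soliton equation; two derivatives produce the factor [- x^2]. *)
Lemma kG_eq x : (1 + x ^+ 2) * kG x = 2^-1 * hint (fun y => kQ y ^+ 2) x.
Proof.
pose Q1 x := - (kQ x * th x); pose Q2 x := kQ x - 2^-1 * kQ x ^+ 2.
have dQ := kQ_der; have dt := th_der.
have dQ1 y : hasder Q1 y (Q2 y) by rewrite /Q1; der; rewrite /Q2 /kQ; field.
have th1 y : `|- th y| <= 1 by rewrite normrN ler_norml !ltW ?th_lt1 ?th_gtN1.
have mth : measR (fun y => - th y).
 by apply: measurable_funN; exact: continuous_measR th_continuous.
have sQ1 : sqint Q1.
 rewrite (_ : Q1 = (fun x => kQ x * - th x)); last by apply/funext => y; rewrite /Q1 mulrN.
 exact: kQ_mul_sqint mth th1.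
have iQ1 : rint Q1.
 apply: (rint_le (sqint_meas sQ1) kQ_rint) => y.
 by rewrite /Q1 -mulrN normrM ger0_norm ?(ltW (kQ_gt0 y))// ler_piMr// ltW// kQ_gt0.
have sQ2 : sqint Q2 by apply: sqintB; [exact: kQ_sqint|apply: sqintZ; exact: kQ2_sqint].
have iQ2 : rint Q2 by apply: rintB; [exact: kQ_rint|apply: rintZ; exact: kQ2_rint].
have cQ1 : continuous Q1 := der_continuous dQ1.
have cQ2 : continuous Q2.
 move=> y; apply: cvgB; first exact: kQ_continuous.
 by apply: cvgM; [exact: cvg_cst|apply: (@continuous_comp _ _ _ kQ (fun y => y ^+ 2)); [exact: kQ_continuous|exact: exprn_continuous]].
have vQ := H1_vanish dQ cQ1 kQ_sqint sQ1.
have vQ1 := H1_vanish dQ1 cQ2 sQ1 sQ2.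
have vQm : kQ (- n%:R) @[n --> \oo] --> 0.
 by rewrite (_ : (fun n => _) = (fun n : nat => kQ n%:R))//; apply/funext => n; rewrite kQ_even.
have vQ1m : Q1 (- n%:R) @[n --> \oo] --> 0.
 rewrite (_ : (fun n => _) = (fun n : nat => - Q1 n%:R)); last first.
  by apply/funext => n; rewrite /Q1 kQ_even th_odd mulrN.
 by rewrite -oppr0; apply: cvgN.
have h1 := hint_der x dQ1 cQ2 iQ1 iQ2 vQ1 vQ1m.
have h2 := hint_der (- x) dQ cQ1 kQ_rint iQ1 vQ vQm.
have h3 := hint_lin 1 (- 2^-1) x kQ_rint kQ2_rint.
have h4 : hint Q2 x = 1 * hint kQ x + - 2^-1 * hint (fun y => kQ y ^+ 2) x.
 by rewrite -h3; congr (hint _ x); apply/funext => y; rewrite /Q2; ring.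
rewrite h2 h4 !opprK in h1; rewrite /kG; move: h1.
by move: (hint kQ x) (hint (fun y => kQ y ^+ 2) x) => A B h1; nra.
Qed.

Lemma kG_sqint : sqint kG.
Proof. exact: sqint_hint kQ_sqint kQ_rint. Qed.

Lemma kG_V : VD w2 kG.
Proof.
have ev : aeven kG.
 by apply: aeW => x; apply: hint_even; [exact: kQ_rint|apply: aeW => y; exact: kQ_even].
apply: (VDP w2_weight (sqint_meas kG_sqint) ev).
apply: (@sqint_le _ _ _ mu _ (fun x => 2^-1 * hint (fun y => kQ y ^+ 2) x)).
- apply: mfunM; last exact: (sqint_meas kG_sqint).
 by apply: sw_meas; case: w2_weight.
- by apply: sqintZ; apply: sqint_hint; [exact: kQ2_sqint|exact: kQ2_rint].
- move=> x; rewrite -kG_eq !normrM ler_wpM2r// /sw ger0_norm ?sqrtr_ge0//.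
 have h : 1 <= w2 x by rewrite /w2 lerDl sqr_ge0.
 have -> : `|1 + x ^+ 2| = Num.sqrt (w2 x ^+ 2) by rewrite sqrtr_sqr.
  rewrite ler_wsqrtr//.
 by rewrite expr2 ler_peMl// (le_trans ler01).
Qed.

(** By the soliton equation [w2 * kG] is half the transform of [kQ ^ 2], so pairing with the profile
    becomes an integral in physical space. *)
Lemma q_kG g : VD w2 g -> q w2 kG g = 2^-1 * \int[mu]_x (kQ x ^+ 2 * Ht g x).
Proof.
move=> Vg; rewrite (qE _ _ w2_weight).
have E (x : R) : w2 x * kG x * g x = 2^-1 * (hint (fun y => kQ y ^+ 2) x * g x).
 by rewrite [in RHS]mulrA -kG_eq.
have s := kQ2_sqint; have r := kQ2_rint; have g2 := VD_sq Vg.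
transitivity (\int[mu]_x (2^-1 * (hint (fun y => kQ y ^+ 2) x * g x))).
 by apply: eq_Int; exact: E.
rewrite IntZ; last by apply: sqint_mul => //; exact: sqint_hint.
congr (_ * _); rewrite -[LHS]/(ip _ _) -[RHS]/(ip (fun x => kQ x ^+ 2) (Ht g)) -Ht_sym//.
apply: ae_ip; [exact: sqint_meas (sqint_hint s r)|exact: sqint_meas g2|
 exact: sqint_meas (Ht_sq s)|exact: sqint_meas g2|exact: ae_sym (Ht_explicit s r)|].
exact: aeW.
Qed.

Lemma Ht_kG : {ae mu, forall x, Ht kG x = kQ x}.
Proof.
apply: ae_trans (HtK kQ_sqint); apply: Ht_ae; [exact: kG_sqint|exact: Ht_sq kQ_sqint|].
exact: ae_sym (Ht_explicit kQ_sqint kQ_rint).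
Qed.

Lemma T_kG d : V1 d -> aeven d -> T kG d d = \int[mu]_x (kQ x * (Ht d x * Ht d x)).
Proof.
move=> Vd ed; rewrite (TE kG_sqint Vd ed Vd ed).
have [[d2 _] [s _]] := (Vd, Ht_mul Vd ed Vd ed).
rewrite -[LHS]/(ip (Ht kG) (fun x => Ht d x * Ht d x)) -[RHS]/(ip kQ (fun x => Ht d x * Ht d x)).
apply: ae_ip; [exact: sqint_meas (Ht_sq kG_sqint)|exact: sqint_meas s|exact: kQ_meas|
 exact: sqint_meas s|exact: Ht_kG|exact: aeW].
Qed.

Lemma q_kG_kG : q w2 kG kG = 144 / 5.
Proof.
rewrite (q_kG kG_V).
transitivity (2^-1 * \int[mu]_x (kQ x ^+ 3) : R); last by rewrite kQ3_int; field.
congr (_ * _); have s := Ht_sq kG_sqint.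
rewrite (_ : \int[mu]_x (kQ x ^+ 3) = ip (fun x => kQ x ^+ 2) kQ); last first.
 by apply: eq_Int => x; rewrite -exprSr.
rewrite -[LHS]/(ip (fun x => kQ x ^+ 2) (Ht kG)).
apply: ae_ip; [exact: sqint_meas kQ2_sqint|exact: sqint_meas s|exact: sqint_meas kQ2_sqint|exact: kQ_meas|exact: aeW|exact: Ht_kG].
Qed.

Lemma T3_kG : T3 kG = 288 / 5.
Proof.
have [V e _] := kG_V; rewrite /T3 (T_kG V e) -kQ3_int.
apply: ae_Int.
- apply: mfunM; first exact: kQ_meas.
 by apply: mfunM; exact: sqint_meas (Ht_sq kG_sqint).
- exact: rint_meas kQ3_rint.
- by apply: filterS Ht_kG => x ->; rewrite -expr2 -exprS.
Qed.

End soliton.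

(** * Second variation at the KdV soliton *)

Record H1e f f1 : Prop := MkH1e {
 h1_der : forall x, hasder f x (f1 x);
 h1_cont : continuous f1;
 h1_sq : sqint f;
 h1_sq1 : sqint f1;
 h1_even : forall x, f (- x) = f x }.

Lemma h1_odd f f1 x : H1e f f1 -> f1 (- x) = - f1 x.
Proof.
move=> H; have d := h1_der H.
have d1 : hasder (fun y => f (- y)) x (f1 (- x) * -1).
 by apply: (@der_comp f (fun y => - y)) => //; exact: (derN (der_id x)).
have e : (fun y => f (- y)) = f by apply/funext => y; exact: h1_even H y.
rewrite e in d1; have := der_derive1 d1; rewrite (der_derive1 (d x)) => ->; ring.
Qed.

Lemma hint_H1e g : sqint g -> rint g -> sqint (fun y => y * g y) -> rint (fun y => y * g y) ->
 aeven g -> H1e (hint g) (fun x => hint (fun y => y * g y) (- x)).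
Proof.
move=> g2 g1 yg2 yg1 eg; split.
- by move=> x; exact: der_hint.
- move=> x; apply: (@continuous_comp _ _ _ -%R (hint (fun y => y * g y))); first exact: opp_continuous.
 exact: hint_continuous.
- exact: sqint_hint.
- exact: sqint_opp (sqint_hint yg2 yg1).
- by move=> x; exact: hint_even.
Qed.

Lemma w2_moment g : VD w2 g -> sqint (fun y => y * g y).
Proof.
move=> Vg; apply: (sqint_le _ (VD_sw Vg)).
 by apply: mfunM; [exact: measurable_id|exact: (sqint_meas (VD_sq Vg))].
move=> x; rewrite !normrM ler_wpM2r// /sw [leRHS]ger0_norm ?sqrtr_ge0//.
by rewrite -sqrtr_sqr ler_wsqrtr// /w2 lerDr.
Qed.

Lemma q_w2 g : VD w2 g -> q w2 g g = ip g g + ip (fun y => y * g y) (fun y => y * g y).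
Proof.
move=> Vg; have g2 := VD_sq Vg; have yg := w2_moment Vg.
rewrite (qE _ _ w2_weight) !ipsE -IntD; [|exact: sqint_sq|exact: sqint_sq].
by apply: eq_Int => x; rewrite /w2; ring.
Qed.

Lemma VD_trunc w n g : VD w g -> VD w (trunc n g).
Proof.
move=> [V e s]; split; [exact: V1_trunc|exact: trunc_aeven|].
have -> : (fun x => sw w x * trunc n g x) = trunc n (fun x => sw w x * g x).
 by apply/funext => x; rewrite /trunc mulrCA.
exact: trunc_sqint.
Qed.

Lemma trunc_q_cvg w g : VD w g ->
 q w (lin 1 (trunc n g) (-1) g) (lin 1 (trunc n g) (-1) g) @[n --> \oo] --> 0.
Proof.
move=> V; have := trunc_sqdist (VD_sw V).
rewrite (_ : (fun n => sqdist _ _) = (fun n => q w (lin 1 (trunc n g) (-1) g) (lin 1 (trunc n g) (-1) g)))//.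
apply/funext => n; rewrite qdef /sqdist.
have e : (fun x => trunc n (fun x => sw w x * g x) x - sw w x * g x) =
  (fun x => sw w x * (1 * trunc n g x + -1 * g x)) by apply/funext => x; rewrite /trunc; ring.
by rewrite e.
Qed.

Lemma T_trunc_cvg f g : sqint f -> V1 g -> T f (trunc n g) (trunc n g) @[n --> \oo] --> T f g g.
Proof.
move=> f2 V; have c := wn_trunc_cvg V.
have Vn n := V1_trunc n V.
have := @corr_cvg _ _ g g _ Vn Vn V V (fun n => wn_trunc n V) c c.
move=> /(@ip_sqdist_cvg _ _ f (fun n => corr_sqint (Vn n) (Vn n)) (corr_sqint V V) f2) cc.
rewrite Tdef ipC (_ : (fun n => _) = (fun n => hc * ip (corr (trunc n g) (trunc n g)) f)).
 by apply: cvgM; [exact: cvg_cst|exact: cc].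
by apply/funext => n; rewrite Tdef ipC.
Qed.

Lemma sqint_bdd f g C : sqint f -> measR g -> (forall x, `|g x| <= C) -> sqint (fun x => g x * f x).
Proof.
move=> f2 mb bC; apply: (sqint_le _ (sqintZ C f2)).
 by apply: mfunM => //; exact: (sqint_meas f2).
move=> x; rewrite !normrM ler_wpM2r//; exact: le_trans (bC x) (ler_norm _).
Qed.

Lemma riccati_itv D Z Z1 a b : a <= b -> continuous D ->
 (forall x, a <= x <= b -> [/\ {for x, continuous Z1}, hasder Z x (Z1 x) & 0 <= D x + Z1 x]) ->
 Z a - Z b <= \int[mu]_x (icc a b x * D x).
Proof.
move=> ab cD H.
have [i e] := FTCab ab (fun x hx => let: And3 h _ _ := H x hx in h) (fun x hx => let: And3 _ h _ := H x hx in h).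
have j : rint (fun x => icc a b x * D x) := @continuous_rint_itv D a b cD.
have : 0 <= \int[mu]_x (icc a b x * D x + icc a b x * Z1 x); last by rewrite IntD// e; lra.
apply: Int_ge0 => x; rewrite -mulrDr iccE; have [/H[_ _ h]|_] := boolP (a <= x <= b); last by rewrite mul0r.
by rewrite mul1r.
Qed.

(** Pointwise inequality for the Riccati function [5/3 * th * kQ] near the origin, with [t = th x]
    and [p] the derivative of [z]. After completing a square the remaining factor is nonnegative as
    long as [t <= 1/8]. *)
Lemma left_num (t p z : R) : 0 <= t <= 8^-1 ->
 0 <= (p + t * z) ^+ 2 - 5 / 9 * (3 * (1 - t ^+ 2)) * z ^+ 2 +
  (5 / 3 * (3 * (1 - t ^+ 2) / 6 * (3 * (1 - t ^+ 2)) - t * (3 * (1 - t ^+ 2) * t)) * z ^+ 2 +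
  5 / 3 * (t * (3 * (1 - t ^+ 2))) * (2 * z * p)).
Proof.
move=> /andP[t0 t1]; have ts : t ^+ 2 <= 64^-1 by nra.
set Y := 5 / 3 * (t * (3 * (1 - t ^+ 2))).
have -> : (p + t * z) ^+ 2 - 5 / 9 * (3 * (1 - t ^+ 2)) * z ^+ 2 +
  (5 / 3 * (3 * (1 - t ^+ 2) / 6 * (3 * (1 - t ^+ 2)) - t * (3 * (1 - t ^+ 2) * t)) * z ^+ 2 +
  Y * (2 * z * p)) = (p + t * z + Y * z) ^+ 2 +
  3 * (1 - t ^+ 2) * (5 / 18 - 85 / 6 * t ^+ 2 + 25 / 3 * (t ^+ 2) ^+ 2) * z ^+ 2 by rewrite /Y; field.
apply: addr_ge0; first exact: sqr_ge0.
apply: mulr_ge0; last exact: sqr_ge0.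
have := sqr_ge0 (t ^+ 2); have := sqr_ge0 t; move: (t ^+ 2) ts => s; nra.
Qed.

(** The counterpart of [left_num] away from the origin, for the Riccati function
    [- kQ / (6 (th - 1/10))]; its pole at [th = 1/10] lies to the left of the range [th >= 1/8]. *)
Lemma right_num (t p z s k : R) : 8^-1 <= t <= 1 -> s = t - 10^-1 -> k = 3 * (1 - t ^+ 2) ->
 0 <= (p + t * z) ^+ 2 - 5 / 9 * k * z ^+ 2 +
  ((6^-1 * (k * t) * s^-1 + 6^-1 * k * (s ^- 2 * (k / 6))) * z ^+ 2 - 6^-1 * k * s^-1 * (2 * z * p)).
Proof.
move=> /andP[t0 t1] es ek.
have s0 : 0 < s by rewrite es; lra.
have sn : s != 0 by rewrite gt_eqF.
have -> : (p + t * z) ^+ 2 - 5 / 9 * k * z ^+ 2 +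
  ((6^-1 * (k * t) * s^-1 + 6^-1 * k * (s ^- 2 * (k / 6))) * z ^+ 2 - 6^-1 * k * s^-1 * (2 * z * p)) =
 (p + t * z - 6^-1 * k * s^-1 * z) ^+ 2 + k * (1 - t) * (18 * s)^-1 * z ^+ 2.
 have et : t = s + 10^-1 by rewrite es; ring.
 by rewrite ek et; field; exact: sn.
have k0 : 0 <= k by rewrite ek; nra.
apply: addr_ge0; first exact: sqr_ge0.
apply: mulr_ge0; last exact: sqr_ge0.
apply: mulr_ge0; first by apply: mulr_ge0 => //; rewrite subr_ge0.
by rewrite invr_ge0 mulr_ge0// ltW.
Qed.

Section half_line.
Variables (f f1 : R -> R).
Hypothesis H : H1e f f1.
Let df : forall x, hasder f x (f1 x). Proof. exact: h1_der H. Qed.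
Let cf1 : continuous f1. Proof. exact: h1_cont H. Qed.
Let cf : continuous f. Proof. exact: der_continuous df. Qed.
Let f2 : sqint f. Proof. exact: h1_sq H. Qed.
Let f12 : sqint f1. Proof. exact: h1_sq1 H. Qed.
Let dt := th_der.
Let dQ := kQ_der.
Let ct := th_continuous.
Let cQ := kQ_continuous.
Let cM u v : continuous u -> continuous v -> continuous (fun x => u x * v x).
Proof. by move=> cu cv x; apply: cvgM; [exact: cu|exact: cv]. Qed.
Let cA u v : continuous u -> continuous v -> continuous (fun x => u x + v x).
Proof. by move=> cu cv x; apply: cvgD; [exact: cu|exact: cv]. Qed.
Let cB u v : continuous u -> continuous v -> continuous (fun x => u x - v x).
Proof. by move=> cu cv x; apply: cvgB; [exact: cu|exact: cv]. Qed.
Let cC c : continuous (fun _ : R => c).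
Proof. by move=> x; exact: cvg_cst. Qed.
Let mth : measR (th : R -> R). Proof. exact: continuous_measR ct. Qed.
Let th1 x : `|th x| <= 1.
Proof. by rewrite ler_norml !ltW ?th_lt1 ?th_gtN1. Qed.
Let kQ3' x : `|kQ x| <= 3.
Proof. by rewrite ger0_norm ?kQ_le3// ltW// kQ_gt0. Qed.

Let e x := f1 x + th x * f x.

Let e2 : sqint e.
Proof. by apply: sqintD => //; exact: (@sqint_bdd _ _ 1). Qed.

Let S := \int[mu]_x (hp x * (f1 x ^+ 2 + f x ^+ 2)).
Let P := \int[mu]_x (hp x * (kQ x * f x ^+ 2)).
Let L := \int[mu]_x (hp x * (kQ x ^+ 2 * f x)).

Let iQ : rint (fun x => kQ x * f x ^+ 2).
Proof.
apply: rint_eq (sqint_mul (sqint_bdd f2 kQ_meas kQ3') f2) => x.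
by rewrite expr2 mulrA.
Qed.

Let iL : rint (fun x => kQ x ^+ 2 * f x).
Proof. exact: sqint_mul kQ2_sqint f2. Qed.

Let iS : rint (fun x => f1 x ^+ 2 + f x ^+ 2).
Proof. by apply: rintD; exact: sqint_sq. Qed.

(** The soliton satisfies [kQ' + th * kQ = 0]. Expanding [(f' + th f)^2], the cross term is the
    derivative of [th * f^2] up to a multiple of [kQ * f^2], and no boundary term remains since
    [th 0 = 0]. *)
Let energy_factor : \int[mu]_x (hp x * e x ^+ 2) = S - P / 2.
Proof.
pose g x := kQ x / 6 * f x ^+ 2 + th x * (2 * f x * f1 x).
pose F x := th x * f x ^+ 2.
have dF x : hasder F x (g x) by rewrite /F /g; der; ring.
have cg : continuous g.
 apply: cA; first by apply: cM; [apply: cM => //; exact: cC|under eq_fun do rewrite expr2; exact: cM].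
 by apply: cM => //; apply: cM => //; apply: cM => //; exact: cC.
have ig : rint g.
 apply: rintD.
  by apply: rint_eq (rintZ 6^-1 iQ) => x; ring.
 apply: rint_eq (rintZ 2 (sqint_mul (sqint_bdd f2 mth th1) f12)) => x; ring.
have vf := H1_vanish df cf1 f2 f12.
have vF : F n%:R @[n --> \oo] --> (0 : R).
 have v2 : f n%:R ^+ 2 @[n --> \oo] --> (0 : R) ^+ 2.
  by apply: (@cvg_comp _ _ _ (fun n : nat => f n%:R) (fun y => y ^+ 2)) vf _; exact: exprn_continuous.
 rewrite expr0n/= in v2.
 apply: norm_cvg0; apply: (@squeeze_cvgr _ _ _ _ (fun=> 0) (fun n => f n%:R ^+ 2)) => //.
  by near=> n; rewrite normr_ge0/= /F normrM (ger0_norm (sqr_ge0 _)) ler_piMl ?sqr_ge0.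
 exact: cvg_cst.
have hg : rint (fun x => hp (x - 0) * g x).
 by apply: rint_eq (hp_rint ig) => x; rewrite subr0.
have Z := FTCn (fun x _ => cg x) (fun x _ => dF x) hg vF.
have Z0 : \int[mu]_x (hp x * g x) = 0.
 rewrite (_ : \int[mu]_x (hp x * g x) = \int[mu]_x (hp (x - 0) * g x)); last by apply: eq_Int => x; rewrite subr0.
 by rewrite Z /F th0 mul0r subr0.
transitivity (\int[mu]_x (hp x * (f1 x ^+ 2 + f x ^+ 2) - 2^-1 * (hp x * (kQ x * f x ^+ 2)) + hp x * g x)).
 by apply: eq_Int => x; rewrite /e /g /kQ; field.
rewrite IntD; [|by apply: rintB; [exact: hp_rint|apply: rintZ; exact: hp_rint]|exact: hp_rint].
rewrite IntB; [|exact: hp_rint|by apply: rintZ; exact: hp_rint].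
rewrite IntZ; last exact: hp_rint.
by rewrite Z0 /S /P; ring.
Unshelve. all: by end_near. Qed.

(** The factored energy dominates [5/9] of the weighted norm of [z = f - c kQ], since a multiple of
    the soliton does not change [f' + th f]. As [1/2 + 5/9 = 19/18], this is coercivity with factor
    [18/19], up to the pairing [L] with the soliton. *)
Lemma soliton_coercive : P <= 18 / 19 * S + L ^+ 2 / 54.
Proof.
(* The point where [th = 1/8], at which the two Riccati functions are joined. *)
pose x0 : R := ln (9 / 7).
have ex0 : expR x0 = 9 / 7 by rewrite lnK// posrE.
have tx0 : th x0 = 8^-1 :> R by rewrite /th ex0; field.
have x00 : 0 <= x0 by rewrite /x0 ln_ge0//; lra.
have tmono (x y : R) : x <= y -> th x <= th y.
 move=> xy; rewrite /th lerB// ler_wpM2l// lef_pV2 ?posrE ?addr_gt0 ?expR_gt0//.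
 by rewrite lerD2r ler_expR.
(* With [z x0 = 0] the boundary terms at the junction vanish. The unknown [c] is eliminated at the
   end by completing the square against [L]. *)
pose c := f x0 / kQ x0.
pose z x := f x - c * kQ x.
have zx0 : z x0 = 0 by rewrite /z /c mulfVK ?subrr// gt_eqF ?kQ_gt0.
pose p x := f1 x + c * (kQ x * th x).
have dz x : hasder z x (p x) by rewrite /z /p; der; ring.
have cz : continuous z := der_continuous dz.
have cp : continuous p by apply: cA => //; apply: cM; [exact: cC|exact: cM].
have pe x : p x + th x * z x = e x by rewrite /p /z /e; ring.
pose D x := e x ^+ 2 - 5 / 9 * kQ x * z x ^+ 2.
have ce : continuous e by apply: cA => //; exact: cM.
have cX u : continuous u -> continuous (fun x => u x ^+ 2).
 by move=> cu; under eq_fun do rewrite expr2; exact: cM.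
have cD : continuous D.
 by apply: cB; [exact: cX|apply: cM; [apply: cM => //; exact: cC|exact: cX]].
have HL : 0 <= \int[mu]_x (icc 0 x0 x * D x).
 pose Z x := 5 / 3 * (th x * kQ x) * z x ^+ 2.
 pose Z1 x := 5 / 3 * (kQ x / 6 * kQ x - th x * (kQ x * th x)) * z x ^+ 2 + 5 / 3 * (th x * kQ x) * (2 * z x * p x).
 have dZ x : hasder Z x (Z1 x) by rewrite /Z /Z1; der; ring.
 have cZ1 : continuous Z1.
  apply: cA; (apply: cM; last by [exact: cX|apply: cM => //; apply: cM => //; exact: cC]).
  - apply: cM; first exact: cC.
   by apply: cB; apply: cM => //; [apply: cM => //; exact: cC|exact: cM].
  - by apply: cM; [exact: cC|exact: cM].
 apply: le_trans (@riccati_itv D Z Z1 0 x0 x00 cD _).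
  by rewrite /Z th0 zx0 mul0r mulr0 expr0n/= !mulr0 mul0r subrr.
 move=> x /andP[x0' x1]; split; [exact: cZ1|exact: dZ|].
 have tx : 0 <= th x <= 8^-1 by rewrite th_ge0//= -tx0 tmono.
 by have := left_num (p x) (z x) tx; rewrite /D -pe /Z1 /kQ.
have HR n : x0 <= n%:R -> 0 <= \int[mu]_x (icc x0 n%:R x * D x).
 move=> x0n.
 pose s x := th x - 10^-1.
 have s0 x : x0 <= x -> 0 < s x by move=> /tmono; rewrite tx0 /s; lra.
 pose Z x := - (6^-1 * kQ x * (s x)^-1 * z x ^+ 2).
 pose Z1 x := (6^-1 * (kQ x * th x) * (s x)^-1 + 6^-1 * kQ x * ((s x) ^- 2 * (kQ x / 6))) * z x ^+ 2 -
  6^-1 * kQ x * (s x)^-1 * (2 * z x * p x).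
 have ds x : hasder s x (kQ x / 6) by rewrite /s; der; ring.
 have dZ x : x0 <= x -> hasder Z x (Z1 x).
  move=> h; have sn : s x != 0 by rewrite gt_eqF ?s0.
  by rewrite /Z /Z1; der; [exact: sn|field; exact: sn].
 have cs : continuous s := der_continuous ds.
 have cZ1 x : x0 <= x -> {for x, continuous Z1}.
  move=> h; have sn : s x != 0 by rewrite gt_eqF ?s0.
  have cV : {for x, continuous (fun y => (s y)^-1)} by apply: cvgV => //; exact: cs.
  have cV2 : {for x, continuous (fun y => (s y) ^- 2)}.
   by apply: cvgV; [rewrite expf_neq0|exact: (cX s cs x)].
  apply: cvgB; apply: cvgM.
  - apply: cvgD; apply: cvgM.
   + apply: cvgM; [exact: cvg_cst|apply: cvgM; [exact: cQ|exact: ct]].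
   + exact: cV.
   + apply: cvgM; [exact: cvg_cst|exact: cQ].
   + apply: cvgM; first exact: cV2.
    by apply: cvgM; [exact: cQ|exact: cvg_cst].
  - exact: (cX z cz x).
  - apply: cvgM; [apply: cvgM; [exact: cvg_cst|exact: cQ]|exact: cV].
  - apply: cvgM; [apply: cvgM; [exact: cvg_cst|exact: cz]|exact: cp].
 apply: le_trans (@riccati_itv D Z Z1 x0 n%:R x0n cD _).
  rewrite /Z zx0 expr0n/= mulr0 oppr0 sub0r opprK mulr_ge0 ?sqr_ge0//.
  apply: mulr_ge0; first by apply: mulr_ge0; [rewrite invr_ge0|exact: ltW (kQ_gt0 _)].
  by rewrite invr_ge0; exact: ltW (s0 _ x0n).
 move=> x /andP[x0' x1]; split; [exact: cZ1|exact: dZ|].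
 have tx : 8^-1 <= th x <= 1 by rewrite -tx0 tmono//= ltW// th_lt1.
 have := right_num (p x) (z x) tx erefl erefl.
 by rewrite /D -pe /Z1.
have iz : rint (fun x => kQ x * z x ^+ 2) /\
  \int[mu]_x (hp x * (kQ x * z x ^+ 2)) = P - 2 * c * L + c ^+ 2 * (144 / 5).
 have E x : kQ x * z x ^+ 2 = (kQ x * f x ^+ 2 - 2 * c * (kQ x ^+ 2 * f x)) + c ^+ 2 * kQ x ^+ 3.
  by rewrite /z; ring.
 split.
  apply: rint_eq (rintD (rintB iQ (rintZ (2 * c) iL)) (rintZ (c ^+ 2) kQ3_rint)) => x.
  by rewrite E.
 transitivity (\int[mu]_x ((hp x * (kQ x * f x ^+ 2) - 2 * c * (hp x * (kQ x ^+ 2 * f x))) + c ^+ 2 * (hp x * kQ x ^+ 3))).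
  by apply: eq_Int => x; rewrite E; ring.
 have k3 := hp_rint kQ3_rint; have hL := hp_rint iL; have hP := hp_rint iQ.
 rewrite IntD; [|by apply: rintB => //; exact: rintZ|exact: rintZ].
 rewrite IntB; [|by []|exact: rintZ].
 by rewrite !IntZ// kQ3_half.
have iD : rint D.
 by apply: rint_eq (rintB (sqint_sq e2) (rintZ (5 / 9) iz.1)) => x; rewrite /D; ring.
have mD := rint_meas iD.
have [_ cD0] : rint (fun x => hp x * D x) /\
  \int[mu]_x (icc 0 n%:R x * D x) @[n --> \oo] --> \int[mu]_x (hp x * D x).
 apply: (@dct _ _ _ mu (fun n x => icc 0 n%:R x * D x) _ (fun x => `|D x|)).
 - by move=> n; apply: mfunM => //; exact: icc_meas.
 - by apply: mfunM => //; exact: hp_meas.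
 - exact: rint_norm.
 - by move=> n x; rewrite normrM ler_piMl// iccE; case: (_ <= _ <= _); rewrite ?normr1 ?normr0.
 - apply: aeW => x; apply: cvgM; last exact: cvg_cst.
  by have := @icc_hp_cvg 0 x; rewrite subr0.
have D0 : 0 <= \int[mu]_x (hp x * D x).
 apply: (ler_cvg_to (cvg_cst 0) cD0); near=> n.
 have x0n : x0 <= n%:R by near: n; exact: nbhs_infty_ger.
 have rI a b : rint (fun x => icc a b x * D x) := @continuous_rint_itv D a b cD.
 rewrite (_ : \int[mu]_x (icc 0 n%:R x * D x) = \int[mu]_x (icc 0 x0 x * D x + icc x0 n%:R x * D x)).
  by rewrite IntD//; apply: addr_ge0; [exact: HL|exact: HR].
 apply: ae_Int; [exact: rint_meas (rI _ _)|exact: rint_meas (rintD (rI _ _) (rI _ _))|].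
 apply: filterS (ae_neq x0) => x xn; rewrite -mulrDl; congr (_ * _); rewrite !iccE.
 have [xlt|xgt|xe] := ltgtP x x0.
 - by rewrite (le_trans (ltW xlt) x0n) !andbT/= addr0.
 - by rewrite (le_trans x00 (ltW xgt)) andbF/= add0r.
 - by rewrite xe eqxx in xn.
have ED : \int[mu]_x (hp x * D x) = S - P / 2 - 5 / 9 * (P - 2 * c * L + c ^+ 2 * (144 / 5)).
 rewrite -energy_factor -iz.2 -IntZ; last exact: hp_rint iz.1.
 rewrite -IntB; [|exact: hp_rint (sqint_sq e2)|apply: rintZ; exact: hp_rint iz.1].
 by apply: eq_Int => x; rewrite /D; ring.
rewrite ED in D0; move: D0; move: P S L => P' S' L' D0.
have := sqr_ge0 (144 / 5 * c - L'); have := sqr_ge0 L'; nra.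
Unshelve. all: by end_near. Qed.

End half_line.

(** The transform of a truncated function is continuously differentiable, so the half-line
    inequalities apply; evenness doubles the half-line integrals. *)
Lemma trunc_soliton (d : R -> R) n : VD w2 d ->
 let g := trunc n d in let f := hint g in let f1 := fun x => hint (fun y => y * g y) (- x) in
 [/\ H1e f f1, q w2 g g = 2 * \int[mu]_x (hp x * (f1 x ^+ 2 + f x ^+ 2)),
 T kG g g = 2 * \int[mu]_x (hp x * (kQ x * f x ^+ 2)) &
 q w2 kG g = \int[mu]_x (hp x * (kQ x ^+ 2 * f x))].
Proof.
move=> Vd; rewrite /=.
set g := trunc n d.
have Vg : VD w2 g := VD_trunc n Vd.
have g2 := VD_sq Vg; have yg2 := w2_moment Vg; have eg := VD_even Vg.
have g1 : rint g := trunc_rint n (VD_sq Vd).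
have yg1 : rint (fun y => y * g y).
 by apply: rint_eq (trunc_rint n (w2_moment Vd)) => y; rewrite /g /trunc mulrCA.
set f := hint g; set f1 := fun x => hint (fun y => y * g y) (- x).
have H : H1e f f1 := hint_H1e g2 g1 yg2 yg1 eg.
have f2 := h1_sq H; have f12 := h1_sq1 H.
have fE := Ht_explicit g2 g1.
have mf := sqint_meas f2; have mf1 := sqint_meas f12; have mH := sqint_meas (Ht_sq g2).
have ev x : f (- x) = f x by exact: h1_even H x.
have ev1 x : f1 (- x) = - f1 x by exact: h1_odd H.
have S1 : q w2 g g = 2 * \int[mu]_x (hp x * (f1 x ^+ 2 + f x ^+ 2)).
 have i : rint (fun x => f1 x ^+ 2 + f x ^+ 2) by apply: rintD; exact: sqint_sq.
 rewrite -Int_even//; last by apply: aeW => x; rewrite ev ev1 sqrrN.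
 have E1 : ip g g = \int[mu]_x f x ^+ 2 by rewrite -(ip_hint g2 g1 g2 g1) ipsE.
 have E2 : ip (fun y => y * g y) (fun y => y * g y) = \int[mu]_x f1 x ^+ 2.
  rewrite -(ip_hint yg2 yg1 yg2 yg1) ipsE.
  have mh : measR (fun x => hint (fun y => y * g y) x ^+ 2).
   by apply: measurable_funX; exact: sqint_meas (sqint_hint yg2 yg1).
  exact: esym (Int_opp mh).
 rewrite (q_w2 Vg) E1 E2 IntD; [|exact: sqint_sq|exact: sqint_sq].
 exact: addrC.
have P1 : T kG g g = 2 * \int[mu]_x (hp x * (kQ x * f x ^+ 2)).
 have i : rint (fun x => kQ x * f x ^+ 2).
  apply: rint_eq (sqint_mul (@sqint_bdd _ _ 3 f2 kQ_meas _) f2) => x; first by rewrite expr2 mulrA.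
  by rewrite ger0_norm ?kQ_le3// ltW// kQ_gt0.
 rewrite -Int_even//; last by apply: aeW => x; rewrite ev kQ_even.
 rewrite (T_kG (VD_V1 Vg) eg); apply: ae_Int.
 - by apply: mfunM; [exact: kQ_meas|exact: mfunM].
 - exact: rint_meas i.
 - by apply: filterS fE => x ->; rewrite expr2.
have L1 : q w2 kG g = \int[mu]_x (hp x * (kQ x ^+ 2 * f x)).
 have i : rint (fun x => kQ x ^+ 2 * f x) := sqint_mul kQ2_sqint f2.
 rewrite (q_kG Vg).
 have -> : \int[mu]_x (kQ x ^+ 2 * Ht g x) = \int[mu]_x (kQ x ^+ 2 * f x).
  apply: ae_ip; [exact: sqint_meas kQ2_sqint|exact: mH|exact: sqint_meas kQ2_sqint|exact: mf|exact: aeW|exact: fE].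
 rewrite Int_even//; first by field.
 by apply: aeW => x; rewrite ev kQ_even.
by split.
Qed.

Lemma soliton_second_variation (d : R -> R) : VD w2 d ->
 2 * T kG d d <= 36 / 19 * q w2 d d + 2 / 27 * q w2 kG d ^+ 2.
Proof.
move=> Vd; have V := VD_V1 Vd.
have [c2 c1] := q_cvg (fun n => VD_trunc n Vd) Vd kG_V (trunc_q_cvg Vd).
have cT := T_trunc_cvg kG_sqint V.
have cl : 2 * T kG (trunc n d) (trunc n d) @[n --> \oo] --> 2 * T kG d d.
 by apply: cvgM; [exact: cvg_cst|exact: cT].
have cr : 36 / 19 * q w2 (trunc n d) (trunc n d) + 2 / 27 * q w2 kG (trunc n d) ^+ 2 @[n --> \oo] -->
  36 / 19 * q w2 d d + 2 / 27 * q w2 kG d ^+ 2.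
 apply: cvgD; first by apply: cvgM; [exact: cvg_cst|exact: c1].
 apply: cvgM; first exact: cvg_cst.
 rewrite (qC w2 kG); under eq_fun do rewrite (qC w2 kG).
 by apply: (@cvg_comp _ _ _ (fun n : nat => q w2 (trunc n d) kG) (fun y => y ^+ 2)) c2 _; exact: exprn_continuous.
apply: ler_cvg_to cl cr _.
near=> n; have [H S1 P1 L1] := trunc_soliton n Vd.
have := soliton_coercive H; rewrite S1 P1 L1.
move: (\int[mu]_x _) (\int[mu]_x _) (\int[mu]_x _) => *; lra.
Unshelve. all: by end_near. Qed.

(** * Stability of the KdV soliton *)

Lemma der_xsqrt x : hasder (fun y : R => y * Num.sqrt y) x (3 / 2 * Num.sqrt x).
Proof.
have [x0|x0|->] := ltgtP x 0.
- rewrite ltr0_sqrtr// mulr0; apply: near_eq_is_derive (der_cst 0 x).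
 near=> y; rewrite ltr0_sqrtr ?mulr0//.
 by near: y; exact: lt_nbhsl.
- have h : 0 < Num.sqrt x by rewrite sqrtr_gt0.
 apply: (@der_eq _ _ (1 * Num.sqrt x + x * ((2 * Num.sqrt x)^-1 * 1))).
  by apply: derM; [exact: der_id|exact: der_sqrt (der_id x) x0].
 rewrite -[X in _ + X * _](sqr_sqrtr (ltW x0)); field; exact: lt0r_neq0.
- rewrite sqrtr0 mulr0.
 have c : (fun h : R => h^-1 *: ((h *: 1 + 0) * Num.sqrt (h *: 1 + 0) - 0 * Num.sqrt 0)) @ 0^' --> 0.
  have s0 : Num.sqrt h @[h --> 0^'] --> (0 : R).
   by apply: cvg_within_filter; have := @sqrt_continuous R 0; rewrite /continuous_at sqrtr0.
  apply: cvg_trans s0; apply: near_eq_cvg; near=> h.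
  have h0 : h != 0 by near: h; exact: nbhs_dnbhs_neq.
  by rewrite !scaler1 addr0 mul0r subr0 /GRing.scale/= mulrA mulVf// mul1r.
 by apply: DeriveDef; [apply/cvg_ex; exists 0|exact: cvg_lim].
Unshelve. all: by end_near. Qed.

Lemma sqrt_continuous_comp f : continuous f -> continuous (fun x => Num.sqrt (f x)).
Proof. by move=> cf x; apply: (@continuous_comp _ _ _ f (fun y : R => Num.sqrt y)); [exact: cf|exact: sqrt_continuous]. Qed.

(** Bounds the derivative of [r - t] where [r >= t]. Without the defect [e] and the regularization,
    [r] and [t] solve the same equation [y' = (1 - y^2) / 2]; the regularization costs [k^2 / 2],
    and [e] is split by Young's inequality with parameter [s]. *)
Lemma gronwall_num (t r w z e m k s : R) : 0 <= t <= 1 -> t <= r -> 0 < k -> k <= r -> r ^+ 2 = z + k ^+ 2 ->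
 0 <= w -> w ^+ 2 = z -> 0 < m -> 0 < s ->
 ((1 - z) * w - e / m) * (2 * r)^-1 - 2^-1 * (1 - t ^+ 2) <= k ^+ 2 / 2 + (s + e ^+ 2 / s) / (4 * m * k).
Proof.
move=> /andP[t0 t1] tr k0 kr er w0 ew m0 s0.
have r0 : 0 < r by apply: lt_le_trans kr.
have wr : w <= r by nra.
have A : (1 - z) * w / (2 * r) <= 2^-1 * (1 - t ^+ 2) + k ^+ 2 / 2.
 rewrite ler_pdivrMr ?mulr_gt0//.
 have [z1|z1] := leP z 1.
  have : (1 - z) * w <= (1 - z) * r by rewrite ler_wpM2l// subr_ge0.
  have : t ^+ 2 <= r ^+ 2 by rewrite ler_pXn2r ?nnegrE// ltW.
  rewrite er => h1 h2; nra.
 apply: (@le_trans _ _ 0); first by rewrite mulr_le0_ge0// subr_le0 ltW.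
 have t2 : t ^+ 2 <= 1 by rewrite expr_le1.
 by have := sqr_ge0 k => k2; apply: mulr_ge0; [lra|rewrite mulr_ge0// ltW].
have B : - (e / m) / (2 * r) <= (s + e ^+ 2 / s) / (4 * m * k).
 have es : 2 * `|e| <= s + e ^+ 2 / s.
  rewrite -subr_ge0 (_ : _ - _ = (s - `|e|) ^+ 2 / s); first by rewrite mulr_ge0 ?sqr_ge0// invr_ge0 ltW.
  by rewrite -(norm_sq e); field; exact: lt0r_neq0.
 apply: (@le_trans _ _ (2 * `|e| / (4 * m * k))); last first.
  by rewrite ler_wpM2r// invr_ge0 !mulr_ge0// ltW.
 apply: (@le_trans _ _ (`|e| / m / (2 * r))).
  by rewrite ler_wpM2r ?invr_ge0 ?mulr_ge0 ?(ltW r0)// -mulNr ler_wpM2r ?invr_ge0 ?(ltW m0)// -normrN ler_norm.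
 rewrite (_ : 2 * `|e| / (4 * m * k) = `|e| / m / (2 * k)); last by field; rewrite !lt0r_neq0.
 rewrite ler_wpM2l ?divr_ge0 ?(ltW m0)// lef_pV2 ?posrE ?mulr_gt0//.
 by rewrite ler_pM2l.
have -> : ((1 - z) * w - e / m) * (2 * r)^-1 = (1 - z) * w / (2 * r) + - (e / m) / (2 * r) by rewrite mulrDl.
move: A B; move: (_ / (2 * r)) (_ / (2 * r)) (_ / (4 * m * k)) => a b c; lra.
Qed.

Section peak.
Variables (f f1 : R -> R).
Hypotheses (H : H1e f f1) (fm : forall x, `|f x| <= f 0) (m0 : 0 < f 0).
Let df : forall x, hasder f x (f1 x). Proof. exact: h1_der H. Qed.
Let cf1 : continuous f1. Proof. exact: h1_cont H. Qed.
Let cf : continuous f. Proof. exact: der_continuous df. Qed.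
Let f2 : sqint f. Proof. exact: h1_sq H. Qed.
Let f12 : sqint f1. Proof. exact: h1_sq1 H. Qed.
Let m := f 0.
Let cM u v : continuous u -> continuous v -> continuous (fun x => u x * v x).
Proof. by move=> cu cv x; apply: cvgM; [exact: cu|exact: cv]. Qed.
Let cA u v : continuous u -> continuous v -> continuous (fun x => u x + v x).
Proof. by move=> cu cv x; apply: cvgD; [exact: cu|exact: cv]. Qed.
Let cB u v : continuous u -> continuous v -> continuous (fun x => u x - v x).
Proof. by move=> cu cv x; apply: cvgB; [exact: cu|exact: cv]. Qed.
Let cC c : continuous (fun _ : R => c).
Proof. by move=> x; exact: cvg_cst. Qed.
Let m_neq0 : m != 0. Proof. exact: lt0r_neq0. Qed.

Let z x := 1 - f x * m^-1.
Let rz x := Num.sqrt (z x).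
(** The defect in the first-order equation [f' = - f sqrt (1 - f / m)], which the soliton with
    height [m = 3] satisfies on the positive half line. *)
Let e x := f1 x + f x * rz x.

Let cz : continuous z. Proof. by apply: cB; [exact: cC|apply: cM => //; exact: cC]. Qed.
Let crz : continuous rz. Proof. exact: sqrt_continuous_comp. Qed.
Let ce : continuous e. Proof. by apply: cA => //; exact: cM. Qed.
Let dz x : hasder z x (- (f1 x * m^-1)). Proof. by rewrite /z; der; ring. Qed.

Let fmV x : `|f x * m^-1| <= 1.
Proof. by rewrite normrM normfV (gtr0_norm m0) ler_pdivrMr// mul1r. Qed.
Let z_ge0 x : 0 <= z x.
Proof. by rewrite /z subr_ge0; apply: le_trans (fmV x); exact: ler_norm. Qed.
Let z_le2 x : z x <= 2.
Proof. by have := fmV x; rewrite /z ler_norml => /andP[h _]; lra. Qed.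
Let rz_sq x : rz x ^+ 2 = z x. Proof. exact: sqr_sqrtr. Qed.
Let rz_ge0 x : 0 <= rz x. Proof. exact: sqrtr_ge0. Qed.
Let rz_le2 x : `|rz x| <= 2.
Proof. by rewrite ger0_norm//; have := z_le2 x; have := rz_sq x; have := rz_ge0 x; nra. Qed.

Let e2 : sqint e.
Proof.
apply: sqintD => //.
have := sqint_bdd f2 (continuous_measR crz) rz_le2.
by rewrite (_ : (fun x => rz x * f x) = (fun x => f x * rz x))//; apply/funext => x; rewrite mulrC.
Qed.

Let N := \int[mu]_x (hp x * (f1 x ^+ 2 + f x ^+ 2)).
Let X := \int[mu]_x (hp x * f x ^+ 3).
Let E := \int[mu]_x (hp x * e x ^+ 2).

Let iX : rint (fun x => f x ^+ 3).
Proof.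
have fb x : `|f x| <= m by exact: fm.
apply: rint_eq (sqint_mul (sqint_bdd f2 (continuous_measR cf) fb) f2) => x.
by rewrite !exprS expr0 mulr1 mulrA.
Qed.

(** Completing the square: the cross term [2 f f' sqrt (1 - f / m)] is an exact derivative, and its
    boundary values at the peak and at infinity give [8/15 * m^2]. *)
Lemma peak_energy : E = N - X / m - 8 / 15 * m ^+ 2.
Proof.
pose hz x := z x * Num.sqrt (z x).
have dhz x : hasder hz x (3 / 2 * rz x * - (f1 x * m^-1)).
 exact: (der_comp (dz x) (der_xsqrt (z x))).
pose F x := - 2 * m ^+ 2 * (2 / 3 * hz x - 2 / 5 * (z x * hz x)).
pose g x := 2 * (rz x * f x) * f1 x.
have dF x : hasder F x (g x).
 rewrite /F; der; rewrite /g /hz -/(rz x).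
 have -> : f x = m * (1 - z x) by rewrite /z; field.
 by field.
have cg : continuous g by apply: cM => //; apply: cM; [exact: cC|exact: cM].
have ig : rint g.
 apply: rint_eq (rintZ 2 (sqint_mul (sqint_bdd f2 (continuous_measR crz) rz_le2) f12)) => x.
 by rewrite /g; ring.
have vf := H1_vanish df cf1 f2 f12.
have vz : z n%:R @[n --> \oo] --> (1 : R).
 rewrite -[X in _ --> X](subr0 1) -[X in _ --> _ - X](mul0r m^-1); apply: cvgB; first exact: cvg_cst.
 by apply: cvgM; [exact: vf|exact: cvg_cst].
have vhz : hz n%:R @[n --> \oo] --> (1 : R).
 have vs : Num.sqrt (z n%:R) @[n --> \oo] --> Num.sqrt (1 : R).
  by apply: (@cvg_comp _ _ _ (fun n : nat => z n%:R) (fun y : R => Num.sqrt y)) vz _; exact: sqrt_continuous.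
 have c : z n%:R * Num.sqrt (z n%:R) @[n --> \oo] --> 1 * Num.sqrt (1 : R) by apply: cvgM.
 by rewrite sqrtr1 mulr1 in c; exact: c.
have vF : F n%:R @[n --> \oo] --> (- 2 * m ^+ 2 * (2 / 3 * 1 - 2 / 5 * (1 * 1)) : R).
 apply: cvgM; first exact: cvg_cst.
 apply: cvgB; apply: cvgM; try exact: cvg_cst; first exact: vhz.
 by apply: cvgM; [exact: vz|exact: vhz].
have hg : rint (fun x => hp (x - 0) * g x).
 by apply: rint_eq (hp_rint ig) => x; rewrite subr0.
have Z := FTCn (fun x _ => cg x) (fun x _ => dF x) hg vF.
have z0 : z 0 = 0 by rewrite /z -/m divff// subrr.
have Z0 : \int[mu]_x (hp x * g x) = - 8 / 15 * m ^+ 2.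
 rewrite (_ : \int[mu]_x (hp x * g x) = \int[mu]_x (hp (x - 0) * g x)); last by apply: eq_Int => x; rewrite subr0.
 by rewrite Z /F /hz z0; field.
have iN : rint (fun x => f1 x ^+ 2 + f x ^+ 2) by apply: rintD; exact: sqint_sq.
have hN := hp_rint iN; have hX := hp_rint iX; have hhg := hp_rint ig.
transitivity (\int[mu]_x (hp x * (f1 x ^+ 2 + f x ^+ 2) - m^-1 * (hp x * f x ^+ 3) + hp x * g x)).
 apply: eq_Int => x; rewrite /e /g.
 have -> : (f1 x + f x * rz x) ^+ 2 = f1 x ^+ 2 + 2 * f1 x * f x * rz x + f x ^+ 2 * rz x ^+ 2 by ring.
 by rewrite rz_sq /z; field.
rewrite IntD; [|by apply: rintB => //; exact: rintZ|by []].
rewrite IntB; [|by []|exact: rintZ].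
by rewrite IntZ// Z0 /N /X; field.
Qed.

(** If the defect vanished, [sqrt (1 - f / m)] would solve the equation of [th] with the same value
    at 0, whatever [m]. The term [k ^+ 4] makes the square root differentiable at the peak, and
    [D * sqrt D] is continuously differentiable across [D = 0] and zero for negative [D], so only
    the excess over [th] is propagated. *)
Lemma peak_comparison (k s L : R) : 0 < k -> k <= 1 -> 0 < s ->
 forall x, 0 <= x <= L ->
 let D := Num.sqrt (z x + k ^+ 4) - th x in
 D * Num.sqrt D <= k ^+ 3 + 9 / 4 * (k ^+ 4 / 2 + s / (4 * m * k ^+ 2)) * L + 9 / 4 * ((s * (4 * m * k ^+ 2))^-1 * E).
Proof.
move=> k0 k1 s0 x /andP[x0 xL] /=.
have k4 : 0 < k ^+ 4 by exact: exprn_gt0.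
have k20 : 0 < k ^+ 2 by exact: exprn_gt0.
pose r y := Num.sqrt (z y + k ^+ 4).
have zk y : 0 < z y + k ^+ 4 by rewrite ltr_wpDl.
have r_sq y : r y ^+ 2 = z y + k ^+ 2 ^+ 2 by rewrite sqr_sqrtr -?exprM// ltW.
have kr y : k ^+ 2 <= r y.
 have -> : k ^+ 2 = Num.sqrt (k ^+ 4) by rewrite (_ : k ^+ 4 = k ^+ 2 ^+ 2) -?exprM// exprM sqrtr_sqr ger0_norm// ltW.
 by rewrite ler_wsqrtr// lerDr.
have r0 y : 0 < r y by exact: lt_le_trans (kr y).
pose D y := r y - th y.
pose D1 y := (2 * r y)^-1 * - (f1 y * m^-1) - kQ y / 6.
have dt := th_der.
have dD y : hasder D y (D1 y).
 rewrite /D /r; der; first exact: zk.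
 by rewrite addr0.
pose G y := 3 / 2 * Num.sqrt (D y) * D1 y.
have dG y : hasder (fun y => D y * Num.sqrt (D y)) y (G y).
 exact: (der_comp (dD y) (der_xsqrt (D y))).
have cr : continuous r by apply: sqrt_continuous_comp; apply: cA => //; exact: cC.
have cD : continuous D := der_continuous dD.
have cG : continuous G.
 apply: cM; first by apply: cM; [exact: cC|exact: sqrt_continuous_comp].
 apply: cB; last by apply: cM; [exact: kQ_continuous|exact: cC].
 apply: cM; last by move=> y; apply: cvgN; apply: (@cM _ _ cf1 (@cC m^-1) y).
 move=> y; apply: cvgV; first by rewrite mulf_neq0// lt0r_neq0.
 exact: (@cM _ _ (@cC 2) cr y).
have [iG eG] := FTCab x0 (fun y _ => cG y) (fun y _ => dG y).
pose c1 := 9 / 4 * (k ^+ 4 / 2 + s / (4 * m * k ^+ 2)).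
pose c2 := 9 / 4 * (s * (4 * m * k ^+ 2))^-1.
have mk : 0 < 4 * m * k ^+ 2 by rewrite !mulr_gt0.
have c10 : 0 <= c1 by rewrite mulr_ge0 ?addr_ge0 ?divr_ge0 ?ltW.
have c20 : 0 <= c2 by rewrite mulr_ge0// invr_ge0 ltW// mulr_gt0.
have Gle y : 0 <= y -> G y <= c1 + c2 * e y ^+ 2.
 move=> y0; have c0 : 0 <= c1 + c2 * e y ^+ 2 by rewrite addr_ge0// mulr_ge0// sqr_ge0.
 have [Dn|Dp] := leP (D y) 0; first by rewrite /G ler0_sqrtr// mulr0 mul0r.
 have B := @gronwall_num (th y) (r y) (rz y) (z y) (e y) m (k ^+ 2) s.
 have t01 : 0 <= th y <= 1 by rewrite th_ge0//= ltW// th_lt1.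
 have tr : th y <= r y by rewrite -subr_ge0 ltW.
 have {}B := B t01 tr k20 (kr y) (r_sq y) (rz_ge0 y) (rz_sq y) m0 s0.
 have ED : D1 y = ((1 - z y) * rz y - e y / m) * (2 * r y)^-1 - 2^-1 * (1 - th y ^+ 2).
  by rewrite /D1 /e /z /kQ; field; rewrite m_neq0 lt0r_neq0.
 rewrite -ED in B.
 have sD : Num.sqrt (D y) <= 3 / 2.
  have : r y <= 9 / 4 by have := z_le2 y; have := r_sq y; have := r0 y; have : k ^+ 2 ^+ 2 <= 1 by [rewrite !exprn_ile1// ltW]; nra.
  have : D y <= r y by rewrite /D gerBl th_ge0.
  have := sqr_sqrtr (ltW Dp); have := sqrtr_ge0 (D y); move: (Num.sqrt (D y)) => S; nra.
 have B0 : 0 <= (k ^+ 2) ^+ 2 / 2 + (s + e y ^+ 2 / s) / (4 * m * k ^+ 2).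
  by rewrite addr_ge0 ?divr_ge0 ?sqr_ge0 ?addr_ge0 ?divr_ge0 ?sqr_ge0 ?(ltW s0) ?(ltW mk).
 rewrite /G (_ : c1 + _ = 3 / 2 * (3 / 2) * ((k ^+ 2) ^+ 2 / 2 + (s + e y ^+ 2 / s) / (4 * m * k ^+ 2))); last first.
  by rewrite /c1 /c2; field; rewrite !lt0r_neq0.
 have := ler_wpM2l (sqrtr_ge0 (D y)) B; have := ler_wpM2r B0 sD.
 move: (_ / 2 + _) (D1 y) (Num.sqrt (D y)) => B' d' s'; lra.
have ie : rint (fun y => icc 0 x y * (c1 + c2 * e y ^+ 2)).
 apply: (@continuous_rint_itv (fun y => c1 + c2 * e y ^+ 2)); apply: cA; first exact: cC.
 by apply: cM; [exact: cC|under eq_fun do rewrite expr2; exact: cM].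
have h2 := hp_rint (sqint_sq e2).
have ih : rint (fun y => c1 * icc 0 x y + c2 * (hp y * e y ^+ 2)).
 by apply: rintD; apply: rintZ => //; exact: icc_rint.
have I1 : \int[mu]_y (icc 0 x y * G y) <= \int[mu]_y (c1 * icc 0 x y + c2 * (hp y * e y ^+ 2)).
 apply: Int_le => // y; rewrite iccE; have [/andP[y0 yx]|_] := boolP (0 <= y <= x).
  by rewrite mul1r mulr1 hp_pos// mul1r Gle.
 rewrite mul0r mulr0 add0r; apply: mulr_ge0 => //.
 exact: mulr_ge0 (hp_ge0 _) (sqr_ge0 _).
rewrite eG IntD in I1; [|by apply: rintZ; exact: icc_rint|exact: rintZ].
rewrite !IntZ// in I1; last exact: icc_rint.
rewrite int_icc0// -/E in I1.
have D0 : D 0 * Num.sqrt (D 0) = k ^+ 3.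
 have z0 : z 0 = 0 by rewrite /z -/m divff// subrr.
 have -> : D 0 = k ^+ 2.
  by rewrite /D /r th0 subr0 z0 add0r (_ : k ^+ 4 = (k ^+ 2) ^+ 2) -?exprM// exprM sqrtr_sqr ger0_norm// ltW.
 by rewrite sqrtr_sqr ger0_norm ?(ltW k0)// -exprSr.
rewrite D0 lerBlDl in I1; apply: le_trans I1 _.
rewrite -/c1 (mulrA (9 / 4)) -/c2 addrA lerD2r lerD2l ler_wpM2l//.
Qed.

End peak.

Lemma peak_num (z t D r ep : R) : 0 <= t <= 1 -> 0 < ep -> ep <= 1 -> 0 <= z -> z <= r ^+ 2 -> 0 <= r ->
 D = r - t -> D * Num.sqrt D <= ep ^+ 3 -> z <= t ^+ 2 + 3 * ep ^+ 2.
Proof.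
move=> /andP[t0 t1] e0 e1 z0 zr r0 eD h.
have De : D <= ep ^+ 2.
 rewrite leNgt; apply/negP => lt; suff : ep ^+ 3 < D * Num.sqrt D by rewrite ltNge h.
 have se : ep <= Num.sqrt D.
  rewrite -[X in X <= _]ger0_norm ?(ltW e0)// -sqrtr_sqr ler_wsqrtr// ltW//.
 rewrite exprSr; apply: (@lt_le_trans _ _ (D * ep)); first by rewrite ltr_pM2r.
 by rewrite ler_wpM2l// (le_trans (sqr_ge0 ep))// ltW.
have e2 : 0 <= ep ^+ 2 <= ep by rewrite sqr_ge0/= expr2 ler_piMr// ltW.
have rt : r <= t + ep ^+ 2 by move: De; rewrite eD; lra.
apply: le_trans zr _; move: e2; move: (ep ^+ 2) rt => q rt /andP[q0 qe]; nra.
Qed.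

(** At the extremal values of [N] and [X] the energy identity has numerator
    [- 8/15 * (m - 3)^2 (m + 6)], so nonnegativity pins the height at 3. *)
Lemma peak_height (m X N d : R) : 0 < m -> N <= 72 / 5 -> 144 / 5 - d / 2 <= X ->
 0 <= N - X / m - 8 / 15 * m ^+ 2 -> (m - 3) ^+ 2 <= d / 6.
Proof.
move=> m0 hN hX h.
have : 0 <= m * (N - X / m - 8 / 15 * m ^+ 2) by rewrite mulr_ge0// ltW.
have -> : m * (N - X / m - 8 / 15 * m ^+ 2) = m * N - X - 8 / 15 * m ^+ 3 by field; exact: lt0r_neq0.
have := sqr_ge0 (m - 3).
have : m * N <= m * (72 / 5) by rewrite ler_pM2l.
have e : (m - 3) ^+ 2 * (m + 6) = m ^+ 3 - 27 * m + 54 by ring.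
have := mulr_ge0 (sqr_ge0 (m - 3)) (ltW m0).
nra.
Qed.

Lemma peak_defect_num (m X N d : R) : 0 <= d -> 2 <= m -> N <= 72 / 5 -> 144 / 5 - d / 2 <= X ->
 N - X / m - 8 / 15 * m ^+ 2 <= d / 4.
Proof.
move=> d0 m2 hN hX; have m0 : 0 < m by lra.
have := mulr_ge0 (sqr_ge0 (m - 3)) (ltW m0); have := sqr_ge0 (m - 3).
have e : (m - 3) ^+ 2 * (m + 6) = m ^+ 3 - 27 * m + 54 by ring.
have -> : N - X / m - 8 / 15 * m ^+ 2 = (m * N - X - 8 / 15 * m ^+ 3) / m by field; exact: lt0r_neq0.
rewrite ler_pdivrMr//; have : m * N <= m * (72 / 5) by rewrite ler_pM2l.
nra.
Qed.

(** [k] and [s] are tied to the length [L] so that the error accumulated over [[0, L]] stays below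
    [ep ^+ 3]. *)
Lemma peak_total_num (ep L k s m E : R) : 0 < ep -> ep <= 1 -> 1 <= L -> k = ep / (2 * L) ->
 s = ep ^+ 3 * k ^+ 2 / L -> 2 <= m -> E <= s ^+ 2 / 4 ->
 k ^+ 3 + 9 / 4 * (k ^+ 4 / 2 + s / (4 * m * k ^+ 2)) * L + 9 / 4 * ((s * (4 * m * k ^+ 2))^-1 * E) <= ep ^+ 3.
Proof.
move=> e0 e1 L1 ek es m2 hE.
have L0 : 0 < L by lra.
have m0 : 0 < m by lra.
have k0 : 0 < k by rewrite ek divr_gt0// mulr_gt0.
have s0 : 0 < s by rewrite es divr_gt0// mulr_gt0// exprn_gt0.
have e30 : 0 < ep ^+ 3 by rewrite exprn_gt0.
have k2 : k <= ep / 2.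
 by rewrite ek invfM mulrA ler_piMr ?invf_le1// divr_ge0// ltW.
have k3 : k ^+ 3 <= ep ^+ 3 / 8.
 have -> : ep ^+ 3 / 8 = (ep / 2) ^+ 3 by field.
 by rewrite ler_pXn2r// nnegrE ?divr_ge0// ltW.
have a1 : k ^+ 4 / 2 * L <= ep ^+ 3 / 32.
 have -> : k ^+ 4 / 2 * L = k ^+ 3 * (ep / 4) by rewrite [X in _ * (X / 4)](_ : ep = k * (2 * L)); [by field|rewrite ek; field; exact: lt0r_neq0].
 have : k ^+ 3 * (ep / 4) <= k ^+ 3 * (1 / 4) by rewrite ler_pM2l ?exprn_gt0// ler_pM2r// invr_gt0.
 lra.
have a2 : s / (4 * m * k ^+ 2) * L <= ep ^+ 3 / 8.
 have -> : s / (4 * m * k ^+ 2) * L = ep ^+ 3 / (4 * m) by rewrite es; field; rewrite !lt0r_neq0.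
 by rewrite ler_pM2l// lef_pV2 ?posrE ?mulr_gt0//; lra.
have a3 : (s * (4 * m * k ^+ 2))^-1 * E <= ep ^+ 3 / 32.
 apply: le_trans (ler_wpM2l _ hE) _; first by rewrite invr_ge0 ltW// mulr_gt0// !mulr_gt0// exprn_gt0.
 have -> : (s * (4 * m * k ^+ 2))^-1 * (s ^+ 2 / 4) = ep ^+ 3 / (16 * m * L).
  by rewrite es; field; rewrite !lt0r_neq0.
 rewrite ler_pM2l// lef_pV2 ?posrE ?mulr_gt0//; nra.
move: a1 a2 a3 k3 e30; move: (s / _) (_^-1 * E) (k ^+ 4) (k ^+ 3) (ep ^+ 3) => A B C D F; clear => *; nra.
Qed.

Lemma peak_profile f f1 (ep L : R) : H1e f f1 -> (forall x, `|f x| <= f 0) -> 0 < f 0 ->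
 0 < ep -> ep <= 1 -> 1 <= L -> let s := ep ^+ 3 * (ep / (2 * L)) ^+ 2 / L in
 \int[mu]_x (hp x * (f1 x ^+ 2 + f x ^+ 2)) <= 72 / 5 ->
 144 / 5 - s ^+ 2 / 2 <= \int[mu]_x (hp x * f x ^+ 3) ->
 `|f 0 - 3| <= ep /\ forall x, 0 <= x <= L -> f 0 / 3 * kQ x - 3 * f 0 * ep ^+ 2 <= f x.
Proof.
move=> H fm m0 e0 e1 L1 s hN hX; set m := f 0 in m0 *.
have L0 : 0 < L by lra.
set k := ep / (2 * L) in s hX *.
have k0 : 0 < k by rewrite divr_gt0// mulr_gt0.
have k1 : k <= 1 by rewrite ler_pdivrMr ?mulr_gt0//; lra.
have s0 : 0 < s by rewrite divr_gt0// mulr_gt0// exprn_gt0.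
have se : s <= ep.
 rewrite /s ler_pdivrMr//; have kk : k ^+ 2 <= 1 by rewrite expr_le1// ltW.
 have ee : ep ^+ 3 <= ep by rewrite exprS ler_piMr// ?expr_le1// ltW.
 apply: (@le_trans _ _ ep); last by rewrite ler_peMr// ltW.
 by apply: le_trans ee; rewrite ler_piMr// exprn_ge0// ltW.
have E := peak_energy H fm m0; rewrite -/m in E.
set e := fun x => _ in E.
have E0 : 0 <= \int[mu]_x (hp x * (f1 x + f x * Num.sqrt (1 - f x * m^-1)) ^+ 2).
 by apply: Int_ge0 => x; rewrite mulr_ge0 ?hp_ge0 ?sqr_ge0.
rewrite E in E0.
have h := peak_height m0 hN hX E0.
have me : `|m - 3| <= ep.
 rewrite -(ler_pXn2r (_ : (0 < 2)%N)) ?nnegrE// ?(ltW e0)// norm_sq//.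
 apply: le_trans h _; have : s ^+ 2 <= ep ^+ 2 by rewrite ler_pXn2r ?nnegrE// ltW.
 have := sqr_ge0 ep; lra.
split=> //.
have m2 : 2 <= m by move: me; rewrite ler_norml => /andP[? _]; lra.
have hE := peak_defect_num (sqr_ge0 s) m2 hN hX.
rewrite -E in hE.
move=> x hx; have /andP[x0 xL] := hx.
have cmp := peak_comparison H fm m0 k0 k1 s0 hx.
rewrite /= -/m in cmp.
have num := peak_total_num e0 e1 L1 erefl erefl m2 hE.
have {}cmp := le_trans cmp num.
have fx : `|f x * m^-1| <= 1 by rewrite normrM normfV (gtr0_norm m0) ler_pdivrMr// mul1r; exact: fm.
have z0 : 0 <= 1 - f x * m^-1 by rewrite subr_ge0; apply: le_trans fx; exact: ler_norm.
have k4 : 0 <= k ^+ 4 by rewrite exprn_ge0// ltW.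
have t01 : 0 <= th x <= 1 by rewrite th_ge0//= ltW// th_lt1.
have zr : 1 - f x * m^-1 <= Num.sqrt (1 - f x * m^-1 + k ^+ 4) ^+ 2 by rewrite (sqr_sqrtr (addr_ge0 z0 k4)) lerDl.
have zt := peak_num t01 e0 e1 z0 zr (sqrtr_ge0 _) erefl cmp.
have := ler_wpM2l (ltW m0) zt.
have -> : m * (1 - f x * m^-1) = m - f x by field; exact: lt0r_neq0.
by rewrite /kQ; move: (th x ^+ 2) (ep ^+ 2) => *; nra.
Qed.

Lemma kQ2_moment : rint (fun x => hp x * (x * kQ x ^+ 2)).
Proof.
apply: (@hp_exp_rint (fun x => x * kQ x ^+ 2) 144).
 by apply: mfunM; [exact: measurable_id|apply: measurable_funX; exact: kQ_meas].
move=> x x0; rewrite ger0_norm; last by rewrite mulr_ge0 ?sqr_ge0.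
have h : kQ x ^+ 2 <= (12 * expR (- x)) ^+ 2.
 by rewrite ler_pXn2r ?nnegrE ?(ltW (kQ_gt0 x)) ?mulr_ge0 ?expR_ge0//; exact: kQ_le_exp.
apply: le_trans (ler_wpM2l x0 h) _.
have xe : x * expR (- x) <= 1.
 by rewrite expRN ler_pdivrMr ?expR_gt0// mul1r; have := expR_ge1Dx x; lra.
have -> : x * (12 * expR (- x)) ^+ 2 = 144 * expR (- x) * (x * expR (- x)) by ring.
by rewrite ler_piMr// mulr_ge0// expR_ge0.
Qed.

(** On a long interval [f] is bounded below by almost the soliton. Beyond it [f >= - f 0], and the
    first moment of [kQ ^ 2] makes that tail negligible. *)
Lemma soliton_stability_H1 (e : R) : 0 < e -> exists2 d, 0 < d & forall f f1, H1e f f1 ->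
 (forall x, `|f x| <= f 0) -> \int[mu]_x (hp x * (f1 x ^+ 2 + f x ^+ 2)) <= 72 / 5 ->
 144 / 5 - d <= \int[mu]_x (hp x * f x ^+ 3) ->
 144 / 5 - e <= \int[mu]_x (hp x * (kQ x ^+ 2 * f x)).
Proof.
move=> e0.
have q2 := hp_rint kQ2_rint; have q3 := hp_rint kQ3_rint; have xq := kQ2_moment.
set C0 := \int[mu]_x (hp x * kQ x ^+ 2); set C1 := \int[mu]_x (hp x * (x * kQ x ^+ 2)).
have C00 : 0 <= C0 by apply: Int_ge0 => x; rewrite mulr_ge0 ?hp_ge0 ?sqr_ge0.
have C10 : 0 <= C1.
 apply: Int_ge0 => x; rewrite hpE; case: (leP 0 x) => x0; last by rewrite mul0r.
 by rewrite mul1r mulr_ge0 ?sqr_ge0.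
pose B := 2 * (10 + 12 * C0).
have B0 : 0 < B by rewrite /B; lra.
pose ep := Order.min 1 (e / B); pose L := 1 + 16 * C1 / e.
have ep0 : 0 < ep by rewrite lt_min ltr01/= divr_gt0.
have ep1 : ep <= 1 by rewrite ge_min lexx.
have epB : B * ep <= e by rewrite mulrC -ler_pdivlMr// ge_min lexx orbT.
have L1 : 1 <= L by rewrite lerDl divr_ge0 ?mulr_ge0// ltW.
have L0 : 0 < L by lra.
have LC : 8 * C1 / L <= e / 2.
 rewrite ler_pdivrMr// /L mulrDr mulr1 (_ : e / 2 * (16 * C1 / e) = 8 * C1); last by field; exact: lt0r_neq0.
 by rewrite lerDr divr_ge0// ltW.
pose s := ep ^+ 3 * (ep / (2 * L)) ^+ 2 / L.
have s0 : 0 < s by rewrite divr_gt0// mulr_gt0// exprn_gt0// divr_gt0// mulr_gt0.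
exists (Order.min 1 (s ^+ 2 / 2)); first by rewrite lt_min ltr01 divr_gt0// exprn_gt0.
move=> f f1 H fm hN hX.
have cf := der_continuous (h1_der H); have f2 := h1_sq H.
have dmin : Order.min 1 (s ^+ 2 / 2) <= 1 /\ Order.min 1 (s ^+ 2 / 2) <= s ^+ 2 / 2.
 by rewrite !ge_min !lexx orbT.
have m0 : 0 < f 0.
 rewrite lt_neqAle (le_trans (normr_ge0 _) (fm 0)) andbT; apply/eqP => z.
 move: hX; rewrite (_ : \int[mu]_x (hp x * f x ^+ 3) = 0); first by lra.
 transitivity (\int[mu]_x (0 : R)); last by rewrite Rintegral_cst// mul0r.
 apply: eq_Int => x; have := fm x.
 by rewrite -z normr_le0 => /eqP ->; rewrite expr0n mulr0.
have hX' : 144 / 5 - s ^+ 2 / 2 <= \int[mu]_x (hp x * f x ^+ 3) by lra.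
have [m3 low] := peak_profile H fm m0 ep0 ep1 L1 hN hX'.
set m := f 0 in m0 m3 low *.
have [ml mu4] : 3 - ep <= m /\ m <= 4 by move: m3; rewrite ler_norml => /andP[? ?]; split; lra.
have i := hp_rint (sqint_mul kQ2_sqint f2).
(* The term [2 m x / L] makes one lower bound valid everywhere: for [x > L] it exceeds [2 m], and
   [m / 3 * kQ - 2 m <= - m <= f]. *)
have I1 : \int[mu]_x ((m / 3 * (hp x * kQ x ^+ 3) - 3 * m * ep ^+ 2 * (hp x * kQ x ^+ 2)) - 2 * m / L * (hp x * (x * kQ x ^+ 2)))
  <= \int[mu]_x (hp x * (kQ x ^+ 2 * f x)).
 apply: Int_le => //.
  by apply: rintB; [apply: rintB; exact: rintZ|exact: rintZ].
 move=> x; rewrite hpE; case: (leP 0 x) => x0; last by rewrite !mul0r !mulr0 !subrr.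
 rewrite !mul1r.
 have -> : m / 3 * kQ x ^+ 3 - 3 * m * ep ^+ 2 * kQ x ^+ 2 - 2 * m / L * (x * kQ x ^+ 2) =
  kQ x ^+ 2 * (m / 3 * kQ x - 3 * m * ep ^+ 2 - 2 * m * (x / L)) by ring.
 apply: ler_wpM2l (sqr_ge0 _) _ _ _.
 have xL0 : 0 <= x / L by rewrite divr_ge0// ltW.
 have e20 := sqr_ge0 ep.
 have [xL|Lx] := leP x L; first by have := low x; rewrite x0 xL => /(_ isT); nra.
 have : 1 <= x / L by rewrite ler_pdivlMr// mul1r ltW.
 have := fm x; rewrite -/m ler_norml => /andP[fl _] h; have := kQ_le3 x; nra.
rewrite IntB in I1; [|by apply: rintB; exact: rintZ|exact: rintZ].
rewrite IntB in I1; [|exact: rintZ|exact: rintZ].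
rewrite !IntZ// kQ3_half -/C0 -/C1 in I1.
apply: le_trans I1.
have e2 : ep ^+ 2 <= ep by rewrite expr2 ler_piMr// ltW.
have h1 : 3 * m * ep ^+ 2 * C0 <= 12 * C0 * ep.
 have -> : 12 * C0 * ep = C0 * (3 * 4 * ep) by ring.
 rewrite [leLHS]mulrC; apply: ler_wpM2l => //; have := sqr_ge0 ep; nra.
have h2 : 2 * m / L * C1 <= 8 * C1 / L.
 have -> : 2 * m / L * C1 = m * (2 * (C1 / L)) by ring.
 have -> : 8 * C1 / L = 4 * (2 * (C1 / L)) by ring.
 by rewrite ler_wpM2r// mulr_ge0// divr_ge0// ltW.
move: epB; rewrite /B => epB; lra.
Qed.

(** Nonnegativity of [g] makes its transform attain its largest modulus at 0, which gives the peak
    required by the comparison. Truncation preserves sign and parity and makes the transform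
    differentiable. *)
Lemma soliton_profile_stability (e : R) : 0 < e -> exists2 d, 0 < d & forall g, VD w2 g -> (forall x, 0 <= g x) ->
 q w2 g g <= 144 / 5 -> 288 / 5 - d <= T3 g -> 144 / 5 - e <= q w2 g kG.
Proof.
move=> e0; have [d d0 Hd] := soliton_stability_H1 e0; exists d => // d' Vd' g0 hq hT.
have cq := trunc_q_cvg Vd'.
have cT := @T3_cvg w2 _ (fun n => trunc n d') d' w2_weight (fun n => VD_trunc n Vd') Vd' cq.
have [c2 _] := q_cvg (fun n => VD_trunc n Vd') Vd' kG_V cq.
apply: ler_cvg_to (cvg_cst (144 / 5 - e)) c2 _.
have nT : \forall n \near \oo, T3 d' - d < T3 (trunc n d').
 by move/cvgrPdist_lt : cT => /(_ d d0); apply: filterS => n; rewrite ltr_norml => /andP[_ h]; lra.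
near=> n.
have Tn : 288 / 5 - 2 * d <= T3 (trunc n d').
 have : T3 d' - d < T3 (trunc n d') by near: n.
 move: (T3 _) (T3 _) hT => *; lra.
have [H S1 _ L1] := trunc_soliton n Vd'.
set g := trunc n d' in H S1 L1 Tn *; set f := hint g in H S1 L1 *.
have Vg : VD w2 g := VD_trunc n Vd'.
have g2 := VD_sq Vg; have eg := VD_even Vg.
have g1 : rint g := trunc_rint n (VD_sq Vd').
have gn0 x : 0 <= g x by rewrite /g /trunc mulr_ge0// iccE.
have f2 := h1_sq H; have cf := der_continuous (h1_der H).
have fE := Ht_explicit g2 g1.
have f0 : f 0 = hc * \int[mu]_x g x.
 by rewrite /f /hint; congr (_ * _); apply: eq_Int => y; rewrite mulr0 /cas cos0 sin0 addr0 mulr1.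
have fm x : `|f x| <= f 0.
 have e1 : f x = hc * \int[mu]_y (g y * cos (y * x)).
  have ic : rint (fun y => g y * cas (y * x)) := rint_cas x g1.
  have icm : rint (fun y => g y * cas (y * - x)) := rint_cas (- x) g1.
  have : 2 * f x = hc * \int[mu]_y (g y * cas (y * x) + g y * cas (y * - x)).
   by rewrite IntD// mulrDr -/(hint g x) -/(hint g (- x)) (hint_even x g1 eg) -/f; ring.
  rewrite (_ : \int[mu]_y (g y * cas (y * x) + g y * cas (y * - x)) = 2 * \int[mu]_y (g y * cos (y * x))).
   by move: (f x) (\int[mu]_y _) => u v h; lra.
  rewrite -IntZ; first by apply: eq_Int => y; rewrite /cas mulrN cosN sinN; ring.
  apply: rint_eq (rintZ 2^-1 (rintD ic icm)) => y.
  by rewrite /cas mulrN cosN sinN; field.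
 have ic : rint (fun y => g y * cos (y * x)).
  apply: (rint_le _ g1); last by move=> y; rewrite normrM (ger0_norm (gn0 y)) ler_piMr// ler_norml cos_geN1 cos_le1.
  apply: mfunM; first exact: rint_meas g1.
  apply: continuous_measR; apply: (@der_continuous _ (fun y => - sin (y * x) * x)) => y; der; ring.
 rewrite e1 f0 normrM (gtr0_norm hc_gt0) ler_pM2l ?hc_gt0//.
 apply: le_trans (Int_norm ic) _; apply: Int_le => //; first exact: rint_norm.
 by move=> y; rewrite normrM (ger0_norm (gn0 y)) ler_piMr// ler_norml cos_geN1 cos_le1.
have iX : rint (fun x => f x ^+ 3).
 apply: rint_eq (sqint_mul (sqint_bdd f2 (continuous_measR cf) fm) f2) => x.
 by rewrite !exprS expr0 mulr1 mulrA.
have EX : T3 g = 2 * \int[mu]_x (hp x * f x ^+ 3).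
 rewrite -Int_even//; last by apply: aeW => x; rewrite (h1_even H).
 rewrite /T3 (TE g2 (VD_V1 Vg) eg (VD_V1 Vg) eg).
 have mH := sqint_meas (Ht_sq g2).
 apply: ae_Int; [by apply: mfunM => //; exact: mfunM|exact: rint_meas iX|].
 by apply: filterS fE => x ->; rewrite !exprS expr0 mulr1.
have hqn : q w2 g g <= 144 / 5.
 apply: le_trans hq; rewrite !qdef !ipsE; apply: Int_le; [exact: sqint_sq (VD_sw Vg)|exact: sqint_sq (VD_sw Vd')|].
 move=> x; rewrite -(norm_sq (sw w2 x * g x)) -[leRHS](norm_sq _).
 have h : `|sw w2 x * g x| <= `|sw w2 x * d' x|
  by rewrite (normrM (sw w2 x) (g x)) (normrM (sw w2 x) (d' x)) ler_wpM2l//; exact: trunc_le.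
 by rewrite (ler_pXn2r (isT : (0 < 2)%N)) ?nnegrE.
rewrite (qC w2) L1; apply: Hd H fm _ _; move: S1 hqn EX Tn.
 by move: (q w2 g g) (\int[mu]_x _) => *; lra.
by move: (T3 g) (\int[mu]_x (hp x * f x ^+ 3)) => *; lra.
Unshelve. all: by end_near. Qed.

Definition kdv_r : R := Num.sqrt (5 / 144).

Lemma kdv_base : base w2 2^-1 (lin kdv_r kG 0 kG) (2 * kdv_r).
Proof.
have V := kG_V; have VQ := VD_lin kdv_r 0 V V.
have r0 : 0 < kdv_r by rewrite sqrtr_gt0.
have r2 : kdv_r ^+ 2 = 5 / 144 by rewrite sqr_sqrtr.
have TQ d : VD w2 d -> T (lin kdv_r kG 0 kG) d d = kdv_r * T kG d d.
 by move=> Vd; rewrite (T_lin _ _ (VD_sq V) (VD_sq V) (VD_V1 Vd) (VD_V1 Vd)) mul0r addr0.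
have qQ d : VD w2 d -> q w2 (lin kdv_r kG 0 kG) d = kdv_r * q w2 kG d.
 by move=> Vd; rewrite (q_linl _ _ V V Vd) mul0r addr0.
split; [exact: w2_weight|exact: VQ| | |by rewrite mulr_gt0| |].
- by rewrite (q_scale _ V) r2 q_kG_kG; field.
- rewrite (T3_scale _ (VD_V1 V) (VD_even V)) T3_kG exprS r2; by field.
- move=> e e0; have e0' : 0 < e / kdv_r ^+ 2 by rewrite divr_gt0// exprn_gt0.
 have [d d0 Hd] := soliton_profile_stability e0'.
 exists (d * kdv_r ^+ 3); first by rewrite mulr_gt0// exprn_gt0.
 move=> g Vg g0 hq hT.
 pose h := lin kdv_r^-1 g 0 g.
 have Vh : VD w2 h := VD_lin _ _ Vg Vg.
 have rV : 0 < kdv_r^-1 by rewrite invr_gt0.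
 have h0 x : 0 <= h x by rewrite /h mul0r addr0 mulr_ge0// ltW.
 have qh : q w2 h h <= 144 / 5.
  rewrite (q_scale _ Vg) exprVn r2; move: (q w2 g g) hq => y hy; lra.
 have Th : 288 / 5 - d <= T3 h.
  rewrite (T3_scale _ (VD_V1 Vg) (VD_even Vg)) exprVn.
  rewrite [leRHS]mulrC ler_pdivlMr ?exprn_gt0// mulrBl; apply: le_trans hT.
  by rewrite lerD2r exprS r2; lra.
 have := Hd h Vh h0 qh Th.
 rewrite (q_linl _ _ Vg Vg V) mul0r addr0.
 rewrite (qC w2 g (lin _ _ _ _)) (qQ _ Vg) (qC w2 g kG).
 move: (q w2 kG g) => y hy; have := ler_wpM2l (sqr_ge0 kdv_r) hy.
 have -> : kdv_r ^+ 2 * (144 / 5 - e / kdv_r ^+ 2) = kdv_r ^+ 2 * (144 / 5) - e by field; exact: lt0r_neq0.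
 have -> : kdv_r ^+ 2 * (kdv_r^-1 * y) = kdv_r * y by field; exact: lt0r_neq0.
 rewrite r2; lra.
- exists (2 * kdv_r / 19), (2 / 27 / kdv_r); split; first by rewrite divr_gt0// mulr_gt0.
 move=> d Vd; rewrite (TQ _ Vd) (qQ _ Vd).
 have := ler_wpM2l (ltW r0) (soliton_second_variation Vd).
 move: (T kG d d) (q w2 d d) (q w2 kG d) => t y x h.
 have -> : 2 / 27 / kdv_r * (kdv_r * x) ^+ 2 = 2 / 27 * kdv_r * x ^+ 2 by field; exact: lt0r_neq0.
 lra.
Qed.

(** * Perturbation of the weight *)

Section perturbation.
Implicit Types (m d p : R -> R).

Lemma q_rint w c f g : weight w c -> VD w f -> VD w g -> rint (fun x => w x * f x * g x).
Proof.
move=> hw Vf Vg; apply: rint_eq (sqint_mul (VD_sw Vf) (VD_sw Vg)) => x.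
by rewrite -(sw_sq x hw); ring.
Qed.

Lemma q_le_mult w c w' c' k g : weight w c -> weight w' c' -> (forall x, w x <= k * w' x) -> VD w' g ->
 VD w g /\ q w g g <= k * q w' g g.
Proof.
move=> hw hw' le V; have g2 := VD_sq V; have [mw _ _ _] := hw.
have k0 : 0 <= k.
 by have := le_trans (ltW (weight_gt0 0 hw)) (le 0); rewrite pmulr_lge0// (weight_gt0 0 hw').
have Vg : VD w g.
 apply: (VDP hw (sqint_meas g2) (VD_even V)).
 apply: (sqint_le _ (sqintZ (Num.sqrt k) (VD_sw V))).
  by apply: mfunM; [exact: sw_meas|exact: sqint_meas g2].
 move=> x; rewrite mulrA !normrM ler_wpM2r// /sw -normrM -sqrtrM//.
 by rewrite !ger0_norm ?sqrtr_ge0// ler_wsqrtr.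
split; first exact: Vg.
rewrite (qE _ _ hw) (qE _ _ hw') -IntZ; last exact: (q_rint hw' V V).
apply: Int_le; [exact: (q_rint hw Vg Vg)|by apply: rintZ; exact: (q_rint hw' V V)|].
by move=> x; rewrite -!mulrA -!expr2 mulrA ler_wpM2r// sqr_ge0.
Qed.

Lemma q_diff w0 c0 w c p h m d : weight w0 c0 -> weight w c -> VD w0 m -> VD w0 d -> VD w m -> VD w d ->
 sqint (fun x => p x * m x) -> sqint (fun x => h x * d x) -> (forall x, p x * h x = w0 x - w x) ->
 (q w0 m d - q w m d) ^+ 2 <=
  ip (fun x => p x * m x) (fun x => p x * m x) * ip (fun x => h x * d x) (fun x => h x * d x).
Proof.
move=> hw0 hw V0m V0d Vm Vd pm hd e; apply: le_trans (cauchy_schwarz pm hd).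
rewrite (qE _ _ hw0) (qE _ _ hw) -IntB; [|exact: (q_rint hw0 V0m V0d)|exact: (q_rint hw Vm Vd)].
apply: le_of_eq; congr (_ ^+ 2); apply: eq_Int => x.
transitivity ((w0 x - w x) * m x * d x); first ring.
by rewrite -e; ring.
Qed.

(** The difference of the weights is factored as [sw w0] times a function of size [s / 2 * sw w0],
    and Cauchy-Schwarz fills the term in [s] of [close_cross]. *)
Lemma close_mult w0 c0 w c Q0 s : weight w0 c0 -> weight w c -> VD w0 Q0 -> q w0 Q0 Q0 = 1 ->
 0 < s -> s <= 2^-1 -> (forall x, `|w x - w0 x| <= s / 2 * w0 x) -> near_base w0 Q0 w s.
Proof.
move=> hw0 hw VQ qQ s0 s1 le.
have le1 x : w x <= (1 + s / 2) * w0 x by have := le x; rewrite ler_norml => /andP[_ h]; rewrite mulrDl mul1r; lra.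
have le2 x : w0 x <= (1 - s / 2)^-1 * w x.
 rewrite mulrC ler_pdivlMr; last by lra.
 by have := le x; rewrite ler_norml => /andP[h _]; rewrite mulrBr mulr1; lra.
have sub g : VD w g -> VD w0 g by move=> V; case: (q_le_mult hw0 hw le2 V).
have low g : VD w g -> (1 - s / 2) * q w0 g g <= q w g g.
 move=> V; have [_] := q_le_mult hw0 hw le2 V.
 by rewrite mulrC ler_pdivlMr 1?mulrC//; lra.
have [VwQ up] := q_le_mult hw hw0 le1 VQ.
split => //; last by rewrite qQ in up; lra.
 by move=> g /low h; apply: le_trans h; have := q_ge0 w0 g; nra.
move=> m d Vm Vd; have V0m := sub _ Vm; have V0d := sub _ Vd.
have swp x := sw_gt0 x hw0; have sws x := sw_sq x hw0.
have [[mw0 _ _ _] [mw _ _ _]] := (hw0, hw).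
pose p x := (w0 x - w x) * (sw w0 x)^-1.
have p_le x : `|p x * m x| <= `|s / 2 * (sw w0 x * m x)|.
 rewrite mulrA [leLHS]normrM [leRHS]normrM ler_wpM2r// /p.
 rewrite normrM normfV !(gtr0_norm (swp x)) ler_pdivrMr// distrC.
 rewrite [leRHS](_ : _ = s / 2 * w0 x); first exact: le.
 have pos : 0 <= s / 2 * sw w0 x by rewrite mulr_ge0 ?divr_ge0// ltW.
 by rewrite (ger0_norm pos) -(sws x); ring.
have mp : measR p.
 apply: mfunM; first exact: measurable_funB.
 by apply: (mfunC measR_inv); exact: sw_meas.
have pm : sqint (fun x => p x * m x).
 apply: (sqint_le _ (sqintZ (s / 2) (VD_sw V0m)) p_le).
 by apply: mfunM => //; exact: sqint_meas (VD_sq V0m).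
have e x : p x * sw w0 x = w0 x - w x by rewrite /p mulfVK// gt_eqF.
apply: le_trans (q_diff hw0 hw V0m V0d Vm Vd pm (VD_sw V0d) e) _.
rewrite -(qdef w0 d d).
have pp : ip (fun x => p x * m x) (fun x => p x * m x) <= (s / 2) ^+ 2 * q w0 m m.
 rewrite qdef !ipsE -IntZ; last exact: sqint_sq (VD_sw V0m).
 apply: Int_le; [exact: sqint_sq|by apply: rintZ; exact: sqint_sq (VD_sw V0m)|].
 move=> x; rewrite -exprMn -(norm_sq (p x * m x)) -[leRHS](norm_sq _).
 by rewrite (ler_pXn2r (isT : (0 < 2)%N)) ?nnegrE.
have := low _ Vd; move: pp; have := q_ge0 w0 m; have := q_ge0 w0 d; have := q_ge0 w d; have := normr_ge0 (q w m m - q w0 m m).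
move: (ip _ _) (`|q w m m - q w0 m m|) => t n; move: (q w0 m m) (q w0 d d) (q w d d) => m0 d0 d1 n0 h1 h2 h3 h4 h5.
have h6 : d0 <= 4 / 3 * d1 by nra.
apply: (@le_trans _ _ ((s / 2) ^+ 2 * m0 * d0)); first by rewrite ler_wpM2r.
apply: (@le_trans _ _ (s * m0 * d1)); last by rewrite ler_wpM2r// lerDr.
have -> : (s / 2) ^+ 2 * m0 * d0 = s * m0 * (s / 4 * d0) by field.
by apply: ler_wpM2l; [rewrite mulr_ge0// ltW|nra].
Qed.

(** Here [w - w0] need not be small. Its own form is nonnegative, so Cauchy-Schwarz for that form
    bounds the cross term by the energy that [m] gains times that of [d]. *)
Lemma close_ge w0 c0 w c Q0 s : weight w0 c0 -> weight w c -> (forall x, w0 x <= w x) ->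
 VD w Q0 -> 0 < s -> q w Q0 Q0 <= 1 + s -> near_base w0 Q0 w s.
Proof.
move=> hw0 hw le VQ s0 up.
have le1 x : w0 x <= 1 * w x by rewrite mul1r.
have sub g : VD w g -> VD w0 g by move=> V; case: (q_le_mult hw0 hw le1 V).
have low g : VD w g -> q w0 g g <= q w g g.
 by move=> V; have [_] := q_le_mult hw0 hw le1 V; rewrite mul1r.
split => //.
 by move=> g /low h; apply: le_trans h; rewrite ler_piMl ?q_ge0//; lra.
move=> m d Vm Vd; have V0m := sub _ Vm; have V0d := sub _ Vd.
have [[mw0 _ _ _] [mw _ _ _]] := (hw0, hw).
pose p x := Num.sqrt (w x - w0 x).
have p2 x : p x ^+ 2 = w x - w0 x by rewrite sqr_sqrtr// subr_ge0.
have key g : VD w g -> VD w0 g -> sqint (fun x => p x * g x) /\ ip (fun x => p x * g x) (fun x => p x * g x) = q w g g - q w0 g g.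
 move=> V V0; split.
  apply: (sqint_le _ (VD_sw V)).
   apply: mfunM; last exact: sqint_meas (VD_sq V).
   by apply: sw_meas; exact: measurable_funB.
  move=> x; rewrite !normrM ler_wpM2r// !ger0_norm ?sqrtr_ge0// ler_wsqrtr// gerBl.
  exact: ltW (weight_gt0 x hw0).
 rewrite (qE _ _ hw) (qE _ _ hw0) -IntB; [|exact: (q_rint hw V V)|exact: (q_rint hw0 V0 V0)].
 rewrite ipsE; apply: eq_Int => x; rewrite exprMn p2; ring.
have [pm Em] := key m Vm V0m; have [pd Ed] := key d Vd V0d.
have npm : sqint (fun x => - p x * m x).
 by have := sqintN pm; rewrite (_ : (fun x => - (p x * m x)) = (fun x => - p x * m x))//; apply/funext => x; rewrite mulNr.
have e x : - p x * p x = w0 x - w x by rewrite mulNr -expr2 p2; ring.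
apply: le_trans (q_diff hw0 hw V0m V0d Vm Vd npm pd e) _.
have -> : ip (fun x => - p x * m x) (fun x => - p x * m x) = ip (fun x => p x * m x) (fun x => p x * m x).
 by apply: eq_Int => x; ring.
rewrite Em Ed; have := low _ Vm; have := q_ge0 w0 m; have := q_ge0 w0 d; have := q_ge0 w d.
move: (q w m m) (q w0 m m) (q w d d) (q w0 d d) => m1 m0 d1 d0 h1 h2 h3 h4.
rewrite ger0_norm ?subr_ge0//; apply: (@le_trans _ _ ((m1 - m0) * d1)).
 by rewrite ler_wpM2l ?subr_ge0// gerBl.
by rewrite ler_wpM2r// lerDl mulr_ge0// ltW.
Qed.

(** Stability already implies maximality. A function exceeding [M0], normalized and made
    nonnegative, satisfies [base_S1] for every error, so it equals the profile, whose cubic form is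
    [M0]. *)
Lemma base_cubic_max w0 c0 Q0 M0 : base w0 c0 Q0 M0 -> cubic_max w0 M0.
Proof.
case=> hw VQ qQ TQ M0p S1 _ g Vg; rewrite leNgt; apply/negP => lt.
have [V' q'] := VD_norm Vg.
have q0 : 0 < q w0 g g.
 rewrite lt_neqAle q_ge0 andbT; apply/eqP => z.
 have := T_le hw Vg Vg Vg; rewrite -z sqrtr0 !mulr0 normr_le0 => /eqP t.
 by rewrite /T3 t -z mul0r mulr0 ltxx in lt.
pose r := (Num.sqrt (q w0 g g))^-1; have r0 : 0 < r by rewrite invr_gt0 sqrtr_gt0.
pose h := lin r (fun x => `|g x|) 0 (fun x => `|g x|).
have Vh : VD w0 h := VD_lin _ _ V' V'.
have qh : q w0 h h = 1 by rewrite (q_scale _ V') q' exprVn sqr_sqrtr ?mulVf ?q_ge0// gt_eqF.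
have h0 x : 0 <= h x by rewrite /h mul0r addr0 mulr_ge0// ltW.
have Th : M0 < T3 h.
 rewrite (T3_scale _ (VD_V1 V') (VD_even V')); apply: (@lt_le_trans _ _ (r ^+ 3 * T3 g)).
  rewrite /r exprVn mulrC ltr_pdivlMr ?exprn_gt0 ?sqrtr_gt0//.
  by rewrite exprSr sqr_sqrtr ?q_ge0.
 by rewrite ler_pM2l ?exprn_gt0//; exact: T3_norm (VD_V1 Vg).
have q1 : 1 <= q w0 h Q0.
 apply/ler_addgt0Pr => e e0; have [d d0 Hd] := S1 e e0.
 have Tl : M0 - d <= T3 h by move: (T3 h) Th => t; lra.
 have := Hd h Vh h0 _ Tl; rewrite qh => /(_ (lexx _)); move: (q w0 h Q0) => y; lra.
have z : q w0 (lin 1 h (-1) Q0) (lin 1 h (-1) Q0) = 0.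
 apply/eqP; rewrite eq_le q_ge0 andbT (q_norm2 Vh VQ) qh qQ.
 by move: (q w0 h Q0) q1 => y; lra.
have ae := q_eq0 hw (VD_lin _ _ Vh VQ) z.
have : T3 h = T3 Q0.
 apply: T3_eq; [exact: VD_sq Vh|exact: VD_sq VQ|].
 by apply: filterS ae => x; rewrite mul1r mulN1r => /eqP; rewrite subr_eq0 => /eqP.
by rewrite TQ => e; rewrite e ltxx in Th.
Qed.

(** [A] and [B] are the energies of each maximizer for the weight of the other. Chaining the two
    cubic bounds gives [A B >= 1], so upper bounds alone force both to be close to 1. *)
Lemma perturb_num (A B M M' dl : R) : 0 <= dl -> dl <= 1 -> 0 < M -> 0 < M' -> 0 <= A -> A <= 1 + dl -> 0 <= B -> B <= 1 + dl ->
 M' <= M * (A * Num.sqrt A) -> M <= M' * (B * Num.sqrt B) ->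
 [/\ 0 < A, `|1 - A| <= dl, M * (1 - 3 * dl) <= M' / (A * Num.sqrt A) & `|M' - M| <= 3 * dl * M].
Proof.
move=> d0 d1 M0 M0' A0 A1 B0 B1 hA hB.
set a := Num.sqrt A; set b := Num.sqrt B.
have a0 : 0 <= a by exact: sqrtr_ge0.
have b0 : 0 <= b by exact: sqrtr_ge0.
have ea : a ^+ 2 = A by exact: sqr_sqrtr.
have eb : b ^+ 2 = B by exact: sqr_sqrtr.
rewrite -/a in hA; rewrite -/b in hB; rewrite -ea -eb in hA hB A1 B1 *.
have ap : 0 < a by rewrite lt_neqAle a0 andbT; apply/eqP => z; rewrite -z mulr0 mulr0 in hA; lra.
have bp : 0 < b by rewrite lt_neqAle b0 andbT; apply/eqP => z; rewrite -z mulr0 mulr0 in hB; lra.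
have ab3 : 1 <= (a * b) ^+ 3.
 have : M <= M * ((a ^+ 2 * a) * (b ^+ 2 * b)).
  by apply: le_trans hB _; rewrite [leRHS](mulrA M) ler_wpM2r// mulr_ge0// sqr_ge0.
 by rewrite -[X in X <= _]mulr1 ler_pM2l// => h; apply: le_trans h _; apply: le_of_eq; ring.
have ab1 : 1 <= a * b.
 by rewrite leNgt; apply/negP => lt; move: ab3; rewrite leNgt exprn_ilt1// mulr_ge0.
have ale : a <= 1 + dl by nra.
have ble : b <= 1 + dl by nra.
have a2p : 0 < a ^+ 2 by rewrite exprn_gt0.
have Al : 1 - dl <= a ^+ 2.
 have : 1 <= a ^+ 2 * b ^+ 2 by rewrite -exprMn exprn_ege1.
 by move: A1 B1 a2p; move: (a ^+ 2) (b ^+ 2) => x y; nra.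
have b3 : b ^+ 2 * b <= 1 + 3 * dl by move: B1 (sqr_ge0 b); move: (b ^+ 2) => y h1 h2; nra.
have a3 : a ^+ 2 * a <= 1 + 3 * dl by move: A1 a2p; move: (a ^+ 2) => y h1 h2; nra.
split => //.
- by rewrite ler_norml; apply/andP; split; lra.
- rewrite ler_pdivlMr ?mulr_gt0//.
 have [l|l] := leP (1 - 3 * dl) 0.
  by apply: le_trans (ltW M0'); rewrite mulr_le0_ge0 ?mulr_ge0_le0 ?(ltW M0)// mulr_ge0// ltW.
 have h : (1 - 3 * dl) * ((a ^+ 2 * a) * (b ^+ 2 * b)) <= 1.
  have e6 : (a ^+ 2 * a) * (b ^+ 2 * b) <= (1 + dl) ^+ 3.
   rewrite (_ : _ * _ = (a * b) ^+ 3); last by ring.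
   rewrite ler_pXn2r ?nnegrE ?mulr_ge0//; last by lra.
   rewrite -(ler_pXn2r (isT : (0 < 2)%N)) ?nnegrE ?mulr_ge0//; last by lra.
   by rewrite exprMn [leRHS]expr2 ler_pM ?sqr_ge0.
  apply: le_trans (ler_wpM2l (ltW l) e6) _.
  have -> : (1 - 3 * dl) * (1 + dl) ^+ 3 = 1 - 6 * dl ^+ 2 - 8 * dl ^+ 3 - 3 * dl ^+ 4 by ring.
  by have := sqr_ge0 dl; have := exprn_ge0 3 d0; have := exprn_ge0 4 d0; lra.
 have bb : 0 < b ^+ 2 * b by rewrite mulr_gt0// exprn_gt0.
 rewrite -(ler_pM2r bb); apply: le_trans (_ : M <= _); last exact: hB.
 by rewrite -[leRHS]mulr1 -!(mulrA M) ler_pM2l// -mulrA.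
- rewrite ler_norml; apply/andP; split.
  have : M <= M' * (1 + 3 * dl) by apply: le_trans hB _; rewrite ler_pM2l.
  by nra.
 have : M' <= M * (1 + 3 * dl) by apply: le_trans hA _; rewrite ler_pM2l.
 by lra.
Qed.

(** Normalized for [w], the maximizer [u'] has a small deficit, and the stability of [u] turns this
    deficit into a distance. *)
Lemma maximizer_perturb w c c1 M u w' c' M' u' dl : weight w c -> 0 < c1 ->
 maximizer w c1 M u -> maximizer w' c' M' u' -> VD w u' -> VD w' u ->
 0 <= dl -> dl <= 1 -> q w u' u' <= 1 + dl -> q w' u u <= 1 + dl ->
 q w (lin 1 u (-1) u') (lin 1 u (-1) u') <= dl * (6 * M / c1 + 2) /\ `|M' - M| <= 3 * dl * M.
Proof.
move=> hw c10 [Vu u0 qu Tu M0 mx st] [Vu' u0' qu' Tu' M0' mx' _] Vw V'w d0 d1 A1 B1.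
have hA := mx _ Vw; have hB := mx' _ V'w; rewrite Tu' in hA; rewrite Tu in hB.
have [A0 A2 h3 h4] := perturb_num d0 d1 M0 M0' (q_ge0 w u') A1 (q_ge0 w' u) B1 hA hB.
split=> //.
set A := q w u' u' in A0 A1 A2 h3 hA *; pose a := Num.sqrt A.
have a0 : 0 < a by rewrite sqrtr_gt0.
have ea : a ^+ 2 = A by rewrite sqr_sqrtr// ltW.
pose v := lin a^-1 u' 0 u'.
have Vv : VD w v := VD_lin _ _ Vw Vw.
have qv : q w v v = 1 by rewrite (q_scale _ Vw) -/A exprVn ea mulVf// gt_eqF.
have v0 x : 0 <= v x by rewrite /v mul0r addr0 mulr_ge0// invr_ge0 ltW.
have Tv : T3 v = M' / (A * a).
 by rewrite (T3_scale _ (VD_V1 Vw) (VD_even Vw)) Tu' exprVn exprSr ea mulrC.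
have := st v Vv v0 qv; rewrite Tv => h.
have Vuv := VD_lin 1 (-1) Vu Vv.
have -> : lin 1 u (-1) u' = lin 1 (lin 1 u (-1) v) (1 - a) v.
 by apply/funext => x; rewrite /v; field; exact: lt0r_neq0.
have E1 := q_comb 1 (1 - a) Vuv Vv; have E2 := q_comb 1 (- (1 - a)) Vuv Vv.
have P := q_ge0 w (lin 1 (lin 1 u (-1) v) (- (1 - a)) v).
rewrite E1; rewrite E2 qv sqrrN in P; rewrite qv.
have a2 : (1 - a) ^+ 2 <= dl.
 apply: le_trans A2; rewrite -ea (_ : 1 - a ^+ 2 = (1 - a) * (1 + a)); last by ring.
 rewrite normrM -norm_sq// expr2 ler_wpM2l// [leRHS]ger0_norm; last by lra.
 by rewrite ler_norml; apply/andP; split; lra.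
have h5 : q w (lin 1 u (-1) v) (lin 1 u (-1) v) <= 3 * dl * M / c1.
 rewrite ler_pdivlMr// mulrC; apply: le_trans h _; move: h3; rewrite -/a.
 by move: (M' / _) => t ht; lra.
have e6 : dl * (6 * M / c1 + 2) = 2 * (3 * dl * M / c1) + 2 * dl by ring.
rewrite e6; move: P a2 h5; move: (q w _ _) (q w _ _) (3 * dl * M / c1) ((1 - a) ^+ 2) => Y Z W t.
move: (1 - a) => k *; lra.
Qed.

End perturbation.

(** * Test functions and Fourier multipliers *)

Section test_functions.
Implicit Types (psi p : R -> R) (t : R) (k n : nat).

(** The classical flat function [expR (- t / x)] divided by a power of [x]. The powers make the
    family stable under differentiation; the parameter [t] is sent to 0 to approximate
    indicators. *)
Definition flat t k x : R := if 0 < x then x^-1 ^+ k * expR (- (t * x^-1)) else 0.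

Lemma flat_ge0 t k x : 0 <= flat t k x.
Proof. by rewrite /flat; case: ltP => // x0; rewrite mulr_ge0 ?expR_ge0 ?exprn_ge0 ?invr_ge0 ?ltW. Qed.

(* [expR y >= (1 + y / n) ^ n] with [n = k + 1] *)
Lemma flat_le t k x : 0 < t -> flat t k x <= (k.+1%:R / t) ^+ k.+1 * `|x|.
Proof.
move=> t0; have n0 : 0 < k.+1%:R :> R by [].
rewrite /flat; case: ltP => x0; last by rewrite mulr_ge0// exprn_ge0// divr_ge0// ltW.
pose y := t * x^-1 / k.+1%:R.
have y0 : 0 < y by rewrite !mulr_gt0 ?invr_gt0.
have e : expR (t * x^-1) = expR y ^+ k.+1.
 by rewrite -expRM_natl; congr expR; rewrite /y; field; rewrite !gt_eqF.
have le : y ^+ k.+1 <= expR y ^+ k.+1.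
 by rewrite ler_pXn2r ?nnegrE ?expR_ge0 ?(ltW y0)//; have := expR_ge1Dx y; lra.
rewrite (gtr0_norm x0) expRN e.
apply: (@le_trans _ _ (x^-1 ^+ k * (y ^+ k.+1)^-1)).
 by rewrite ler_wpM2l ?exprn_ge0 ?invr_ge0 ?(ltW x0)// lef_pV2// posrE exprn_gt0// expR_gt0.
apply: le_of_eq.
have -> : k.+1%:R / t = x^-1 * y^-1.
 by rewrite /y; field; rewrite !gt_eqF.
rewrite (exprMn k.+1 x^-1 y^-1) [x^-1 ^+ k.+1]exprSr (exprVn y).
have -> (A C : R) : A * x^-1 * C * x = A * C * (x^-1 * x) by ring.
by rewrite mulVf ?mulr1// gt_eqF.
Qed.

Lemma der_flat t k x : 0 < t -> hasder (flat t k) x (t * flat t k.+2 x - k%:R * flat t k.+1 x).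
Proof.
move=> t0; have [x0|x0|->] := ltgtP x 0.
- have z n : flat t n x = 0 by rewrite /flat ltNge (ltW x0).
 rewrite !z !mulr0 subrr; apply: near_eq_is_derive (der_cst 0 x); near=> y.
 rewrite /flat ltNge (_ : y <= 0)//; apply: ltW; near: y; exact: lt_nbhsl.
- have xn : x != 0 by rewrite gt_eqF.
 have d : hasder (fun y => y^-1 ^+ k * expR (- (t * y^-1))) x (t * flat t k.+2 x - k%:R * flat t k.+1 x).
  have dV : hasder (@GRing.inv R) x (- x ^- 2 * 1) by apply: (@derV (fun y => y)) => //; exact: der_id.
  rewrite /flat x0; der.
  by case: k => [|k]; rewrite -!exprVn /= ?exprS; ring.
 apply: near_eq_is_derive d; near=> y; rewrite /flat (_ : 0 < y)//; near: y; exact: lt_nbhsr.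
- have z n : flat t n 0 = 0 by rewrite /flat ltxx.
 rewrite !z !mulr0 subrr.
 have c1 : (k.+2%:R / t) ^+ k.+2 * `|h| @[h --> (0 : R)] --> (k.+2%:R / t) ^+ k.+2 * `|0 : R|.
  by apply: cvgM; [exact: cvg_cst|exact: norm_continuous].
 rewrite normr0 mulr0 in c1.
 have c : (fun h : R => h^-1 *: (flat t k (h *: 1 + 0) - flat t k 0)) @ 0^' --> 0.
  apply: norm_cvg0; apply: (@squeeze_cvgr _ _ _ _ (fun=> 0) (fun h : R => (k.+2%:R / t) ^+ k.+2 * `|h|)).
  + near=> h; rewrite normr_ge0/= scaler1 addr0 z subr0 /GRing.scale/= normrM.
   rewrite (ger0_norm (flat_ge0 _ _ _)); apply: le_trans (@flat_le t k.+1 h t0).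
   rewrite /flat; case: ltP => h0; last by rewrite mulr0.
   by rewrite normfV (gtr0_norm h0) mulrA -exprS.
  + exact: cvg_cst.
  + exact: cvg_within_filter c1.
 by apply: DeriveDef; [apply/cvg_ex; exists 0|exact: cvg_lim].
Unshelve. all: by end_near. Qed.

(** An algebra of functions closed under differentiation; membership therefore propagates to all
    derivatives and gives smoothness. *)
Inductive flat_alg t a b : (R -> R) -> Prop :=
| FlatL k : flat_alg t a b (fun x => flat t k (x - a))
| FlatR k : flat_alg t a b (fun x => flat t k (b - x))
| FlatZ c f : flat_alg t a b f -> flat_alg t a b (fun x => c * f x)
| FlatD f g : flat_alg t a b f -> flat_alg t a b g -> flat_alg t a b (fun x => f x + g x)
| FlatM f g : flat_alg t a b f -> flat_alg t a b g -> flat_alg t a b (fun x => f x * g x).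

Lemma flat_alg_der t a b f : 0 < t -> flat_alg t a b f ->
 exists2 f1, flat_alg t a b f1 & forall x, hasder f x (f1 x).
Proof.
move=> t0; have df n x := der_flat n x t0.
elim=> {f} [n|n|c f _ [f1 A d]|f g _ [f1 A d] _ [g1 B e]|f g Af [f1 A d] Ag [g1 B e]].
- exists (fun x => t * flat t n.+2 (x - a) + (- n%:R) * flat t n.+1 (x - a)).
  by apply: FlatD; apply: FlatZ; exact: FlatL.
 move=> x; apply: (@der_eq _ _ ((t * flat t n.+2 (x - a) - n%:R * flat t n.+1 (x - a)) * (1 + - 0))); last by ring.
 by apply: (@der_comp (flat t n) (fun y => y - a)) => //; apply: derD (der_id x) (derN (der_cst a x)).
- exists (fun x => - t * flat t n.+2 (b - x) + n%:R * flat t n.+1 (b - x)).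
  by apply: FlatD; apply: FlatZ; exact: FlatR.
 move=> x; apply: (@der_eq _ _ ((t * flat t n.+2 (b - x) - n%:R * flat t n.+1 (b - x)) * (0 + - 1))); last by ring.
 by apply: (@der_comp (flat t n) (fun y => b - y)) => //; apply: derD (der_cst b x) (derN (der_id x)).
- by exists (fun x => c * f1 x); [exact: FlatZ|move=> x; der; ring].
- by exists (fun x => f1 x + g1 x); [exact: FlatD|move=> x; der; ring].
- exists (fun x => f1 x * g x + f x * g1 x); last by move=> x; der; ring.
 by apply: FlatD; exact: FlatM.
Qed.

Definition bump t a b x : R := flat t 0 (x - a) * flat t 0 (b - x).

Lemma bump_test t a b : 0 < t -> test_function (bump t a b).
Proof.
move=> t0; split; last first.
 exists (Order.max `|a| `|b|) => x; rewrite gt_max => /andP[xa xb]; rewrite /bump /flat !subr_gt0.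
 have [ax|] := ltP a x; last by rewrite mul0r.
 have [xlb|] := ltP x b; last by rewrite mulr0.
 by move: xa xb; case: (ler0P x); case: (ler0P a); case: (ler0P b) => *; lra.
move=> n; have A : flat_alg t a b (bump t a b) by apply: FlatM; [exact: FlatL|exact: FlatR].
have : flat_alg t a b (derive1n n (bump t a b)).
 elim: n => [//|n IH]; rewrite /=; have [f1 A1 d1] := flat_alg_der t0 IH.
 by rewrite (_ : derive1 _ = f1)//; apply/funext => x; exact: der_derive1 (d1 x).
by move=> /(flat_alg_der t0)[f1 _ d1] x; exact: der_derivable (d1 x).
Qed.

Lemma test_derive psi : test_function psi ->
 [/\ forall x, hasder psi x (derive1 psi x), continuous psi, rint psi, sqint psi & test_function (derive1 psi)].
Proof.
move=> [sm [A hA]]; have d x : hasder psi x (derive1 psi x) := derivable_der (sm 0%N x).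
have c := der_continuous d.
have ic f : continuous f -> (forall x, A < `|x| -> f x = 0) -> rint f.
 move=> cf z; apply: rint_eq (@continuous_rint_itv f (- A) A cf) => x; rewrite indic_cc -ler_norml.
 by case: (leP `|x| A) => [_|/z ->]; rewrite ?mul1r ?mulr0.
split=> //; first exact: ic.
 split; first exact: continuous_measR.
 apply: ic => [x|x /hA ->]; last by rewrite expr0n.
 by apply: (@continuous_comp _ _ _ psi (fun y => y ^+ 2)); [exact: c|exact: exprn_continuous].
split; first by move=> n x; rewrite -derive1Sn; exact: sm.
exists A => x Ax; apply: der_derive1; apply: near_eq_is_derive (der_cst 0 x).
near=> y; apply/esym/hA; near: y.
by apply: (cvgr_gt _ (@norm_continuous _ R x)).
Unshelve. all: by end_near. Qed.

(** As [t] tends to 0 the bumps converge boundedly to the indicator of an interval, so [f] has zero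
    integral over every interval. *)
Lemma test_orth f : sqint f -> (forall psi, test_function psi -> \int[mu]_x (f x * psi x) = 0) ->
 {ae mu, forall x, f x = 0}.
Proof.
move=> f2 H; have mf := sqint_meas f2.
have i a b : rint (fun x => icc a b x * f x).
 by apply: rint_eq (sqint_mul f2 (icc_sqint a b)) => x; rewrite mulrC.
apply: (zero_itv_ae i mf) => a b ab.
pose B n := bump n.+1%:R^-1 a b.
have tn n : 0 < n.+1%:R^-1 :> R by [].
have Bt n : test_function (B n) := bump_test _ _ (tn n).
have fl n x : flat n.+1%:R^-1 0 x <= 1.
 rewrite /flat; case: ltP => // x0; rewrite expr0 mul1r -expR0 ler_expR oppr_le0.
 by rewrite mulr_ge0 ?invr_ge0// ltW.
have fc x : 0 < x -> flat n.+1%:R^-1 0 x @[n --> \oo] --> (1 : R).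
 move=> x0; suff : flat n.+1%:R^-1 0 x @[n --> \oo] --> expR (- (0 * x^-1)) by rewrite mul0r oppr0 expR0.
 rewrite (_ : (fun n => _) = (fun n : nat => expR (- (n.+1%:R^-1 * x^-1)))).
  apply: (@cvg_comp _ _ _ (fun n : nat => - (n.+1%:R^-1 * x^-1)) expR); last exact: continuous_expR.
  by apply: cvgN; apply: cvgM; [exact: cvg_harmonic|exact: cvg_cst].
 by apply/funext => n; rewrite /flat x0 expr0 mul1r.
have [_ c] : rint (fun x => icc a b x * f x) /\
  \int[mu]_x (f x * B n x) @[n --> \oo] --> \int[mu]_x (icc a b x * f x).
 apply: (@dct _ _ _ mu (fun n x => f x * B n x) _ (fun x => `|icc a b x * f x|)).
 - by move=> n; apply: mfunM => //; have [_ c _ _ _] := test_derive (Bt n); exact: continuous_measR.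
 - exact: rint_meas (i a b).
 - exact: rint_norm.
 - move=> n x; rewrite mulrC normrM [leRHS]normrM ler_wpM2r// ger0_norm ?mulr_ge0 ?flat_ge0// /B /bump iccE.
  have [xa|xa] := leP x a; first by rewrite /flat subr_gt0 ltNge xa mul0r.
  have [bx|bx] := leP b x; first by rewrite /flat !subr_gt0 [x < b]ltNge bx mulr0.
  by rewrite (ltW xa) (ltW bx) /= normr1 mulr_ile1 ?flat_ge0.
 - apply: filterS2 (ae_neq a) (ae_neq b) => x xa xb; rewrite mulrC; apply: cvgM; first exact: cvg_cst.
  rewrite iccE; have [lt|lt|e] := ltgtP x a; last by rewrite e eqxx in xa.
   rewrite /= (_ : (fun n => _) = (fun=> 0)); first exact: cvg_cst.
   by apply/funext => n; rewrite /B /bump /flat subr_gt0 ltNge (ltW lt) mul0r.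
  have [lt'|lt'|e] := ltgtP x b; last by rewrite e eqxx in xb.
   by rewrite -[X in _ --> X](mulr1 1); apply: cvgM; apply: fc; rewrite subr_gt0.
  rewrite /= (_ : (fun n => _) = (fun=> 0)); first exact: cvg_cst.
  by apply/funext => n; rewrite /B /bump /flat !subr_gt0 [x < b]ltNge (ltW lt') mulr0.
by apply: cvgn_uniq c (cvg_cst 0) _ => n; rewrite H.
Qed.

Lemma hint_test psi xi : test_function psi -> hint (derive1 psi) xi = - xi * hint psi (- xi).
Proof.
move=> tp; have [d _ i _ tp1] := test_derive tp; have [_ c1 i1 _ _] := test_derive tp1.
have [_ [A hA]] := tp.
have v (s : R) : s = 1 \/ s = -1 -> psi (s * n%:R) @[n --> \oo] --> 0.
 move=> hs; have : (fun n : nat => 0 : R) @ \oo --> 0 by exact: cvg_cst.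
 apply: cvg_trans; apply: near_eq_cvg; near=> n; rewrite hA// normrM.
 have -> : `|s| = 1 by case: hs => ->; rewrite ?normrN normr1.
 by rewrite mul1r ger0_norm//; near: n; exact: nbhs_infty_gtr.
apply: hint_der => //.
 by under eq_fun do rewrite -[_%:R]mul1r; apply: v; left.
by under eq_fun do rewrite -mulN1r; apply: v; right.
Unshelve. all: by end_near. Qed.

(** It is enough to exhibit [B] whose even and odd parts assemble the multiplied Fourier transform:
    [Ht B] then has that transform, and any other choice agrees with it almost everywhere. *)
Lemma fourier_multE (m : R -> R[i]) f B : sqint f -> sqint B ->
 {ae mu, forall xi, m xi * fourier f xi = Complex (ev B xi) (- od B xi)} ->
 sqint (fourier_mult m f) /\ {ae mu, forall x, fourier_mult m f x = Ht B x}.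
Proof.
move=> f2 B2 hB; have HB2 := Ht_sq B2; have HK := HtK B2.
have [g2 hg] : L2 (fourier_mult m f) /\
  {ae @lebesgue_measure R, forall xi, fourier (fourier_mult m f) xi = m xi * fourier f xi}.
 apply: (@xgetPex _ (cst 0) [set g | L2 g /\ {ae @lebesgue_measure R, forall xi, fourier g xi = m xi * fourier f xi}]).
 exists (Ht B); split; first exact/sqintL2.
 apply: filterS (filterI (filterI hB (fourierE HB2)) (filterI HK (ae_opp HK))) => x [[-> ->] [e1 e2]].
 by rewrite /ev /od e1 e2.
move/sqintL2: g2 => g2; split=> //; set g := fourier_mult m f in g2 hg *.
have e : {ae mu, forall x, Ht g x = B x}.
 apply: filterS (filterI (filterI hB (fourierE g2)) hg) => x [[h1 h2] h3].
 move: h3; rewrite h1 h2 => -[]; rewrite /ev /od => h4 /oppr_inj h5.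
 have : ev (Ht g) x + od (Ht g) x = ev B x + od B x by rewrite /ev /od h4 h5.
 rewrite /ev /od; move: (Ht g x) (Ht g (- x)) (B x) (B (- x)) => *; lra.
have h := ae_sym (HtK g2); apply: ae_trans h _; apply: Ht_ae => //; exact: Ht_sq.
Qed.

Lemma DhalfE f : sqint f -> sqint (fun x => hs x * Ht f x) ->
 sqint (Dhalf f) /\ {ae mu, forall x, Dhalf f x = Ht (fun x => hs x * Ht f x) x}.
Proof.
move=> f2 h2; apply: fourier_multE => //; apply: filterS (fourierE f2) => x ->.
rewrite powR12_sqrt// /ev /od /hs normrN; apply/eqP; rewrite eq_complex/=; apply/andP; split; apply/eqP; ring.
Qed.

(** Composed with the derivative, the Hilbert transform has the real even symbol [- |xi|], which
    acts on the Hartley side as plain multiplication. *)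
Lemma hilbert_test psi : test_function psi ->
 let B := fun xi => - (`|xi| * hint psi xi) in
 [/\ sqint B, sqint (hilbert (derive1 psi)) & {ae mu, forall x, hilbert (derive1 psi) x = Ht B x}].
Proof.
move=> tp B; have [d c i s tp1] := test_derive tp; have [_ c1 i1 s1 _] := test_derive tp1.
have B2 : sqint B.
 apply: (sqint_le _ (sqint_opp (sqint_hint s1 i1))).
  apply: measurable_funN; apply: mfunM; first exact: measR_norm.
  exact: sqint_meas (sqint_hint s i).
 by move=> x; rewrite hint_test// !opprK normrN !normrM normr_id.
have [] := @fourier_multE (fun xi => Complex 0 (Num.sg xi)) (derive1 psi) B s1 B2; last by split.
have e := Ht_explicit s1 i1.
apply: filterS (filterI (fourierE s1) (filterI e (ae_opp e))) => x [-> [e1 e2]].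
rewrite /ev /od e1 e2 !hint_test// !opprK /B normrN; apply/eqP; rewrite eq_complex/=.
have [x0|x0|->] := ltgtP x 0; last by rewrite sgr0 normr0 !mul0r !(subr0, oppr0, mulr0, addr0) eqxx.
 by rewrite ltr0_sg// ltr0_norm//; apply/andP; split; apply/eqP; ring.
by rewrite gtr0_sg// gtr0_norm//; apply/andP; split; apply/eqP; ring.
Qed.

(** Differentiation multiplies the Hartley transform by [- x] and reflects it; for even [f] the
    reflection has no effect. Uniqueness of the weak derivative comes from [test_orth]. *)
Lemma weak_derivativeE f : sqint f -> aeven f -> sqint (fun x => x * Ht f x) ->
 sqint (weak_derivative f) /\ {ae mu, forall x, weak_derivative f x = - Ht (fun x => x * Ht f x) x}.
Proof.
move=> f2 ef xf; have Hxf := Ht_sq xf; have Hf := Ht_sq f2; have eH := aeven_Ht f2 ef.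
set g0 := fun x => - Ht (fun x => x * Ht f x) x.
have g02 : sqint g0 by exact: sqintN.
have key psi : test_function psi -> \int[mu]_x (f x * derive1 psi x) = - \int[mu]_x (g0 x * psi x).
 move=> tp; have [d c i s tp1] := test_derive tp; have [_ c1 i1 s1 _] := test_derive tp1.
 have h1 := sqint_hint s1 i1; have h0 := sqint_hint s i.
 transitivity (ip (Ht f) (Ht (derive1 psi))); first by rewrite Ht_ip.
 transitivity (ip (fun x => x * Ht f x) (Ht psi)).
  transitivity (\int[mu]_x (Ht f x * (- x * hint psi (- x)))).
   apply: ae_ip; [exact: sqint_meas Hf|exact: sqint_meas (Ht_sq s1)|exact: sqint_meas Hf| |exact: aeW|].
    apply: mfunM; first by apply: measurable_funN; exact: measurable_id.
    by apply: meas_opp; exact: sqint_meas h0.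
   by apply: filterS (Ht_explicit s1 i1) => x ->; rewrite hint_test.
  have m1 : measR (fun x => x * Ht f (- x) * hint psi x).
   apply: mfunM; last exact: sqint_meas h0.
   by apply: mfunM; [exact: measurable_id|apply: meas_opp; exact: sqint_meas Hf].
  transitivity (\int[mu]_x (x * Ht f (- x) * hint psi x)).
   rewrite -(Int_opp m1); apply: eq_Int => x; rewrite opprK; ring.
  apply: ae_Int => //.
   by apply: mfunM; [exact: sqint_meas xf|exact: sqint_meas (Ht_sq s)].
  by apply: filterS (filterI eH (Ht_explicit s i)) => x [-> ->].
 rewrite -Ht_sym// -IntN; last exact: sqint_mul.
 by apply: eq_Int => x; rewrite /g0; ring.
have [w2' hw] : L2 (weak_derivative f) /\ forall psi, test_function psi ->
  \int[@lebesgue_measure R]_x (f x * derive1 psi x) = - \int[@lebesgue_measure R]_x (weak_derivative f x * psi x).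
 apply: (@xgetPex _ (cst 0) [set g | L2 g /\ forall psi, test_function psi ->
   \int[@lebesgue_measure R]_x (f x * derive1 psi x) = - \int[@lebesgue_measure R]_x (g x * psi x)]).
 by exists g0; split; [exact/sqintL2|exact: key].
move/sqintL2: w2' => w2'; split=> //; set g := weak_derivative f in w2' hw *.
have : {ae mu, forall x, g x - g0 x = 0}.
 apply: test_orth; first exact: sqintB.
 move=> psi tp; have [_ _ _ s _] := test_derive tp.
 have e : \int[mu]_x (g x * psi x) = \int[mu]_x (g0 x * psi x).
  by apply: oppr_inj; rewrite -(key _ tp); exact: esym (hw _ tp).
 have := ipBl w2' g02 s; rewrite /ip e subrr; exact.
by apply: filterS => x /eqP; rewrite subr_eq0 => /eqP.
Qed.

End test_functions.

(** * From maximizers to ground states *)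

Section ground_states.
Implicit Types (psi phi : R -> R) (s : R).

Definition wab a b x : R := 1 + b * `|x| + a * x ^+ 2.

Lemma wab_continuous a b : continuous (wab a b).
Proof.
move=> x; apply: cvgD; first by apply: cvgD; [exact: cvg_cst|apply: cvgM; [exact: cvg_cst|exact: norm_continuous]].
by apply: cvgM; [exact: cvg_cst|exact: exprn_continuous].
Qed.

Lemma measR_sobolev s : measR (fun x : R => (1 + x ^+ 2) `^ s).
Proof.
apply: (mfunC (measurable_powR s)); apply: measurable_funD; first exact: measurable_cst.
by apply: measurable_funX; exact: measurable_id.
Qed.

(** For even [f] the odd part of the Hartley transform vanishes, so the modulus of the Fourier
    transform is that of [Ht f]. *)
Lemma Hnorm_even s f : sqint f -> aeven f ->
 Hnorm s f = ((\int[mu]_x ((1 + x ^+ 2) `^ s * Ht f x ^+ 2)%:E) `^ 2^-1)%E.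
Proof.
move=> f2 ef; congr (_ `^ _)%E; have mH := sqint_meas (Ht_sq f2).
have e : {ae mu, forall x, sqnormc (fourier f x) = Ht f x ^+ 2}.
 apply: filterS (filterI (fourierE f2) (aeven_Ht f2 ef)) => x [-> e].
 by rewrite /sqnormc /= /ev /od e; field.
have mp : measR (fun x => (1 + x ^+ 2) `^ s * Ht f x ^+ 2).
 by apply: mfunM; [exact: measR_sobolev|exact: measurable_funX].
have [mR mI] : measR (fun x => complex.Re (fourier f x)) /\ measR (fun x => complex.Im (fourier f x)).
 by have [? ? _] : is_fourier f (fourier f) by apply: (@xgetPex _ (cst 0) [set g | is_fourier f g]); eexists; exact: is_fourier_Ht.
apply: ae_eq_integral => //.
- apply/mEFinP; apply: mfunM; first exact: measR_sobolev.
 by apply: measurable_funD; exact: measurable_funX.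
- exact/mEFinP.
- by apply: filterS e => x -> _.
Qed.

Lemma Hs_evenP s f : sqint f -> aeven f ->
 Hs s f <-> rint (fun x => (1 + x ^+ 2) `^ s * Ht f x ^+ 2).
Proof.
move=> f2 ef; rewrite /Hs Hnorm_even//.
have mp : measR (fun x => (1 + x ^+ 2) `^ s * Ht f x ^+ 2).
 by apply: mfunM; [exact: measR_sobolev|apply: measurable_funX; exact: sqint_meas (Ht_sq f2)].
have p0 x : 0 <= (1 + x ^+ 2) `^ s * Ht f x ^+ 2 by rewrite mulr_ge0 ?powR_ge0 ?sqr_ge0.
split=> [[_ h]|i].
 apply: ge0_rintP => //; rewrite ltNge leye_eq; apply/negP => /eqP e.
 by rewrite e poweRyr ?ltxx ?invr_neq0 in h.
split; first exact/sqintL2.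
by rewrite IntE// poweR_EFin ltry.
Qed.

Section weighted.
Variables (alpha beta c : R).
Hypotheses (a0 : 0 <= alpha) (hw : weight (wab alpha beta) c).
Let w := wab alpha beta.

Let w_sq x : 0 < alpha -> 1 + x ^+ 2 <= (c^-1 + (1 + `|beta| / c) / alpha) * w x.
Proof.
move=> ap; have [_ c0 low _] := hw; have lx := low x.
have cw : 1 + `|x| <= c^-1 * w x by rewrite mulrC ler_pdivlMr// mulrC.
have bw : `|beta| * `|x| <= `|beta| / c * w x.
 by rewrite -mulrA ler_wpM2l//; have := normr_ge0 x; lra.
have aw : alpha * x ^+ 2 <= (1 + `|beta| / c) * w x.
 rewrite mulrDl mul1r; apply: le_trans (lerD (lexx _) bw); rewrite /w /wab.
 by have := normr_ge0 x; have := ler_norm (- beta); rewrite normrN => h1 h2; nra.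
rewrite mulrDl mulrAC; have : x ^+ 2 <= (1 + `|beta| / c) * w x / alpha by rewrite ler_pdivlMr// mulrC.
by have := normr_ge0 x; lra.
Qed.

Let p := (theta alpha).
(** The weight is comparable with the Sobolev weight of order [theta alpha] in both cases, so the
    form domain is exactly the even Sobolev space of the problem. *)
Let pk : exists2 k, 0 <= k & forall x, (1 + x ^+ 2) `^ p <= k * w x /\ w x <= k * (1 + x ^+ 2) `^ p.
Proof.
have [_ c0 low _] := hw; have w0 x : 0 < w x := weight_gt0 x hw.
have [ap|an] := ltP 0 alpha.
 set k := c^-1 + (1 + `|beta| / c) / alpha.
 have k0 : 0 <= k by rewrite addr_ge0 ?invr_ge0 ?divr_ge0 ?addr_ge0 ?divr_ge0 ?normr_ge0 ?(ltW c0).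
 exists (k + (1 + `|beta| + alpha)) => [|x]; first by apply: addr_ge0 => //; rewrite addr_ge0// addr_ge0.
 rewrite /p /theta ap powRr1; last by rewrite addr_ge0// sqr_ge0.
 split; rewrite mulrDl.
  apply: le_trans (w_sq x ap) _; rewrite lerDl; apply: mulr_ge0; last exact: ltW (w0 x).
  by apply: addr_ge0 => //; exact: addr_ge0.
 apply: (@le_trans _ _ ((1 + `|beta| + alpha) * (1 + x ^+ 2))); last by rewrite lerDr mulr_ge0// addr_ge0// sqr_ge0.
 rewrite /w /wab; have := ler_norm beta; have := normr_ge0 x; have := normr_ge0 beta.
 by have := sqr_ge0 (`|x| - 1); rewrite -(norm_sq x); move: `|x| `|beta| => t b *; nra.
have ae : alpha = 0 by apply/eqP; rewrite eq_le an a0.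
exists (c^-1 + 2 * (1 + `|beta|)) => [|x]; first by rewrite addr_ge0 ?invr_ge0 ?(ltW c0)// mulr_ge0// addr_ge0.
rewrite /p /theta ae ltxx powR12_sqrt ?addr_ge0 ?sqr_ge0//; set S := Num.sqrt _.
have S0 : 0 <= S by exact: sqrtr_ge0.
have ES : S ^+ 2 = 1 + `|x| ^+ 2 by rewrite sqr_sqrtr ?norm_sq// addr_ge0// sqr_ge0.
have x0 := normr_ge0 x.
have S1 : S <= 1 + `|x| by nra.
have S2 : 1 + `|x| <= 2 * S.
 rewrite -(ler_pXn2r (isT : (0 < 2)%N)) ?nnegrE ?addr_ge0 ?mulr_ge0// exprMn ES.
 by have := sqr_ge0 (`|x| - 1); nra.
split; rewrite mulrDl.
 have cw : 1 + `|x| <= c^-1 * w x by rewrite mulrC ler_pdivlMr// mulrC; exact: low.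
 apply: le_trans (le_trans S1 cw) _; rewrite lerDl; apply: mulr_ge0; last exact: ltW (w0 x).
 by rewrite mulr_ge0// addr_ge0.
apply: (@le_trans _ _ (2 * (1 + `|beta|) * S)); last by rewrite lerDr mulr_ge0 ?invr_ge0// ltW.
rewrite /w /wab ae mul0r addr0; have := ler_norm beta; have := normr_ge0 beta; nra.
Qed.

Lemma Hs_VD f : sqint f -> aeven f -> Hs (theta alpha) f <-> VD w (Ht f).
Proof.
move=> f2 ef; have [k k0 hk] := pk; have H2 := Ht_sq f2; have mH := sqint_meas H2.
have [mw _ _ _] := hw; have w0 x : 0 < w x := weight_gt0 x hw.
rewrite Hs_evenP//; split=> [i|V].
 apply: (VDP hw mH (aeven_Ht f2 ef)); split.
  by apply: mfunM => //; exact: sw_meas.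
 apply: (rint_le _ (rintZ k i)).
  by apply: measurable_funX; apply: mfunM => //; exact: sw_meas.
 move=> x; rewrite ger0_norm ?sqr_ge0// exprMn (sw_sq x hw) mulrA ler_wpM2r ?sqr_ge0//.
 by case: (hk x).
have j : rint (fun x => k * w x * Ht f x ^+ 2).
 by apply: rint_eq (rintZ k (q_rint hw V V)) => x; rewrite /w; ring.
apply: (rint_le _ j).
 by apply: mfunM; [exact: measR_sobolev|exact: measurable_funX].
move=> x; have n0 : 0 <= (1 + x ^+ 2) `^ theta alpha * Ht f x ^+ 2 by rewrite mulr_ge0 ?powR_ge0 ?sqr_ge0.
by rewrite (ger0_norm n0); apply: ler_wpM2r (sqr_ge0 _) _ _ _; case: (hk x).
Qed.

Section transform.
Variable f : R -> R.
Let g := Ht f.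
Hypotheses (f2 : sqint f) (ef : aeven f) (Vg : VD w g).
Let fg : {ae mu, forall x, f x = Ht g x}. Proof. exact: ae_sym (HtK f2). Qed.
Let g2 : sqint g. Proof. exact: Ht_sq. Qed.
Let mg : measR g. Proof. exact: sqint_meas g2. Qed.
Let mf : measR f. Proof. exact: sqint_meas f2. Qed.

Let ae_sqE (d h : R -> R) : sqint d -> sqint h -> {ae mu, forall x, d x = Ht h x} ->
 \int[mu]_x (d x ^+ 2) = ip h h.
Proof.
move=> d2 h2 e; rewrite -(Ht_norm h2) -ipsE.
by apply: ae_ip => //; [exact: sqint_meas d2|exact: sqint_meas d2|exact: sqint_meas (Ht_sq h2)|exact: sqint_meas (Ht_sq h2)].
Qed.

Lemma energyE : energy alpha beta f = 2^-1 * q w g g.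
Proof.
rewrite (qE _ _ hw); congr (_ * _).
have hg : sqint (fun x => hs x * g x) by case: (VD_V1 Vg).
have [D2 DE] := DhalfE f2 hg.
have iD := rintZ beta (sqint_sq D2); have ihg := rintZ beta (sqint_sq hg).
have ED := ae_sqE D2 hg DE.
have [iw [ixg Ew]] : rint (fun x => alpha * weak_derivative f x ^+ 2) /\
  (rint (fun x => alpha * (x * g x) ^+ 2) /\
  \int[mu]_x (alpha * weak_derivative f x ^+ 2) = \int[mu]_x (alpha * (x * g x) ^+ 2)).
 (* For [alpha = 0] nothing is known about [weak_derivative f], and its term is erased by the
    factor; otherwise the weight dominates [x^2] and the weak derivative is genuine. *)
 have [z|ap] := eqVneq alpha 0.
  have e0 h : (fun x => alpha * h x ^+ 2) = (fun=> 0) by apply/funext => x; rewrite z mul0r.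
  by rewrite (e0 (weak_derivative f)) (e0 (fun x => x * g x)); do 2![split; first exact: rint0].
 have xg : sqint (fun x => x * g x).
  split; first by apply: mfunM => //; exact: measurable_id.
  apply: (rint_le _ (rintZ (c^-1 + (1 + `|beta| / c) / alpha) (q_rint hw Vg Vg))).
   by apply: measurable_funX; apply: mfunM => //; exact: measurable_id.
  move=> x; rewrite ger0_norm ?sqr_ge0// exprMn -[in leRHS]mulrA -expr2 mulrA ler_wpM2r ?sqr_ge0//.
  by apply: le_trans (w_sq x _); rewrite ?lerDr// lt_neqAle eq_sym ap.
 have [W2 WE] := weak_derivativeE f2 ef xg.
 have nxg : sqint (fun x => - (x * g x)) by exact: sqintN.
 have WE' : {ae mu, forall x, weak_derivative f x = Ht (fun x => - (x * g x)) x}.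
  have e := Ht_lin (-1) 0 xg xg.
  rewrite (_ : (fun x => -1 * (x * g x) + 0 * (x * g x)) = (fun x => - (x * g x))) in e; last by apply/funext => x; ring.
  by apply: filterS (filterI WE e) => x [-> ->]; ring.
 split; first by apply: rintZ; exact: sqint_sq.
 split; first by apply: rintZ; exact: sqint_sq.
 rewrite !IntZ; [|exact: sqint_sq|exact: sqint_sq]; congr (_ * _).
 by rewrite (ae_sqE W2 nxg WE') ipsE; apply: eq_Int => x; rewrite sqrrN.
have Ef : \int[mu]_x (f x ^+ 2) = \int[mu]_x (g x ^+ 2) by rewrite -!ipsE -(Ht_norm f2).
have if2 := sqint_sq f2; have ig2 := sqint_sq g2.
transitivity (\int[mu]_x (alpha * weak_derivative f x ^+ 2 + beta * Dhalf f x ^+ 2 + f x ^+ 2)); first by [].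
rewrite IntD; [|by apply: rintD|by []]; rewrite IntD// Ew Ef (IntZ beta); last exact: sqint_sq.
rewrite ED ipsE -IntZ; last exact: sqint_sq.
rewrite -IntD// -IntD//; last by apply: rintD.
by apply: eq_Int => x; rewrite /wab -hs_sq; ring.
Qed.

Lemma K_E : K f = 6^-1 * T3 g.
Proof.
have [V1g eg] := (VD_V1 Vg, VD_even Vg); have [m2 _] := Ht_mul V1g eg V1g eg.
rewrite /T3 (TE g2 V1g eg V1g eg); congr (_ * _); apply: ae_Int.
- exact: measurable_funX.
- by apply: mfunM; [exact: sqint_meas (Ht_sq g2)|exact: sqint_meas m2].
- by apply: filterS fg => x ->; rewrite !exprS expr0 mulr1.
Qed.

Lemma solvesE psi : test_function psi ->
 let P := hint psi in [/\ sqint (fun x => w x * P x), sqint P,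
 \int[mu]_x (f x * (psi x - alpha * derive1n 2 psi x - beta * hilbert (derive1 psi) x)) = \int[mu]_x (g x * (w x * P x)) &
 \int[mu]_x (2^-1 * f x ^+ 2 * psi x) = 2^-1 * \int[mu]_x (hc * corr g g x * P x)].
Proof.
move=> tp P; have [_ _ i s tp1] := test_derive tp; have [_ _ i1 s1 tp2] := test_derive tp1.
have [_ _ i2 s2 _] := test_derive tp2; have [B2 h2 hE] := hilbert_test tp.
have P2 : sqint P := sqint_hint s i.
have mP := sqint_meas P2.
pose x0 x := psi x - alpha * derive1n 2 psi x; pose x1 x := x0 x - beta * hilbert (derive1 psi) x.
have x02 : sqint x0 by apply: sqintB => //; exact: sqintZ.
have x12 : sqint x1 by apply: sqintB => //; exact: sqintZ.
have e : {ae mu, forall x, Ht x1 x = w x * P x}.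
 have l1 := Ht_lin 1 (- alpha) s s2; have l2 := Ht_lin 1 (- beta) x02 h2.
 rewrite (_ : (fun y => 1 * psi y + - alpha * derive1 (derive1 psi) y) = x0) in l1; last by apply/funext => x; rewrite /x0 /=; ring.
 rewrite (_ : (fun y => 1 * x0 y + - beta * hilbert (derive1 psi) y) = x1) in l2; last by apply/funext => x; rewrite /x1; ring.
 have l3 := Ht_ae h2 (Ht_sq B2) hE; have l4 := HtK B2.
 apply: filterS (filterI (filterI l1 l2) (filterI (filterI l3 l4) (filterI (Ht_explicit s i) (Ht_explicit s2 i2)))) => x.
 move=> [[-> ->] [[-> ->] [-> ->]]]; rewrite (hint_test x tp1) (hint_test (- x) tp) !opprK -/P /w /wab; ring.
have mw : measR w by case: hw.
have wP2 : sqint (fun x => w x * P x).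
 by apply: ae_sqint (Ht_sq x12) => //; exact: mfunM.
split=> //.
 transitivity (ip g (Ht x1)); first by rewrite Ht_ip.
 by apply: ae_ip => //; [exact: sqint_meas (Ht_sq x12)|exact: sqint_meas wP2|exact: aeW].
have [V1v ev] := (VD_V1 Vg, VD_even Vg); have [m2 em] := Ht_mul V1v ev V1v ev.
transitivity (2^-1 * ip (fun y => Ht g y * Ht g y) psi).
 have j := rintZ 2^-1 (sqint_mul m2 s); rewrite -IntZ; last exact: sqint_mul.
 apply: ae_Int; [|exact: rint_meas j|by apply: filterS fg => x ->; ring].
 apply: mfunM; last exact: sqint_meas s.
 by apply: mfunM; [exact: measurable_cst|exact: measurable_funX].
congr (_ * _); rewrite -Ht_ip//; apply: ae_ip => //.
- exact: sqint_meas (Ht_sq m2).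
- exact: sqint_meas (Ht_sq s).
- by apply: mfunM; [exact: measurable_cst|exact: sqint_meas (corr_sqint V1v V1v)].
- exact: Ht_explicit.
Qed.

End transform.

Variables (c1 M0 : R) (u : R -> R).
Hypotheses (c10 : 0 < c1) (mx : maximizer w c1 M0 u).
Let Vu : VD w u. Proof. exact: mx_V mx. Qed.
Let Mp : 0 < M0. Proof. exact: mx_M mx. Qed.
Let Vs r : VD w (lin r u 0 u). Proof. exact: VD_lin. Qed.
Let EL : {ae mu, forall x, hc * corr u u x = M0 * (w x * u x)}.
Proof. exact: euler_lagrange hw (mx_max mx) (ltW Mp) Vu (mx_q mx) (mx_T mx). Qed.

Let T3s r : T3 (lin r u 0 u) = M0 * r ^+ 3.
Proof. by rewrite (T3_scale _ (VD_V1 Vu) (VD_even Vu)) (mx_T mx) mulrC. Qed.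
Let qs r : q w (lin r u 0 u) (lin r u 0 u) = r ^+ 2.
Proof. by rewrite (q_scale _ Vu) (mx_q mx) mulr1. Qed.

Let from_Hs f : Hs_even (theta alpha) f -> [/\ sqint f, aeven f & VD w (Ht f)].
Proof.
move=> [H ef]; have f2 : sqint f by case: H => /sqintL2.
by split=> //; exact: (proj1 (Hs_VD f2 ef) H).
Qed.

Lemma Ht_VD v : VD w v ->
 [/\ sqint (Ht v), aeven (Ht v), VD w (Ht (Ht v)) & {ae mu, forall x, Ht (Ht v) x = v x}].
Proof.
move=> V; have v2 := VD_sq V; have f2 := Ht_sq v2; have gv := HtK v2.
have ef := aeven_Ht v2 (VD_even V); have mg := sqint_meas (Ht_sq f2); have [mw _ _ _] := hw.
split=> //; apply: (VDP hw mg (aeven_Ht f2 ef)); apply: ae_sqint (VD_sw V).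
 by apply: mfunM => //; exact: sw_meas.
by apply: filterS gv => x ->.
Qed.

Let Ht_facts r : let Q := Ht (lin r u 0 u) in
 [/\ Hs_even (theta alpha) Q, K Q = 6^-1 * (M0 * r ^+ 3) & energy alpha beta Q = 2^-1 * r ^+ 2].
Proof.
have [Q2 eQ VQ ae] := Ht_VD (Vs r); split.
- by split; [exact/(Hs_VD Q2 eQ)|exact: eQ].
- by rewrite (K_E Q2 VQ) (T3_eq (VD_sq VQ) (VD_sq (Vs r)) ae) T3s.
- by rewrite (@energyE _ Q2 eQ VQ) (q_ae VQ (Vs r) ae) qs.
Qed.

(** By homogeneity: with [K] fixed at [M0 r^3 / 6], the cubic bound forces [q >= r^2], and the
    rescaled maximizer attains it. *)
Let inf_energy r : 0 < r -> M alpha beta (6^-1 * (M0 * r ^+ 3)) = (2^-1 * r ^+ 2)%:E.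
Proof.
move=> r0; have [h1 h2 h3] := Ht_facts r; apply/eqP; rewrite eq_le; apply/andP; split.
 by apply: ereal_inf_lbound; exists (Ht (lin r u 0 u)) => //; rewrite h3.
apply: le_ereal_inf_tmp => _ [f [hf Kf] <-]; have [f2 ef V] := from_Hs hf.
rewrite lee_fin (@energyE _ f2 ef V) ler_pM2l ?invr_gt0//.
have := mx_max mx V; move: Kf; rewrite (K_E f2 V).
have := q_ge0 w (Ht f); move: (q w _ _) (T3 _) => y t y0 /(mulfI (lt0r_neq0 _)) -> // le.
 have e3 : Num.sqrt y ^+ 3 = y * Num.sqrt y by rewrite exprSr sqr_sqrtr.
 have : r ^+ 3 <= Num.sqrt y ^+ 3 by rewrite e3 -(ler_pM2l Mp).
 rewrite ler_pXn2r ?nnegrE ?sqrtr_ge0 ?(ltW r0)// => ry.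
 by rewrite -(sqr_sqrtr y0) ler_pXn2r ?nnegrE ?sqrtr_ge0// ltW.
Qed.

(** By the Euler-Lagrange equation both sides of the tested equation are multiples of one
    functional, with coefficients [r] and [r^2 M0 / 2]. Hence the scale [2 / M0]. *)
Let solvesP_Ht r : solvesP alpha beta (Ht (lin r u 0 u)) <->
 forall psi, test_function psi -> (r - 2^-1 * r ^+ 2 * M0) * \int[mu]_x (u x * (w x * hint psi x)) = 0.
Proof.
have [Q2 eQ VQ ae] := Ht_VD (Vs r); have u2 := VD_sq Vu.
have mQ := sqint_meas (VD_sq VQ); have mr := sqint_meas (VD_sq (Vs r)).
have key psi : test_function psi ->
  \int[mu]_x (Ht (lin r u 0 u) x * (psi x - alpha * derive1n 2 psi x - beta * hilbert (derive1 psi) x)) =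
   r * \int[mu]_x (u x * (w x * hint psi x)) /\
  \int[mu]_x (2^-1 * Ht (lin r u 0 u) x ^+ 2 * psi x) =
   2^-1 * r ^+ 2 * M0 * \int[mu]_x (u x * (w x * hint psi x)).
 move=> tp; have [wP2 P2 -> ->] := solvesE Q2 VQ tp.
 have mwP := sqint_meas wP2; have mP := sqint_meas P2; have muu := sqint_meas u2.
 have iu := sqint_mul u2 wP2; split.
  rewrite -IntZ//; apply: ae_Int; [exact: mfunM|exact: rint_meas (rintZ r iu)|].
  by apply: filterS ae => x ->; ring.
 rewrite -(mulrA 2^-1) -(mulrA 2^-1); congr (_ * _); rewrite -IntZ//.
 have mc : measR (corr (Ht (Ht (lin r u 0 u))) (Ht (Ht (lin r u 0 u)))) by exact: corr_meas.
 apply: ae_Int; [by apply: mfunM => //; exact: mfunM|exact: rint_meas (rintZ _ iu)|].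
 apply: filterS EL => x el; rewrite (corr_ae _ mQ mr ae).
 have -> : corr (lin r u 0 u) (lin r u 0 u) x = r ^+ 2 * corr u u x.
  by rewrite (corr_linl _ _ _ u2 u2 (VD_sq (Vs r))) !(corr_linr _ _ _ u2 u2 u2); ring.
 transitivity (r ^+ 2 * (hc * corr u u x) * hint psi x); first by ring.
 by rewrite el; ring.
split=> [sol|H] psi tp.
 by have [e1 e2] := key _ tp; rewrite mulrBl -e1 -e2; apply/eqP; rewrite subr_eq0; apply/eqP; exact: sol.
have [e1 e2] := key _ tp; have := H _ tp; rewrite mulrBl -e1 -e2 => /eqP; rewrite subr_eq0 => /eqP; exact.
Qed.

(* A test function paired with the transform of [corr u u] sees [(Ht u) ^ 2]. *)
Let test_nondegenerate : ~ forall psi, test_function psi -> \int[mu]_x (u x * (w x * hint psi x)) = 0.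
Proof.
move=> H; have u2 := VD_sq Vu; have [V1u eu] := (VD_V1 Vu, VD_even Vu).
have [m2 em] := Ht_mul V1u eu V1u eu.
have z : {ae mu, forall x, Ht u x * Ht u x = 0}.
 apply: test_orth => // psi tp; have [_ _ i s _] := test_derive tp.
 rewrite -[LHS]/(ip (fun x => Ht u x * Ht u x) psi) -Ht_ip//.
 transitivity (M0 * \int[mu]_x (u x * (w x * hint psi x))); last by rewrite H ?mulr0.
 have h2 := sqint_hint s i; have c2 := corr_sqint V1u V1u; have [mw _ _ _] := hw.
 have muu := sqint_meas u2; have mh := sqint_meas h2.
 transitivity (\int[mu]_x (M0 * (u x * (w x * hint psi x)))).
  apply: ae_Int.
  - by apply: mfunM; [exact: sqint_meas (Ht_sq m2)|exact: sqint_meas (Ht_sq s)].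
  - by apply: mfunM => //; apply: mfunM => //; exact: mfunM.
  - apply: filterS (filterI (filterI em EL) (Ht_explicit s i)) => x [[-> ->] ->]; ring.
 have [Q2 _ VQ _] := Ht_VD Vu; have [wP2 _ _ _] := solvesE Q2 VQ tp.
 by rewrite IntZ//; exact: sqint_mul.
have : T3 u = 0.
 rewrite /T3 (TE u2 V1u eu V1u eu); transitivity (\int[mu]_x (0 : R)); last by rewrite Rintegral_cst// mul0r.
 apply: ae_Int => //; last by apply: filterS z => x ->; rewrite mulr0.
 by apply: mfunM; [exact: sqint_meas (Ht_sq u2)|exact: sqint_meas m2].
by rewrite (mx_T mx) => e; move: Mp; rewrite e ltxx.
Qed.

Hypothesis cw : continuous w.

(** Every constrained minimizer is, after scaling and transforming, the unique maximizer, whatever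
    the level [lam]. The equation itself then selects the scale, because the functional in
    [solvesP_Ht] does not vanish identically. *)
Lemma ground_state : unique_even_ground_state alpha beta (Ht (lin (2 / M0) u 0 u)).
Proof.
have k0 : 0 < 2 / M0 by rewrite divr_gt0.
have [h1 h2 h3] := Ht_facts (2 / M0); split.
 split; first by case: h1.
  by apply/solvesP_Ht => psi tp; rewrite (_ : _ - _ = 0) ?mul0r//; field; exact: lt0r_neq0.
 exists (6^-1 * (M0 * (2 / M0) ^+ 3)); split=> //; first by rewrite mulr_gt0 ?invr_gt0// mulr_gt0// exprn_gt0.
 by rewrite h3 inf_energy.
move=> f [_ sol [lam [lam0 hf Kf Ef]]]; have [f2 ef V] := from_Hs hf.
(* The scale at which the rescaled maximizer has [K] equal to [lam]. *)
pose r := (6 * lam / M0) `^ 3^-1.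
have r0 : 0 < r by rewrite powR_gt0// divr_gt0// mulr_gt0.
have r3 : r ^+ 3 = 6 * lam / M0.
 by rewrite -powR_mulrn ?powR_ge0// -powRrM mulVf// powRr1// divr_ge0// ltW// mulr_gt0.
have el : lam = 6^-1 * (M0 * r ^+ 3) by rewrite r3; field; exact: lt0r_neq0.
have q2 : q w (Ht f) (Ht f) = r ^+ 2.
 move: Ef; rewrite {1}el inf_energy// (@energyE _ f2 ef V) => -[]; apply: mulfI; exact: lt0r_neq0.
have T2 : T3 (Ht f) = M0 * r ^+ 3.
 by move: Kf; rewrite (K_E f2 V) el; apply: mulfI; exact: lt0r_neq0.
pose v := lin r^-1 (Ht f) 0 (Ht f); have Vv : VD w v := VD_lin _ _ V V.
have qv : q w v v = 1 by rewrite (q_scale _ V) q2 exprVn mulVf// gt_eqF// exprn_gt0.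
have Tv : T3 v = M0.
 by rewrite (T3_scale _ (VD_V1 V) (VD_even V)) T2 exprVn mulrCA mulVf ?mulr1// gt_eqF// exprn_gt0.
have vu := maximizer_unique hw cw c10 mx Vv qv Tv.
have fu : {ae mu, forall x, Ht f x = lin r u 0 u x}.
 apply: filterS vu => x <-; rewrite /v; field; exact: lt0r_neq0.
have fQ : {ae mu, forall x, f x = Ht (lin r u 0 u) x}.
 have e := ae_sym (HtK f2); apply: ae_trans e _.
 by apply: Ht_ae => //; [exact: VD_sq V|exact: VD_sq (Vs r)].
suff rk : r = 2 / M0 by rewrite -rk; apply: filterS fQ => x ->.
apply/eqP; apply/negP => /negP rk; apply: test_nondegenerate => psi tp.
have [Q2 _ _ _] := Ht_VD (Vs r).
have /solvesP_Ht/(_ _ tp)/eqP : solvesP alpha beta (Ht (lin r u 0 u)).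
 move=> chi tc; have [d _ i s tc1] := test_derive tc; have [_ _ _ s1 tc2] := test_derive tc1.
 have [_ _ _ s2 _] := test_derive tc2; have [_ hh _] := hilbert_test tc.
 have mf := sqint_meas f2; have mQ := sqint_meas Q2; have ms := sqint_meas s.
 have mx1 : measR (fun x => chi x - alpha * derive1n 2 chi x - beta * hilbert (derive1 chi) x).
  have h := sqintB (sqintB s (sqintZ alpha s2)) (sqintZ beta hh).
  exact: sqint_meas h.
 have <- : \int[mu]_x (f x * (chi x - alpha * derive1n 2 chi x - beta * hilbert (derive1 chi) x)) =
   \int[mu]_x (Ht (lin r u 0 u) x * (chi x - alpha * derive1n 2 chi x - beta * hilbert (derive1 chi) x)).
  by apply: ae_Int; [exact: mfunM|exact: mfunM|apply: filterS fQ => x ->].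
 have <- : \int[mu]_x (2^-1 * f x ^+ 2 * chi x) = \int[mu]_x (2^-1 * Ht (lin r u 0 u) x ^+ 2 * chi x).
  apply: ae_Int; [| |by apply: filterS fQ => x ->];
   by apply: mfunM => //; apply: mfunM; [exact: measurable_cst|exact: measurable_funX].
 exact: sol.
rewrite mulf_eq0 => /orP[/eqP e|/eqP //]; case/eqP: rk.
have : r * (1 - 2^-1 * r * M0) = 0 by rewrite -[RHS]e; ring.
move/eqP; rewrite mulf_eq0 gt_eqF//= subr_eq0 => /eqP e1.
rewrite -mulrA in e1; by apply: (mulIf (lt0r_neq0 Mp)); rewrite mulfVK ?lt0r_neq0//; move: e1; move: (r * M0) => *; lra.
Qed.

End weighted.
End ground_states.

(** * Continuity in H^1 and the regime of small [beta] *)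

Lemma wab10 : wab 1 0 = w2 :> (R -> R).
Proof. by apply/funext => x; rewrite /wab /w2 mul0r mul1r addr0. Qed.

Lemma wab01 : wab 0 1 = w1 :> (R -> R).
Proof. by apply/funext => x; rewrite /wab /w1 mul0r mul1r addr0. Qed.

Lemma Hs1_Ht v : VD w2 v -> Hs 1 (Ht v).
Proof.
rewrite -wab10 => V; have hw : weight (wab 1 0 : R -> R) 2^-1 by rewrite wab10; exact: w2_weight.
have [f2 ef VH _] := Ht_VD hw V.
by have := proj2 (Hs_VD ler01 hw f2 ef) VH; rewrite /theta ltr01.
Qed.

Lemma Hnorm1_Ht v h : VD w2 v -> VD w2 h ->
 Hnorm 1 (Ht v \- Ht h) = (Num.sqrt (q w2 (lin 1 v (-1) h) (lin 1 v (-1) h)))%:E.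
Proof.
move=> V W; have v2 := VD_sq V; have h2 := VD_sq W.
have Vd := VD_lin 1 (-1) V W; have d2 := VD_sq Vd.
have e : {ae mu, forall x, (Ht v \- Ht h) x = Ht (lin 1 v (-1) h) x}.
 by apply: filterS (Ht_lin 1 (-1) v2 h2) => x ->; rewrite mul1r mulN1r.
have f2 : sqint (Ht v \- Ht h) := sqintB (Ht_sq v2) (Ht_sq h2).
have ef : aeven (Ht v \- Ht h).
 by apply: filterS (filterI (aeven_Ht v2 (VD_even V)) (aeven_Ht h2 (VD_even W))) => x [/= -> ->].
have e2 : {ae mu, forall x, Ht (Ht v \- Ht h) x = lin 1 v (-1) h x}.
 have t := Ht_ae f2 (Ht_sq d2) e; apply: ae_trans t _; exact: HtK.
have i := q_rint w2_weight Vd Vd.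
rewrite (Hnorm_even _ f2 ef) (qE _ _ w2_weight) -powR12_sqrt; last first.
 by apply: Int_ge0 => x; rewrite -mulrA mulr_ge0 -?expr2 ?sqr_ge0// /w2 addr_ge0 ?sqr_ge0.
rewrite -poweR_EFin -(IntE i); congr (_ `^ _)%E; apply: ae_eq_integral => //.
- apply/mEFinP; apply: mfunM; first exact: measR_sobolev.
 by apply: measurable_funX; exact: sqint_meas (Ht_sq f2).
- by apply/mEFinP; exact: rint_meas i.
- apply: filterS e2 => x -> _; rewrite powRr1; last by rewrite addr_ge0 ?sqr_ge0.
 by congr EFin; rewrite /w2; ring.
Qed.

(** The ground state is the maximizer scaled by [2 / M a], so continuity of [M] and of the maximizer
    in the form of [w2], which is the squared H^1 norm, is enough. *)
Lemma H1_continuous (A : set R) (M : R -> R) (u : R -> R -> R) :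
 (forall a, A a -> VD w2 (u a) /\ 0 < M a) ->
 (forall a e, A a -> 0 < e -> exists2 d, 0 < d & forall b, A b -> `|b - a| < d ->
  `|M b - M a| <= e /\ q w2 (lin 1 (u a) (-1) (u b)) (lin 1 (u a) (-1) (u b)) <= e) ->
 H1_continuous_on A (fun a => Ht (lin (2 / M a) (u a) 0 (u a))).
Proof.
move=> VM near_a a Aa; have [Va Ma] := VM _ Aa.
have Vs b : A b -> VD w2 (lin (2 / M b) (u b) 0 (u b)) by move=> Ab; have [Vb _] := VM _ Ab; exact: VD_lin.
split; first exact: Hs1_Ht (Vs _ Aa).
pose D b := q w2 (lin 1 (lin (2 / M b) (u b) 0 (u b)) (-1) (lin (2 / M a) (u a) 0 (u a)))
 (lin 1 (lin (2 / M b) (u b) 0 (u b)) (-1) (lin (2 / M a) (u a) 0 (u a))).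
have cD : (Num.sqrt (D b))%:E @[b --> within A (nbhs a)] --> 0%E.
 apply: cvg_EFin; first exact: nearW.
 apply/cvgrPdist_le => e e0 /=.
 pose q0 := q w2 (u a) (u a); have q00 : 0 <= q0 := q_ge0 _ _.
 pose C := 32 / M a ^+ 2 + 32 / M a ^+ 4 * q0.
 have C0 : 0 < C by apply: ltr_wpDr; [rewrite mulr_ge0// divr_ge0// exprn_ge0// ltW|rewrite divr_gt0// exprn_gt0].
 pose e' := Order.min (Order.min 1 (M a / 2)) (e ^+ 2 / C).
 have e'0 : 0 < e' by rewrite !lt_min ltr01 !divr_gt0// exprn_gt0.
 have [e'1 e'M e'C] : [/\ e' <= 1, e' <= M a / 2 & e' <= e ^+ 2 / C] by rewrite /e' !ge_min !lexx !orbT.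
 have [d d0 hd] := near_a a e' Aa e'0.
 rewrite near_withinE; apply/nbhs_ballP; exists d => //= b; rewrite /ball/= distrC => bd Ab.
 have [hM hq] := hd b Ab bd; have [Vb Mb] := VM _ Ab.
 rewrite sub0r normrN ger0_norm ?sqrtr_ge0// -[leRHS]ger0_norm ?(ltW e0)// -sqrtr_sqr ler_wsqrtr//.
 have Mb2 : M a / 2 <= M b by move: hM; rewrite ler_norml => /andP[]; lra.
 have Vd := VD_lin 1 (-1) Va Vb.
 (* The difference of the rescaled maximizers is split into the difference of the maximizers and the
    change of scale. *)
 have eD : D b = q w2 (lin (- (2 / M b)) (lin 1 (u a) (-1) (u b)) (2 / M b - 2 / M a) (u a))
   (lin (- (2 / M b)) (lin 1 (u a) (-1) (u b)) (2 / M b - 2 / M a) (u a)).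
  by rewrite /D; congr q; apply/funext => x; ring.
 rewrite eD (q_comb _ _ Vd Va).
 have P := q_ge0 w2 (lin (2 / M b) (lin 1 (u a) (-1) (u b)) (2 / M b - 2 / M a) (u a)).
 rewrite (q_comb _ _ Vd Va) in P.
 have k1 : (2 / M b) ^+ 2 <= 16 / M a ^+ 2.
  rewrite (_ : 16 / M a ^+ 2 = (4 / M a) ^+ 2); last by field; exact: lt0r_neq0.
  rewrite ler_pXn2r ?nnegrE ?divr_ge0 ?(ltW Ma) ?(ltW Mb)//.
  by rewrite ler_pdivrMr// mulrAC ler_pdivlMr//; lra.
 have k2 : (2 / M b - 2 / M a) ^+ 2 <= 16 / M a ^+ 4 * e'.
  have -> : 2 / M b - 2 / M a = 2 / M b * ((M a - M b) / M a) by field; rewrite !lt0r_neq0.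
  have h1 : (M a - M b) ^+ 2 <= e'.
   rewrite -(norm_sq _) distrC; apply: le_trans (_ : e' ^+ 2 <= _).
    by rewrite ler_pXn2r ?nnegrE// ltW.
   by rewrite expr2 ler_piMr// ltW.
  rewrite exprMn [X in _ * X]expr_div_n (_ : 16 / M a ^+ 4 * e' = 16 / M a ^+ 2 * (e' / M a ^+ 2)); last by field; exact: lt0r_neq0.
  apply: ler_pM => //; first exact: sqr_ge0; first by rewrite divr_ge0 ?sqr_ge0.
  by rewrite ler_pM2r// invr_gt0 exprn_gt0.
 have hC : C * e' <= e ^+ 2 by rewrite mulrC -ler_pdivlMr.
 apply: le_trans hC; move: P hq k1 k2 (sqr_ge0 (2 / M b)) q00; rewrite /C -/q0 sqrrN.
 have r0 : 0 <= 16 / M a ^+ 2 by rewrite divr_ge0// exprn_ge0// ltW.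
 move: (q w2 (lin 1 (u a) (-1) (u b)) (lin 1 (u a) (-1) (u b))) (q w2 (lin 1 (u a) (-1) (u b)) (u a)) (q_ge0 w2 (lin 1 (u a) (-1) (u b))) => X Y X0.
 have -> : 32 / M a ^+ 2 = 2 * (16 / M a ^+ 2) by ring.
 have -> : 32 / M a ^+ 4 = 2 * (16 / M a ^+ 4) by ring.
 have -> : 2 * - (2 / M b) * (2 / M b - 2 / M a) * Y = - (2 * (2 / M b) * (2 / M b - 2 / M a) * Y) by ring.
 move: (2 * (2 / M b) * _ * Y) ((2 / M b - 2 / M a) ^+ 2) ((2 / M b) ^+ 2) (16 / M a ^+ 2) (16 / M a ^+ 4) r0 => Z s t m n m0 P hX ht hs t0 q0'.
 have h1 : t * X <= m * e' by exact: ler_pM.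
 have h2 : s * q0 <= n * e' * q0 by rewrite ler_wpM2r.
 by nra.
apply: cvg_trans cD; apply: near_eq_cvg; rewrite near_withinE; apply: nearW => b Ab.
exact: esym (Hnorm1_Ht (Vs _ Ab) (Vs _ Aa)).
Qed.

Lemma kdv_weight b : `|b| <= 1 -> weight (wab 1 b) 4^-1.
Proof.
move=> b1; split; [exact: continuous_measR (@wab_continuous 1 b)|by rewrite invr_gt0| |by move=> x; rewrite /wab normrN sqrrN].
move=> x; rewrite /wab -(norm_sq x); have := normr_ge0 x.
by move: b1; rewrite ler_norml => /andP[b1 _]; have := sqr_ge0 (`|x| - 5 / 8); move: `|x| => t *; nra.
Qed.

Lemma bo_weight a : 0 <= a -> weight (wab a 1) 1.
Proof.
move=> a0; split; [exact: continuous_measR (@wab_continuous a 1)|exact: ltr01| |by move=> x; rewrite /wab normrN sqrrN].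
by move=> x; rewrite /wab !mul1r lerDl mulr_ge0// sqr_ge0.
Qed.

Lemma maximizers_exist (w : R -> R -> R) (c c1 : R) (A : set R) :
 (forall a, A a -> exists M u, maximizer (w a) c1 M u) ->
 exists M, exists u : R -> R -> R, forall a, A a -> maximizer (w a) c1 (M a) (u a).
Proof.
move=> H; have /choice[F hF] : forall a, exists Mu : R * (R -> R), A a -> maximizer (w a) c1 Mu.1 Mu.2.
 move=> a; have [/H[M [u mx]]|nA] := pselect (A a); first by exists (M, u).
 by exists (0, fun=> 0).
by exists (fun a => (F a).1), (fun a => (F a).2).
Qed.

Lemma perturb_close w c c1 M u w' c' M' u' dl k e : weight w c -> weight w' c' -> 0 < c1 ->
 maximizer w c1 M u -> maximizer w' c1 M' u' -> 0 <= dl -> dl <= 1 ->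
 (forall x, w' x <= (1 + dl) * w x) -> (forall x, w x <= (1 + dl) * w' x) -> (forall x, w2 x <= k * w x) ->
 dl * (3 * M + k * (6 * M / c1 + 2)) <= e ->
 `|M' - M| <= e /\ q w2 (lin 1 u (-1) u') (lin 1 u (-1) u') <= e.
Proof.
move=> hw hw' c10 m m' dl0 dl1 le' le le2 de.
have [Vab A1] := q_le_mult hw hw' le (mx_V m').
have [Vba B1] := q_le_mult hw' hw le' (mx_V m).
rewrite (mx_q m') mulr1 in A1; rewrite (mx_q m) mulr1 in B1.
have [h1 h2] := maximizer_perturb hw c10 m m' Vab Vba dl0 dl1 A1 B1.
have [_ h3] := q_le_mult w2_weight hw le2 (VD_lin 1 (-1) (mx_V m) Vab).
have M0 := mx_M m.
have K0 : 0 <= 6 * M / c1 + 2 by rewrite addr_ge0// divr_ge0 ?mulr_ge0// ltW.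
have k0 : 0 <= k.
 have := le_trans (ltW (weight_gt0 0 w2_weight)) (le2 0).
 by rewrite pmulr_lge0// (weight_gt0 0 hw).
have e1 : 0 <= dl * (3 * M) by rewrite !mulr_ge0// ltW.
have e2 : 0 <= dl * (k * (6 * M / c1 + 2)) by rewrite !mulr_ge0.
rewrite mulrDr in de; split.
 by apply: le_trans h2 _; move: e1 e2 de; rewrite [dl * (3 * M)]mulrCA -(mulrA 3); move: (dl * M) (dl * _) => *; lra.
apply: le_trans h3 (le_trans (ler_wpM2l k0 h1) _); rewrite mulrCA; apply: le_trans de.
by rewrite lerDr.
Qed.

(** Since [|x| <= 1 + x^2], the perturbation is small relative to [w2]. Weights for two values of
    [beta] have ratio at most [1 + 4 |b - a|], the 4 coming from the lower bound in [kdv_weight],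
    and all these forms are equivalent to the H^1 form. *)
Lemma kdv_regime : exists beta0 : R, 0 < beta0 /\ exists Q : R -> R -> R,
 (forall beta : R, `|beta| < beta0 -> unique_even_ground_state 1 beta (Q beta)) /\
 H1_continuous_on [set beta | - beta0 < beta < beta0] Q.
Proof.
have B := kdv_base; have [hw0 VQ qQ _ _ _ _] := B.
have [s [c1 [s0 s1 c10 ex]]] := local_maximizer B.
exists (s / 2); split; first by rewrite divr_gt0.
pose A := [set b : R | - (s / 2) < b < s / 2].
have Ab b : A b -> `|b| <= s / 2 /\ `|b| <= 1 by rewrite /A/= -ltr_norml => h; split; lra.
have mxe b : A b -> exists M u, maximizer (wab 1 b) c1 M u.
 move=> /Ab[b1 b2]; apply: ex (kdv_weight b2) _; apply: close_mult hw0 (kdv_weight b2) VQ qQ s0 s1 _ => x.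
 rewrite /wab /w2 mul1r (_ : _ - _ = b * `|x|); last by ring.
 rewrite normrM normr_id ler_pM// -(norm_sq x); have := sqr_ge0 (`|x| - 1); nra.
have [M [u mx]] := maximizers_exist 0 mxe.
have hw b : A b -> weight (wab 1 b) 4^-1 by move=> /Ab[_ b2]; exact: kdv_weight.
have le a b x : A a -> wab 1 b x <= (1 + 4 * `|b - a|) * wab 1 a x.
 move=> Aa; have [_ _ low _] := hw _ Aa; have := low x; have := ler_norm (b - a); have := normr_ge0 (b - a).
 have -> : wab 1 b x = wab 1 a x + (b - a) * `|x| by rewrite /wab; ring.
 by have := normr_ge0 x; move: (wab 1 a x) `|x| `|b - a| (b - a) => W t n r *; nra.
have le2 a x : A a -> w2 x <= 2 * wab 1 a x.
 move=> /Ab[_]; rewrite /w2 /wab ler_norml => /andP[a1 _].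
 by rewrite -(norm_sq x); have := sqr_ge0 (`|x| - 1); have := normr_ge0 x; move: `|x| => t *; nra.
exists (fun b => Ht (lin (2 / M b) (u b) 0 (u b))); split.
 move=> b; rewrite ltr_norml => hb.
 exact: (ground_state ler01 (hw _ hb) c10 (mx _ hb) (@wab_continuous 1 b)).
apply: H1_continuous => [a Aa|a e Aa e0].
 have m := mx _ Aa; split; last exact: mx_M m.
 by case: (q_le_mult w2_weight (hw _ Aa) (fun x => le2 a x Aa) (mx_V m)).
have m := mx _ Aa; have Ma := mx_M m.
pose C := 3 * M a + 2 * (6 * M a / c1 + 2).
have C0 : 0 < C by rewrite addr_gt0 ?mulr_gt0// addr_gt0// divr_gt0// mulr_gt0.
exists (Order.min 4^-1 (e / C / 4)); first by rewrite lt_min invr_gt0 ltr0n !divr_gt0.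
move=> b Abb; rewrite lt_min => /andP[d1 d2].
have dl1 : 4 * `|b - a| <= 1 by lra.
have de : 4 * `|b - a| * C <= e by rewrite -ler_pdivlMr//; lra.
have le1 x : wab 1 a x <= (1 + 4 * `|b - a|) * wab 1 b x by rewrite distrC; exact: le.
exact: (perturb_close (hw _ Aa) (hw _ Abb) c10 m (mx _ Abb) (mulr_ge0 (ler0n _ 4) (normr_ge0 _)) dl1
 (fun x => le a b x Aa) le1 (fun x => le2 a x Aa) de).
Qed.

(** * The regime of small [alpha] *)

Lemma hE_sqint2 : sqint (fun x => w2 x * hE x).
Proof.
have [mw _ _ _] := w2_weight.
have m : measR (fun x => w2 x * hE x) by apply: mfunM => //; exact: hE_meas.
apply: even_sqint => //; last by move=> x; rewrite /w2 /hE sqrrN normrN.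
have mh : measR (fun x => hp x * (w2 x * hE x)) by apply: mfunM => //; exact: hp_meas.
split=> //; apply: (rint_eq _ (@hp_exp_rint (fun x => (w2 x * hE x) ^+ 2) 256 _ _)) => [x||x x0].
- by rewrite [in RHS]exprMn [in RHS]expr2 hp_sq.
- exact: measurable_funX.
have e4 : expR x = expR (x / 4) ^+ 4 by rewrite -expRM_natl; congr expR; field.
have e1 : 1 + x <= 4 * expR (x / 4) by have := expR_ge1Dx (x / 4); lra.
have e2 : w2 x ^+ 2 <= (1 + x) ^+ 4.
 rewrite (exprM _ 2 2) (ler_pXn2r (isT : (0 < 2)%N)) ?nnegrE ?sqr_ge0 ?addr_ge0 ?sqr_ge0// /w2; nra.
rewrite ger0_norm ?sqr_ge0// /hE ger0_norm// (_ : _ ^+ 2 = w2 x ^+ 2 * expR (- x) * expR (- x)); last by ring.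
rewrite ler_wpM2r ?expR_ge0// expRN ler_pdivrMr ?expR_gt0// e4; apply: le_trans e2 _.
rewrite (_ : 256 * expR (x / 4) ^+ 4 = (4 * expR (x / 4)) ^+ 4); last by rewrite exprMn; congr (_ * _); ring.
by rewrite ler_pXn2r ?nnegrE ?addr_ge0 ?mulr_ge0 ?expR_ge0.
Qed.

Lemma VD_w2 g : measR g -> aeven g -> sqint (fun x => w2 x * g x) -> VD w2 g.
Proof.
move=> mg eg s; have [mw _ _ _] := w2_weight.
apply: (VDP w2_weight mg eg); apply: (sqint_le _ s).
 by apply: mfunM => //; exact: sw_meas.
move=> x; have h : 1 <= w2 x by rewrite /w2 lerDl sqr_ge0.
rewrite !normrM ler_wpM2r// /sw ger0_norm ?sqrtr_ge0// ger0_norm; last exact: le_trans h.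
by rewrite -[leRHS]ger0_norm ?(le_trans ler01 h)// -sqrtr_sqr ler_wsqrtr// expr2 ler_peMr// (le_trans ler01 h).
Qed.

Lemma q_wab a g : 0 <= a -> VD w2 g ->
 VD (wab a 1) g /\ q (wab a 1) g g <= q w1 g g + a * q w2 g g.
Proof.
move=> a0 V; have hw := bo_weight a0.
have le x : wab a 1 x <= (2 + a) * w2 x.
 rewrite /wab /w2 -(norm_sq x); have := sqr_ge0 (`|x| - 1); have := normr_ge0 x.
 by have := mulr_ge0 a0 (sqr_ge0 `|x|); move: `|x| => t *; nra.
have [Va _] := q_le_mult hw w2_weight le V.
have V1' : VD w1 g.
 have le1 x : w1 x <= 1 * wab a 1 x by rewrite /w1 /wab !mul1r lerDl mulr_ge0// sqr_ge0.
 by case: (q_le_mult w1_weight hw le1 Va).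
split=> //; have i1 := q_rint w1_weight V1' V1'; have i2 := q_rint w2_weight V V.
have i3 := rintZ a i2; have i4 := q_rint hw Va Va.
rewrite (qE _ _ hw) (qE _ _ w1_weight) (qE _ _ w2_weight) -IntZ// -IntD//.
apply: Int_le => //; first exact: rintD.
move=> x; rewrite -subr_ge0 (_ : _ - _ = a * g x ^+ 2); last by rewrite /w1 /w2 /wab; ring.
by rewrite mulr_ge0// sqr_ge0.
Qed.

Lemma four_squares (h k m b c1 c2 c3 d e : R) : d ^+ 2 <= e ^+ 2 ->
 (h * (k * c1) + h * (m * c2) + h * (m * c3) + b * d) ^+ 2 <=
  4 * (h ^+ 2 * (k ^+ 2 * c1 ^+ 2 + m ^+ 2 * (c2 ^+ 2 + c3 ^+ 2)) + b ^+ 2 * e ^+ 2).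
Proof.
move=> de; have sq2 (p1 p2 : R) : (p1 + p2) ^+ 2 <= 2 * (p1 ^+ 2 + p2 ^+ 2) by have := sqr_ge0 (p1 - p2); rewrite sqrrB sqrrD; lra.
have := ler_wpM2l (sqr_ge0 b) de; have := sq2 (h * (k * c1) + h * (m * c2)) (h * (m * c3) + b * d).
by have := sq2 (h * (k * c1)) (h * (m * c2)); have := sq2 (h * (m * c3)) (b * d); rewrite !exprMn addrA; lra.
Qed.

(** Read with [H = hc ^+ 2] and [P = pi]: the bound on correlations costs a factor [pi] that the
    normalization of the transform absorbs. *)
Lemma scale_bounds (H P k m Y I1 I2 I3 b G : R) : 0 <= H -> H * (2 * P) = 1 -> I1 <= P -> I2 <= P * Y -> I3 <= P * Y ->
 4 * (H * (k ^+ 2 * I1 + m ^+ 2 * (I2 + I3)) + b ^+ 2 * G) <= 2 * k ^+ 2 + 4 * m ^+ 2 * Y + 4 * b ^+ 2 * G.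
Proof.
move=> H0 HP h1 h2 h3; have HI1 : H * I1 <= 2^-1 by have := ler_wpM2l H0 h1; lra.
have HI : H * (I2 + I3) <= Y.
 have := ler_wpM2l H0 (lerD h2 h3); have -> : H * (P * Y + P * Y) = H * (2 * P) * Y by ring.
 by rewrite HP mul1r.
have := ler_wpM2l (sqr_ge0 k) HI1; have := ler_wpM2l (sqr_ge0 m) HI.
move: (k ^+ 2) (m ^+ 2) (b ^+ 2) => K L B; rewrite [L * (H * _)]mulrCA [K * (H * _)]mulrCA; lra.
Qed.

(* Subtracting the two Euler-Lagrange equations bounds the weight [wab b 1] times the difference. *)
Lemma euler_lagrange_diff b M0 u Mb v : 0 <= b -> VD w1 u -> VD w1 v -> q w1 u u <= 1 -> q w1 v v <= 1 ->
 sqint (fun x => w2 x * u x) -> 0 < M0 -> 0 < Mb ->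
 {ae mu, forall x, hc * corr u u x = M0 * (w1 x * u x)} ->
 {ae mu, forall x, hc * corr v v x = Mb * (wab b 1 x * v x)} ->
 q w2 (lin 1 u (-1) v) (lin 1 u (-1) v) <=
  2 * (M0^-1 - Mb^-1) ^+ 2 + 4 * Mb^-1 ^+ 2 * q w1 (lin 1 u (-1) v) (lin 1 u (-1) v) +
  4 * b ^+ 2 * ip (fun x => w2 x * u x) (fun x => w2 x * u x).
Proof.
move=> b0 Vu Vv qu qv s Mp Mbp eu ev; pose r := lin 1 u (-1) v; rewrite -/r.
have Vr : VD w1 r := VD_lin _ _ Vu Vv.
have u2 := VD_sq Vu; have v2 := VD_sq Vv; have r2 := VD_sq Vr.
pose k := M0^-1 - Mb^-1; pose G := ip (fun x => w2 x * u x) (fun x => w2 x * u x).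
have cs f g : VD w1 f -> VD w1 g -> q w1 g g <= 1 -> rint (fun x => corr f g x ^+ 2) /\
  \int[mu]_x (corr f g x ^+ 2) <= pi * q w1 f f.
 move=> Vf Vg q1; split; first exact: sqint_sq (corr_sqint (VD_V1 Vf) (VD_V1 Vg)).
 rewrite -ipsE; apply: le_trans (corr_le (VD_V1 Vf) (VD_V1 Vg)) _.
 by rewrite (wn_q1 Vf) (wn_q1 Vg) ler_pM2l ?pi_gt0// ler_piMr// q_ge0.
have [i1 I1] := cs u u Vu Vu qu; have [i2 I2] := cs r u Vr Vu qu; have [i3 I3] := cs r v Vr Vv qv.
have i4 := sqint_sq s.
have corr_diff x : corr u u x - corr v v x = corr r u x + corr v r x.
 rewrite (corr_linl 1 (-1) x u2 v2 u2) (corr_linr 1 (-1) x u2 v2 v2); ring.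
pose S x := 4 * (hc ^+ 2 * (k ^+ 2 * corr u u x ^+ 2 + Mb^-1 ^+ 2 * (corr r u x ^+ 2 + corr v r x ^+ 2)) + b ^+ 2 * (w2 x * u x) ^+ 2).
have evr : aeven r := VD_even Vr.
have cvr x : corr v r x = corr r v (- x) by rewrite corr_reflect//; [exact: sqint_meas r2|exact: sqint_meas v2].
have i3' : rint (fun x => corr v r x ^+ 2) by apply: rint_eq (rint_opp i3) => x; rewrite cvr.
have I3' : \int[mu]_x (corr v r x ^+ 2) = \int[mu]_x (corr r v x ^+ 2).
 by rewrite -(Int_opp (rint_meas i3)); apply: eq_Int => x; rewrite cvr.
have j := rintD i2 i3'; have j1 := rintZ (Mb^-1 ^+ 2) j; have j0 := rintZ (k ^+ 2) i1.
have j2 := rintZ (hc ^+ 2) (rintD j0 j1); have j3 := rintZ (b ^+ 2) i4.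
have iS : rint S := rintZ 4 (rintD j2 j3).
have ES : \int[mu]_x S x = 4 * (hc ^+ 2 * (k ^+ 2 * \int[mu]_x (corr u u x ^+ 2) +
  Mb^-1 ^+ 2 * (\int[mu]_x (corr r u x ^+ 2) + \int[mu]_x (corr v r x ^+ 2))) + b ^+ 2 * G).
 rewrite /S IntZ; last exact: rintD.
 rewrite IntD// IntZ; last exact: rintD.
 by rewrite IntD// !IntZ// IntD// /G ipsE.
have pw : {ae mu, forall x, w2 x * r x * r x <= S x}.
 apply: filterS (filterI eu ev) => x [e1 e2].
 have E : wab b 1 x * r x = hc * (k * corr u u x) + hc * (Mb^-1 * corr r u x) + hc * (Mb^-1 * corr v r x) + b * (x ^+ 2 * u x).
  have -> : hc * (k * corr u u x) + hc * (Mb^-1 * corr r u x) + hc * (Mb^-1 * corr v r x) =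
   M0^-1 * (hc * corr u u x) - Mb^-1 * (hc * corr v v x) + hc * Mb^-1 * (corr r u x + corr v r x - (corr u u x - corr v v x)) by rewrite /k; ring.
  rewrite e1 e2 corr_diff subrr mulr0 addr0 !mulKf ?lt0r_neq0//.
  by rewrite /r /wab /w1; ring.
 have le1 : w2 x * r x * r x <= (wab b 1 x * r x) ^+ 2.
  rewrite -mulrA -expr2 exprMn ler_wpM2r ?sqr_ge0//.
  have : 1 + `|x| <= wab b 1 x by have [_ _ h _] := bo_weight b0; rewrite -[leLHS]mul1r.
  rewrite /w2 -(norm_sq x); have := normr_ge0 x.
  by move: (wab b 1 x) `|x| => y t; clear => *; nra.
 apply: le_trans le1 _; rewrite E /S; apply: four_squares; rewrite !exprMn ler_wpM2r ?sqr_ge0//.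
 by rewrite (ler_pXn2r (isT : (0 < 2)%N)) ?nnegrE ?sqr_ge0 ?addr_ge0 ?sqr_ge0// /w2 lerDr.
have S0 x : 0 <= S x.
 apply: mulr_ge0 => //; apply: addr_ge0; last exact: mulr_ge0 (sqr_ge0 _) (sqr_ge0 _).
 apply: mulr_ge0 (sqr_ge0 _) _; apply: addr_ge0; first exact: mulr_ge0 (sqr_ge0 _) (sqr_ge0 _).
 exact: mulr_ge0 (sqr_ge0 _) (addr_ge0 (sqr_ge0 _) (sqr_ge0 _)).
have [mw _ _ _] := w2_weight; have mr := sqint_meas r2.
have mf : measR (fun x => w2 x * r x * r x) by do 2![apply: mfunM => //].
have f0 x : 0 <= w2 x * r x * r x by rewrite -mulrA mulr_ge0 -?expr2 ?sqr_ge0// /w2 addr_ge0 ?sqr_ge0.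
(* The bound by [S] holds only almost everywhere. Taking the minimum makes it hold everywhere
   without changing the integral, so integrability of the left side need not be known beforehand. *)
pose m x := Order.min (w2 x * r x * r x) (S x).
have im : rint m.
 apply: (rint_le _ iS); first by apply: measurable_minr => //; exact: rint_meas iS.
 by move=> x; rewrite ger0_norm /m ?ge_min ?lexx ?orbT// le_min f0 S0.
have le : q w2 r r <= \int[mu]_x S x.
 rewrite (qE _ _ w2_weight); apply: (@le_trans _ _ (\int[mu]_x m x)).
  apply: le_of_eq; apply: ae_Int mf (rint_meas im) _.
  by apply: filterS pw => x h; rewrite /m min_l.
 by apply: Int_le => // x; rewrite /m ge_min lexx orbT.
apply: le_trans le _; rewrite ES I3' -/k -/G.
have {}I1 : \int[mu]_x (corr u u x ^+ 2) <= pi by apply: le_trans I1 _; rewrite ler_piMr// pi_ge0.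
exact: (scale_bounds _ _ _ _ (sqr_ge0 _) hc_sq I1 I2 I3).
Qed.

(** Makes the estimate of [euler_lagrange_diff] linear in [b]. The condition [b * C1 <= 6^-1] keeps
    [Mb] above [M0 / 2], so the inverses stay bounded. *)
Lemma bo_limit_num (M0 Mb b C1 G k Y X : R) : 0 < M0 -> 0 <= b -> b <= 1 -> 0 <= C1 -> 0 <= k -> 0 <= G ->
 b * C1 <= 6^-1 -> `|Mb - M0| <= 3 * (b * C1) * M0 -> Y <= b * C1 * k ->
 X <= 2 * (M0^-1 - Mb^-1) ^+ 2 + 4 * Mb^-1 ^+ 2 * Y + 4 * b ^+ 2 * G ->
 X <= b * (C1 * (72 + 16 * k) / M0 ^+ 2 + 4 * G).
Proof.
move=> Mp b0 b1 c0 k0 G0 dl6 hM hY hX; have dl0 : 0 <= b * C1 by rewrite mulr_ge0.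
have -> : b * (C1 * (72 + 16 * k) / M0 ^+ 2 + 4 * G) = b * C1 * (72 + 16 * k) / M0 ^+ 2 + 4 * b * G by ring.
move: (b * C1) dl0 dl6 hM hY => d d0 d6 hM hY.
have Mb2 : M0 / 2 <= Mb by move: hM; rewrite ler_norml => /andP[h _]; nra.
have Mb0 : 0 < Mb by lra.
pose v := (M0 ^+ 2)^-1; have v0 : 0 <= v by rewrite invr_ge0 sqr_ge0.
have V : Mb^-1 ^+ 2 <= 4 * v.
 rewrite (_ : 4 * v = (M0 / 2)^-1 ^+ 2); last by rewrite /v; field; exact: lt0r_neq0.
 by rewrite ler_pXn2r ?nnegrE ?invr_ge0 ?lef_pV2 ?posrE ?divr_gt0// ltW// divr_gt0.
have S : (M0^-1 - Mb^-1) ^+ 2 <= 9 * d ^+ 2 * Mb^-1 ^+ 2.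
 have -> : (M0^-1 - Mb^-1) ^+ 2 = (Mb - M0) ^+ 2 * v * Mb^-1 ^+ 2 by rewrite /v; field; rewrite !lt0r_neq0.
 rewrite ler_wpM2r ?sqr_ge0// /v ler_pdivrMr ?exprn_gt0//.
 rewrite -(norm_sq _) (_ : 9 * d ^+ 2 * M0 ^+ 2 = (3 * d * M0) ^+ 2); last by ring.
 by rewrite ler_pXn2r ?nnegrE ?mulr_ge0// ltW.
have S' : (M0^-1 - Mb^-1) ^+ 2 <= 36 * (d * v).
 apply: le_trans S _; have dd : 9 * d ^+ 2 <= 9 * d by rewrite ler_pM2l// expr2 ler_piMr//; lra.
 have := ler_wpM2l (sqr_ge0 d) V; have : d ^+ 2 * v <= d * v by rewrite ler_wpM2r// expr2 ler_piMr//; lra.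
 rewrite (_ : d ^+ 2 * (4 * v) = 4 * (d ^+ 2 * v)); last by ring.
 by rewrite -mulrA; move: (d ^+ 2 * Mb^-1 ^+ 2) (d ^+ 2 * v) (d * v) => *; lra.
have Y1 : Mb^-1 ^+ 2 * Y <= 4 * (d * k * v).
 apply: le_trans (ler_wpM2l (sqr_ge0 _) hY) _; have dk : 0 <= d * k by rewrite mulr_ge0.
 by have := ler_wpM2l dk V; rewrite [leLHS]mulrC; move: (_ * (d * k)) => y; lra.
have G1 : b ^+ 2 * G <= b * G by rewrite ler_wpM2r// expr2 ler_piMr.
apply: le_trans hX _; rewrite -/v -!(mulrA 4).
have -> : d * (72 + 16 * k) * v = 72 * (d * v) + 16 * (d * k * v) by ring.
move: S' Y1 G1; move: ((M0^-1 - Mb^-1) ^+ 2) (Mb^-1 ^+ 2 * Y) (b ^+ 2 * G) (b * G) (d * v) (d * k * v); clear => *; lra.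
Qed.

(** At a positive [alpha] the forms are comparable with H^1 and the relative perturbation argument
    applies, with constants that blow up as [alpha] tends to 0. At 0 the energy controls H^(1/2)
    only, and the decay of the explicit profile together with the difference of the Euler-Lagrange
    equations supplies the missing weight. *)
Lemma bo_regime : exists alpha0 : R, 0 < alpha0 /\ exists Q : R -> R -> R,
 (forall alpha : R, 0 <= alpha < alpha0 -> unique_even_ground_state alpha 1 (Q alpha)) /\
 H1_continuous_on [set alpha | 0 <= alpha < alpha0] Q.
Proof.
have B := bo_base; have [hw0 VQ qQ TQ M0p _ _] := B.
have [s [c1 [s0 s1 c10 ex]]] := local_maximizer B.
set Q0 := lin bo_r hE 0 hE in B VQ qQ TQ ex.
have mQ := sqint_meas (VD_sq VQ).
(* The exponential decay of the profile gives it finite energy for the weight [1 + x^2], so adding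
   [alpha x^2] costs little there although it is unbounded relative to [w1]. *)
have Q2 : sqint (fun x => w2 x * Q0 x).
 by apply: (ae_sqint _ _ (sqintZ bo_r hE_sqint2)); [by have [m _ _ _] := w2_weight; exact: mfunM|apply: aeW => x; rewrite /Q0; ring].
have V2Q := VD_w2 mQ (VD_even VQ) Q2.
have C0 := q_ge0 w2 Q0; set C := q w2 Q0 Q0 in C0.
(* For [alpha < a0] the energy of the profile rises by at most [alpha * C <= s], the closeness
   required in [near_base]. *)
pose a0 := s / (1 + C); have a00 : 0 < a0 by rewrite divr_gt0//; lra.
exists a0; split=> //.
pose A := [set a : R | 0 <= a < a0].
have A0 : A 0 by rewrite /A/= lexx.
have hw a : A a -> weight (wab a 1) 1 by move=> /andP[h _]; exact: bo_weight.
have le1 a x : A a -> w1 x <= wab a 1 x by move=> /andP[h _]; rewrite /w1 /wab !mul1r lerDl mulr_ge0// sqr_ge0.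
have mxe a : A a -> exists M u, maximizer (wab a 1) c1 M u.
 move=> Aa; have /andP[a1 a2] := Aa; have [Va up] := q_wab a1 V2Q.
 apply: ex (hw _ Aa) _; apply: close_ge hw0 (hw _ Aa) (fun x => le1 a x Aa) Va s0 _.
 apply: le_trans up _; rewrite qQ lerD2l -/C; apply: (@le_trans _ _ (a0 * C)); first by rewrite ler_wpM2r// ltW.
 have : a0 * (1 + C) = s by rewrite /a0 mulfVK// gt_eqF//; lra.
 by rewrite mulrDr mulr1; move: (a0 * C) => y; lra.
have [M [u mx]] := maximizers_exist 0 mxe.
have m0 := mx _ A0; rewrite wab01 in m0.
(* The maximizer at [alpha = 0] is the explicit profile, by uniqueness, and inherits its decay. *)
have uQ : {ae mu, forall x, u 0 x = Q0 x}.
 have h1 := mx_max m0 VQ; have h2 := base_cubic_max B (mx_V m0).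
 rewrite qQ TQ sqrtr1 !mulr1 in h1; rewrite (mx_q m0) (mx_T m0) sqrtr1 !mulr1 in h2.
 have e : T3 Q0 = M 0 by rewrite TQ; apply/eqP; rewrite eq_le h1 h2.
 apply: ae_sym; apply: (maximizer_unique hw0 _ c10 m0 VQ qQ e).
 by rewrite -wab01; exact: wab_continuous.
have mu0 := sqint_meas (VD_sq (mx_V m0)).
have u02 : sqint (fun x => w2 x * u 0 x).
 apply: (ae_sqint _ _ Q2); first by have [m _ _ _] := w2_weight; exact: mfunM.
 by apply: filterS uQ => x ->.
have V20 := VD_w2 mu0 (VD_even (mx_V m0)) u02.
have le2 a x : 0 < a -> w2 x <= (1 + a^-1) * wab a 1 x.
 move=> ap; have aV : 0 < a^-1 by rewrite invr_gt0.
 rewrite /w2 /wab; have := normr_ge0 x; have := sqr_ge0 x; move: (x ^+ 2) `|x| => y t y0 t0.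
 have -> : (1 + a^-1) * (1 + 1 * t + a * y) = 1 + y + (a^-1 + t + a * y + a^-1 * t) by field; exact: lt0r_neq0.
 by rewrite lerDl !addr_ge0 ?mulr_ge0 ?(ltW aV) ?(ltW ap).
exists (fun a => Ht (lin (2 / M a) (u a) 0 (u a))); split.
 move=> a ha; have /andP[a1 _] := ha.
 exact: (ground_state a1 (hw _ ha) c10 (mx _ ha) (@wab_continuous a 1)).
apply: H1_continuous => [a Aa|a e Aa e0].
 have m := mx _ Aa; split; last exact: mx_M m.
 have /andP[a1 _] := Aa; have [->//|an] := eqVneq a 0.
 have ap : 0 < a by rewrite lt_neqAle eq_sym an.
 by case: (q_le_mult w2_weight (hw _ Aa) (fun x => le2 a x ap) (mx_V m)).
have m := mx _ Aa; have Ma := mx_M m; have /andP[a1 _] := Aa.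
have K0 : 0 < 6 * M a / c1 + 2 by rewrite addr_gt0// divr_gt0// mulr_gt0.
(* For [a > 0] the weights near [a] have ratio at most [1 + (2 / a) |b - a|]; this degenerates at
   [a = 0], which is treated apart. *)
have [az|an] := eqVneq a 0; last first.
 have ap : 0 < a by rewrite lt_neqAle eq_sym an.
 have aV : 0 < a^-1 by rewrite invr_gt0.
 pose D := 3 * M a + (1 + a^-1) * (6 * M a / c1 + 2).
 have D0 : 0 < D by rewrite addr_gt0 ?mulr_gt0// addr_gt0.
 exists (a / 2 * Order.min 1 (e / D)); first by rewrite mulr_gt0 ?divr_gt0// lt_min ltr01 divr_gt0.
 move=> b Ab; rewrite -ltr_pdivrMl ?divr_gt0// lt_min invfM invrK => /andP[d1 d2].
 have /andP[b1 _] := Ab.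
 have ed : a^-1 * 2 * `|b - a| = 2 / a * `|b - a| by ring.
 rewrite ed in d1 d2.
 have ba : `|b - a| <= a / 2 by move: d1; rewrite mulrAC ltr_pdivrMr// mul1r; lra.
 have dl0 : 0 <= 2 / a * `|b - a| by rewrite mulr_ge0// divr_ge0// ltW.
 have le b' a' x : A a' -> a / 2 <= a' -> `|b' - a'| = `|b - a| ->
   wab b' 1 x <= (1 + 2 / a * `|b - a|) * wab a' 1 x.
  move=> /andP[a'0 _] ha' ea; rewrite -ea.
  have -> : wab b' 1 x = wab a' 1 x + (b' - a') * x ^+ 2 by rewrite /wab; ring.
  rewrite [leRHS]mulrDl [X in _ <= X + _]mul1r lerD2l; apply: (@le_trans _ _ (`|b' - a'| * x ^+ 2)).
   by rewrite ler_wpM2r ?sqr_ge0// ler_norm.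
  have h : x ^+ 2 <= 2 / a * wab a' 1 x.
   by rewrite mulrAC ler_pdivlMr//; have := normr_ge0 x; rewrite /wab; have := sqr_ge0 x; nra.
  by rewrite [leRHS](_ : _ = `|b' - a'| * (2 / a * wab a' 1 x)); [exact: ler_wpM2l|ring].
 apply: (perturb_close (hw _ Aa) (hw _ Ab) c10 m (mx _ Ab) dl0 (ltW d1) _ _ (fun x => le2 a x ap)).
 - by move=> x; apply: le => //; lra.
 - by move=> x; apply: le; rewrite 1?distrC//; move: ba; rewrite ler_norml => /andP[]; lra.
 - by rewrite -/D -ler_pdivlMr// ltW.
rewrite az in K0 Ma *; pose k := 6 * M 0 / c1 + 2.
pose C1 := q w2 (u 0) (u 0); pose G := ip (fun x => w2 x * u 0 x) (fun x => w2 x * u 0 x).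
have C10 : 0 <= C1 := q_ge0 _ _; have G0 : 0 <= G := ip_ge0 _ _.
pose D := C1 * (3 * M 0) + (C1 * (72 + 16 * k) / M 0 ^+ 2 + 4 * G).
have D1 : 0 <= C1 * (3 * M 0) by rewrite !mulr_ge0// ltW.
have D2 : 0 <= C1 * (72 + 16 * k) / M 0 ^+ 2 + 4 * G.
 by rewrite addr_ge0 ?mulr_ge0 ?invr_ge0 ?exprn_ge0 ?addr_ge0 ?mulr_ge0// ltW.
exists (Order.min (Order.min 1 (6 * (C1 + 1))^-1) (e / (D + 1))).
 by rewrite !lt_min ltr01 invr_gt0 divr_gt0 ?mulr_gt0//; rewrite /D; lra.
move=> b Ab; have /andP[b0 _] := Ab; rewrite subr0 ger0_norm// !lt_min -andbA => /and3P[b1 bC bD].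
have mb := mx _ Ab; have Mb := mx_M mb.
have dl0 : 0 <= b * C1 by rewrite mulr_ge0.
have dl6 : b * C1 <= 6^-1.
 move: bC; rewrite -[_^-1]mul1r ltr_pdivlMr; last by rewrite mulr_gt0//; lra.
 by rewrite mulrCA mulrDr mulr1; move: (b * C1) => y; lra.
have [Vb A1] := q_le_mult hw0 (hw _ Ab) (fun x => eq_ind_r (fun y => w1 x <= y) (le1 b x Ab) (mul1r _)) (mx_V mb).
rewrite (mx_q mb) mul1r in A1.
have [V0 B1] := q_wab b0 V20; rewrite (mx_q m0) -/C1 in B1.
have A2 : q w1 (u b) (u b) <= 1 + b * C1 by rewrite (le_trans A1)// lerDl.
have dl1 : b * C1 <= 1 by lra.
have [h1 h2] := maximizer_perturb hw0 c10 m0 mb Vb V0 dl0 dl1 A2 B1.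
have E0 := euler_lagrange hw0 (mx_max m0) (ltW Ma) (mx_V m0) (mx_q m0) (mx_T m0).
have Eb := euler_lagrange (hw _ Ab) (mx_max mb) (ltW Mb) (mx_V mb) (mx_q mb) (mx_T mb).
have q0 : q w1 (u 0) (u 0) <= 1 by rewrite (mx_q m0).
have X := euler_lagrange_diff b0 (mx_V m0) Vb q0 A1 u02 Ma Mb E0 Eb.
have X' := bo_limit_num Ma b0 (ltW b1) C10 (ltW K0) G0 dl6 h2 h1 X.
have be : b * D <= e.
 move: bD; rewrite ltr_pdivlMr; last by rewrite /D; lra.
 by rewrite mulrDr mulr1; move: (b * D) => y; lra.
rewrite /D mulrDr in be; have P1 := mulr_ge0 b0 D1; have P2 := mulr_ge0 b0 D2; split.
 have e3 : 3 * (b * C1) * M 0 = b * (C1 * (3 * M 0)) by ring.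
 by rewrite e3 in h2; apply: le_trans h2 _; apply: le_trans be; rewrite lerDl.
by apply: le_trans X' _; apply: le_trans be; rewrite lerDr.
Qed.

End line.

Theorem proposition3p1 (R : realType) :
 (exists beta0 : R, 0 < beta0 /\
  exists Q : R -> R -> R,
   (forall beta : R, `|beta| < beta0 ->
     unique_even_ground_state 1 beta (Q beta)) /\
   H1_continuous_on [set beta | - beta0 < beta < beta0] Q) /\
 (exists alpha0 : R, 0 < alpha0 /\
  exists Q : R -> R -> R,
   (forall alpha : R, 0 <= alpha < alpha0 ->
     unique_even_ground_state alpha 1 (Q alpha)) /\
   H1_continuous_on [set alpha | 0 <= alpha < alpha0] Q).
Proof. by split; [exact: kdv_regime|exact: bo_regime]. Qed.
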